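(* Starting with an empty graph on $n$ vertices, under any online sequence of edge insertions and deletions that keeps the graph bipartite, there is a deterministic fully dynamic algorithm maintaining an implicit 2-coloring with amortized $O(\log^2 n)$ update time, amortized $O(\log n)$ query time for $\mathsf{getColor}(v)$, and at most one recoloring per update in the worst case.
   Context: An implicit coloring algorithm does not necessarily store the color of every vertex after each update; instead, a query $\mathsf{getColor}(v)$ computes the color of $v$, and at every moment the colors returned by queries form a proper coloring (adjacent vertices receive different colors) of the current graph using the two available colors. A recoloring is a change of a stored vertex color during an update. *)

(* Defs.v *)
From mathcomp Require Import all_boot.

Set Implicit Arguments.
Unset Strict Implicit.
Unset Printing Implicit Defensive.

(* Programs are uniform: one fixed program serves every n, on words of
   k * lg n bits for a constant k.  There is no preprocessing phase: memory
   starts zeroed, and n is supplied as an argument of every call. *)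

Inductive binop := Add | Sub | Mul | Div | Mod | Eq | Lt.

Inductive expr :=
| Const of nat
| Var of nat
| Read of expr
| Stored of expr
| Bin of binop & expr & expr.

Inductive cmd :=
| Skip
| Assign of nat & expr
| Write of expr & expr
| SetStored of expr & expr
| Seq of cmd & cmd
| If of expr & cmd & cmd
| While of expr & cmd.

(* [tab] is the table of stored vertex colors, kept apart from the ordinary
   memory [mem]; [tab v = None] means that no color of v is stored. *)
Record state := State {
  vars : nat -> nat;
  mem : nat -> nat;
  tab : nat -> option bool }.

Definition upd (T : Type) (f : nat -> T) (i : nat) (x : T) : nat -> T :=
  fun j => if j == i then x else f j.

Definition word_of_color (c : option bool) : nat :=
  if c is Some b then nat_of_bool b else 2.

Definition color_of_word (x : nat) : option bool :=
  match x with 0 => Some false | 1 => Some true | _ => None end.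

Definition binop_sem (o : binop) (a b : nat) : nat :=
  match o with
  | Add => a + b
  | Sub => a - b
  | Mul => a * b
  | Div => a %/ b
  | Mod => a %% b
  | Eq => a == b
  | Lt => a < b
  end.

(* All values are reduced modulo 2 ^ w, so every variable, memory cell and
   address is a w-bit word; subtraction saturates at 0. *)
Fixpoint eval (w : nat) (s : state) (e : expr) : nat :=
  match e with
  | Const c => c %% 2 ^ w
  | Var x => vars s x
  | Read a => mem s (eval w s a)
  | Stored a => word_of_color (tab s (eval w s a)) %% 2 ^ w
  | Bin o a b => binop_sem o (eval w s a) (eval w s b) %% 2 ^ w
  end.

Fixpoint cost (e : expr) : nat :=
  match e with
  | Const _ | Var _ => 1
  | Read a | Stored a => (cost a).+1
  | Bin _ a b => (cost a + cost b).+1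
  end.

(* [exec w c s t r s']: on w-bit words, c started in s halts in s' after t unit
   cost steps, of which exactly r changed an entry of the color table. Storing
   a color where there was none, and erasing one, count as changes. *)
Inductive exec (w : nat) : cmd -> state -> nat -> nat -> state -> Prop :=
| exec_skip s : exec w Skip s 1 0 s
| exec_assign x e s :
    exec w (Assign x e) s (cost e).+1 0
      (State (upd (vars s) x (eval w s e)) (mem s) (tab s))
| exec_store a e s :
    exec w (Write a e) s (cost a + cost e).+1 0
      (State (vars s) (upd (mem s) (eval w s a) (eval w s e)) (tab s))
| exec_set_stored a e s :
    exec w (SetStored a e) s (cost a + cost e).+1
      (tab s (eval w s a) != color_of_word (eval w s e))
      (State (vars s) (mem s)
         (upd (tab s) (eval w s a) (color_of_word (eval w s e))))
| exec_seq c1 c2 s s1 s2 t1 t2 r1 r2 :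
    exec w c1 s t1 r1 s1 -> exec w c2 s1 t2 r2 s2 ->
    exec w (Seq c1 c2) s (t1 + t2) (r1 + r2) s2
| exec_if_true e c1 c2 s s1 t r :
    eval w s e != 0 -> exec w c1 s t r s1 ->
    exec w (If e c1 c2) s (cost e + t).+1 r s1
| exec_if_false e c1 c2 s s1 t r :
    eval w s e = 0 -> exec w c2 s t r s1 ->
    exec w (If e c1 c2) s (cost e + t).+1 r s1
| exec_while_false e c s :
    eval w s e = 0 -> exec w (While e c) s (cost e).+1 0 s
| exec_while_true e c s s1 s2 t1 t2 r1 r2 :
    eval w s e != 0 -> exec w c s t1 r1 s1 ->
    exec w (While e c) s1 t2 r2 s2 ->
    exec w (While e c) s (cost e + t1 + t2).+1 (r1 + r2) s2.

Lemma exec_det w c s t r s1 (H : exec w c s t r s1) :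
  forall t' r' s1', exec w c s t' r' s1' -> [/\ t = t', r = r' & s1 = s1'].
Proof.
elim: H => {c s t r s1}.
- by move=> s t' r' s1' H; inversion H.
- by move=> x e s t' r' s1' H; inversion H.
- by move=> a e s t' r' s1' H; inversion H.
- by move=> a e s t' r' s1' H; inversion H.
- move=> c1 c2 s s1 s2 t1 t2 r1 r2 _ IH1 _ IH2 t' r' s1' H.
  inversion H; subst.
  match goal with h : exec w c1 s _ _ _ |- _ =>
    have [? ? ?] := IH1 _ _ _ h; subst end.
  by match goal with h : exec w c2 _ _ _ _ |- _ =>
    have [? ? ?] := IH2 _ _ _ h; subst end.
- move=> e c1 c2 s s1 t r e0 _ IH t' r' s1' H.
  inversion H; subst; last by move: e0; rewrite (_ : eval w s e = 0).
  by match goal with h : exec w c1 _ _ _ _ |- _ =>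
    have [? ? ?] := IH _ _ _ h; subst end.
- move=> e c1 c2 s s1 t r e0 _ IH t' r' s1' H.
  inversion H; subst; first by match goal with h : is_true _ |- _ =>
    move: h; rewrite e0 end.
  by match goal with h : exec w c2 _ _ _ _ |- _ =>
    have [? ? ?] := IH _ _ _ h; subst end.
- move=> e c s e0 t' r' s1' H; inversion H; subst => //.
  by match goal with h : is_true _ |- _ => move: h; rewrite e0 end.
- move=> e c s s1 s2 t1 t2 r1 r2 e0 _ IH1 _ IH2 t' r' s1' H.
  inversion H; subst; first by move: e0; rewrite (_ : eval w _ e = 0).
  match goal with h : exec w c s _ _ _ |- _ =>
    have [? ? ?] := IH1 _ _ _ h; subst end.
  by match goal with h : exec w (While e c) _ _ _ _ |- _ =>
    have [? ? ?] := IH2 _ _ _ h; subst end.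
Qed.

(* An edge of a simple graph on 'I_n is an unordered pair of vertices. *)
Definition graph (n : nat) := {set {set 'I_n}}.

Definition proper_coloring (n : nat) (G : graph n) (col : 'I_n -> bool) :=
  forall u v : 'I_n, [set u; v] \in G -> col u != col v.

Definition bipartite (n : nat) (G : graph n) :=
  exists col : 'I_n -> bool, proper_coloring G col.

Inductive op (n : nat) :=
| Insert of 'I_n & 'I_n
| Delete of 'I_n & 'I_n
| GetColor of 'I_n.

Definition is_update (n : nat) (o : op n) : bool :=
  if o is GetColor _ then false else true.

Definition apply_op (n : nat) (G : graph n) (o : op n) : graph n :=
  match o with
  | Insert u v => [set u; v] |: G
  | Delete u v => G :\ [set u; v]
  | GetColor _ => G
  end.

Definition legal (n : nat) (G : graph n) (o : op n) : Prop :=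
  match o with
  | Insert u v => u != v /\ [set u; v] \notin G
  | Delete u v => is_true ([set u; v] \in G)
  | GetColor _ => True
  end.

Fixpoint admissible (n : nat) (G : graph n) (ops : seq (op n)) : Prop :=
  if ops is o :: ops' then
    [/\ legal G o, bipartite (apply_op G o) & admissible (apply_op G o) ops']
  else True.

Definition graph_after (n : nat) (ops : seq (op n)) : graph n :=
  foldl (@apply_op n) set0 ops.

Record algorithm := Algorithm {
  word_factor : nat;
  insert_prog : cmd;
  delete_prog : cmd;
  getcolor_prog : cmd }.

(* The number of binary digits of n: this is Theta(log n) for n >= 2, and
   positive for all n. *)
Definition lg (n : nat) : nat := (trunc_log 2 n).+1.

(* What survives between two calls; variables are local to a call. *)
Record config := Config {
  cmem : nat -> nat;
  ctab : nat -> option bool }.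

(* The edgeless graph starts with the color [false] stored at each vertex. *)
Definition init_config : config := Config (fun=> 0) (fun=> Some false).

Definition op_prog (A : algorithm) (n : nat) (o : op n) : cmd :=
  match o with
  | Insert _ _ => insert_prog A
  | Delete _ _ => delete_prog A
  | GetColor _ => getcolor_prog A
  end.

Definition op_args (n : nat) (o : op n) : seq nat :=
  match o with
  | Insert u v | Delete u v => [:: n; nat_of_ord u; nat_of_ord v]
  | GetColor v => [:: n; nat_of_ord v]
  end.

(* [call A o g t r g' x]: serving o in configuration g takes time t, makes r
   changes of stored colors, leads to g' and returns x.  Arguments are passed
   in variables 0, 1, 2 and the result is read from variable 0. *)
Definition call (A : algorithm) (n : nat) (o : op n) (g : config)
    (t r : nat) (g' : config) (x : nat) : Prop :=
  exists s : state,
    [/\ exec (word_factor A * lg n) (op_prog A o)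
          (State (nth 0 (op_args o)) (cmem g) (ctab g)) t r s,
        g' = Config (mem s) (tab s) & x = vars s 0].

(* [serves A g ops costs g']: the operations are served one after the other,
   and costs lists the time and the number of recolorings of each. *)
Inductive serves (A : algorithm) (n : nat) :
    config -> seq (op n) -> seq (nat * nat) -> config -> Prop :=
| serves_nil g : serves A g [::] [::] g
| serves_cons g o t r g1 x ops costs g2 :
    call A o g t r g1 x -> serves A g1 ops costs g2 ->
    serves A g (o :: ops) ((t, r) :: costs) g2.

Definition agrees (n : nat) (tb : nat -> option bool) (col : 'I_n -> bool) :=
  forall (v : 'I_n) (b : bool), tb v = Some b -> col v = b.

(* The stored colors are genuine colors of col, and they represent it: col is
   the only proper coloring that agrees with them.  Uniqueness keeps the count
   of recolorings meaningful, since an algorithm cannot hide its coloring in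
   ordinary memory instead of the color table. *)
Definition implicit_coloring (n : nat) (G : graph n)
    (tb : nat -> option bool) (col : 'I_n -> bool) : Prop :=
  [/\ proper_coloring G col, agrees tb col &
      forall col' : 'I_n -> bool,
        proper_coloring G col' -> agrees tb col' -> col' =1 col].

(* In configuration g every query returns the color given by a single implicit
   proper coloring of G, and a query changes no stored color. *)
Definition maintains (A : algorithm) (n : nat) (G : graph n) (g : config) :=
  exists col : 'I_n -> bool,
    implicit_coloring G (ctab g) col /\
    forall v : 'I_n, exists (t : nat) (g' : config),
      call A (GetColor v) g t 0 g' (nat_of_bool (col v)).

Definition num_updates (n : nat) (ops : seq (op n)) : nat :=
  count (@is_update n) ops.

Definition num_queries (n : nat) (ops : seq (op n)) : nat :=
  count (fun o => ~~ is_update o) ops.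

Definition total_time (costs : seq (nat * nat)) : nat :=
  sumn [seq c.1 | c <- costs].

Definition one_recoloring_per_update (n : nat) (ops : seq (op n))
    (costs : seq (nat * nat)) : bool :=
  all2 (fun o c => is_update o ==> (c.2 <= 1)) ops costs.

(* Main.v *)
Require Import Defs.
From mathcomp Require Import all_boot.
From mathcomp Require Import zify.

(** Dynamic connectivity in the manner of Holm, de Lichtenberg and Thorup: every
    edge has a level between 0 and 2 lg n, the tree edges of level at least i form
    a forest whose trees have at most n^2 / 2^i arcs, and the Euler tours of this
    forest are kept in splay trees, for each i.  When a tree edge is deleted, the
    edges at the smaller side are examined from its level downwards.  Those that
    do not reconnect the two sides are promoted to the next level, which pays for
    their examination.

    Exactly one vertex of each component stores a color.  Any other vertex has
    the color given by the parity of its distance to the stored vertex, which is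
    the parity of the number of arcs between the two in the Euler tour.  Linking
    two components erases the color of one of them, and splitting a component
    stores a color on the side that was left without one, so an update changes at
    most one stored color.

    The splay trees maintain sums of weights, written in base n^2 + 1: the digits
    count the arcs of a tour, its arcs marked at the current level and its
    non-tree edges, and name its stored vertex. *)

Set Implicit Arguments.
Unset Strict Implicit.
Unset Printing Implicit Defensive.

(** * Programs and trees in memory *)

(** Memory starts zeroed and nothing may be preprocessed, yet every vertex stores a color from the
    start. Hence a vertex node counts as a tour of one node even with weight 0. A vertex receives
    the weight that names it as stored vertex only when an update needs it; before that it may carry
    its color alone, as long as it is isolated.

    Sizes are counted in ordered pairs of vertices. Within a level such a pair determines a node, so
    a tour has at most n^2 nodes: sums of digits 0 and 1 never carry in base n^2 + 1, and 2 lg n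
    levels suffice because 2^k <= n^2 forces k <= 2 lg n.

    Acyclicity is expressed without paths: each tree edge has a vertex predicate that changes across
    it and across no other arc of its level.

    A deleted tree edge is cut at all its levels before the search. Every level cut in this way
    keeps room for two arcs in its size bound, and this room is what a replacement edge fills.

    Two potentials pay for time: the ranks in the splay trees, and the promotions that each edge may
    still undergo. An insertion deposits O(log n) promotions of O(log n) time each, whence the
    square. *)

(** A precondition for total correctness: a halting run is exhibited, and [Q] receives the time and
    the recolorings accumulated since the start, so that specifications chain by continuation. *)
Definition wp w c t r s (Q : nat -> nat -> state -> Prop) :=
  exists dt dr s', exec w c s dt dr s' /\ Q (t + dt) (r + dr) s'.

Lemma wp_skip w t r s Q : Q t.+1 r s -> wp w Skip t r s Q.
Proof.
move=> HQ; exists 1, 0, s; split; first exact: exec_skip.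
by rewrite addn1 addn0.
Qed.

Lemma wp_assign w x e v t r vs m tb Q :
  eval w (State vs m tb) e = v ->
  Q (t + (cost e).+1) r (State (upd vs x v) m tb) ->
  wp w (Assign x e) t r (State vs m tb) Q.
Proof.
move=> <- HQ; exists (cost e).+1, 0; eexists; split; first exact: exec_assign.
by rewrite addn0.
Qed.

Lemma wp_write w a e x v t r vs m tb Q :
  eval w (State vs m tb) a = x -> eval w (State vs m tb) e = v ->
  Q (t + (cost a + cost e).+1) r (State vs (upd m x v) tb) ->
  wp w (Write a e) t r (State vs m tb) Q.
Proof.
move=> <- <- HQ; exists (cost a + cost e).+1, 0; eexists.
by split; [exact: exec_store | rewrite addn0].
Qed.

Lemma wp_set_stored w a e x v t r vs m tb Q :
  eval w (State vs m tb) a = x -> eval w (State vs m tb) e = v ->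
  Q (t + (cost a + cost e).+1) (r + (tb x != color_of_word v))
    (State vs m (upd tb x (color_of_word v))) ->
  wp w (SetStored a e) t r (State vs m tb) Q.
Proof.
move=> <- <- HQ; exists (cost a + cost e).+1; do 2 eexists.
by split; [exact: exec_set_stored | exact: HQ].
Qed.

Lemma wp_seq w c1 c2 t r s Q :
  wp w c1 t r s (fun t' r' s' => wp w c2 t' r' s' Q) ->
  wp w (Seq c1 c2) t r s Q.
Proof.
case=> t1 [r1 [s1 [H1 [t2 [r2 [s2 [H2 HQ]]]]]]].
exists (t1 + t2), (r1 + r2), s2; split; first exact: exec_seq H1 H2.
by rewrite !addnA.
Qed.

Lemma wp_if w e c1 c2 t r s Q :
  (eval w s e != 0 -> wp w c1 (t + (cost e).+1) r s Q) ->
  (eval w s e = 0 -> wp w c2 (t + (cost e).+1) r s Q) ->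
  wp w (If e c1 c2) t r s Q.
Proof.
case: (eqVneq (eval w s e) 0) => e0 H1 H2.
  have [//|t1 [r1 [s1 [H HQ]]]] := H2; exists (cost e + t1).+1, r1, s1.
  by split; [exact: exec_if_false | rewrite -addSn addnA].
have [//|t1 [r1 [s1 [H HQ]]]] := H1; exists (cost e + t1).+1, r1, s1.
by split; [exact: exec_if_true | rewrite -addSn addnA].
Qed.

Lemma wp_while w e c t r s Q :
  (eval w s e = 0 -> Q (t + (cost e).+1) r s) ->
  (eval w s e != 0 ->
   wp w c (t + (cost e).+1) r s (fun t' r' s' => wp w (While e c) t' r' s' Q)) ->
  wp w (While e c) t r s Q.
Proof.
case: (eqVneq (eval w s e) 0) => e0 H1 H2.
  exists (cost e).+1, 0, s; split; first exact: exec_while_false.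
  by rewrite addn0; exact: H1.
have [//|t1 [r1 [s1 [H [t2 [r2 [s2 [H' HQ]]]]]]]] := H2.
exists (cost e + t1 + t2).+1, (r1 + r2), s2.
split; first exact: exec_while_true H H'.
have -> : t + (cost e + t1 + t2).+1 = t + (cost e).+1 + t1 + t2 by lia.
by rewrite addnA.
Qed.

Notation "a ;; b" := (Seq a b) (at level 100, right associativity).

(* Field [f] of node [x] is the memory cell [x * 8 + f]. Fields 0 and 1 are the
   children, 2 the parent, 3 the weight of the node and 4 the weight of its
   subtree; node 0 is the null pointer. *)
Definition addr (f e : expr) := Bin Add (Bin Mul e (Const 8)) f.
Definition Fe (f e : expr) := Read (addr f e).
Definition Fd (f : nat) (e : expr) := Fe (Const f) e.
Definition Wr (f : nat) (e v : expr) := Write (addr (Const f) e) v.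
Definition fd (f : nat) (m : nat -> nat) (x : nat) := m (x * 8 + f).
Definition setf (f x v : nat) (m : nat -> nat) := upd m (x * 8 + f) v.

Lemma fd_setf f g x v m z : f < 8 -> g < 8 ->
  fd f (setf g x v m) z = if (f == g) && (z == x) then v else fd f m z.
Proof.
move=> hf hg; rewrite /fd /setf /upd.
case: eqP => h; case: andP => // k; first by case: k; split; apply/eqP; lia.
by case: k => /eqP ? /eqP ?; lia.
Qed.

Inductive tree := Lf | Nd of tree & nat & tree.

Definition rt t := if t is Nd _ x _ then x else 0.
Fixpoint ino t := if t is Nd l x r then ino l ++ x :: ino r else [::].
Definition tsz t := size (ino t).
Definition wsum (wt : nat -> nat) (s : seq nat) := sumn (map wt s).

(** [p] is the parent of the root. A leaf constrains nothing, so the cells of the null node may hold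
    garbage; only its field 4 is kept at 0, by separate hypotheses. *)
Fixpoint rep (m : nat -> nat) (p : nat) (t : tree) : Prop :=
  if t is Nd l x r then
    [/\ [/\ fd 0 m x = rt l, fd 1 m x = rt r, fd 2 m x = p &
         fd 4 m x = wsum (fd 3 m) (ino t)], rep m x l & rep m x r]
  else True.

(** The Sleator-Tarjan potential: the sum of the ranks, with logarithms rounded down. *)
Fixpoint pot t :=
  if t is Nd l x r then pot l + trunc_log 2 (tsz t) + pot r else 0.

(* Zippers: a frame [(d, y, s)] says that the focus is the child of [y] on side
   [d], and that [s] is the other child. *)
Definition frame := (bool * nat * tree)%type.
Definition fr1 (f : frame) t :=
  let: (d, y, s) := f in if d then Nd s y t else Nd t y s.
Definition plug t (c : seq frame) := foldl (fun t f => fr1 f t) t c.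
Definition ctop (c : seq frame) := if c is (_, y, _) :: _ then y else 0.
Definition fnodes (f : frame) := let: (d, y, s) := f in y :: ino s.
Definition cnodes (c : seq frame) := flatten (map fnodes c).

(** A context sees the tree at the focus only through its root [r] and its total weight [S]. *)
Fixpoint repc (m : nat -> nat) (r S : nat) (c : seq frame) : Prop :=
  if c is (d, y, s) :: c' then
    let S' := S + wsum (fd 3 m) (y :: ino s) in
    [/\ [/\ fd (nat_of_bool d) m y = r, fd (nat_of_bool (~~ d)) m y = rt s,
            fd 2 m y = ctop c' & fd 4 m y = S'], rep m y s & repc m y S' c']
  else True.

Lemma wsum_cat wt s1 s2 : wsum wt (s1 ++ s2) = wsum wt s1 + wsum wt s2.
Proof. by rewrite /wsum map_cat sumn_cat. Qed.

Lemma wsum_cons wt x s : wsum wt (x :: s) = wt x + wsum wt s.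
Proof. by []. Qed.

Lemma rt_ino t : t <> Lf -> rt t \in ino t.
Proof. by case: t => // l x r _ /=; rewrite mem_cat inE eqxx orbT. Qed.

(** This makes rewriting at the focus local: the context is affected only by a change of the root or
    of the total weight there. *)
Lemma rep_plug m t c :
  rep m 0 (plug t c) <->
  rep m (ctop c) t /\ repc m (rt t) (wsum (fd 3 m) (ino t)) c.
Proof.
elim: c t => [|[[d y] s] c IH] t /=; first by split=> [|[]].
rewrite IH /=; case: d => /=; rewrite !wsum_cat !wsum_cons.
  have -> : wsum (fd 3 m) (ino s) + (fd 3 m y + wsum (fd 3 m) (ino t)) =
    wsum (fd 3 m) (ino t) + (fd 3 m y + wsum (fd 3 m) (ino s)) by lia.
  by split=> [[[[h1 h2 h3 h4] h5 h6] h7]|[h6 [[h1 h2 h3 h4] h5 h7]]].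
by split=> [[[[h1 h2 h3 h4] h5 h6] h7]|[h6 [[h1 h2 h3 h4] h5 h7]]].
Qed.

Lemma ino_plug t1 t2 c : ino t1 = ino t2 -> ino (plug t1 c) = ino (plug t2 c).
Proof.
elim: c t1 t2 => [|[[d y] s] c IH] t1 t2 //= E; apply: IH.
by case: d => /=; rewrite E.
Qed.

Lemma mem_plug t c z : (z \in ino (plug t c)) = (z \in ino t) || (z \in cnodes c).
Proof.
elim: c t => [|[[d y] s] c IH] t /=; first by rewrite orbF.
rewrite IH /cnodes /= in_cons mem_cat; case: d => /=;
  rewrite mem_cat in_cons; by case: (z \in ino t) (z == y) (z \in ino s) => [] [] [].
Qed.

Lemma perm_plug t c : perm_eq (ino (plug t c)) (ino t ++ cnodes c).
Proof.
elim: c t => [|[[d y] s] c IH] t /=; first by rewrite cats0.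
apply: (perm_trans (IH _)); rewrite /cnodes /= -cat_cons catA perm_cat2r.
by apply/permP => a; case: d; rewrite /= !count_cat /=; lia.
Qed.

(** The ranks in the context depend on sizes alone, so they cancel. *)
Lemma plug_pot t1 t2 c : tsz t1 = tsz t2 ->
  pot (plug t1 c) + pot t2 = pot (plug t2 c) + pot t1.
Proof.
elim: c t1 t2 => [|[[d y] s] c IH] t1 t2 E /=; first by rewrite addnC.
have E2 : tsz (fr1 (d, y, s) t1) = tsz (fr1 (d, y, s) t2).
  by rewrite /tsz; case: d => /=; rewrite !size_cat /=; rewrite /tsz in E; lia.
have := IH _ _ E2; case: d E2 => /= ->; lia.
Qed.

Lemma eq_wsum (w1 w2 : nat -> nat) s : {in s, w1 =1 w2} -> wsum w1 s = wsum w2 s.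
Proof. by move=> H; rewrite /wsum; congr sumn; apply/eq_in_map. Qed.

Definition agree (m m' : nat -> nat) z := forall f, f < 5 -> fd f m' z = fd f m z.

Lemma rep_move m m' p p' t :
  uniq (ino t) ->
  (forall z, z \in ino t -> z != rt t -> fd 2 m' z = fd 2 m z) ->
  (forall z f, z \in ino t -> f < 5 -> f != 2 -> fd f m' z = fd f m z) ->
  (t <> Lf -> fd 2 m' (rt t) = p') ->
  rep m p t -> rep m' p' t.
Proof.
elim: t p p' => [//|l IHl x r IHr] p p' /= U H2 Hf Hr [[h0 h1 h2 h4] hl hr].
have U' := U; rewrite cat_uniq /= in U' => //.
case/and3P: U' => Ul /norP [/negP xl /hasPn lr] /andP [/negP xr Ur].
have W s : {subset s <= ino l ++ x :: ino r} ->
  wsum (fd 3 m') s = wsum (fd 3 m) s.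
  by move=> S; apply: eq_wsum => z /S zi; rewrite Hf.
have xi : x \in ino l ++ x :: ino r by rewrite mem_cat inE eqxx orbT.
have li z : z \in ino l -> z \in ino l ++ x :: ino r by rewrite mem_cat => ->.
have ri z : z \in ino r -> z \in ino l ++ x :: ino r.
  by rewrite mem_cat inE => ->; rewrite !orbT.
have lx z : z \in ino l -> z != x by move=> zl; apply/eqP => E; subst z.
have rx z : z \in ino r -> z != x by move=> zl; apply/eqP => E; subst z.
have K q t : {subset ino t <= ino l ++ x :: ino r} ->
  (forall z, z \in ino t -> z != x) -> rep m q t -> t <> Lf -> fd 2 m' (rt t) = q.
  case: t => //= a y b S X [[_ _ E _] _ _] _.
  have yi : y \in ino a ++ y :: ino b by rewrite mem_cat inE eqxx orbT.
  by rewrite H2 ?X ?S.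
split; first split.
- by rewrite Hf.
- by rewrite Hf.
- exact: Hr.
- by rewrite Hf // h4 W.
- apply: (IHl x) => //; [|by move=> z f zl; apply: Hf; apply: li|].
  + by move=> z zl _; rewrite H2 ?li ?lx.
  + by apply: K hl.
- apply: (IHr x) => //; [|by move=> z f zl; apply: Hf; apply: ri|].
  + by move=> z zl _; rewrite H2 ?ri ?rx.
  + by apply: K hr.
Qed.

Lemma rep_frame m m' p t :
  (forall z, z \in ino t -> agree m m' z) -> rep m p t -> rep m' p t.
Proof.
elim: t p => [//|l IHl x r IHr] p /= H [[h0 h1 h2 h4] hl hr].
have xi : x \in ino l ++ x :: ino r by rewrite mem_cat inE eqxx orbT.
split; first split.
- by rewrite H.
- by rewrite H.
- by rewrite H.
- by rewrite H // h4; apply: eq_wsum => z zi; rewrite H.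
- by apply: IHl hl => z zl; apply: H; rewrite mem_cat zl.
- by apply: IHr hr => z zl; apply: H; rewrite mem_cat inE zl !orbT.
Qed.

Lemma repc_frame m m' r S c :
  (forall z, z \in cnodes c -> agree m m' z) -> repc m r S c -> repc m' r S c.
Proof.
elim: c r S => [//|[[d y] s] c IH] r S /= H [[h0 h1 h2 h4] hs hc].
have yi : y \in cnodes ((d, y, s) :: c) by rewrite inE eqxx.
have si z : z \in ino s -> z \in cnodes ((d, y, s) :: c).
  by rewrite /cnodes /= inE mem_cat => ->; rewrite orbT.
have ci z : z \in cnodes c -> z \in cnodes ((d, y, s) :: c).
  by rewrite /cnodes /= inE mem_cat => ->; rewrite !orbT.
have E : wsum (fd 3 m') (y :: ino s) = wsum (fd 3 m) (y :: ino s).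
  by apply: eq_wsum => z; rewrite inE => /predU1P [->|/si zi]; rewrite H.
rewrite E; split; first split; rewrite ?H //.
- by case: (d).
- by case: (d).
- by apply: rep_frame hs => z /si; apply: H.
- by apply: IH hc => z /ci; apply: H.
Qed.

(** The counterpart for contexts: only the child pointer of the innermost frame changes. *)
Lemma repc_move m m' r r' S c :
  uniq (cnodes c) ->
  (forall z, z \in cnodes c -> z != ctop c -> agree m m' z) ->
  (if c is (d, y, s) :: c' then
    [/\ fd (nat_of_bool d) m' y = r',
        fd (nat_of_bool (~~ d)) m' y = fd (nat_of_bool (~~ d)) m y &
        forall f, 2 <= f < 5 -> fd f m' y = fd f m y] else True) ->
  repc m r S c -> repc m' r' S c.
Proof.
case: c => [//|[[d y] s] c] /= /andP [yn _] H [e1 e2 ef] [[h0 h1 h2 h4] hs hc].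
have si z : z \in ino s -> z \in cnodes ((d, y, s) :: c).
  by rewrite /cnodes /= inE mem_cat => ->; rewrite orbT.
have ci z : z \in cnodes c -> z \in cnodes ((d, y, s) :: c).
  by rewrite /cnodes /= inE mem_cat => ->; rewrite !orbT.
have sy z : z \in ino s -> z != y.
  by move=> zs; apply/eqP => E; case/negP: yn; rewrite mem_cat -E zs.
have cy z : z \in cnodes c -> z != y.
  by move=> zs; apply/eqP => E; case/negP: yn; rewrite mem_cat -E zs orbT.
have E : wsum (fd 3 m') (y :: ino s) = wsum (fd 3 m) (y :: ino s).
  apply: eq_wsum => z; rewrite inE => /predU1P [->|zs]; first by rewrite ef.
  by rewrite H ?si ?sy.
rewrite E; split; first split; rewrite ?e1 ?e2 ?ef //.
- by apply: rep_frame hs => z zs; apply: H; rewrite ?si ?sy.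
- by apply: repc_frame hc => z zs; apply: H; rewrite ?ci ?cy.
Qed.

(** * Rotations *)

Section Ram.
Variables (w N : nat).
(** The addresses of the nodes up to [N] and the constants below 16 fit in a word, so none of them
    wraps around. *)
Hypothesis hN : N * 8 + 16 <= 2 ^ w.

Lemma small_word k : k < 16 -> k %% 2 ^ w = k.
Proof. by move=> hk; rewrite modn_small //; lia. Qed.

Lemma eval_addr s f e k x :
  eval w s f = k -> k < 8 -> eval w s e = x -> x <= N ->
  eval w s (addr f e) = x * 8 + k.
Proof.
move=> /= -> hk -> hx.
by rewrite (@small_word 8) // (@modn_small (x * 8)) ?modn_small //; lia.
Qed.

Lemma eval_Fe s f e k x :
  eval w s f = k -> k < 8 -> eval w s e = x -> x <= N ->
  eval w s (Fe f e) = fd k (Defs.mem s) x.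
Proof. by move=> h1 h2 h3 h4; rewrite /fd -(eval_addr h1 h2 h3 h4). Qed.

Lemma eval_Fd s f e x : f < 8 -> eval w s e = x -> x <= N ->
  eval w s (Fd f e) = fd f (Defs.mem s) x.
Proof. by move=> h; apply: eval_Fe => //=; rewrite small_word //; lia. Qed.

Lemma eval_eq s e1 e2 x y : eval w s e1 = x -> eval w s e2 = y ->
  eval w s (Bin Eq e1 e2) = (x == y).
Proof. by move=> /= -> ->; rewrite small_word //; case: eqP. Qed.

Lemma eval_add s e1 e2 x y : eval w s e1 = x -> eval w s e2 = y ->
  x + y < 2 ^ w -> eval w s (Bin Add e1 e2) = x + y.
Proof. by move=> /= -> -> h; rewrite modn_small. Qed.

Lemma eval_sub1 s e (d : bool) : eval w s e = d ->
  eval w s (Bin Defs.Sub (Const 1) e) = ~~ d.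
Proof. by move=> /= ->; case: d; rewrite !small_word. Qed.

(** A missing subtree or grandparent needs no test: the writes then fall on fields 0, 1 or 2 of the
    null node, whose contents do not matter. *)
Definition rotup v :=
  Assign 60 (Var v) ;;
  Assign 61 (Fd 2 (Var 60)) ;;
  Assign 62 (Fd 2 (Var 61)) ;;
  Assign 63 (Bin Eq (Fd 1 (Var 61)) (Var 60)) ;;
  Assign 64 (Bin Eq (Fd 1 (Var 62)) (Var 61)) ;;
  Assign 66 (Bin Defs.Sub (Const 1) (Var 63)) ;;
  Assign 65 (Fe (Var 66) (Var 60)) ;;
  Write (addr (Var 63) (Var 61)) (Var 65) ;;
  Wr 2 (Var 65) (Var 61) ;;
  Write (addr (Var 66) (Var 60)) (Var 61) ;;
  Wr 2 (Var 61) (Var 60) ;;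
  Wr 2 (Var 60) (Var 62) ;;
  Write (addr (Var 64) (Var 62)) (Var 60) ;;
  Wr 4 (Var 60) (Fd 4 (Var 61)) ;;
  Wr 4 (Var 61) (Bin Add (Bin Add (Fd 4 (Fd 0 (Var 61))) (Fd 4 (Fd 1 (Var 61))))
                    (Fd 3 (Var 61))).

(** The result of rotating [x] above its parent [y]; [d] tells that [x] was the right child. *)
Definition rott (d : bool) A x B y S :=
  if d then Nd (Nd S y A) x B else Nd A x (Nd B y S).

(** The eight writes of [rotup], the last one outermost. *)
Definition rmem (d e : bool) x y z b sx sy m :=
  setf 4 y sy (setf 4 x sx (setf e z x (setf 2 x z (setf 2 y x
    (setf (~~ d) x y (setf 2 b y (setf d y b m))))))).

(** The disequalities keep the writes from overlapping. The sums [sl] and [sr] are those of the two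
    subtrees that [y] has after the rotation. *)
Lemma rot_exec vs m tb t r v x y z b (d e : bool) sl sr Q :
  vs v = x -> x <= N -> fd 2 m x = y -> y <= N -> fd 2 m y = z -> z <= N ->
  (fd 1 m y == x) = d -> (fd 1 m z == y) = e ->
  fd (nat_of_bool (~~ d)) m x = b -> b <= N ->
  y != x -> y != 0 -> z != x -> z != y -> x != 0 ->
  fd (nat_of_bool (~~ d)) m y <= N ->
  (if d then fd 4 m (fd 0 m y) else fd 4 m b) = sl ->
  (if d then fd 4 m b else fd 4 m (fd 1 m y)) = sr ->
  (if d then fd 0 m y else fd 1 m y) != x ->
  b != x ->
  sl + sr + fd 3 m y < 2 ^ w ->
  (forall t' vs', t' <= t + 200 -> (forall k, k < 60 -> vs' k = vs k) ->
    Q t' r (State vs' (rmem d e x y z b (fd 4 m y) (sl + sr + fd 3 m y) m) tb)) ->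
  wp w (rotup v) t r (State vs m tb) Q.
Proof.
move=> vx xN Ey yN Ez zN Ed Ee Eb bN yx y0 zx zy x0 yN' Esl Esr nx bx hs HQ.
have dN (a : bool) : a < 8 by case: a.
apply/wp_seq/(wp_assign (v := x)) => //.
apply/wp_seq/(wp_assign (v := y)); first by rewrite (@eval_Fd _ _ _ x).
apply/wp_seq/(wp_assign (v := z)); first by rewrite (@eval_Fd _ _ _ y).
apply/wp_seq/(wp_assign (v := d)).
  by rewrite -Ed; apply: eval_eq => //; rewrite (@eval_Fd _ _ _ y).
apply/wp_seq/(wp_assign (v := e)).
  by rewrite -Ee; apply: eval_eq => //; rewrite (@eval_Fd _ _ _ z).
apply/wp_seq/(wp_assign (v := ~~ d)); first exact: eval_sub1.
apply/wp_seq/(wp_assign (v := b)).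
  by rewrite (@eval_Fe _ _ _ (~~ d) x).
apply/wp_seq/(wp_write (x := y * 8 + d) (v := b)) => //.
  exact: eval_addr.
apply/wp_seq/(wp_write (x := b * 8 + 2) (v := y)) => //.
  by apply: eval_addr => //=; rewrite small_word.
apply/wp_seq/(wp_write (x := x * 8 + (~~ d)) (v := y)) => //.
  exact: eval_addr.
apply/wp_seq/(wp_write (x := y * 8 + 2) (v := x)) => //.
  by apply: eval_addr => //=; rewrite small_word.
apply/wp_seq/(wp_write (x := x * 8 + 2) (v := z)) => //.
  by apply: eval_addr => //=; rewrite small_word.
apply/wp_seq/(wp_write (x := z * 8 + e) (v := x)) => //.
  exact: eval_addr.
rewrite -[upd _ (z * 8 + e) _]/(setf e z x _) -[upd _ (x * 8 + 2) _]/(setf 2 x z _).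
rewrite -[upd _ (y * 8 + 2) _]/(setf 2 y x _) -[upd _ (x * 8 + (~~ d)) _]/(setf (~~ d) x y _).
rewrite -[upd _ (b * 8 + 2) _]/(setf 2 b y _) -[upd m _ _]/(setf d y b m).
set m1 := setf e z x _.
have F k u : (k != 2) || (u != b) && (u != x) && (u != y) ->
  (k != d) || (u != y) -> (k != (~~ d)) || (u != x) -> (k != e) || (u != z) ->
  k < 8 -> fd k m1 u = fd k m u.
  move=> h1 h2 h3 h4 hk; rewrite /m1 !fd_setf //.
  rewrite !(fun_if id).
  case: eqP h4 => //= _; [move=> /negbTE ->|];
  case: eqP h1 => //= _; [move=> /andP [/andP [/negbTE -> /negbTE ->] /negbTE ->]| |
   move=> /andP [/andP [/negbTE -> /negbTE ->] /negbTE ->]|];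
  case: eqP h2 => //= _; try move=> /negbTE ->; case: eqP h3 => //= _; try by move=> /negbTE ->.
have F4 u : fd 4 m1 u = fd 4 m u by apply: F => //; [case: (d)|case: (d)|case: (e)].
have F3 u : fd 3 m1 u = fd 3 m u by apply: F => //; [case: (d)|case: (d)|case: (e)].
apply/wp_seq/(wp_write (x := x * 8 + 4) (v := fd 4 m y)).
- by apply: eval_addr => //=; rewrite small_word.
- by rewrite (@eval_Fd _ _ _ y) //= F4.
rewrite -[upd _ (x * 8 + 4) _]/(setf 4 x (fd 4 m y) _).
have Fd' : fd (nat_of_bool d) m1 y = b.
  rewrite /m1 !fd_setf // [y == z]eq_sym (negbTE zy) andbF.
  by case: (d) => /=; rewrite eqxx.
have Fnd : fd (nat_of_bool (~~ d)) m1 y = fd (nat_of_bool (~~ d)) m y.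
  rewrite /m1 !fd_setf // [y == z]eq_sym (negbTE zy) (negbTE yx) !andbF.
  by case: (d).
apply: (wp_write (x := y * 8 + 4) (v := sl + sr + fd 3 m y)).
- by apply: eval_addr => //=; rewrite small_word.
- apply: eval_add => //; last by rewrite (@eval_Fd _ _ _ y) //= fd_setf //= F3.
  apply: eval_add; last by move: hs; lia.
    rewrite (@eval_Fd _ _ _ (if d then fd 0 m y else b)) //.
    + rewrite /= fd_setf //= F4 -Esl; case: (d) nx => [/negbTE -> //|_].
      by rewrite (negbTE bx).
    + rewrite (@eval_Fd _ _ _ y) //= fd_setf //=.
      by case: (d) Fd' Fnd => /=.
    + by case: (d) yN'.
  rewrite (@eval_Fd _ _ _ (if d then b else fd 1 m y)) //.
  + rewrite /= fd_setf //= F4 -Esr; case: (d) nx => [_|/negbTE -> //].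
    by rewrite (negbTE bx).
  + rewrite (@eval_Fd _ _ _ y) //= fd_setf //=.
    by case: (d) Fd' Fnd => /=.
  + by case: (d) yN'.
apply: HQ => [|k hk]; first by rewrite -!addnA leq_add2l.
by rewrite /upd !ltn_eqF // (leq_trans hk).
Qed.

Lemma rep_rt m p t : rep m p t -> t <> Lf -> fd 2 m (rt t) = p.
Proof. by case: t => //= l x r [[]]. Qed.

Lemma rep_sum m p t : fd 4 m 0 = 0 -> rep m p t -> fd 4 m (rt t) = wsum (fd 3 m) (ino t).
Proof. by case: t => //= l x r _ [[]]. Qed.

Lemma rmem_fd d e x y z b sx sy m k u : k < 5 ->
  fd k (rmem d e x y z b sx sy m) u =
  if (k == 4) && (u == y) then sy else if (k == 4) && (u == x) then sx else
  if (k == e) && (u == z) then x else if (k == 2) && (u == x) then z else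
  if (k == 2) && (u == y) then x else if (k == (~~ d)) && (u == x) then y else
  if (k == 2) && (u == b) then y else if (k == d) && (u == y) then b else fd k m u.
Proof.
move=> hk; have hk8 : k < 8 by lia.
by rewrite /rmem !fd_setf //; [case: (d)|case: (d)|case: (e)].
Qed.

Lemma rot_spec vs m tb t r v A x B d y S c Q :
  let T := plug (Nd A x B) ((d, y, S) :: c) in
  vs v = x -> rep m 0 T -> uniq (0 :: ino T) -> all (fun z => z <= N) (ino T) ->
  wsum (fd 3 m) (ino T) < 2 ^ w -> fd 4 m 0 = 0 ->
  (forall t' vs' m', t' <= t + 200 -> (forall k, k < 60 -> vs' k = vs k) ->
     rep m' 0 (plug (rott d A x B y S) c) ->
     (forall z, z \notin 0 :: ino T -> agree m m' z) ->
     fd 3 m' =1 fd 3 m -> fd 4 m' 0 = 0 -> Q t' r (State vs' m' tb)) ->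
  wp w (rotup v) t r (State vs m tb) Q.
Proof.
move=> T vx hrep /andP [T0 TU] /allP TN hs hz HQ.
have hP : perm_eq (ino T) (ino (fr1 (d, y, S) (Nd A x B)) ++ cnodes c).
  exact: (perm_plug (fr1 (d, y, S) (Nd A x B)) c).
have hW : wsum (fd 3 m) (ino (fr1 (d, y, S) (Nd A x B))) < 2 ^ w.
  by apply: leq_ltn_trans hs; rewrite /wsum (perm_sumn (perm_map _ hP)) map_cat sumn_cat leq_addr.
have hmem u : (u \in ino T) = [|| u == x, u == y, u \in ino A, u \in ino B, u \in ino S | u \in cnodes c].
  rewrite (perm_mem hP) mem_cat; case: (d) => /=; rewrite !(mem_cat, inE);
  by case: (u == x) (u == y) (u \in ino A) (u \in ino B) (u \in ino S) => [] [] [] [] [].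
have U : uniq (x :: y :: (ino A ++ ino B ++ ino S ++ cnodes c)).
  rewrite -(perm_uniq (_ : perm_eq (ino T) _)) //; apply: (perm_trans hP).
  by apply/permP => a; case: (d); rewrite /= !count_cat /= ?count_cat /=; clear; lia.
have xy : x != y by move: U => /= /andP []; rewrite inE negb_or => /andP [].
have x0 : x != 0 by apply: contraNneq T0 => <-; rewrite hmem eqxx.
have y0 : y != 0 by apply: contraNneq T0 => <-; rewrite hmem eqxx orbT.
have xN : x <= N by apply: TN; rewrite hmem eqxx.
have yN : y <= N by apply: TN; rewrite hmem eqxx orbT.
have [xn [yn [nd]]] : x \notin ino A ++ ino B ++ ino S ++ cnodes c /\
  y \notin ino A ++ ino B ++ ino S ++ cnodes c /\
  uniq (ino A ++ ino B ++ ino S ++ cnodes c).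
  by move: U => /= /and3P []; rewrite inE negb_or => /andP [].
move: nd; rewrite !cat_uniq => /and5P [UA /hasPn DA UB /hasPn DB /and3P [US /hasPn DS Uc]].
have nx u : u \in ino A ++ ino B ++ ino S ++ cnodes c -> (u == x) = false.
  by move=> h; apply: contraNF xn => /eqP <-.
have ny u : u \in ino A ++ ino B ++ ino S ++ cnodes c -> (u == y) = false.
  by move=> h; apply: contraNF yn => /eqP <-.
have n0 u : u \in ino T -> (u == 0) = false.
  by move=> h; apply: contraNF T0 => /eqP <-.
have zc : ctop c = 0 \/ ctop c \in cnodes c.
  by case: (c) => [|[[? z'] ?] ?]; [left | right; rewrite inE eqxx].
have zN : ctop c <= N by case: zc => [-> //|h]; apply: TN; rewrite hmem h !orbT.
have nz u : u != 0 -> u \notin cnodes c -> (u == ctop c) = false.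
  by move=> u0 uc; apply/negbTE; case: zc => [-> //|h]; apply: contraNneq uc => ->.
have rtc t' : rt t' = 0 \/ rt t' \in ino t'.
  by case: t' => [|l q r']; [left | right; apply: rt_ino].
have nt u t' : u != 0 -> u \notin ino t' -> (u == rt t') = false.
  by move=> u0 ut; apply/negbTE; case: (rtc t') => [-> //|h]; apply: contraNneq ut => ->.
have tN t' : {subset ino t' <= ino T} -> rt t' <= N.
  by move=> h; case: (rtc t') => [-> //|/h h']; apply: TN.
have SA u : u \in ino A -> u \in ino T by rewrite hmem => ->; rewrite !orbT.
have SB u : u \in ino B -> u \in ino T by rewrite hmem => ->; rewrite !orbT.
have SS u : u \in ino S -> u \in ino T by rewrite hmem => ->; rewrite !orbT.
have Sc u : u \in cnodes c -> u \in ino T by rewrite hmem => ->; rewrite !orbT.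
have [AN BN SN] : [/\ rt A <= N, rt B <= N & rt S <= N] by split; apply: tN.
have zx : ctop c != x.
  by case: zc => [->|h]; [rewrite eq_sym | apply: contraNneq xn => <-; rewrite !mem_cat h !orbT].
have zy : ctop c != y.
  by case: zc => [->|h]; [rewrite eq_sym | apply: contraNneq yn => <-; rewrite !mem_cat h !orbT].
have inA u : u \in ino A -> [/\ u != 0, (u == x) = false, (u == y) = false, u \notin ino B & (u \notin ino S) && (u \notin cnodes c)].
  move=> h; rewrite n0 ?SA // nx ?ny ?mem_cat ?h //.
  by rewrite -negb_or -mem_cat; split=> //; apply/negP => k; have := DA u; rewrite mem_cat k ?orbT /= h => /(_ isT).
have inB u : u \in ino B -> [/\ u != 0, (u == x) = false, (u == y) = false, u \notin ino A & (u \notin ino S) && (u \notin cnodes c)].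
  move=> h; rewrite n0 ?SB // nx ?ny ?mem_cat ?h ?orbT //.
  rewrite -negb_or -mem_cat; split=> //; first by have := DA u; rewrite mem_cat h; exact.
  by apply/negP => k; have := DB u; rewrite k /= h => /(_ isT).
have inS u : u \in ino S -> [/\ u != 0, (u == x) = false, (u == y) = false, u \notin ino A & (u \notin ino B) && (u \notin cnodes c)].
  move=> h; rewrite n0 ?SS // nx ?ny ?mem_cat ?h ?orbT //.
  split=> //; first by have := DA u; rewrite !mem_cat h orbT; exact.
  have -> /= := DB u; last by rewrite mem_cat h.
  by apply/negP => k; have := DS u; rewrite k /= h => /(_ isT).
have inc u : u \in cnodes c -> [/\ u != 0, (u == x) = false, (u == y) = false, u \notin ino A & (u \notin ino B) && (u \notin ino S)].
  move=> h; rewrite n0 ?Sc // nx ?ny ?mem_cat ?h ?orbT //.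
  split=> //; first by have := DA u; rewrite !mem_cat h !orbT; exact.
  have -> /= := DB u; last by rewrite mem_cat h orbT.
  by have := DS u; rewrite h; exact.
have := (rep_plug m (fr1 (d, y, S) (Nd A x B)) c).1 hrep.
set W := wsum _ _ => -[hf hc].
(* With an empty context [e] is read from the null node and may be anything; otherwise it is the
   side of [y] below its parent. *)
set e := fd 1 m (ctop c) == y.
have eE : if c is (d2, _, _) :: _ then e = d2 else True.
  rewrite /e; case: (c) hc inc => [//|[[d2 z2] S2] c2] /= [[k0 k1 _ _] _ _] inc.
  have yy : rt (fr1 (d, y, S) (Nd A x B)) = y by case: (d).
  have {}inc := inc (rt S2); rewrite inE mem_cat in inc.
  move: k0 k1; case: (d2) => /= k0 k1; first by rewrite k0 yy eqxx.
  rewrite k1; case: (rtc S2) => [->|h]; first by rewrite eq_sym; apply/negbTE.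
  by have [|_ _ ->] := inc; rewrite ?h ?orbT.
have agr u b sx sy : u != x -> u != y -> u != ctop c -> u != b ->
  agree m (rmem d e x y (ctop c) b sx sy m) u.
  by move=> /negbTE h1 /negbTE h2 /negbTE h3 /negbTE h4 f hf'; rewrite rmem_fd // h1 h2 h3 h4 !andbF.
have cont b sx sy : b = rt A \/ b = rt B ->
  repc m (rt (fr1 (d, y, S) (Nd A x B))) W c -> repc (rmem d e x y (ctop c) b sx sy m) x W c.
  move=> hb; have nb u : u \in cnodes c -> u != b.
    move=> /inc [u0 _ _ uA /andP [uB _]].
    by case: hb => ->; rewrite nt.
  apply: repc_move => //.
    by move=> u uc uz; have [_ h1 h2 _ _] := inc u uc; apply: agr; rewrite ?h1 ?h2 ?nb.
  case: (c) inc nb eE zx zy => [//|[[d2 z2] S2] c2] /= {}inc {}nb -> {}zx {}zy.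
  have /nb /negbTE zb : z2 \in cnodes ((d2, z2, S2) :: c2) by rewrite inE eqxx.
  split=> [||f hf']; rewrite rmem_fd ?zb ?(negbTE zx) ?(negbTE zy) ?eqxx ?andbF ?andbT //; try by case: (d2).
    by case: (d2); case: f hf' => [|[|f]].
  by case/andP: hf'.
have F3 b0 sx sy u : fd 3 (rmem d e x y (ctop c) b0 sx sy m) u = fd 3 m u.
  by rewrite rmem_fd //; case: (d); case: (e).
have nrt u t' : (u == 0) = false -> u \notin ino t' -> rt t' != u.
  by move=> /negbT h1 h2; rewrite eq_sym nt.
have xA : x \notin ino A by apply: contra xn; rewrite mem_cat => ->.
have xB : x \notin ino B by apply: contra xn; rewrite !mem_cat => ->; rewrite !orbT.
have xS : x \notin ino S by apply: contra xn; rewrite !mem_cat => ->; rewrite !orbT.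
have ez b0 sx sy : fd 4 (rmem d e x y (ctop c) b0 sx sy m) 0 = 0.
  rewrite rmem_fd // [0 == y]eq_sym [0 == x]eq_sym (negbTE x0) (negbTE y0) !andbF.
  by case: (d); case: (e).
have out b0 sx sy : b0 = rt A \/ b0 = rt B ->
  forall z, z \notin 0 :: ino T -> agree m (rmem d e x y (ctop c) b0 sx sy m) z.
  move=> hb u; rewrite inE negb_or hmem => /andP [u0].
  rewrite !negb_or => /and5P [ux uy uA uB /andP [uS uc]]; apply: agr => //.
    by rewrite nz.
  by case: hb => ->; rewrite nt.
have agA u b0 sx sy : b0 = rt B -> u \in ino A -> agree m (rmem d e x y (ctop c) b0 sx sy m) u.
  by move=> -> /inA [u0 h1 h2 h3 /andP [h4 h5]]; apply: agr; rewrite ?h1 ?h2 ?nz ?nt.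
have agB u b0 sx sy : b0 = rt A -> u \in ino B -> agree m (rmem d e x y (ctop c) b0 sx sy m) u.
  by move=> -> /inB [u0 h1 h2 h3 /andP [h4 h5]]; apply: agr; rewrite ?h1 ?h2 ?nz ?nt.
have agS u b0 sx sy : b0 = rt A \/ b0 = rt B -> u \in ino S -> agree m (rmem d e x y (ctop c) b0 sx sy m) u.
  move=> hb /inS [u0 h1 h2 h3 /andP [h4 h5]]; apply: agr; rewrite ?h1 ?h2 ?nz ?nt //.
  by case: hb => ->; rewrite nt.
have mvA sx sy : rep m x A -> rep (rmem d e x y (ctop c) (rt A) sx sy m) y A.
  apply: rep_move => // [u uA ur|u f uA hf' f2|nA];
    last by have [h0 h1 h2 h3 /andP [h4 h5]] := inA _ (rt_ino nA); rewrite rmem_fd // h1 h2 nz // !andbF /= eqxx.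
    by have [h0 h1 h2 h3 /andP [h4 h5]] := inA _ uA; rewrite rmem_fd // h1 h2 nz // (negbTE ur) !andbF.
  by have [h0 h1 h2 h3 /andP [h4 h5]] := inA _ uA; rewrite rmem_fd // h1 h2 nz // (negbTE f2) !andbF.
have mvB sx sy : rep m x B -> rep (rmem d e x y (ctop c) (rt B) sx sy m) y B.
  apply: rep_move => // [u uA ur|u f uA hf' f2|nA];
    last by have [h0 h1 h2 h3 /andP [h4 h5]] := inB _ (rt_ino nA); rewrite rmem_fd // h1 h2 nz // !andbF /= eqxx.
    by have [h0 h1 h2 h3 /andP [h4 h5]] := inB _ uA; rewrite rmem_fd // h1 h2 nz // (negbTE ur) !andbF.
  by have [h0 h1 h2 h3 /andP [h4 h5]] := inB _ uA; rewrite rmem_fd // h1 h2 nz // (negbTE f2) !andbF.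
have eqS : rt S != x by rewrite nrt ?(negbTE x0).
have bnd : wsum (fd 3 m) (ino A) + wsum (fd 3 m) (ino B) + wsum (fd 3 m) (ino S) + fd 3 m x + fd 3 m y < 2 ^ w.
  apply: leq_ltn_trans hW; case: (d) => /=; rewrite !wsum_cat !wsum_cons ?wsum_cat ?wsum_cons; clear; lia.
have zy0 : (ctop c == y) = false by apply/negbTE.
have zx0 : (ctop c == x) = false by apply/negbTE.
have nAx : rt A != x by rewrite nrt ?(negbTE x0).
have nBx : rt B != x by rewrite nrt ?(negbTE x0).
have yA : y \notin ino A by apply: contra yn; rewrite mem_cat => ->.
have yB : y \notin ino B by apply: contra yn; rewrite !mem_cat => ->; rewrite !orbT.
have nAy : rt A != y by rewrite nrt ?(negbTE y0).
have nBy : rt B != y by rewrite nrt ?(negbTE y0).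
have yx0 : (y == x) = false by rewrite eq_sym; apply/negbTE.
have WE s1 s2 b0 sx sy : perm_eq s1 s2 ->
   wsum (fd 3 (rmem d e x y (ctop c) b0 sx sy m)) s1 = wsum (fd 3 m) s2.
  by move=> /(perm_map (fd 3 m)) /perm_sumn; rewrite /wsum => <-; apply: eq_wsum => u _; exact: F3.
have xz0 : (x == ctop c) = false by rewrite eq_sym.
have yz0 : (y == ctop c) = false by rewrite eq_sym.
have xy0 : (x == y) = false by rewrite eq_sym.
have xA0 : (x == rt A) = false by rewrite eq_sym; apply/negbTE.
have xB0 : (x == rt B) = false by rewrite eq_sym; apply/negbTE.
have yA0 : (y == rt A) = false by rewrite eq_sym; apply/negbTE.
have yB0 : (y == rt B) = false by rewrite eq_sym; apply/negbTE.
pose smp := (zx0, zy0, xz0, yz0, xy0, yx0, xA0, xB0, yA0, yB0, eqxx, andbF, andbT).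
destruct d.
  case: hf => [[e0 e1 e2 e4] rS [[f0 f1 f2 f4] rA rB]].
  apply: (@rot_exec vs m tb t r v x y (ctop c) (rt A) true e (wsum (fd 3 m) (ino S)) (wsum (fd 3 m) (ino A))) => //.
  - by rewrite e1 /= eqxx.
  - by rewrite eq_sym.
  - by rewrite /= e0.
  - by rewrite e0 (rep_sum hz rS).
  - by rewrite (rep_sum hz rA).
  - by rewrite e0.
  - by move: bnd; clear; lia.
  move=> t' vs' ht hvs.
  apply: HQ => //; last by apply: out; left.
  apply/rep_plug; split; last first.
    rewrite (@WE _ (ino (fr1 (true, y, S) (Nd A x B)))); first by apply: cont => //; left.
    by apply/permP => a; rewrite /= !count_cat /= !count_cat /= ; clear; lia.
  split; [split| |by apply: rep_frame rB => u; apply: agB].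
  - by rewrite rmem_fd // !smp /= ?f0 ?f1 ?e0 ?e1.
  - by rewrite rmem_fd // !smp /= ?f0 ?f1 ?e0 ?e1.
  - by rewrite rmem_fd // !smp /= ?f0 ?f1 ?e0 ?e1.
  - rewrite rmem_fd // !smp /= e4; symmetry; apply: WE.
    by apply/permP => a; rewrite /= !count_cat /= !count_cat /= ; clear; lia.
  split; [split| |exact: mvA].
  - by rewrite rmem_fd // !smp /= ?f0 ?f1 ?e0 ?e1.
  - by rewrite rmem_fd // !smp /= ?f0 ?f1 ?e0 ?e1.
  - by rewrite rmem_fd // !smp /= ?f0 ?f1 ?e0 ?e1.
  - rewrite rmem_fd // !smp /= (WE _ (ino S ++ y :: ino A)) // wsum_cat wsum_cons; clear; lia.
  by apply: rep_frame rS => u; apply: agS; left.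
case: hf => [[e0 e1 e2 e4] [[f0 f1 f2 f4] rA rB] rS].
apply: (@rot_exec vs m tb t r v x y (ctop c) (rt B) false e (wsum (fd 3 m) (ino B)) (wsum (fd 3 m) (ino S))) => //.
- by rewrite e1 /=; apply/negbTE.
- by rewrite eq_sym.
- by rewrite /= e1.
- by rewrite (rep_sum hz rB).
- by rewrite e1 (rep_sum hz rS).
- by rewrite e1.
- by move: bnd; clear; lia.
move=> t' vs' ht hvs.
apply: HQ => //; last by apply: out; right.
apply/rep_plug; split; last first.
  rewrite (@WE _ (ino (fr1 (false, y, S) (Nd A x B)))); first by apply: cont => //; right.
  by apply/permP => a; rewrite /= !count_cat /= !count_cat /= ; clear; lia.
split; [split|by apply: rep_frame rA => u; apply: agA|].
- by rewrite rmem_fd // !smp /= ?f0 ?f1 ?e0 ?e1.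
- by rewrite rmem_fd // !smp /= ?f0 ?f1 ?e0 ?e1.
- by rewrite rmem_fd // !smp /= ?f0 ?f1 ?e0 ?e1.
- rewrite rmem_fd // !smp /= e4; symmetry; apply: WE.
  by apply/permP => a; rewrite /= !count_cat /= !count_cat /= ; clear; lia.
split; [split|exact: mvB|].
- by rewrite rmem_fd // !smp /= ?f0 ?f1 ?e0 ?e1.
- by rewrite rmem_fd // !smp /= ?f0 ?f1 ?e0 ?e1.
- by rewrite rmem_fd // !smp /= ?f0 ?f1 ?e0 ?e1.
- rewrite rmem_fd // !smp /= (WE _ (ino B ++ y :: ino S)) // wsum_cat wsum_cons; clear; lia.
by apply: rep_frame rS => u; apply: agS; right.
Qed.
End Ram.

(** * Splaying *)

(** If both ranks equalled that of [c], then [a + b] would be at least twice [2 ^ trunc_log 2 c],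
    and the rank of [c] would be larger. The unit gained here is what pays for a double rotation. *)
Lemma rank_add a b c : 0 < a -> 0 < b -> a + b <= c ->
  trunc_log 2 a + trunc_log 2 b + 1 <= (trunc_log 2 c).*2.
Proof.
wlog ab : a b / a <= b.
  move=> H a0 b0 h; case: (leqP a b) => ab; first exact: H.
  by rewrite [trunc_log 2 a + _]addnC H //; [exact: ltnW | rewrite addnC].
move=> a0 b0 h; have hbc : trunc_log 2 b <= trunc_log 2 c.
  by apply: leq_trunc_log; apply: leq_trans h; apply: leq_addl.
have hab : trunc_log 2 a <= trunc_log 2 b by apply: leq_trunc_log.
case: (ltnP (trunc_log 2 a) (trunc_log 2 c)) => hac; first by lia.
have hh : (trunc_log 2 c).+1 <= trunc_log 2 c.
  apply: trunc_log_max => //.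
  have ha := trunc_logP (isT : 1 < 2) a0; have hb := trunc_logP (isT : 1 < 2) b0.
  have hca : 2 ^ trunc_log 2 c <= 2 ^ trunc_log 2 a by rewrite leq_exp2l.
  have hcb : 2 ^ trunc_log 2 c <= 2 ^ trunc_log 2 b by rewrite leq_exp2l //; lia.
  by rewrite expnS; lia.
by rewrite ltnn in hh.
Qed.

Lemma Nd_neq A x B : Nd A x B <> Lf.
Proof. by []. Qed.

Lemma fr1_neq f t : fr1 f t <> Lf.
Proof. by case: f => [[[] y] S]. Qed.

Lemma tsz_Nd A x B : tsz (Nd A x B) = tsz A + (tsz B).+1.
Proof. by rewrite /tsz /= size_cat. Qed.

Lemma ino_rott d A x B y S : ino (rott d A x B y S) = ino (fr1 (d, y, S) (Nd A x B)).
Proof. by case: d => /=; rewrite -?catA. Qed.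

(** A single rotation costs at most the growth of one rank, and it occurs at most once per splay, at
    the top. *)
Lemma pot_zig d A x B y S :
  pot (rott d A x B y S) + trunc_log 2 (tsz (Nd A x B)) <=
  pot (fr1 (d, y, S) (Nd A x B)) + trunc_log 2 (tsz (rott d A x B y S)).
Proof.
have H a b : a <= b -> trunc_log 2 a <= trunc_log 2 b by exact: leq_trunc_log.
case: d; rewrite /= ?tsz_Nd.
- have := H (tsz S + (tsz A).+1) (tsz S + (tsz A).+1 + (tsz B).+1).
  have -> : tsz S + (tsz A + (tsz B).+1).+1 = tsz S + (tsz A).+1 + (tsz B).+1 by lia.
  lia.
- have := H (tsz B + (tsz S).+1) (tsz A + (tsz B + (tsz S).+1).+1).
  have -> : tsz A + (tsz B).+1 + (tsz S).+1 = tsz A + (tsz B + (tsz S).+1).+1 by lia.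
  lia.
Qed.

(* The subtree that replaces the one at the grandparent [z] in a double step. *)
Definition step2 d1 d2 A x B y S z R :=
  if d1 == d2 then
    if d1 then rott true A x B y (Nd R z S) else rott false A x B y (Nd S z R)
  else if d1 then Nd (Nd S y A) x (Nd B z R) else Nd (Nd R z A) x (Nd B y S).

(** The access lemma for one double step: apart from three times the growth of the rank of [x], the
    potential drops by one unit, which [rank_add] provides. *)
Lemma pot_step2 d1 d2 A x B y S z R :
  let T := fr1 (d2, z, R) (fr1 (d1, y, S) (Nd A x B)) in
  pot (step2 d1 d2 A x B y S z R) + 1 + 3 * trunc_log 2 (tsz (Nd A x B)) <=
  pot T + 3 * trunc_log 2 (tsz T).
Proof.
have H a b : a <= b -> trunc_log 2 a <= trunc_log 2 b by exact: leq_trunc_log.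
case: d1 d2 => [] []; rewrite /step2 /= ?tsz_Nd;
set a := tsz A; set b := tsz B; set s := tsz S; set q := tsz R.
- have -> : q + s.+1 + a.+1 + b.+1 = q + (s + (a + b.+1).+1).+1 by lia.
  have h1 := @rank_add (q + s.+1) (a + b.+1) (q + (s + (a + b.+1).+1).+1).
  have h2 := H (q + s.+1 + a.+1) (q + (s + (a + b.+1).+1).+1).
  have h3 := H (a + b.+1) (s + (a + b.+1).+1).
  lia.
- have -> : s + a.+1 + (b + q.+1).+1 = s + (a + b.+1).+1 + q.+1 by lia.
  have h1 := @rank_add (s + a.+1) (b + q.+1) (s + (a + b.+1).+1 + q.+1).
  have h2 := H (a + b.+1) (s + (a + b.+1).+1).
  have h3 := H (a + b.+1) (s + (a + b.+1).+1 + q.+1).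
  lia.
- have -> : q + a.+1 + (b + s.+1).+1 = q + (a + b.+1 + s.+1).+1 by lia.
  have h1 := @rank_add (q + a.+1) (b + s.+1) (q + (a + b.+1 + s.+1).+1).
  have h2 := H (a + b.+1) (a + b.+1 + s.+1).
  have h3 := H (a + b.+1) (q + (a + b.+1 + s.+1).+1).
  lia.
- have -> : a + (b + (s + q.+1).+1).+1 = a + b.+1 + s.+1 + q.+1 by lia.
  have h1 := @rank_add (a + b.+1) (s + q.+1) (a + b.+1 + s.+1 + q.+1).
  have h2 := H (b + (s + q.+1).+1) (a + b.+1 + s.+1 + q.+1).
  have h3 := H (a + b.+1) (a + b.+1 + s.+1).
  lia.
Qed.

Lemma ino_step2 d1 d2 A x B y S z R :
  ino (step2 d1 d2 A x B y S z R) = ino (fr1 (d2, z, R) (fr1 (d1, y, S) (Nd A x B))).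
Proof. by case: d1 d2 => [] []; rewrite /step2 /= -?catA /= -?catA /= -?catA. Qed.

Section Ram.
Variables (w N : nat).
Hypothesis hN : N * 8 + 16 <= 2 ^ w.

Definition okT m T :=
  [/\ rep m 0 T, uniq (0 :: ino T), all (fun z => z <= N) (ino T),
      wsum (fd 3 m) (ino T) < 2 ^ w & fd 4 m 0 = 0].

(** Pointers and sums may change at the nodes of [s] and at the null node; weights change
    nowhere. *)
Definition relink (s : seq nat) (m m' : nat -> nat) :=
  (forall z, z \notin 0 :: s -> agree m m' z) /\ fd 3 m' =1 fd 3 m.

Lemma relink_trans s m1 m2 m3 :
  relink s m1 m2 -> relink s m2 m3 -> relink s m1 m3.
Proof.
move=> [h1 h2] [h3 h4]; split=> [z zs f hf|z]; last by rewrite h4.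
by rewrite h3 // h1.
Qed.

Lemma okT_rep m m' T T' : okT m T -> relink (ino T) m m' -> ino T' = ino T ->
  fd 4 m' 0 = 0 -> rep m' 0 T' -> okT m' T'.
Proof.
move=> [h1 h2 h3 h4 h5] [r1 r2] E h6 h7; split; rewrite ?E //.
by rewrite (eq_wsum (w2 := fd 3 m)) // => z _; rewrite r2.
Qed.

Lemma rot_ok vs m tb t r v A x B d y S c Q :
  let T := plug (fr1 (d, y, S) (Nd A x B)) c in
  vs v = x -> okT m T ->
  (forall t' vs' m', t' <= t + 200 -> (forall k, k < 60 -> vs' k = vs k) ->
     okT m' (plug (rott d A x B y S) c) -> relink (ino T) m m' ->
     Q t' r (State vs' m' tb)) ->
  wp w (rotup v) t r (State vs m tb) Q.
Proof.
move=> T vx ok HQ; case: (ok) => h1 h2 h3 h4 h5.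
apply: (rot_spec hN vx h1) => // t' vs' m' ht hvs hr ho hw hz.
apply: HQ => //; apply: (okT_rep ok) => //.
by apply: ino_plug; rewrite ino_rott.
Qed.

Lemma side_ok m d y S X c : okT m (plug (fr1 (d, y, S) X) c) -> X <> Lf ->
  [/\ (fd 1 m y == rt X) = d, y <= N, y != 0, fd 2 m (rt X) = y & fd 2 m y = ctop c].
Proof.
move=> [/rep_plug [hf _] hu /allP hn _ _] nX.
move: hu; rewrite cons_uniq => /andP [u0 u].
have sub : {subset ino (fr1 (d, y, S) X) <= ino (plug (fr1 (d, y, S) X) c)}.
  by move=> z zi; rewrite mem_plug zi.
have yi : y \in ino (fr1 (d, y, S) X) by case: (d); rewrite /= mem_cat inE eqxx orbT.
have y0 : y != 0 by apply: contraNneq u0 => <-; apply: sub.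
have ru : uniq (ino (fr1 (d, y, S) X)).
  by move: u; rewrite (perm_uniq (perm_plug _ _)) cat_uniq => /andP [].
have Xi := rt_ino nX.
have yN : y <= N by apply/hn/sub.
case: (d) hf sub ru u0 => /= -[[e0 e1 e2 e4] hS hX] sub ru u0.
  by split=> //; [rewrite e1 eqxx | exact: rep_rt hX nX].
split=> //; last exact: rep_rt hS nX.
rewrite e1; apply/negbTE/eqP; case: (S) hX ru => [|S1 s S2] _ ru /= E.
  by case/negP: u0; apply: sub; rewrite mem_cat E Xi.
move: ru; rewrite cat_uniq => /and3P [_ /hasPn /(_ (rt X))]; rewrite Xi /=.
by rewrite inE mem_cat inE -E eqxx !orbT => /(_ isT).
Qed.

(** Bottom-up splaying. If the two edges above the node go in the same direction, the parent is
    rotated first, otherwise the node itself. *)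
Definition splay_loop :=
  While (Fd 2 (Var 50)) (
    Assign 51 (Fd 2 (Var 50)) ;;
    Assign 52 (Fd 2 (Var 51)) ;;
    If (Var 52)
      (If (Bin Eq (Bin Eq (Fd 1 (Var 51)) (Var 50)) (Bin Eq (Fd 1 (Var 52)) (Var 51)))
        (rotup 51) (rotup 50))
      Skip ;;
    rotup 50).

(** A double step removes two frames and frees one unit of potential. The potential is doubled so
    that every frame yields one unit; an odd frame is left to the single rotation, whence
    [odd (size c)]. *)
Lemma splay_loop_ok tb r Q k : forall vs m t A x B c,
  let T := plug (Nd A x B) c in
  size c <= k -> vs 50 = x -> okT m T ->
  (forall t' vs' m' A' B', t' <= t + 20 + 300 * size c ->
     (forall k, k < 50 -> vs' k = vs k) ->
     okT m' (Nd A' x B') -> ino (Nd A' x B') = ino T -> relink (ino T) m m' ->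
     2 * pot (Nd A' x B') + size c + 6 * trunc_log 2 (tsz (Nd A x B)) <=
       2 * pot T + 6 * trunc_log 2 (tsz T) + odd (size c) ->
     Q t' r (State vs' m' tb)) ->
  wp w splay_loop t r (State vs m tb) Q.
Proof.
elim: k => [|k IH] vs m t A x B c; cbv zeta => hk vx ok HQ; have [h1 h2 h3 h4 h5] := ok.
  case: c hk ok HQ h1 h2 h3 h4 => // _ ok HQ h1 h2 /= /allP h3 h4.
  have xN : x <= N by apply: h3; rewrite /= mem_cat inE eqxx orbT.
  have x2 : fd 2 m x = 0 by case: h1 => [[]].
  apply: wp_while => [_|]; last by rewrite (eval_Fd hN (x := x)) //= x2.
  apply: (HQ _ vs m A B) => //; first by rewrite /= -!addnA leq_add2l.
  by rewrite addn0 leq_addr.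
case: c hk ok HQ h1 h2 h3 h4 => [|[[d1 y] S] c] hk ok HQ h1 h2 h3 h4.
  exact: (IH vs m t A x B [::]).
have xT : x \in ino (plug (Nd A x B) ((d1, y, S) :: c)) by rewrite mem_plug /= mem_cat inE eqxx orbT.
have xN : x <= N by move/allP: h3; apply.
have [s1 yN y0 s2 s3] := @side_ok m d1 y S (Nd A x B) c ok (@Nd_neq A x B).
rewrite /= in s1 s2.
apply: wp_while => [|_]; first by rewrite (eval_Fd hN (x := x)) //= s2 => y0'; rewrite y0' in y0.
apply/wp_seq/(wp_assign (v := y)); first by rewrite (eval_Fd hN (x := x)).
apply/wp_seq/(wp_assign (v := ctop c)); first by rewrite (eval_Fd hN (x := y)).
apply/wp_seq.
set t0 := _ + _.
have ht0 : t0 <= t + 30 by rewrite /t0 /= -!addnA leq_add2l.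
set vs0 := upd _ 52 _.
have hvs0 i : i < 50 -> vs0 i = vs i.
  by move=> hi; rewrite /vs0 /upd !ltn_eqF // (leq_trans hi).
have [hv50 hv51 hv52] : [/\ vs0 50 = x, vs0 51 = y & vs0 52 = ctop c] by [].
move: t0 ht0 vs0 hvs0 hv50 hv51 hv52 => t0 ht0 vs0 hvs0 hv50 hv51.
case: c hk ok HQ h1 h2 h3 h4 xT s3 => [|[[d2 z] R] c] hk ok HQ h1 h2 h3 h4 xT s3 /= hv52.
  pose T := plug (Nd A x B) [:: (d1, y, S)].
  apply: wp_if => [|_]; first by rewrite /= hv52.
  apply: wp_skip.
  apply: (@rot_ok vs0 m tb _ r 50 A x B d1 y S [::]) => // t' vs' m' ht' hvs' ok' rl'.
  have [A' [B' E]] : exists A' B', rott d1 A x B y S = Nd A' x B' by case: (d1); do 2 eexists.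
  rewrite /= E in ok'.
  apply: (IH _ _ _ A' x B' [::]) => //.
    by rewrite hvs'.
  move=> t2 vs2 m2 A2 B2 ht2 hvs2 ok2 ino2 rl2 hp.
  have E2 : ino (Nd A' x B') = ino T by rewrite -E ino_rott.
  apply: (HQ t2 vs2 m2 A2 B2) => //.
  - move: ht2 ht' ht0; rewrite /=; clear; lia.
  - by move=> i hi; rewrite hvs2 // hvs' ?hvs0 //; lia.
  - by rewrite ino2.
  - by apply: relink_trans rl' _; rewrite -E2.
  - have E3 : tsz (Nd A' x B') = tsz T by rewrite /tsz E2.
    have := pot_zig d1 A x B y S.
    rewrite E E3 -[fr1 _ _]/T => hz.
    have hr : trunc_log 2 (tsz (Nd A x B)) <= trunc_log 2 (tsz T).
      by apply: leq_trunc_log; rewrite /T; case: (d1); rewrite /= !tsz_Nd; clear; lia.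
    have {}hp : 2 * pot (Nd A2 x B2) + 0 + 6 * trunc_log 2 (tsz (Nd A' x B')) <=
      2 * pot (Nd A' x B') + 6 * trunc_log 2 (tsz (Nd A' x B')) + 0 := hp.
    rewrite -/T [size _]/= [odd _]/=; rewrite E3 in hp; move: hp hz hr.
    generalize (pot (Nd A2 x B2)) (pot (Nd A' x B')) (trunc_log 2 (tsz T)) (pot T).
    generalize (trunc_log 2 (tsz (Nd A x B))).
    clear; lia.
pose T := plug (Nd A x B) [:: (d1, y, S), (d2, z, R) & c].
have [s4 zN z0 s5 s6] := @side_ok m d2 z R (fr1 (d1, y, S) (Nd A x B)) c ok (@fr1_neq (d1, y, S) (Nd A x B)).
have yy : rt (fr1 (d1, y, S) (Nd A x B)) = y by case: (d1).
rewrite yy in s4 s5.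
(* Both kinds of double step end with a rotation of [x], which completes the subtree [step2]. *)
have finish t1 vs1 m1 : t1 <= t0 + 250 -> (forall i, i < 60 -> vs1 i = vs0 i) ->
    (exists A' B' d' y' S', rott d' A' x B' y' S' = step2 d1 d2 A x B y S z R /\
       okT m1 (plug (Nd A' x B') ((d', y', S') :: c))) ->
    relink (ino T) m m1 ->
    wp w (rotup 50) t1 r (State vs1 m1 tb)
      (fun t' r' s' => wp w splay_loop t' r' s' Q).
  move=> ht1 hvs1 [A' [B' [d' [y' [S' [E ok1]]]]]] rl1.
  apply: (@rot_ok vs1 m1 tb _ r 50 A' x B' d' y' S' c) => //; first by rewrite hvs1.
  move=> t2 vs2 m2 ht2 hvs2 ok2 rl2.
  have [A2 [B2 E2]] : exists A2 B2, step2 d1 d2 A x B y S z R = Nd A2 x B2.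
    by rewrite /step2; case: (d1); case: (d2); do 2 eexists.
  rewrite E E2 in ok2.
  have iE : ino (plug (Nd A2 x B2) c) = ino T.
    by rewrite /T /=; apply: ino_plug; rewrite -E2 ino_step2.
  have iE' : ino (plug (Nd A' x B') ((d', y', S') :: c)) = ino T.
    by rewrite -iE /=; apply: ino_plug; rewrite -E2 -E ino_rott.
  apply: (IH _ _ _ A2 x B2 c) => //.
  - by move: hk; rewrite /=; clear; lia.
  - by rewrite hvs2 // hvs1.
  move=> t3 vs3 m3 A3 B3 ht3 hvs3 ok3 ino3 rl3 hp.
  apply: (HQ t3 vs3 m3 A3 B3) => //.
  - move: ht3 ht2 ht1 ht0; rewrite /=; clear; lia.
  - by move=> i hi; rewrite hvs3 // hvs2 ?hvs1 ?hvs0 //; lia.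
  - by rewrite ino3.
  - have {}rl2 : relink (ino T) m1 m2 by rewrite -iE'.
    apply: relink_trans rl1 _; apply: relink_trans rl2 _.
    by rewrite -iE.
  - have eT : tsz (plug (Nd A2 x B2) c) = tsz T by rewrite /tsz iE.
    have e1 : tsz (Nd A2 x B2) = tsz (fr1 (d2, z, R) (fr1 (d1, y, S) (Nd A x B))).
      by rewrite -E2 /tsz ino_step2.
    have := pot_step2 d1 d2 A x B y S z R; cbv zeta; rewrite E2 -[fr1 _ _]/(fr1 (d2, z, R) (fr1 (d1, y, S) (Nd A x B))) => hs.
    have hpp := plug_pot c e1.
    rewrite -/(plug (fr1 (d2, z, R) (fr1 (d1, y, S) (Nd A x B))) c) in hpp.
    have hpT : pot T = pot (plug (fr1 (d2, z, R) (fr1 (d1, y, S) (Nd A x B))) c) by [].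
    rewrite -/T [size _]/= [odd _]/= negbK hpT.
    move: hp hs hpp; rewrite eT e1.
    generalize (pot (Nd A3 x B3)) (pot (Nd A2 x B2)) (pot (plug (Nd A2 x B2) c)) (trunc_log 2 (tsz T)).
    generalize (trunc_log 2 (tsz (fr1 (d2, z, R) (fr1 (d1, y, S) (Nd A x B))))).
    generalize (pot (fr1 (d2, z, R) (fr1 (d1, y, S) (Nd A x B)))).
    generalize (pot (plug (fr1 (d2, z, R) (fr1 (d1, y, S) (Nd A x B))) c)) (trunc_log 2 (tsz (Nd A x B))).
    clear; lia.
apply: wp_if => [_|]; last by rewrite /= hv52 => z00; rewrite z00 eqxx in z0.
have evE : eval w (State vs0 m tb) (Bin Eq (Bin Eq (Fd 1 (Var 51)) (Var 50))
    (Bin Eq (Fd 1 (Var 52)) (Var 51))) = (d1 == d2).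
  have -> : (d1 == d2) = (nat_of_bool d1 == nat_of_bool d2) by case: (d1); case: (d2).
  apply: (eval_eq hN).
    rewrite -s1 -hv50; apply: (eval_eq hN) => //.
    by rewrite (eval_Fd hN (x := y)) //= hv51.
  rewrite -s4 -hv51; apply: (eval_eq hN) => //.
  by rewrite (eval_Fd hN (x := z)) //= hv52.
apply: wp_if; rewrite evE => dd.
  have {}dd : d1 = d2 by move: dd; case: (d1); case: (d2).
  have fin' t1 vs1 m1 : t1 <= t0 + 240 -> (forall k, k < 60 -> vs1 k = vs0 k) ->
     okT m1 (plug (rott d1 (if d1 then S else Nd A x B) y (if d1 then Nd A x B else S) z R) c) ->
     relink (ino T) m m1 ->
     wp w (rotup 50) t1 r (State vs1 m1 tb) (fun t' r' s' => wp w splay_loop t' r' s' Q).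
    move=> ht1 hvs1 ok1 rl1; apply: (finish t1 vs1 m1) => //.
      by apply: leq_trans ht1 _; rewrite leq_add2l.
    exists A, B, d1, y, (if d1 then Nd R z S else Nd S z R); split.
      by rewrite /step2 -dd eqxx; case: (d1).
    by move: ok1; case: (d1).
  apply: (@rot_ok vs0 m tb _ r 51 (if d1 then S else Nd A x B) y (if d1 then Nd A x B else S) d1 z R c) => //.
    by move: (ok); rewrite /= -dd; case: (d1).
  move=> t' vs' m' ht' hvs' ok' rl'; apply: fin' => //.
    by apply: leq_trans ht' _; rewrite -!addnA leq_add2l.
  by move: rl'; rewrite /T /= -dd; case: (d1).
apply: (@rot_ok vs0 m tb _ r 50 A x B d1 y S ((d2, z, R) :: c)) => //.
move=> t' vs' m' ht' hvs' ok' rl'; apply: finish => //.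
  by apply: leq_trans ht' _; rewrite -!addnA leq_add2l.
have {}dd : d1 == d2 = false by move: dd; case: (d1); case: (d2).
move: ok'; rewrite /step2 dd; case: (d1) dd => dd ok'.
  by exists (Nd S y A), B, d2, z, R; split=> //; move: dd; case: (d2).
by exists A, (Nd B y S), d2, z, R; split=> //; move: dd; case: (d2).
Qed.

Definition splay v := Assign 50 (Var v) ;; splay_loop.

Lemma splay_zip vs m tb t r v A x B c T Q :
  T = plug (Nd A x B) c -> vs v = x -> okT m T ->
  (forall t' vs' m' A' B', t' <= t + 30 + 300 * size c ->
     (forall k, k < 50 -> vs' k = vs k) ->
     okT m' (Nd A' x B') -> ino (Nd A' x B') = ino T -> relink (ino T) m m' ->
     2 * pot (Nd A' x B') + size c <= 2 * pot T + 6 * trunc_log 2 (tsz T) + 1 ->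
     Q t' r (State vs' m' tb)) ->
  wp w (splay v) t r (State vs m tb) Q.
Proof.
move=> -> vx ok HQ; apply/wp_seq/(wp_assign (v := x)) => //.
apply: (@splay_loop_ok tb r Q (size c) _ m _ A x B c) => //.
move=> t' vs' m' A' B' ht hvs ok' ino' rl' hp; apply: HQ ok' ino' rl' _ => //.
- by move: ht; rewrite [cost _]/=; clear; lia.
- by move=> k hk; rewrite hvs // /upd ltn_eqF.
- by move: hp; case: (odd _); clear; lia.
Qed.

Lemma plugP x T : x \in ino T -> exists A B c, T = plug (Nd A x B) c.
Proof.
suff H c : x \in ino T -> exists A B c', plug T c = plug (Nd A x B) c'.
  by move=> /(H [::]).
elim: T c => //= l IHl y r' IHr c; rewrite mem_cat inE => /or3P [h|/eqP ->|h].
- by have [A [B [c' E]]] := IHl ((false, y, r') :: c) h; exists A, B, c'.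
- by exists l, r', c.
- by have [A [B [c' E]]] := IHr ((true, y, l) :: c) h; exists A, B, c'.
Qed.
End Ram.

(** * Forests of splay trees *)

Section Forest.
Variables (w N Wb : nat).
Hypothesis hN : N * 8 + 16 <= 2 ^ w.
(** At most [N] nodes of weight at most [Wb]: all sums of weights fit in a word. *)
Hypothesis hW : N * Wb < 2 ^ w.

Definition inos (ts : seq tree) := flatten (map ino ts).

Lemma inos_nth ts i z : z \in ino (nth Lf ts i) -> z \in inos ts.
Proof.
move=> zi; case: (ltnP i (size ts)) => hi; last by rewrite nth_default in zi.
apply/flattenP; exists (ino (nth Lf ts i)) => //.
by rewrite -(nth_map Lf [::]) // mem_nth // size_map.
Qed.

Lemma wsum_le wt s : uniq (0 :: s) -> all (fun z => z <= N) s ->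
  (forall z, wt z <= Wb) -> wsum wt s <= N * Wb.
Proof.
move=> /andP [u0 u] /allP h hw.
have hs : size s <= N.
  suff : size s <= size (iota 1 N) by rewrite size_iota.
  apply: uniq_leq_size => [//|z zi].
  rewrite mem_iota add1n ltnS h // andbT lt0n.
  by apply: contraTneq zi => ->.
apply: leq_trans (_ : size s * Wb <= _); last by rewrite leq_mul2r hs orbT.
rewrite /wsum; elim: (s) => //= z s' IH; rewrite mulSn.
exact: leq_add.
Qed.

Definition trees m ts :=
  [/\ forall i, rep m 0 (nth Lf ts i), uniq (0 :: inos ts),
      all (fun z => z <= N) (inos ts), fd 4 m 0 = 0 & forall z, fd 3 m z <= Wb].

Definition handle t := (rt t, ino t).

(** Scaled by 800, the potential frees 400 units per frame above a splayed node, up to the rank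
    term: 300 pay for the rotations and 100 are left for the walk that led to the node. *)
Definition forest m (H : seq (nat * seq nat)) p :=
  exists ts, [/\ trees m ts, H = map handle ts & p = 800 * sumn (map pot ts)].

Lemma forest_perm m H H' p : perm_eq H H' -> forest m H p -> forest m H' p.
Proof.
rewrite perm_sym => /(perm_iotaP (0, [::])) [is_ hi hH'] [ts [[h1 h2 h3 h4 h5] E ->]].
have P (T : eqType) (f : tree -> T) :
    perm_eq (map f (map (nth Lf ts) is_)) (map f ts).
  rewrite -{2}(mkseq_nth Lf ts) /mkseq -!map_comp; apply: perm_map.
  by move: hi; rewrite E size_map.
have hp := perm_flatten (P _ ino).
exists (map (nth Lf ts) is_); split.
- split=> //; last by rewrite (perm_all _ hp).
    move=> i; case: (ltnP i (size is_)) => hi2; last by rewrite nth_default ?size_map.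
    by rewrite (nth_map 0).
  by rewrite /inos cons_uniq (perm_mem hp) (perm_uniq hp).
- rewrite hH' E -map_comp; apply/eq_in_map => i hi2.
  have hi3 : i < size ts by move: hi2; rewrite (perm_mem hi) mem_iota E size_map.
  by rewrite (nth_map Lf).
- by congr (_ * _); apply/perm_sumn; rewrite perm_sym.
Qed.

Definition cc := (trunc_log 2 N).+1.

Lemma trees_ok m t ts : trees m (t :: ts) -> okT w N m t.
Proof.
case=> h1 h2 h3 h4 h5.
have [u1 u2] : uniq (0 :: ino t) /\ all (fun z => z <= N) (ino t).
  move: h2 h3; rewrite /inos /= all_cat mem_cat cat_uniq negb_or.
  by move=> /andP [/andP [-> _] /and3P [-> _ _]] /andP [-> _].
split=> //; first exact: (h1 0).
by apply: leq_ltn_trans hW; apply: wsum_le.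
Qed.

Lemma rank_cc m t ts : trees m (t :: ts) -> trunc_log 2 (tsz t) < cc.
Proof.
move=> /trees_ok [_ u1 u2 _ _]; rewrite /cc ltnS; apply: leq_trunc_log.
suff : size (ino t) <= size (iota 1 N) by rewrite size_iota.
apply: uniq_leq_size => [|z zi]; first by case/andP: u1.
rewrite mem_iota add1n ltnS (allP u2) // andbT lt0n.
by apply: contraTneq zi => ->; case/andP: u1.
Qed.

(** A frame rule: the trees of [ts2] are untouched, and those of [ts1] are exchanged for others with
    the same nodes. *)
Lemma trees_upd m m' ts1 ts1' ts2 : trees m (ts1 ++ ts2) ->
  (forall z, z \in inos ts2 -> agree m m' z) ->
  (forall i, rep m' 0 (nth Lf ts1' i)) ->
  perm_eq (inos ts1') (inos ts1) ->
  fd 4 m' 0 = 0 -> (forall z, fd 3 m' z <= Wb) -> trees m' (ts1' ++ ts2).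
Proof.
move=> [h1 h2 h3 h4 h5] H1 H2 hp h4' h5'.
have hp' : perm_eq (inos (ts1' ++ ts2)) (inos (ts1 ++ ts2)).
  by rewrite /inos !map_cat !flatten_cat perm_cat2r.
split=> //; last by rewrite (perm_all _ hp').
  move=> i; rewrite nth_cat; case: ltnP => hi; first exact: H2.
  case: (ltnP (i - size ts1') (size ts2)) => hi2; last by rewrite nth_default.
  have := h1 (i - size ts1' + size ts1).
  rewrite nth_cat ltnNge leq_addl /= addnK; apply: rep_frame => z zi; apply: H1.
  exact: inos_nth zi.
by rewrite cons_uniq (perm_mem hp') (perm_uniq hp').
Qed.

Lemma trees_notin m ts1 ts2 z : trees m (ts1 ++ ts2) -> z \in inos ts2 ->
  z \notin 0 :: inos ts1.
Proof.
case=> _ u _ _ _ zi; rewrite inE negb_or.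
move: u; rewrite /inos map_cat flatten_cat cons_uniq cat_uniq mem_cat.
case/andP => /norP [_ u0] /and3P [_ /hasPn h _].
by rewrite h // andbT; apply: contraNneq u0 => <-.
Qed.

Lemma reps1 m t : rep m 0 t -> forall i, rep m 0 (nth Lf [:: t] i).
Proof. by move=> h [|i] //=; rewrite nth_nil. Qed.

Lemma reps2 m t1 t2 : rep m 0 t1 -> rep m 0 t2 -> forall i, rep m 0 (nth Lf [:: t1; t2] i).
Proof. by move=> h1 h2 [|[|i]] //=; rewrite nth_nil. Qed.

(** The term [size c * 100] is the surplus that pays for a descent to the splayed node. *)
Lemma forest_splay_depth vs m tb t r v A x B c ts Q :
  trees m (plug (Nd A x B) c :: ts) -> vs v = x ->
  (forall t' vs' m' A' B', t' + size c * 100 + 800 * pot (Nd A' x B') <=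
       t + 800 * pot (plug (Nd A x B) c) + 2500 * cc ->
     (forall k, k < 50 -> vs' k = vs k) -> fd 3 m' =1 fd 3 m ->
     ino (Nd A' x B') = ino (plug (Nd A x B) c) ->
     trees m' (Nd A' x B' :: ts) -> Q t' r (State vs' m' tb)) ->
  wp w (splay v) t r (State vs m tb) Q.
Proof.
move=> ht vx HQ; have ok := trees_ok ht; have hr := rank_cc ht.
apply: (splay_zip hN (erefl _) vx ok) => t' vs' m' A' B' htt hvs ok' ino' [rl hw] hp.
apply: (HQ t' vs' m' A' B') => //.
  move: htt hp hr; clear.
  generalize (pot (Nd A' x B')) (pot (plug (Nd A x B) c)) (trunc_log 2 (tsz (plug (Nd A x B) c))) (size c) cc.
  by move=> *; lia.
apply: (@trees_upd m m' [:: plug (Nd A x B) c] [:: Nd A' x B'] ts) => //.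
- by move=> z zi; apply: rl; have := trees_notin (ts1 := [:: _]) ht zi; rewrite /inos /= cats0.
- by apply: reps1; case: ok'.
- by rewrite /inos /= !cats0 -ino'.
- by case: ok'.
- by move=> z; rewrite hw; case: ht.
Qed.

Lemma forest_splay vs m tb t r v x s0 s H p Q :
  forest m ((s0, s) :: H) p -> vs v = x -> x \in s ->
  (forall t' vs' m' p', t' + p' <= t + p + 2500 * cc ->
     (forall k, k < 50 -> vs' k = vs k) -> fd 3 m' =1 fd 3 m ->
     forest m' ((x, s) :: H) p' -> Q t' r (State vs' m' tb)) ->
  wp w (splay v) t r (State vs m tb) Q.
Proof.
move=> [[|T ts] [ht //= [E1 E2 E3] Ep]] vx xs HQ; rewrite {}E2 in xs HQ.
have [A [B [c Ec]]] := plugP xs; rewrite Ec in ht.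
apply: (forest_splay_depth ht vx) => t' vs' m' A' B' hp hvs hw ino' ht'.
apply: (HQ _ _ _ (800 * sumn (map pot (Nd A' x B' :: ts)))) => //.
  move: hp; rewrite Ep Ec /=; rewrite -/(pot (Nd A' x B')) !mulnDr; clear; lia.
by exists (Nd A' x B' :: ts); split=> //=; rewrite E3 Ec -ino'.
Qed.

Lemma node_le m r s H p x : forest m ((r, s) :: H) p -> x \in s -> 0 < x <= N.
Proof.
move=> [[|T ts] [[_ h2 h3 _ _] //= [_ E2 _] _]] xs.
have xi : x \in inos (T :: ts) by rewrite /inos /= mem_cat -E2 xs.
by rewrite (allP h3 _ xi) lt0n andbT; apply: contraTneq h2 => <- /=; rewrite xi.
Qed.

(** A node occurs only once in the inorder sequence, so the root determines where the sequence is
    split. *)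
Lemma root_info m x s1 s2 H p : forest m ((x, s1 ++ x :: s2) :: H) p ->
  exists l r ts, [/\ trees m (Nd l x r :: ts), ino l = s1, ino r = s2, H = map handle ts &
    p = 800 * sumn (map pot (Nd l x r :: ts))].
Proof.
move=> [[|T ts] [ht //= [E1 E2 E3] Ep]].
have {}u : uniq (0 :: ino T) by case: (trees_ok ht).
have xT : x \in ino T by rewrite -E2 mem_cat inE eqxx orbT.
case: T E1 E2 u ht Ep xT => [|l y q] //= -> E2 u ht Ep _.
have [e1 e2] : s1 = ino l /\ s2 = ino q; last by exists l, q, ts; rewrite e1 e2.
move: u; rewrite -E2 => /andP [_ u].
have i1 : index y (s1 ++ y :: s2) = size s1.
  rewrite index_cat /= eqxx addn0; case: ifP => // ys.
  by move: u; rewrite cat_uniq => /and3P [_ /hasPn /(_ y)]; rewrite inE eqxx ys => /(_ isT).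
have i2 : index y (ino l ++ y :: ino q) = size (ino l).
  rewrite index_cat /= eqxx addn0; case: ifP => // ys.
  by move: u; rewrite E2 cat_uniq => /and3P [_ /hasPn /(_ y)]; rewrite inE eqxx ys => /(_ isT).
have es : size s1 = size (ino l) by rewrite -i1 -i2 E2.
by move/eqP: E2; rewrite eqseq_cat // => /andP [/eqP -> /eqP [->]].
Qed.

Lemma root_fields m x s1 s2 H p : forest m ((x, s1 ++ x :: s2) :: H) p ->
  [/\ fd 2 m x = 0, fd 4 m x = wsum (fd 3 m) (s1 ++ x :: s2),
      fd 4 m (fd 0 m x) = wsum (fd 3 m) s1, fd 4 m (fd 1 m x) = wsum (fd 3 m) s2 &
      fd 0 m x <= N /\ fd 1 m x <= N].
Proof.
move=> /root_info [l [q [ts [ht <- <- _ _]]]].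
have [hr u /allP hn _ hz] := trees_ok ht.
have [[e0 e1 e2 e4] rl rr] := hr.
split=> //; rewrite ?e0 ?e1 ?(rep_sum hz rl) ?(rep_sum hz rr) //.
by split; [case: (l) hn | case: (q) hn] => //= a y b; apply; rewrite !(mem_cat, inE) eqxx ?orbT.
Qed.

Lemma trees_wsum m ts : trees m ts -> wsum (fd 3 m) (inos ts) < 2 ^ w.
Proof. by case=> _ h2 h3 _ h5; apply: leq_ltn_trans hW; apply: wsum_le. Qed.

Lemma root0 m r s H p : forest m ((r, s) :: H) p -> (r == 0) = (s == [::]).
Proof.
move=> [[|T ts] [ht //= [-> -> _] _]]; have [_ u _ _ _] := trees_ok ht.
case: T ht u => //= l y q _; rewrite -/(uniq (0 :: (ino l ++ y :: ino q))) => u.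
have -> : (ino l ++ y :: ino q == [::]) = false by case: (ino l).
by apply: contraTF u => /eqP ->; rewrite cons_uniq mem_cat inE eqxx orbT.
Qed.

(** Meant for a root, since no sum above [v] is adjusted. *)
Definition detach (d : bool) v dst :=
  Assign dst (Fd d (Var v)) ;;
  Wr d (Var v) (Const 0) ;;
  Wr 2 (Var dst) (Const 0) ;;
  Wr 4 (Var v) (Bin Defs.Sub (Fd 4 (Var v)) (Fd 4 (Var dst))).

Lemma eval_cst s k : k < 16 -> eval w s (Const k) = k.
Proof. by move=> h /=; rewrite (small_word hN). Qed.

(** The potential does not grow, because the only subtree that changes is that of the root, which
    shrinks; the 100 units are plain running time. *)
Lemma detach_ok d vs m tb t r v dst x s1 s2 H p Q :
  forest m ((x, s1 ++ x :: s2) :: H) p -> vs v = x -> v != dst ->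
  (forall t' m' a p', t' + p' <= t + p + 100 -> fd 3 m' =1 fd 3 m ->
     forest m' ((a, if d then s2 else s1) ::
                (x, if d then rcons s1 x else x :: s2) :: H) p' ->
     Q t' r (State (upd vs dst a) m' tb)) ->
  wp w (detach d v dst) t r (State vs m tb) Q.
Proof.
move=> hf vx hv HQ; have [x0 xN] : 0 < x /\ x <= N.
  by apply/andP; apply: (node_le hf); rewrite mem_cat inE eqxx orbT.
have [l [q [ts [ht El Eq EH Ep]]]] := root_info hf.
have [f2 f4 fl fr [lN rN]] := root_fields hf.
have hdN : fd d m x <= N by case: (d).
apply/wp_seq/(wp_assign (v := fd d m x)).
  by rewrite (eval_Fd hN (x := x)) //; case: (d).
set a := fd d m x in hdN *.
have hvs : upd vs dst a v = x by rewrite /upd (negbTE hv).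
have hdst : upd vs dst a dst = a by rewrite /upd eqxx.
set vs' := upd vs dst a in hvs hdst *.
have d8 : d < 8 by case: (d).
apply/wp_seq/(wp_write (x := x * 8 + d) (v := 0)).
- by apply: (eval_addr hN) => //; apply: eval_cst; case: (d).
- by rewrite eval_cst.
apply/wp_seq/(wp_write (x := a * 8 + 2) (v := 0)).
- by apply: (eval_addr hN) => //; apply: eval_cst.
- by rewrite eval_cst.
rewrite -[upd _ (a * 8 + 2) 0]/(setf 2 a 0 _) -[upd m _ 0]/(setf d x 0 m).
set m1 := setf _ _ _ _.
have F4 z : fd 4 m1 z = fd 4 m z by rewrite /m1 !fd_setf //; case: (d).
apply: (wp_write (x := x * 8 + 4) (v := fd 4 m x - fd 4 m a)).
- by apply: (eval_addr hN) => //; apply: eval_cst.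
- have h1 : eval w (State vs' m1 tb) (Fd 4 (Var v)) = fd 4 m x.
    by rewrite (eval_Fd hN (x := x)) //= F4.
  have h2 : eval w (State vs' m1 tb) (Fd 4 (Var dst)) = fd 4 m a.
    by rewrite (eval_Fd hN (x := a)) //= F4.
  rewrite -[LHS]/((eval w (State vs' m1 tb) (Fd 4 (Var v)) -
    eval w (State vs' m1 tb) (Fd 4 (Var dst))) %% 2 ^ w) h1 h2 modn_small //.
  by apply: leq_ltn_trans (leq_subr _ _) _; rewrite f4 -El -Eq; case: (trees_ok ht).
rewrite -[upd m1 _ _]/(setf 4 x (fd 4 m x - fd 4 m a) m1).
have [hr u hn hs hz] := trees_ok ht.
have {hr} [[e0 e1 e2 e4] rl rr] := hr.
have x0' : x != 0 by rewrite -lt0n.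
set m2 := setf 4 _ _ _.
have G k z : k < 5 -> fd k m2 z = if (k == 4) && (z == x) then fd 4 m x - fd 4 m a else
    if (k == 2) && (z == a) then 0 else if (k == d) && (z == x) then 0 else fd k m z.
  by move=> hk; rewrite /m2 /m1 !fd_setf //; move: hk; clear; lia.
have F3 : fd 3 m2 =1 fd 3 m by move=> z; rewrite G //; case: (d).
have ag z : z != x -> z != a -> agree m m2 z.
  by move=> /negbTE z1 /negbTE z2 f hf'; rewrite G // z1 z2 !andbF.
have z4 : fd 4 m2 0 = 0 by rewrite G // [0 == x]eq_sym (negbTE x0') !andbF; case: (d).
have ea : a = if d then rt q else rt l by rewrite /a; case: (d).
have hts z : z \in inos ts -> agree m m2 z.
  move=> zi; have := trees_notin (ts1 := [:: _]) ht zi.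
  rewrite /inos /= cats0 !inE mem_cat inE !negb_or => /and4P [z0 zl zx zr].
  apply: ag => //; rewrite ea; case: (d).
    by case: (q) zr => //= y1 y y2; apply: contraNneq => ->; rewrite mem_cat inE eqxx orbT.
  by case: (l) zl => //= y1 y y2; apply: contraNneq => ->; rewrite mem_cat inE eqxx orbT.
move: u; rewrite /= mem_cat inE !negb_or cat_uniq => /andP [/and3P [u1 _ u3] /and3P [ul /norP [xl /hasPn lr] /andP [xr ur]]].
have lx z : z \in ino l -> z != x by apply: contraTneq => ->.
have rx z : z \in ino q -> z != x by apply: contraTneq => ->.
have l_r z : z \in ino l -> z != rt q.
  move=> zl; case: (q) lr u3 => [|y1 y y2] lr u3 /=; first by apply: contraNneq u1 => <-.
  by apply: contraTneq zl => ->; apply: lr; rewrite /= mem_cat inE eqxx orbT.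
have r_l z : z \in ino q -> z != rt l.
  move=> zq; case: (l) lr => [|y1 y y2] lr /=; first by apply: contraNneq u3 => <-.
  by apply: contraNneq (lr _ zq) => -> /=; rewrite mem_cat inE eqxx orbT.
have xa : x != a.
  rewrite ea; case: (d).
    by case: (q) xr => //= y1 y y2; apply: contraNneq => ->; rewrite mem_cat inE eqxx orbT.
  by case: (l) xl => //= y1 y y2; apply: contraNneq => ->; rewrite mem_cat inE eqxx orbT.
have W3 s0 : wsum (fd 3 m2) s0 = wsum (fd 3 m) s0 by apply: eq_wsum => z _; exact: F3.
have mv tt : rt tt = a -> uniq (ino tt) -> (forall z, z \in ino tt -> z != x) -> rep m x tt -> rep m2 0 tt.
  move=> ta tu tx; apply: rep_move => // [z zt za|z k zt k5 k2|nt].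
  - by rewrite G //= (negbTE (tx z zt)) -ta (negbTE za) andbF.
  - by rewrite G // (negbTE (tx z zt)) (negbTE k2) !andbF.
  - by rewrite G //= ta eqxx.
have [mo1 mo2] : trunc_log 2 (tsz (Nd Lf x q)) <= trunc_log 2 (tsz (Nd l x q)) /\
     trunc_log 2 (tsz (Nd l x Lf)) <= trunc_log 2 (tsz (Nd l x q)).
  by split; apply: leq_trunc_log; rewrite !tsz_Nd /tsz /=; clear; lia.
have ht' : trees m2 ((if d then [:: q; Nd l x Lf] else [:: l; Nd Lf x q]) ++ ts).
  apply: (@trees_upd m m2 [:: Nd l x q]) => //; last 2 first.
  - by apply/permP => c; case: (d); rewrite /inos /= !cats0 /= !count_cat /= ?count_cat /=; clear; lia.
  - by move=> z; rewrite F3; case: ht.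
  move: (d) G ea mv fl fr f4 => [] G ea mv fl fr f4; apply: reps2.
  - by apply: mv.
  - split=> //; last first.
      by apply: rep_frame rl => z zl; apply: ag; rewrite ?ea ?lx ?l_r.
    split; rewrite G // ?(negbTE xa) ?eqxx /= ?W3 //.
    by rewrite f4 ea -e1 fr -El -Eq !wsum_cat !wsum_cons /wsum /=; clear; lia.
  - by apply: mv.
  - split=> //; last first.
      by apply: rep_frame rr => z zl; apply: ag; rewrite ?ea ?rx ?r_l.
    split; rewrite G // ?(negbTE xa) ?eqxx /= ?W3 //.
    by rewrite f4 ea -e0 fl -El -Eq !wsum_cat !wsum_cons /wsum /=; clear; lia.
apply: (HQ _ m2 a (800 * sumn (map pot ((if d then [:: q; Nd l x Lf] else [:: l; Nd Lf x q]) ++ ts)))) => //.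
  rewrite Ep; move: mo1 mo2; case: (d); rewrite /= ;
  generalize (trunc_log 2 (tsz (Nd l x q))) (trunc_log 2 (tsz (Nd Lf x q))) (trunc_log 2 (tsz (Nd l x Lf))); clear=> *; lia.
exists ((if d then [:: q; Nd l x Lf] else [:: l; Nd Lf x q]) ++ ts); split=> //.
by rewrite ea EH -El -Eq /handle; case: (d) => //=; rewrite cats1.
Qed.

Lemma mem_rt (q : tree) z : z != 0 -> z \notin ino q -> z != rt q.
Proof.
by case: q => //= y1 y y2 _; apply: contraNneq => ->; rewrite mem_cat inE eqxx orbT.
Qed.

Lemma rt_le m t ts : trees m (t :: ts) -> rt t <= N.
Proof.
case=> _ _ /allP hn _ _; case: t hn => //= l y q hn.
by apply: hn; rewrite /inos /= !(mem_cat, inE) eqxx orbT.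
Qed.

Definition attach (d : bool) v a :=
  Wr d (Var v) (Var a) ;;
  Wr 2 (Var a) (Var v) ;;
  Wr 4 (Var v) (Bin Add (Fd 4 (Var v)) (Fd 4 (Var a))).

(** The child [d] of [x] is empty before. Only the subtree of [x] grows, so the potential rises by
    at most the rank of one node. *)
Lemma attach_ok d vs m tb t r v va x a s0 s' H p Q :
  forest m ((a, s0) :: (x, if d then rcons s' x else x :: s') :: H) p ->
  vs v = x -> vs va = a ->
  (forall t' m' p', t' + p' <= t + p + 2500 * cc -> fd 3 m' =1 fd 3 m ->
     forest m' ((x, if d then s' ++ x :: s0 else s0 ++ x :: s') :: H) p' ->
     Q t' r (State vs m' tb)) ->
  wp w (attach d v va) t r (State vs m tb) Q.
Proof.
move=> hf vx vva HQ.
have hf2 : forest m ((x, if d then s' ++ x :: [::] else [::] ++ x :: s') :: (a, s0) :: H) p.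
  apply: forest_perm hf; apply/permP => c; case: (d); rewrite /= ?cats1; clear; lia.
have [x0 xN] : 0 < x /\ x <= N.
  apply/andP; apply: (node_le hf2); by case: (d); rewrite mem_cat inE eqxx ?orbT.
have [l [q [ts [ht El Eq EH Ep]]]] : exists l q ts, [/\ trees m (Nd l x q :: ts),
    ino l = (if d then s' else [::]), ino q = (if d then [::] else s'),
    (a, s0) :: H = map handle ts & p = 800 * sumn (map pot (Nd l x q :: ts))].
  by move: hf2; case: (d) => /root_info [l [q [ts [h1 h2 h3 h4 h5]]]]; exists l, q, ts.
case: ts ht EH Ep => // T ts ht [Ea Es EH] Ep.
have Elq : if d then q = Lf else l = Lf.
  by move: El Eq; case: (d) => [_|+ _]; [case: (q)|case: (l)] => // l0 y0 q0 /=; case: (ino l0).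
have ht' : trees m ([:: T; Nd l x q] ++ ts).
  have hi : perm_eq (inos ([:: T; Nd l x q] ++ ts)) (inos [:: Nd l x q, T & ts]).
    by rewrite /inos /=; apply/permP => c; rewrite !count_cat; clear; lia.
  case: ht => h1 h2 h3 h4 h5; split=> //.
  - by move=> [|[|i]]; [apply: (h1 1) | apply: (h1 0) | apply: (h1 i.+2)].
  - by rewrite cons_uniq (perm_mem hi) (perm_uniq hi).
  - by rewrite (perm_all _ hi).
have aN : a <= N by rewrite Ea; apply: rt_le ht'.
have d8 : d < 8 by case: (d).
apply/wp_seq/(wp_write (x := x * 8 + d) (v := a)) => //.
  by apply: (eval_addr hN) => //; apply: eval_cst; case: (d).
apply/wp_seq/(wp_write (x := a * 8 + 2) (v := x)) => //.
  by apply: (eval_addr hN) => //; apply: eval_cst.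
rewrite -[upd _ (a * 8 + 2) _]/(setf 2 a x _) -[upd m _ _]/(setf d x a m).
set m1 := setf _ _ _ _.
have F4 z : fd 4 m1 z = fd 4 m z by rewrite /m1 !fd_setf //; case: (d).
have hs := trees_wsum ht'.
have okT0 := trees_ok ht'; have [hr0 u0 hn0 _ hz] := okT0.
have okX := trees_ok ht; have [hr u hn hs' _] := okX.
have fa : fd 4 m a = wsum (fd 3 m) (ino T) by rewrite Ea (rep_sum hz hr0).
have fx : fd 4 m x = wsum (fd 3 m) (ino (Nd l x q)).
  by case: (hr) => [[]].
have hsum : fd 4 m x + fd 4 m a < 2 ^ w.
  apply: leq_ltn_trans hs; rewrite fx fa.
  have -> : inos ([:: T; Nd l x q] ++ ts) = ino T ++ ino (Nd l x q) ++ inos ts by [].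
  rewrite !(wsum_cat _ (ino T)) (wsum_cat _ (ino (Nd l x q))); clear; lia.
apply: (wp_write (x := x * 8 + 4) (v := fd 4 m x + fd 4 m a)).
- by apply: (eval_addr hN) => //; apply: eval_cst.
- rewrite -!F4; apply: eval_add; rewrite ?F4 //.
    by rewrite (eval_Fd hN (x := x)) //= F4.
  by rewrite (eval_Fd hN (x := a)) //= F4.
rewrite -[upd m1 _ _]/(setf 4 x (fd 4 m x + fd 4 m a) m1).
have {hr} [[e0 e1 e2 e4] rl rr] := hr.
have x0' : x != 0 by rewrite -lt0n.
set m2 := setf 4 _ _ _.
have G k z : k < 5 -> fd k m2 z = if (k == 4) && (z == x) then fd 4 m x + fd 4 m a else
    if (k == 2) && (z == a) then x else if (k == d) && (z == x) then a else fd k m z.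
  by move=> hk; rewrite /m2 /m1 !fd_setf //; move: hk; clear; lia.
have F3 : fd 3 m2 =1 fd 3 m by move=> z; rewrite G //; case: (d).
have ag z : z != x -> z != a -> agree m m2 z.
  by move=> /negbTE z1 /negbTE z2 f hf'; rewrite G // z1 z2 !andbF.
have z4 : fd 4 m2 0 = 0 by rewrite G // [0 == x]eq_sym (negbTE x0') !andbF; case: (d).
have W3 s1 : wsum (fd 3 m2) s1 = wsum (fd 3 m) s1 by apply: eq_wsum => z _; exact: F3.
have hts z : z \in inos ts -> agree m m2 z.
  move=> zi; have := trees_notin ht' zi.
  rewrite /inos /= cats0 !inE !mem_cat inE !negb_or => /and5P [z0 zT zl zx zr].
  by apply: ag => //; rewrite Ea mem_rt.
have [dT xT] : (forall z, z \in ino (Nd l x q) -> (z != 0) && (z \notin ino T)) /\ x \notin ino T.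
  have h z : z \in ino (Nd l x q) -> (z != 0) && (z \notin ino T).
    have E : inos (Nd l x q :: ts) = ino (Nd l x q) ++ inos ts by [].
    move=> zi; have := trees_notin (ts1 := [:: T]) ht' (z := z).
    by rewrite E mem_cat zi /inos /= cats0 inE negb_or; apply.
  have xi : x \in ino (Nd l x q) by rewrite /= mem_cat inE eqxx orbT.
  by split=> //; case/andP: (h x xi).
have xa : x != a by rewrite Ea mem_rt.
have ux : uniq (ino (Nd l x q)) by case/andP: u.
have [xl xq] : x \notin ino l /\ x \notin ino q.
  move: ux; rewrite /= cat_uniq /= => /and3P [_ /norP [-> _] /andP [-> _]] //.
have mv : rep m2 x T.
  have /andP [_ uT] := u0.
  apply: rep_move hr0 => // [z zt za|z k zt k5 k2|nt].
  - rewrite G //= Ea (negbTE za); have -> : (z == x) = false by apply: contraNF xT => /eqP <-.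
    by rewrite andbF.
  - rewrite G // (negbTE k2).
    have -> : (z == x) = false by apply: contraNF xT => /eqP <-.
    by rewrite !andbF.
  - by rewrite G //= Ea eqxx.
have fr tt : {subset ino tt <= ino (Nd l x q)} -> x \notin ino tt -> rep m x tt -> rep m2 x tt.
  move=> st xt; apply: rep_frame => z zt; apply: ag; first by apply: contraTneq zt => ->.
  by have /andP [z0 zT] := dT z (st z zt); rewrite Ea mem_rt.
have rl2 : rep m2 x l by apply: fr => // z zl; rewrite /= mem_cat zl.
have rr2 : rep m2 x q by apply: fr => // z zl; rewrite /= mem_cat inE zl !orbT.
pose T2 := if d then Nd l x T else Nd T x q.
have iT2 : perm_eq (ino T2) (ino T ++ ino (Nd l x q)).
  move: Elq; rewrite /T2; case: (d) => -> /=; apply/permP => c; rewrite !count_cat /=; clear; lia.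
have ht2 : trees m2 (T2 :: ts).
  apply: (@trees_upd m m2 [:: T; Nd l x q] [:: T2]) => //; last 2 first.
  - by rewrite /inos /= !cats0.
  - by move=> z; rewrite F3; case: ht.
  apply: reps1; rewrite /T2; move: Elq G; case: (d) => E G; split=> //.
  - split; rewrite G // ?(negbTE xa) ?eqxx /= ?W3 //.
    by rewrite fx fa E /= !wsum_cat !wsum_cons /wsum /=; clear; lia.
  - split; rewrite G // ?(negbTE xa) ?eqxx /= ?W3 //.
    by rewrite fx fa E /= !wsum_cat !wsum_cons /wsum /=; clear; lia.
apply: (HQ _ m2 (800 * sumn (map pot (T2 :: ts)))) => //.
  have := rank_cc ht2; rewrite Ep /T2.
  move: Elq; case: (d) => -> /=.
    by generalize (trunc_log 2 (tsz (Nd l x T))) (trunc_log 2 (tsz (Nd l x Lf))); clear=> *; lia.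
  by generalize (trunc_log 2 (tsz (Nd T x q))) (trunc_log 2 (tsz (Nd Lf x q))); clear=> *; lia.
exists (T2 :: ts); split=> //=; rewrite EH Es /handle /T2; congr (_ :: _).
by move: El Eq; case: (d) => /= [-> _|_ ->].
Qed.

Definition setw v e :=
  Wr 3 (Var v) e ;;
  Wr 4 (Var v) (Bin Add (Bin Add (Fd 4 (Fd 0 (Var v))) (Fd 4 (Fd 1 (Var v)))) (Fd 3 (Var v))).

(** At a root the new weight enters a single sum, that of the root itself, and no rank depends on
    it. *)
Lemma setw_ok vs m tb t r v e k x s H p Q :
  forest m ((x, s) :: H) p -> x \in s -> vs v = x ->
  eval w (State vs m tb) e = k -> k <= Wb ->
  (forall t' m', t' <= t + 100 + cost e -> fd 3 m' =1 upd (fd 3 m) x k ->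
     forest m' ((x, s) :: H) p -> Q t' r (State vs m' tb)) ->
  wp w (setw v e) t r (State vs m tb) Q.
Proof.
move=> hf xs vx he hk HQ.
have [x0 xN] : 0 < x /\ x <= N by apply/andP; apply: (node_le hf).
case: hf => [[|T ts] [ht //= [E1 E2 EH] Ep]].
case: T E1 E2 ht Ep => [|l y q] E1 E2 ht Ep; first by rewrite E2 in xs.
rewrite /= in E1; subst y.
have okX := trees_ok ht; have [[[e0 e1 e2 e4] rl rr] u hn hs hz] := okX.
apply/wp_seq/(wp_write (x := x * 8 + 3) (v := k)) => //.
  by apply: (eval_addr hN) => //; apply: eval_cst.
rewrite -[upd m _ _]/(setf 3 x k m); set m1 := setf _ _ _ _.
have G1 f z : f < 5 -> fd f m1 z = if (f == 3) && (z == x) then k else fd f m z.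
  by move=> hf; rewrite fd_setf //; lia.
have h3' z : fd 3 m1 z <= Wb by rewrite G1 //; case: ifP => // _; case: ht.
have hsum : wsum (fd 3 m1) (ino (Nd l x q)) < 2 ^ w by apply: leq_ltn_trans hW; apply: wsum_le.
have [xl xq] : x \notin ino l /\ x \notin ino q.
  by move: u => /= /andP [_]; rewrite cat_uniq /= => /and3P [_ /norP [-> _] /andP [-> _]].
have Wn s1 : x \notin s1 -> wsum (fd 3 m1) s1 = wsum (fd 3 m) s1.
  move=> hx; apply: eq_wsum => z zs; rewrite G1 //.
  by have -> : (z == x) = false by apply: contraNF hx => /eqP <-.
have Esum : fd 4 m1 (fd 0 m1 x) + fd 4 m1 (fd 1 m1 x) + fd 3 m1 x = wsum (fd 3 m1) (ino (Nd l x q)).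
  rewrite /= wsum_cat wsum_cons !Wn // !G1 //= eqxx e0 e1 (rep_sum hz rl) (rep_sum hz rr); clear; lia.
have nle z : z \in ino (Nd l x q) -> z <= N by apply: (allP hn).
have rtl (tt : tree) : {subset ino tt <= ino (Nd l x q)} -> rt tt <= N.
  by case: tt => //= a b c st; apply/nle/st; rewrite mem_cat inE eqxx orbT.
have lN : fd 0 m1 x <= N by rewrite G1 //= e0; apply: rtl => z zl; rewrite /= mem_cat zl.
have rN : fd 1 m1 x <= N by rewrite G1 //= e1; apply: rtl => z zl; rewrite /= mem_cat inE zl !orbT.
apply: (wp_write (x := x * 8 + 4) (v := wsum (fd 3 m1) (ino (Nd l x q)))).
- by apply: (eval_addr hN) => //; apply: eval_cst.
- rewrite -Esum; apply: eval_add; last by rewrite Esum.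
    apply: eval_add; last by apply: leq_ltn_trans hsum; rewrite -Esum; apply: leq_addr.
      by rewrite (eval_Fd hN (x := fd 0 m1 x)) // (eval_Fd hN (x := x)).
    by rewrite (eval_Fd hN (x := fd 1 m1 x)) // (eval_Fd hN (x := x)).
  by rewrite (eval_Fd hN (x := x)).
rewrite -[upd m1 _ _]/(setf 4 x (wsum (fd 3 m1) (ino (Nd l x q))) m1); set m2 := setf 4 _ _ _.
have x0' : x != 0 by rewrite -lt0n.
have G f z : f < 5 -> z != x -> fd f m2 z = fd f m z.
  by move=> hf /negbTE zx; rewrite /m2 fd_setf // ?G1 ?zx ?andbF //; lia.
have F3 : fd 3 m2 =1 fd 3 m1 by move=> z; rewrite /m2 fd_setf.
have ag z : z != x -> agree m m2 z by move=> zx f hf; rewrite G.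
have ht' : trees m2 (Nd l x q :: ts).
  apply: (@trees_upd m m2 [:: Nd l x q] [:: Nd l x q]) => //.
  - move=> z zi; have := trees_notin (ts1 := [:: _]) ht zi.
    by rewrite /inos /= cats0 !inE mem_cat inE !negb_or => /and4P [_ _ zx _]; apply: ag.
  - apply: reps1; split.
    + split; rewrite /m2 !fd_setf ?G1 ?andbF //= ?eqxx //.
      by apply: eq_wsum => z _; rewrite -F3.
    + by apply: rep_frame rl => z zl; apply: ag; apply: contraTneq zl => ->.
    + by apply: rep_frame rr => z zl; apply: ag; apply: contraTneq zl => ->.
  - by rewrite G // eq_sym.
  - by move=> z; rewrite F3.
apply: HQ.
- by rewrite /=; clear; lia.
- by move=> z; rewrite F3 G1 // /upd.
- by exists (Nd l x q :: ts); rewrite E2 EH Ep.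
Qed.

Definition new_node v e :=
  Wr 0 (Var v) (Const 0) ;; Wr 1 (Var v) (Const 0) ;; Wr 2 (Var v) (Const 0) ;;
  Wr 3 (Var v) e ;; Wr 4 (Var v) (Fd 3 (Var v)).

(** Whatever an earlier use left in the cells is overwritten. A single node has rank 0, so the
    potential is unchanged. *)
Lemma new_node_ok vs m tb t r v e k x H p Q :
  forest m H p -> 0 < x <= N -> x \notin flatten (unzip2 H) -> vs v = x ->
  (forall m', eval w (State vs m' tb) e = k) -> k <= Wb ->
  (forall t' m', t' <= t + 100 + cost e -> fd 3 m' =1 upd (fd 3 m) x k ->
     forest m' ((x, [:: x]) :: H) p -> Q t' r (State vs m' tb)) ->
  wp w (new_node v e) t r (State vs m tb) Q.
Proof.
move=> [ts [ht EH Ep]] /andP [x0 xN] xH vx he hk HQ.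
have ev f m' : f < 8 -> eval w (State vs m' tb) (addr (Const f) (Var v)) = x * 8 + f.
  by move=> hf; apply: (eval_addr hN) => //; apply: eval_cst; apply: ltn_trans hf _.
apply/wp_seq/(wp_write (x := x * 8 + 0) (v := 0)); [exact: ev|exact: eval_cst|].
apply/wp_seq/(wp_write (x := x * 8 + 1) (v := 0)); [exact: ev|exact: eval_cst|].
apply/wp_seq/(wp_write (x := x * 8 + 2) (v := 0)); [exact: ev|exact: eval_cst|].
apply/wp_seq/(wp_write (x := x * 8 + 3) (v := k)); [exact: ev|exact: he|].
apply: (wp_write (x := x * 8 + 4) (v := k)); first exact: ev.
  by rewrite (eval_Fd hN (x := x)) //= -/(setf 3 x k _) fd_setf //= eqxx.
set m2 := upd _ _ _.
have G f z : f < 5 -> fd f m2 z = if z == x then (if 3 <= f then k else 0) else fd f m z.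
  move=> hf; have f8 : f < 8 by apply: ltn_trans hf _.
  rewrite /m2 -/(setf 0 x 0 m) -/(setf 1 x 0 _) -/(setf 2 x 0 _) -/(setf 3 x k _) -/(setf 4 x k _).
  rewrite !fd_setf //; case: (z == x); rewrite ?andbF ?andbT //.
  by case: f hf {f8} => [|[|[|[|[|]]]]].
have x0' : x != 0 by rewrite -lt0n.
have Ei : flatten (unzip2 H) = inos ts by rewrite EH /inos /unzip2 -map_comp.
rewrite Ei in xH; case: ht => h1 h2 h3 h4 h5.
have ag z : z != x -> agree m m2 z by move=> /negbTE zx f hf; rewrite G // zx.
have ht : trees m2 (Nd Lf x Lf :: ts).
  split.
  - case=> [|i] /=.
      by split=> //; split; rewrite G // eqxx //= /wsum /= G // eqxx addn0.
    apply: rep_frame (h1 i) => z zi; apply: ag; apply: contraNneq xH => <-.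
    exact: inos_nth zi.
  - by move: h2; rewrite /inos /= inE eq_sym (negbTE x0') xH.
  - by rewrite /inos /= xN.
  - by rewrite G // eq_sym (negbTE x0').
  - by move=> z; rewrite G //=; case: ifP.
apply: (HQ _ m2).
- by rewrite /=; clear; lia.
- by move=> z; rewrite G // /upd.
- exists (Nd Lf x Lf :: ts); split=> //; by rewrite EH.
Qed.
End Forest.

(** * Concatenation of the sequences held in two trees *)

Section Seqs.
Variables (w N Wb : nat).
Hypothesis hN : N * 8 + 16 <= 2 ^ w.
Hypothesis hW : N * Wb < 2 ^ w.
Notation forest := (forest N Wb).
Notation trees := (trees N Wb).
Notation cc := (cc N).
(** The amortized time of one splay, the unit of all later bounds. *)
Definition cu := 2500 * cc.

Lemma plug_cat t c1 c2 : plug t (c1 ++ c2) = plug (plug t c1) c2.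
Proof. exact: foldl_cat. Qed.

(* The root of the left tree is overwritten by its rightmost node, in variable 40. *)
Definition rightmost :=
  While (Fd 1 (Var 40)) (Assign 40 (Fd 1 (Var 40))).

(** The path walked is returned as the context [c'], whose length measures the time until a splay
    pays for it. *)
Lemma rightmost_ok m tb r ts Q B : forall vs t A x c,
  trees m (plug (Nd A x B) c :: ts) -> vs 40 = x ->
  (forall t' vs' A' x' c', t' <= t + 20 + 100 * size c' ->
     (forall k, k != 40 -> vs' k = vs k) -> vs' 40 = x' ->
     plug (Nd A x B) c = plug (Nd A' x' Lf) (c' ++ c) ->
     ino (Nd A x B) = ino (plug (Nd A' x' Lf) c') ->
     (exists s, ino (plug (Nd A' x' Lf) c') = rcons s x') ->
     Q t' r (State vs' m tb)) ->
  wp w rightmost t r (State vs m tb) Q.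
Proof.
elim: B => [|B1 _ y B2 IH] vs t A x c ht vx HQ;
  have [/rep_plug [[[f0 f1 f2 f4] rA rB] _] u /allP hn _ hz] := trees_ok hW ht;
  have xN : x <= N by apply: hn; rewrite mem_plug /= mem_cat inE eqxx orbT.
  apply: wp_while; rewrite (eval_Fd hN (x := x)) //= f1 // => _.
  apply: (HQ _ vs A x [::]) => //; first by rewrite /=; clear; lia.
  by exists (ino A); rewrite /= cats1.
have yN : y <= N by apply: hn; rewrite mem_plug /= !(mem_cat, inE) eqxx ?orbT.
have y0 : y != 0.
  by apply: contraTneq u => <-; rewrite cons_uniq mem_plug /= !(mem_cat, inE) eqxx ?orbT.
apply: wp_while; rewrite (eval_Fd hN (x := x)) //= f1 /= => h; first by rewrite h in y0.
apply: (wp_assign (v := y)); first by rewrite (eval_Fd hN (x := x)).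
apply: (IH _ _ B1 y ((true, x, A) :: c)) => // t' vs' A' x' c' ht' hvs hx E Ei [s Es].
apply: (HQ t' vs' A' x' (rcons c' (true, x, A))) => //.
- by move: ht'; rewrite size_rcons [cost _]/=; clear; lia.
- by move=> k hk; rewrite hvs // /upd (negbTE hk).
- by rewrite cat_rcons.
- by rewrite -cats1 plug_cat /= -Ei /= .
- by exists (ino A ++ x :: s); rewrite -cats1 plug_cat /= Es rcons_cat rcons_cons.
Qed.

Definition concat va vb :=
  Assign 40 (Var va) ;;
  If (Var 40) (rightmost ;; splay 40 ;; attach true 40 vb) (Assign 40 (Var vb)).

(** The last node of the left sequence, once splayed, has no right child, and the right tree hangs
    there. The surplus of that splay pays for the walk. *)
Lemma concat_ok vs m tb t r va vb a b s1 s2 H p Q :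
  forest m ((a, s1) :: (b, s2) :: H) p -> vs va = a -> vs vb = b ->
  vb < 50 -> vb != 40 ->
  (forall t' vs' m' p' c, t' + p' <= t + p + 3 * cu -> fd 3 m' =1 fd 3 m ->
     (forall k, k < 50 -> k != 40 -> vs' k = vs k) -> vs' 40 = c ->
     forest m' ((c, s1 ++ s2) :: H) p' -> Q t' r (State vs' m' tb)) ->
  wp w (concat va vb) t r (State vs m tb) Q.
Proof.
move=> hf ea eb vb50 vb40 HQ; have ha := root0 hW hf.
apply/wp_seq/(wp_assign (v := a)) => //.
have hvs k : k < 50 -> k != 40 -> upd vs 40 a k = vs k by move=> _ /negbTE hk; rewrite /upd hk.
apply: wp_if => [a0|/= a0]; last first.
  apply: (wp_assign (v := b)) => /=; first by rewrite hvs.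
  apply: (HQ _ _ m p b) => //; first by rewrite /cu /cc /=; clear; lia.
    by move=> k k1 k2; rewrite /upd (negbTE k2).
  move: ha; rewrite /upd /= in a0; rewrite a0 eqxx => /esym/eqP E1; move: hf; rewrite E1.
  case=> [[|T1 [|T2 ts]] [[h1 h2 h3 h4 h5] //= [E2 E3 E4 E5 E6] Ep]].
  have T1L : T1 = Lf by case: (T1) E3 => // l y q /=; case: (ino l).
  exists (T2 :: ts); split=> //=; rewrite ?E4 ?E5 ?E6 ?Ep ?T1L //.
  by split=> //; [move=> i; apply: (h1 i.+1) | move: h2; rewrite T1L | move: h3; rewrite T1L].
rewrite /= /upd /= in a0.
case: (hf) => [[|T1 ts] [ht //= [Ea Es EH] Ep]].
case: T1 ht Ea Es Ep => [|A x B] ht /= Ea Es Ep; first by rewrite Ea in a0.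
apply/wp_seq.
apply: (@rightmost_ok m tb r ts _ B _ _ A x [::]) => // t1 vs1 A' x' c' ht1 hvs1 hx1 E Ei [s' Es'].
rewrite cats0 in E; rewrite /= in E; rewrite E in ht.
apply/wp_seq/(forest_splay_depth hN hW ht hx1) => t2 vs2 m2 A2 B2 ht2 hvs2 hw2 ino2 tr2.
have hf2 : forest m2 ((b, s2) :: (x', if true then rcons s' x' else x' :: s') :: H)
     (800 * sumn (map pot (Nd A2 x' B2 :: ts))).
  apply: (@forest_perm _ _ _ ((x', rcons s' x') :: (b, s2) :: H)).
    by apply/permP => c /=; clear; lia.
  by exists (Nd A2 x' B2 :: ts); split=> //=; rewrite EH -Es' -ino2.
have x'1 : vs2 40 = x' by rewrite hvs2.
have vb2 : vs2 vb = b by rewrite hvs2 // hvs1 // hvs.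
apply: (attach_ok (d := true) hN hW hf2 x'1 vb2) => t3 m3 p3 ht3 hw3 hf3.
apply: (HQ t3 vs2 m3 p3 x') => //.
- have hE : pot (Nd A x B) = pot (plug (Nd A' x' Lf) c') by rewrite E.
  move: ht3 ht2 ht1; rewrite Ep -[sumn (map pot (Nd A2 x' B2 :: ts))]/(pot (Nd A2 x' B2) + sumn (map pot ts)).
  rewrite -[pot A + _ + _]/(pot (Nd A x B)) hE.
  by generalize (pot (Nd A2 x' B2)) (pot (plug (Nd A' x' Lf) c')) (sumn (map pot ts)) (size c'); rewrite /cu /cc; clear=> *; lia.
- by move=> z; rewrite hw3 hw2.
- by move=> k k1 k2; rewrite hvs2 // hvs1 // hvs.
- by move: hf3; rewrite Es -[ino A ++ _]/(ino (Nd A x B)) E Es' cat_rcons.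
Qed.

End Seqs.

Lemma wsum_subseq wt s1 s2 : subseq s1 s2 -> wsum wt s1 <= wsum wt s2.
Proof.
elim: s2 s1 => [|y s2 IH] [|x s1] //=; case: eqP => [->|_] /IH h; rewrite !wsum_cons.
  by rewrite leq_add2l.
exact: leq_trans h (leq_addl _ _).
Qed.

(** * Search for a node by means of subtree sums *)

Section Find.
Variables (w N Wb : nat).
Hypothesis hN : N * 8 + 16 <= 2 ^ w.
Hypothesis hW : N * Wb < 2 ^ w.
Notation forest := (forest N Wb).
Notation trees := (trees N Wb).
Notation cu := (cu N).

(** The test [tst] may read the variables of the caller, those below 40, which [vs0] fixes; [P] is
    its meaning on words. *)
Variables (tst : expr -> expr) (P : nat -> bool) (vs0 : nat -> nat) (tb : nat -> option bool).
Hypothesis tst_cost : forall e, cost (tst e) <= cost e + 10.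
Hypothesis tst_ok : forall vs m e k, (forall i, i < 40 -> vs i = vs0 i) ->
  eval w (State vs m tb) e = k -> k < 2 ^ w ->
  (eval w (State vs m tb) (tst e) != 0) = P k.

Definition descend :=
  While (Bin Eq (tst (Fd 3 (Var 40))) (Const 0)) (
    Assign 41 (Fd 0 (Var 40)) ;;
    If (tst (Fd 4 (Var 41))) (Assign 40 (Var 41)) (Assign 40 (Fd 1 (Var 40)))).

(** A sum passes the test exactly when one of its terms does, so sums steer the descent: if neither
    the node nor the left sum passes, the right sum must. *)
Lemma descend_ok m r ts Q T : forall vs t c,
  trees m (plug T c :: ts) -> (forall i, i < 40 -> vs i = vs0 i) -> vs 40 = rt T ->
  (forall s', subseq s' (ino T) -> P (wsum (fd 3 m) s') = has (fun z => P (fd 3 m z)) s') ->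
  P (wsum (fd 3 m) (ino T)) ->
  (forall t' vs' A' x' B' c', t' <= t + 50 + 100 * size c' ->
     (forall k, k < 40 -> vs' k = vs0 k) -> vs' 40 = x' ->
     plug T c = plug (Nd A' x' B') (c' ++ c) -> x' \in ino T -> P (fd 3 m x') ->
     Q t' r (State vs' m tb)) ->
  wp w descend t r (State vs m tb) Q.
Proof.
elim: T => [|A IHA x B IHB] vs t c ht hvs vx hP PT HQ.
  by rewrite hP //= in PT.
have [hr u hn _ hz] := trees_ok hW ht.
have /rep_plug [[[f0 f1 f2 f4] rA rB] _] := hr.
have hw : wsum (fd 3 m) (ino (plug (Nd A x B) c)) < 2 ^ w by have [] := trees_ok hW ht.
have le s' : subseq s' (ino (Nd A x B)) -> wsum (fd 3 m) s' < 2 ^ w.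
  move=> hs; apply: leq_ltn_trans hw.
  rewrite /wsum (perm_sumn (perm_map _ (perm_plug _ _))) map_cat sumn_cat.
  apply: leq_trans (leq_addr _ _).
  exact: wsum_subseq.
have nle z : z \in ino (Nd A x B) -> z <= N.
  by move=> zi; apply: (allP hn); rewrite mem_plug zi.
have xN : x <= N by apply: nle; rewrite /= mem_cat inE eqxx orbT.
have sA : subseq (ino A) (ino (Nd A x B)) by apply: prefix_subseq.
have sB : subseq (ino B) (ino (Nd A x B)).
  by apply: subseq_trans (suffix_subseq (ino A) _); apply: subseq_cons.
have sx : subseq [:: x] (ino (Nd A x B)).
  by apply: subseq_trans (suffix_subseq (ino A) _); rewrite sub1seq inE eqxx.
have rtN (T : tree) : {subset ino T <= ino (Nd A x B)} -> rt T <= N.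
  by case: T => //= a b d st; apply/nle/st; rewrite mem_cat inE eqxx orbT.
have AN : rt A <= N by apply: rtN => z; apply: mem_subseq.
have BN : rt B <= N by apply: rtN => z; apply: mem_subseq.
have ex : (eval w (State vs m tb) (tst (Fd 3 (Var 40))) != 0) = P (fd 3 m x).
  apply: tst_ok => //; first by rewrite (eval_Fd hN (x := x)).
  by have := le _ sx; rewrite /wsum /= addn0.
have ec : eval w (State vs m tb) (Bin Eq (tst (Fd 3 (Var 40))) (Const 0)) = ~~ P (fd 3 m x).
  rewrite -ex negbK; exact: (eval_eq hN (erefl _) (eval_cst hN _ (isT : 0 < 16))).
have hcost := tst_cost (Fd 3 (Var 40)).
have hcost2 := tst_cost (Fd 4 (Var 41)).
apply: wp_while; rewrite ec => hx.
  apply: (HQ _ vs A x B [::]) => //; last by case: (P _) hx.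
    by move: hcost; rewrite /=; clear; lia.
  by rewrite /= mem_cat inE eqxx orbT.
have {}hx : P (fd 3 m x) = false by case: (P _) hx.
apply/wp_seq/(wp_assign (v := rt A)); first by rewrite (eval_Fd hN (x := x)).
have hvs1 i : i < 40 -> upd vs 41 (rt A) i = vs0 i.
  by move=> hi; rewrite -hvs // /upd ltn_eqF // (leq_trans hi).
have e2 : (eval w (State (upd vs 41 (rt A)) m tb) (tst (Fd 4 (Var 41))) != 0) = P (wsum (fd 3 m) (ino A)).
  apply: tst_ok => //; last exact: le.
  by rewrite (eval_Fd hN (x := rt A)) //= (rep_sum hz rA).
apply: wp_if; rewrite ?e2 => hA.
  apply: (wp_assign (v := rt A)) => //.
  apply: (IHA _ _ ((false, x, B) :: c)) => //.
  - by move=> i hi; rewrite /upd ltn_eqF // -[if _ then _ else _]/(upd vs 41 (rt A) i) hvs1.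
  - by move=> s' hs; apply: hP; apply: subseq_trans hs sA.
  move=> t' vs' A' x' B' c' ht' hvs' vx' E xi Px.
  apply: (HQ t' vs' A' x' B' (rcons c' (false, x, B))) => //.
  - by move: ht' hcost hcost2; rewrite size_rcons /=; clear; lia.
  - by rewrite cat_rcons.
  - by rewrite /= mem_cat xi.
have {}hA : P (wsum (fd 3 m) (ino A)) = false by move: e2; rewrite hA eqxx.
have hB : P (wsum (fd 3 m) (ino B)).
  move: PT; rewrite !hP //= has_cat /= hx /= -hP // hA /=; exact.
apply: (wp_assign (v := rt B)); first by rewrite (eval_Fd hN (x := x)).
apply: (IHB _ _ ((true, x, A) :: c)) => //.
- by move=> i hi; rewrite /upd ltn_eqF // -[if _ then _ else _]/(upd vs 41 (rt A) i) hvs1.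
- by move=> s' hs; apply: hP; apply: subseq_trans hs sB.
move=> t' vs' A' x' B' c' ht' hvs' vx' E xi Px.
apply: (HQ t' vs' A' x' B' (rcons c' (true, x, A))) => //.
- by move: ht' hcost hcost2; rewrite size_rcons /=; clear; lia.
- by rewrite cat_rcons.
- by rewrite /= mem_cat inE xi !orbT.
Qed.

Lemma find_ok vs m t r x s H p Q :
  forest m ((x, s) :: H) p -> (forall i, i < 40 -> vs i = vs0 i) -> vs 40 = x ->
  (forall s', subseq s' s -> P (wsum (fd 3 m) s') = has (fun z => P (fd 3 m z)) s') ->
  P (wsum (fd 3 m) s) ->
  (forall t' vs' m' p' h, t' + p' <= t + p + 2 * cu -> fd 3 m' =1 fd 3 m ->
     (forall k, k < 40 -> vs' k = vs0 k) -> vs' 40 = h ->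
     h \in s -> P (fd 3 m h) -> forest m' ((h, s) :: H) p' -> Q t' r (State vs' m' tb)) ->
  wp w (descend ;; splay 40) t r (State vs m tb) Q.
Proof.
move=> [[|T ts] [ht //= [Er Es EH] Ep]] hvs vx hP Ps HQ.
apply/wp_seq; apply: (@descend_ok m r ts _ T vs t [::]) => //.
- by rewrite vx.
- by rewrite -Es.
- by rewrite -Es.
move=> t1 vs1 A' x' B' c' ht1 hvs1 hx1 E xi Px.
rewrite cats0 /= in E; rewrite E in ht.
apply: (forest_splay_depth hN hW ht hx1) => t2 vs2 m2 A2 B2 ht2 hvs2 hw2 ino2 tr2.
apply: (HQ t2 vs2 m2 (800 * sumn (map pot (Nd A2 x' B2 :: ts))) x') => //.
- move: ht1 ht2; rewrite Ep E -[sumn (map pot (Nd A2 x' B2 :: ts))]/(pot (Nd A2 x' B2) + sumn (map pot ts)).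
  by generalize (pot (Nd A2 x' B2)) (pot (plug (Nd A' x' B') c')) (sumn (map pot ts)) (size c'); rewrite /cu /cc; clear=> *; lia.
- by move=> k hk; rewrite hvs2 ?hvs1 //; apply: ltn_trans hk _.
- by rewrite hvs2.
- by rewrite Es.
- by exists (Nd A2 x' B2 :: ts); split=> //=; rewrite EH Es E -ino2.
Qed.
End Find.

(** * Tours without their roots: access and the connectivity test *)

Section Composites.
Variables (w N Wb : nat).
Hypothesis hN : N * 8 + 16 <= 2 ^ w.
Hypothesis hW : N * Wb < 2 ^ w.
Notation forest := (forest N Wb).
Notation cu := (cu N).

(** Later arguments speak of tours only, in any order; roots are established again by splaying. *)
Definition FR m (F : seq (seq nat)) p :=
  exists H, perm_eq (unzip2 H) F /\ forest m H p.

Lemma FR_perm m F F' p : perm_eq F F' -> FR m F p -> FR m F' p.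
Proof. by move=> hp [H [h1 h2]]; exists H; split=> //; apply: perm_trans hp. Qed.

Lemma FR_pick m s F p : FR m (s :: F) p ->
  exists r H, forest m ((r, s) :: H) p /\ perm_eq (unzip2 H) F.
Proof.
move=> [H [hp hf]]; have : s \in unzip2 H by rewrite (perm_mem hp) inE eqxx.
case/mapP => -[r s'] hi /= E; subst s'.
have hH := perm_to_rem hi; exists r, (rem (r, s) H); split.
  exact: forest_perm hf.
by rewrite -(perm_cons s); apply: perm_trans hp; rewrite perm_sym; apply: (perm_map snd) hH.
Qed.

Lemma FR_mk m r s H F p : forest m ((r, s) :: H) p -> perm_eq (unzip2 H) F -> FR m (s :: F) p.
Proof. by move=> hf hp; exists ((r, s) :: H); rewrite /= perm_cons. Qed.

(** Forgetting a tree only releases potential. This disposes of nodes that have left their tours. *)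
Lemma FR_drop m s F p : FR m (s :: F) p -> exists2 p', p' <= p & FR m F p'.
Proof.
move=> /FR_pick [r [H [[[|T ts] [[h1 h2 h3 h4 h5] //= [_ _ EH] Ep]] hp]]].
exists (800 * sumn (map pot ts)); first by rewrite Ep leq_mul2l leq_addl orbT.
exists H; split=> //; exists ts; split=> //; split=> //.
- by move=> i; apply: (h1 i.+1).
- move: h2; rewrite /inos /= mem_cat cat_uniq negb_or.
  by move=> /andP [/andP [_ ->] /and3P [_ _ ->]].
- by move: h3; rewrite /inos /= all_cat => /andP [].
Qed.

(** What a program can read at a freshly splayed node: the weight of its tour and, at its left
    child, the weight of the nodes before it. *)
Definition seen m x s :=
  [/\ fd 2 m x = 0, fd 4 m x = wsum (fd 3 m) s, fd 0 m x <= N, 0 < x <= N &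
      forall s1 s2, s = s1 ++ x :: s2 -> fd 4 m (fd 0 m x) = wsum (fd 3 m) s1].

Lemma forest_seen m x s H p : forest m ((x, s) :: H) p -> x \in s -> seen m x s.
Proof.
move=> hf xs; have hx := node_le hf xs.
case/splitPr: xs hf => s1 s2 hf; have [h1 h2 h3 h4 [h5 h6]] := root_fields hW hf.
split=> // s3 s4 E; rewrite E in hf; by have [_ _ ->] := root_fields hW hf.
Qed.

Lemma access_ok vs m tb t r v x s F p Q :
  FR m (s :: F) p -> x \in s -> vs v = x ->
  (forall t' vs' m' p', t' + p' <= t + p + cu -> fd 3 m' =1 fd 3 m ->
     (forall k, k < 50 -> vs' k = vs k) -> seen m' x s ->
     FR m' (s :: F) p' -> Q t' r (State vs' m' tb)) ->
  wp w (splay v) t r (State vs m tb) Q.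
Proof.
move=> /FR_pick [r0 [H [hf hp]]] xs vx HQ.
apply: (forest_splay hN hW hf vx xs) => t' vs' m' p' h1 h2 h3 h4.
by apply: HQ h1 h3 h2 _ _; [apply: forest_seen h4 xs | apply: FR_mk h4 hp].
Qed.

Definition setat v e := splay v ;; setw v e.

Lemma setat_ok vs m tb t r v e k x s F p Q :
  FR m (s :: F) p -> x \in s -> vs v = x -> v < 50 -> cost e <= 10 ->
  (forall vs' m', (forall i, i < 50 -> vs' i = vs i) -> eval w (State vs' m' tb) e = k) ->
  k <= Wb ->
  (forall t' vs' m' p', t' + p' <= t + p + 2 * cu -> fd 3 m' =1 upd (fd 3 m) x k ->
     (forall k, k < 50 -> vs' k = vs k) ->
     FR m' (s :: F) p' -> Q t' r (State vs' m' tb)) ->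
  wp w (setat v e) t r (State vs m tb) Q.
Proof.
move=> /FR_pick [r0 [H [hf hp]]] xs vx v50 ce he hk HQ.
apply/wp_seq/(forest_splay hN hW hf vx xs) => t1 vs1 m1 p1 h1 h2 h3 h4.
have vx1 : vs1 v = x by rewrite h2.
apply: (setw_ok hN hW h4 xs vx1 (he _ m1 h2) hk) => t2 m2 h5 h6 h7.
apply: (HQ t2 vs1 m2 p1) => //.
- by move: h1 h5 ce; rewrite /cu /cc; clear; lia.
- by move=> z; rewrite h6 /upd h3.
- exact: FR_mk h7 hp.
Qed.

Lemma nonroot_par m p t x : rep m p t -> x \in ino t -> x != rt t -> fd 2 m x \in ino t.
Proof.
elim: t p => //= l IHl y q IHq p [_ rl rq]; rewrite mem_cat inE => /or3P [h|/eqP ->|h] xy.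
- case: (eqVneq x (rt l)) => [E|n].
    by rewrite E (rep_rt rl) ?mem_cat ?inE ?eqxx ?orbT //; case: (l) h.
  by rewrite mem_cat (IHl y).
- by rewrite eqxx in xy.
- case: (eqVneq x (rt q)) => [E|n].
    by rewrite E (rep_rt rq) ?mem_cat ?inE ?eqxx ?orbT //; case: (q) h.
  by rewrite mem_cat inE (IHq y) ?orbT.
Qed.

(** Splaying [y] after [x] pushes [x] below the root exactly when both are in one tree; otherwise
    [x] stays a root without parent. *)
Lemma conn_ok vs m tb t r vx vy x y s F p Q :
  FR m (s :: F) p -> x \in s -> y \in flatten (s :: F) -> x != y -> vs vx = x -> vs vy = y ->
  vy < 50 ->
  (forall t' vs' m' p', t' + p' <= t + p + 2 * cu -> fd 3 m' =1 fd 3 m ->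
     (forall k, k < 50 -> vs' k = vs k) -> (fd 2 m' x != 0) = (y \in s) ->
     FR m' (s :: F) p' -> Q t' r (State vs' m' tb)) ->
  wp w (splay vx ;; splay vy) t r (State vs m tb) Q.
Proof.
move=> /FR_pick [r0 [H [hf hp]]] xs yF xy ex ey y50 HQ.
apply/wp_seq/(forest_splay hN hW hf ex xs) => t1 vs1 m1 p1 h1 h2 h3 h4.
have ey1 : vs1 vy = y by rewrite h2.
case: (boolP (y \in s)) => ys.
  apply: (forest_splay hN hW h4 ey1 ys) => t2 vs2 m2 p2 h5 h6 h7 h8.
  apply: (HQ t2 vs2 m2 p2) => //.
  - by move: h1 h5; rewrite /cu /cc; clear; lia.
  - by move=> z; rewrite h7 h3.
  - by move=> k hk; rewrite h6 // h2.
  - rewrite ys; case: h8 => [[|T ts] [ht //= [Er Es EH] Ep]].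
    have [hr u _ _ _] := trees_ok hW ht.
    have := nonroot_par hr; rewrite -Er -Es => /(_ x xs xy) => hi.
    by apply: contraTneq u => E; rewrite cons_uniq -Es -E hi.
  - exact: FR_mk h8 hp.
have : y \in flatten (unzip2 H).
  move: yF; rewrite /= mem_cat (negbTE ys) /= => /flattenP [s' s'F ys'].
  by apply/flattenP; exists s' => //; rewrite (perm_mem hp).
case/flattenP => s' /mapP [[r' s2] hi /= E] ys'; subst s2.
have hH := perm_to_rem hi; set H' := rem _ _ in hH.
have h4' : forest m1 ((r', s') :: (x, s) :: H') p1.
  apply: forest_perm h4; rewrite (perm_trans (y := (x, s) :: (r', s') :: H')) ?perm_cons //.
  by apply/permP => c /=; clear; lia.
apply: (forest_splay hN hW h4' ey1 ys') => t2 vs2 m2 p2 h5 h6 h7 h8.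
have h9 : forest m2 ((x, s) :: (y, s') :: H') p2.
  by apply: forest_perm h8; apply/permP => c /=; clear; lia.
apply: (HQ t2 vs2 m2 p2) => //.
- by move: h1 h5; rewrite /cu /cc; clear; lia.
- by move=> z; rewrite h7 h3.
- by move=> k hk; rewrite h6 // h2.
- by have [-> _ _ _ _] := forest_seen h9 xs; rewrite (negbTE ys).
- apply: FR_mk h9 _; apply: perm_trans hp; rewrite perm_sym.
  exact: (perm_map snd hH).
Qed.
End Composites.

(** * Insertion, removal, linking and cutting of sequences *)

Section Composites.
Variables (w N Wb : nat).
Hypothesis hN : N * 8 + 16 <= 2 ^ w.
Hypothesis hW : N * Wb < 2 ^ w.
Notation forest := (forest N Wb).
Notation FR := (FR N Wb).
Notation cu := (cu N).

Lemma FR_of m H F p : forest m H p -> perm_eq (unzip2 H) F -> FR m F p.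
Proof. by exists H. Qed.

Lemma cu_ge : 2500 <= cu.
Proof. by rewrite /cu /cc; lia. Qed.

Lemma ev0 s : eval w s (Const 0) = 0.
Proof. exact: (eval_cst hN). Qed.

Lemma forest_swap m h1 h2 H p : forest m (h1 :: h2 :: H) p -> forest m (h2 :: h1 :: H) p.
Proof. by apply: forest_perm; apply/permP => c /=; clear; lia. Qed.

(* The tree of the node in variable [v] is dissolved into that node, the nodes
   before it (root in 41) and the nodes after it (root in 42). *)
Definition isolate v := splay v ;; detach false v 41 ;; detach true v 42.

Lemma isolate_ok vs m tb t r v x s1 s2 r0 H p Q :
  forest m ((r0, s1 ++ x :: s2) :: H) p -> vs v = x -> v < 40 ->
  (forall t' vs' m' p' a b, t' + p' <= t + p + 2 * cu -> fd 3 m' =1 fd 3 m ->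
     (forall k, k < 40 -> vs' k = vs k) -> vs' 41 = a -> vs' 42 = b ->
     forest m' ((x, [:: x]) :: (a, s1) :: (b, s2) :: H) p' -> Q t' r (State vs' m' tb)) ->
  wp w (isolate v) t r (State vs m tb) Q.
Proof.
move=> hf vx v40 HQ; have xs : x \in s1 ++ x :: s2 by rewrite mem_cat inE eqxx orbT.
apply/wp_seq/(forest_splay hN hW hf vx xs) => t1 vs1 m1 p1 h1 h2 h3 h4.
have v50 : v < 50 by apply: ltn_trans v40 _.
have vx1 : vs1 v = x by rewrite h2.
have v41 : v != 41 by rewrite ltn_eqF // ltnS ltnW.
have v42 : v != 42 by rewrite ltn_eqF // ltnS ltnW // ltnS ltnW.
apply/wp_seq/(detach_ok (d := false) hN hW h4 vx1 v41) => t2 m2 a p2 h5 h6 /forest_swap h7.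
have vx2 : upd vs1 41 a v = x by rewrite /upd (negbTE v41).
apply: (detach_ok (d := true) (s1 := [::]) hN hW h7 vx2 v42) => t3 m3 b p3 h8 h9 h10.
apply: (HQ t3 _ m3 p3 a b) => //.
- by move: h1 h5 h8 cu_ge; rewrite /cu; clear; lia.
- by move=> z; rewrite h9 h6 h3.
- move=> k hk; rewrite /upd !ltn_eqF ?h2 //; lia.
- by apply: forest_perm h10; apply/permP => c /=; clear; lia.
Qed.

(** The weight is reset because weight 0 is what tells that the node of an edge is in no tour. *)
Definition remove v := isolate v ;; concat 41 42 ;; setw v (Const 0).

Lemma remove_ok vs m tb t r v x s1 s2 F p Q :
  FR m ((s1 ++ x :: s2) :: F) p -> vs v = x -> v < 40 ->
  (forall t' vs' m' p', t' + p' <= t + p + 6 * cu -> fd 3 m' =1 upd (fd 3 m) x 0 ->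
     (forall k, k < 40 -> vs' k = vs k) ->
     FR m' ((s1 ++ s2) :: F) p' -> Q t' r (State vs' m' tb)) ->
  wp w (remove v) t r (State vs m tb) Q.
Proof.
move=> /FR_pick [r0 [H [hf hp]]] vx v40 HQ.
apply/wp_seq/(isolate_ok hf vx v40) => t1 vs1 m1 p1 a b h1 h2 h3 ha hb h4.
have h4' : forest m1 ((a, s1) :: (b, s2) :: (x, [:: x]) :: H) p1.
  by apply: forest_perm h4; apply/permP => c /=; clear; lia.
apply/wp_seq/(concat_ok hN hW h4' ha hb) => // t2 vs2 m2 p2 c h5 h6 h7 _ /forest_swap h8.
have vx2 : vs2 v = x by rewrite h7 ?h3 //; [apply: ltn_trans v40 _ | rewrite ltn_eqF].
apply: (setw_ok (k := 0) hN hW h8 _ vx2) => //; first by rewrite inE.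
  exact: ev0.
move=> t3 m3 h9 h10 h11.
have [p3 hp3 h12] : exists2 p', p' <= p2 & FR m3 ((s1 ++ s2) :: F) p'.
  apply: (@FR_drop _ _ _ [:: x]); apply: FR_of h11 _.
  by rewrite /= !perm_cons.
apply: (HQ t3 vs2 m3 p3) => //.
- by move: h1 h5 h9 hp3 cu_ge; rewrite /=; clear; lia.
- by move=> z; rewrite h10 /upd h6 h2.
- by move=> k hk; rewrite h7 ?h3 ?ltn_eqF //; apply: ltn_trans hk _.
Qed.

Definition insert_before vh vu e :=
  new_node vh e ;; splay vu ;; detach false vu 41 ;; attach false vh 41 ;; attach true vh vu.

Lemma insert_before_ok vs m tb t r vh vu e k h u s1 s2 F p Q :
  FR m ((s1 ++ u :: s2) :: F) p -> h \notin flatten ((s1 ++ u :: s2) :: F) ->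
  0 < h <= N -> vs vh = h -> vs vu = u -> vh < 40 -> vu < 40 ->
  (forall m', eval w (State vs m' tb) e = k) -> k <= Wb -> cost e <= 10 ->
  (forall t' vs' m' p', t' + p' <= t + p + 6 * cu -> fd 3 m' =1 upd (fd 3 m) h k ->
     (forall k, k < 40 -> vs' k = vs k) ->
     FR m' ((s1 ++ h :: u :: s2) :: F) p' -> Q t' r (State vs' m' tb)) ->
  wp w (insert_before vh vu e) t r (State vs m tb) Q.
Proof.
move=> /FR_pick [r0 [H [hf hp]]] hF h0 hh hu vh40 vu40 he hk ce HQ.
have hF' : h \notin flatten (unzip2 ((r0, s1 ++ u :: s2) :: H)).
  by rewrite /=; move: hF; rewrite /= !mem_cat (perm_mem (perm_flatten hp)).
apply/wp_seq/(new_node_ok hN hf h0 hF' hh he hk) => t1 m1 h1 h2 /forest_swap h3.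
have us : u \in s1 ++ u :: s2 by rewrite mem_cat inE eqxx orbT.
apply/wp_seq/(forest_splay hN hW h3 hu us) => t2 vs2 m2 p2 h4 h5 h6 h7.
have w40 k' : k' < 40 -> [/\ k' < 50, k' != 41 & k' != 42] by clear=> ?; split; lia.
have [vu50 vu41 _] := w40 _ vu40; have [vh50 vh41 _] := w40 _ vh40.
have hu2 : vs2 vu = u by rewrite h5.
apply/wp_seq/(detach_ok (d := false) hN hW h7 hu2 vu41) => t3 m3 a p3 h8 h9 h10.
have h10' : forest m3 ((a, s1) :: (h, h :: [::]) :: (u, u :: s2) :: H) p3.
  by apply: forest_perm h10; apply/permP => c /=; clear; lia.
have hh3 : upd vs2 41 a vh = h by rewrite /upd (negbTE vh41) h5.
have hu3 : upd vs2 41 a vu = u by rewrite /upd (negbTE vu41) h5.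
apply/wp_seq/(attach_ok (d := false) hN hW h10' hh3) => // t4 m4 p4 h11 h12 h13.
have h13' : forest m4 ((u, u :: s2) :: (h, rcons s1 h) :: H) p4.
  by apply: forest_perm h13; rewrite cats1; apply/permP => c /=; clear; lia.
apply: (attach_ok (d := true) hN hW h13' hh3 hu3) => t5 m5 p5 h14 h15 h16.
apply: (HQ t5 _ m5 p5) => //.
- by move: h1 h4 h8 h11 h14 ce cu_ge; rewrite /cu; clear; lia.
- by move=> z; rewrite h15 h12 h9 h6 h2.
- by move=> i hi; have [i1 i2 _] := w40 _ hi; rewrite /upd (negbTE i2) h5.
- exact: FR_mk h16 hp.
Qed.

(* [s1 ++ v :: s2] becomes [v :: s2 ++ s1], with its root in variable 43. *)
Definition reroot v := splay v ;; detach false v 41 ;; concat v 41 ;; Assign 43 (Var 40).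

Lemma reroot_ok vs m tb t r v x s1 s2 r0 H p Q :
  forest m ((r0, s1 ++ x :: s2) :: H) p -> vs v = x -> v < 40 ->
  (forall t' vs' m' p' c, t' + p' <= t + p + 5 * cu -> fd 3 m' =1 fd 3 m ->
     (forall k, k < 40 -> vs' k = vs k) -> vs' 43 = c ->
     forest m' ((c, x :: s2 ++ s1) :: H) p' -> Q t' r (State vs' m' tb)) ->
  wp w (reroot v) t r (State vs m tb) Q.
Proof.
move=> hf vx v40 HQ; have xs : x \in s1 ++ x :: s2 by rewrite mem_cat inE eqxx orbT.
apply/wp_seq/(forest_splay hN hW hf vx xs) => t1 vs1 m1 p1 h1 h2 h3 h4.
have w40 k' : k' < 40 -> [/\ k' < 50, k' != 41 & k' != 40] by clear=> ?; split; lia.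
have [v50 v41 _] := w40 _ v40.
have vx1 : vs1 v = x by rewrite h2.
apply/wp_seq/(detach_ok (d := false) hN hW h4 vx1 v41) => t2 m2 a p2 h5 h6 /forest_swap h7.
have vx2 : upd vs1 41 a v = x by rewrite /upd (negbTE v41).
apply/wp_seq/(concat_ok (vb := 41) hN hW h7 vx2 (erefl a)) => // t3 vs3 m3 p3 c h8 h9 h10 h11 h12.
apply: (wp_assign (v := c)) => //.
apply: (HQ _ _ m3 p3 c) => //.
- by move: h1 h5 h8 cu_ge; rewrite /cu /=; clear; lia.
- by move=> z; rewrite h9 h6 h3.
- move=> k hk; have [k1 k2 k3] := w40 _ hk.
  by rewrite /upd ltn_eqF ?h10 // /upd ?(negbTE k2) ?h2 //; lia.
Qed.

(* The tour of [u] absorbs the tour of [v], entered by the arc [a] and left by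
   the arc [b]. *)
Definition link_at va vb vu vv e :=
  new_node va e ;; new_node vb e ;; reroot vv ;; splay vu ;; detach false vu 41 ;;
  attach false va 41 ;; attach true va 43 ;; attach false vb va ;; attach true vb vu.

Lemma link_ok vs m tb t r va vb vu vv e k a b u v s1 s2 s3 s4 F p Q :
  FR m ((s1 ++ u :: s2) :: (s3 ++ v :: s4) :: F) p ->
  a \notin flatten ((s1 ++ u :: s2) :: (s3 ++ v :: s4) :: F) ->
  b \notin flatten ((s1 ++ u :: s2) :: (s3 ++ v :: s4) :: F) -> a != b ->
  0 < a <= N -> 0 < b <= N -> vs va = a -> vs vb = b -> vs vu = u -> vs vv = v ->
  va < 40 -> vb < 40 -> vu < 40 -> vv < 40 ->
  (forall m', eval w (State vs m' tb) e = k) -> k <= Wb -> cost e <= 10 ->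
  (forall t' vs' m' p', t' + p' <= t + p + 12 * cu ->
     fd 3 m' =1 upd (upd (fd 3 m) a k) b k ->
     (forall k, k < 40 -> vs' k = vs k) ->
     FR m' ((s1 ++ a :: v :: s4 ++ s3 ++ b :: u :: s2) :: F) p' -> Q t' r (State vs' m' tb)) ->
  wp w (link_at va vb vu vv e) t r (State vs m tb) Q.
Proof.
move=> /FR_pick [r0 [H [hf hp]]] aF bF ab a0 b0 ea eb eu ev la lb lu lv he hk ce HQ.
have PF : perm_eq (flatten (unzip2 ((r0, s1 ++ u :: s2) :: H))) (flatten ((s1 ++ u :: s2) :: (s3 ++ v :: s4) :: F)).
  by apply: perm_flatten; rewrite /= perm_cons.
have aF' : a \notin flatten (unzip2 ((r0, s1 ++ u :: s2) :: H)) by rewrite (perm_mem PF).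
apply/wp_seq/(new_node_ok hN hf a0 aF' ea he hk) => t1 m1 h1 h2 h3.
have bF' : b \notin flatten (unzip2 ((a, [:: a]) :: (r0, s1 ++ u :: s2) :: H)).
  by rewrite -[unzip2 _]/([:: a] :: unzip2 ((r0, s1 ++ u :: s2) :: H)) /= inE negb_or eq_sym ab (perm_mem PF).
apply/wp_seq/(new_node_ok hN h3 b0 bF' eb he hk) => t2 m2 h4 h5 h6.
have [r1 [H1 [h7 hp1]]] : exists r H1, forest m2 ((r, s3 ++ v :: s4) :: (b, [:: b]) :: (a, [:: a]) :: (r0, s1 ++ u :: s2) :: H1) p /\ perm_eq (unzip2 H1) F.
  have : s3 ++ v :: s4 \in unzip2 H by rewrite (perm_mem hp) inE eqxx.
  case/mapP => -[r' s'] hi /= E; subst s'.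
  have hH := perm_to_rem hi; exists r', (rem (r', s3 ++ v :: s4) H); split.
    apply: forest_perm h6; set X := (r', _) in hH *; set H' := rem _ _ in hH *.
    rewrite (perm_trans (y := [:: (b, [:: b]), (a, [:: a]), (r0, s1 ++ u :: s2), X & H'])) ?perm_cons //.
    by apply/permP => c /=; clear; lia.
  rewrite -(perm_cons (s3 ++ v :: s4)); apply: perm_trans hp; rewrite perm_sym.
  exact: (perm_map snd hH).
apply/wp_seq/(reroot_ok h7 ev lv) => t3 vs3 m3 p3 c h8 h9 h10 h11 h12.
have w40 k' : k' < 40 -> [/\ k' < 50, k' != 41 & k' != 40] by clear=> ?; split; lia.
have h12' : forest m3 ((r0, s1 ++ u :: s2) :: (a, [:: a]) :: (b, [:: b]) :: (c, v :: s4 ++ s3) :: H1) p3.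
  by apply: forest_perm h12; apply/permP => q /=; clear; lia.
have us : u \in s1 ++ u :: s2 by rewrite mem_cat inE eqxx orbT.
have eu3 : vs3 vu = u by rewrite h10.
apply/wp_seq/(forest_splay hN hW h12' eu3 us) => t4 vs4 m4 p4 h13 h14 h15 h16.
have [lu1 lu2 _] := w40 _ lu; have [la1 la2 _] := w40 _ la; have [lb1 lb2 _] := w40 _ lb.
have eu4 : vs4 vu = u by rewrite h14.
apply/wp_seq/(detach_ok (d := false) hN hW h16 eu4 lu2) => t5 m5 x p5 h17 h18 h19.
have h19' : forest m5 ((x, s1) :: (a, a :: [::]) :: (u, u :: s2) :: (b, [:: b]) :: (c, v :: s4 ++ s3) :: H1) p5.
  by apply: forest_perm h19; apply/permP => q /=; clear; lia.
set vs5 := upd vs4 41 x.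
have vs5E i : i < 40 -> vs5 i = vs i.
  by move=> hi; have [i1 i2 _] := w40 _ hi; rewrite /vs5 /upd (negbTE i2) h14 // h10.
have ea5 : vs5 va = a by rewrite vs5E.
have eb5 : vs5 vb = b by rewrite vs5E.
have eu5 : vs5 vu = u by rewrite vs5E.
have ec5 : vs5 43 = c by rewrite /vs5 /upd /= h14.
apply/wp_seq/(attach_ok (d := false) (va := 41) hN hW h19' ea5 (erefl x)) => t6 m6 p6 h20 h21 h22.
have h22' : forest m6 ((c, v :: s4 ++ s3) :: (a, rcons s1 a) :: (u, u :: s2) :: (b, [:: b]) :: H1) p6.
  by apply: forest_perm h22; rewrite cats1; apply/permP => q /=; clear; lia.
apply/wp_seq/(attach_ok (d := true) hN hW h22' ea5 ec5) => t7 m7 p7 h23 h24 h25.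
have h25' : forest m7 ((a, s1 ++ a :: v :: s4 ++ s3) :: (b, b :: [::]) :: (u, u :: s2) :: H1) p7.
  by apply: forest_perm h25; apply/permP => q /=; clear; lia.
apply/wp_seq/(attach_ok (d := false) hN hW h25' eb5 ea5) => t8 m8 p8 h26 h27 h28.
have h28' : forest m8 ((u, u :: s2) :: (b, rcons (s1 ++ a :: v :: s4 ++ s3) b) :: H1) p8.
  by apply: forest_perm h28; rewrite cats1; apply/permP => q /=; clear; lia.
apply: (attach_ok (d := true) hN hW h28' eb5 eu5) => t9 m9 p9 h29 h30 h31.
apply: (HQ t9 vs5 m9 p9) => //.
- by move: h1 h4 h8 h13 h17 h20 h23 h26 h29 ce cu_ge; rewrite /cu; clear; lia.
- by move=> z; rewrite h30 h27 h24 h21 h18 h15 h9 h5 /upd h2.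
- rewrite -catA /= -catA in h31; apply: FR_of h31 _.
  by rewrite /= perm_cons.
Qed.

(** A tour is cyclic: without [a], the part after it followed by the part before it is again one
    sequence, and [b] divides it into the two new tours. *)
Definition cut_at va vb :=
  isolate va ;; concat 42 41 ;; isolate vb ;; setw va (Const 0) ;; setw vb (Const 0).

Lemma cut_ok vs m tb t r va vb a b s1 s2 U V F p Q :
  FR m ((s1 ++ a :: s2) :: F) p -> s2 ++ s1 = V ++ b :: U ->
  vs va = a -> vs vb = b -> va < 40 -> vb < 40 ->
  (forall t' vs' m' p', t' + p' <= t + p + 10 * cu ->
     fd 3 m' =1 upd (upd (fd 3 m) a 0) b 0 ->
     (forall k, k < 40 -> vs' k = vs k) ->
     FR m' (V :: U :: F) p' -> Q t' r (State vs' m' tb)) ->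
  wp w (cut_at va vb) t r (State vs m tb) Q.
Proof.
move=> /FR_pick [r0 [H [hf hp]]] E ea eb la lb HQ.
apply/wp_seq/(isolate_ok hf ea la) => t1 vs1 m1 p1 x y h1 h2 h3 hx hy h4.
have h4' : forest m1 ((y, s2) :: (x, s1) :: (a, [:: a]) :: H) p1.
  by apply: forest_perm h4; apply/permP => c /=; clear; lia.
apply/wp_seq/(concat_ok hN hW h4' hy hx) => // t2 vs2 m2 p2 c h5 h6 h7 _ h8.
rewrite E in h8.
have w40 k' : k' < 40 -> [/\ k' < 50 & k' != 40] by clear=> ?; split; lia.
have vsE i : i < 40 -> vs2 i = vs i by move=> hi; have [i1 i2] := w40 _ hi; rewrite h7 ?h3.
have eb2 : vs2 vb = b by rewrite vsE.
apply/wp_seq/(isolate_ok h8 eb2 lb) => t3 vs3 m3 p3 x' y' h9 h10 h11 hx' hy' h12.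
have ea3 : vs3 va = a by rewrite h11 ?vsE.
have eb3 : vs3 vb = b by rewrite h11 ?vsE.
have h12' : forest m3 ((a, [:: a]) :: (b, [:: b]) :: (x', V) :: (y', U) :: H) p3.
  by apply: forest_perm h12; apply/permP => q /=; clear; lia.
apply/wp_seq/(setw_ok (k := 0) hN hW h12' _ ea3) => //; [by rewrite inE|exact: ev0|].
move=> t4 m4 h13 h14 /forest_swap h15.
apply: (setw_ok (k := 0) hN hW h15 _ eb3) => //; [by rewrite inE|exact: ev0|].
move=> t5 m5 h16 h17 h18.
have [p5 hp5 h19] : exists2 p', p' <= p3 & FR m5 ([:: a] :: V :: U :: F) p'.
  apply: (@FR_drop _ _ _ [:: b]); apply: FR_of h18 _.
  by rewrite /= !perm_cons.
have [p6 hp6 h20] := FR_drop h19.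
apply: (HQ t5 vs3 m5 p6) => //.
- by move: h1 h5 h9 h13 h16 hp5 hp6 cu_ge; rewrite /=; clear; lia.
- by move=> z; rewrite h17 /upd h14 /upd h10 h6 h2.
- by move=> k hk; rewrite h11 ?vsE.
Qed.
End Composites.

(** * Euler tours *)

Section Nodes.
Variables (n L : nat).
Hypothesis n0 : 0 < n.

(** An injective code of a level and an ordered pair, shifted by one because 0 is the null pointer.
    Equal ends stand for a vertex, distinct ends for an arc or for one end of a non-tree edge. *)
Definition nd i x y := ((i * n + x) * n + y).+1.
Definition vx i x := nd i x x.
Definition lv z := (z.-1 %/ n) %/ n.
Definition sr z := (z.-1 %/ n) %% n.
Definition ds z := z.-1 %% n.
Definition maxnd := L.+1 * n * n.

Lemma nd_dec i x y : x < n -> y < n ->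
  [/\ lv (nd i x y) = i, sr (nd i x y) = x & ds (nd i x y) = y].
Proof.
move=> hx hy; rewrite /lv /sr /ds /nd /= divnMDl // [y %/ n]divn_small // addn0.
by rewrite divnMDl // divn_small // addn0 !modnMDl !modn_small.
Qed.

Lemma lv_nd i x y : x < n -> y < n -> lv (nd i x y) = i.
Proof. by move=> hx hy; have [] := nd_dec i hx hy. Qed.
Lemma sr_nd i x y : x < n -> y < n -> sr (nd i x y) = x.
Proof. by move=> hx hy; have [] := nd_dec i hx hy. Qed.
Lemma ds_nd i x y : x < n -> y < n -> ds (nd i x y) = y.
Proof. by move=> hx hy; have [] := nd_dec i hx hy. Qed.

Definition okn z := 0 < z <= maxnd.

Lemma okn_nd i x y : i <= L -> x < n -> y < n -> okn (nd i x y).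
Proof.
move=> hi hx hy; rewrite /okn /nd /maxnd /=.
have h1 : i * n + x < L.+1 * n.
  apply: leq_trans (_ : i.+1 * n <= _); first by rewrite mulSn; lia.
  by rewrite leq_mul2r ltnS hi orbT.
apply: leq_trans (_ : (i * n + x).+1 * n <= _); first by rewrite mulSn; lia.
by rewrite leq_mul2r h1 orbT.
Qed.

Lemma sr_lt z : sr z < n. Proof. exact: ltn_pmod. Qed.
Lemma ds_lt z : ds z < n. Proof. exact: ltn_pmod. Qed.

Lemma nd_eta z : 0 < z -> nd (lv z) (sr z) (ds z) = z.
Proof. by case: z => // z _; rewrite /nd /lv /sr /ds /= -!divn_eq. Qed.

Lemma lv_le z : okn z -> lv z <= L.
Proof.
rewrite /okn /lv /maxnd => /andP [z0 zN].
by rewrite -ltnS ltn_divLR // ltn_divLR // prednK.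
Qed.

(** * Tours as closed walks, and their components *)

Section Walks.
Variable B : nat.
Hypothesis B2 : 1 < B.

Definition arc (wt : nat -> nat) z := wt z %% B != 0.
(** The position after a node: only arcs move; vertex nodes and non-tree edges leave the walk where
    it is. *)
Definition stp wt z := if arc wt z then ds z else sr z.
Fixpoint walk wt p s :=
  if s is z :: s' then (sr z == p) && walk wt (stp wt z) s' else true.
Definition wend wt p s := last p (map (stp wt) s).
(** The starting point is existential, which makes the notion invariant under cyclic shifts. *)
Definition closed wt s := exists p, walk wt p s /\ wend wt p s = p.

Lemma walk_cat wt p s1 s2 : walk wt p (s1 ++ s2) = walk wt p s1 && walk wt (wend wt p s1) s2.
Proof. by elim: s1 p => //= z s IH p; rewrite IH andbA. Qed.

Lemma wend_cat wt p s1 s2 : wend wt p (s1 ++ s2) = wend wt (wend wt p s1) s2.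
Proof. by rewrite /wend map_cat last_cat. Qed.

Lemma wend_cons wt p z s : wend wt p (z :: s) = wend wt (stp wt z) s.
Proof. by []. Qed.

Lemma closed_rot wt s1 s2 : closed wt (s1 ++ s2) -> closed wt (s2 ++ s1).
Proof.
case=> p; rewrite walk_cat wend_cat => -[/andP [h1 h2] h3].
by exists (wend wt p s1); rewrite walk_cat wend_cat h3 h2 h1.
Qed.

Lemma walk_ext wt wt' p s : {in s, stp wt =1 stp wt'} -> walk wt p s = walk wt' p s.
Proof.
elim: s p => //= z s IH p H; rewrite H ?inE ?eqxx // IH // => y ys.
by rewrite H // inE ys orbT.
Qed.

Lemma wend_ext wt wt' p s : {in s, stp wt =1 stp wt'} -> wend wt p s = wend wt' p s.
Proof. by move=> H; rewrite /wend; congr last; apply/eq_in_map. Qed.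

Lemma closed_ext wt wt' s : {in s, stp wt =1 stp wt'} -> closed wt s -> closed wt' s.
Proof. by move=> H [p]; rewrite (walk_ext _ H) (wend_ext _ H); exists p. Qed.

(** Its uses: membership in a component, predicates that separate the two sides of an edge, and the
    difference of two colorings. *)
Lemma walk_const wt p s (T : eqType) (f : nat -> T) : walk wt p s ->
  (forall z, z \in s -> f (sr z) = f (stp wt z)) ->
  (forall z, z \in s -> f (sr z) = f p) /\ f (wend wt p s) = f p.
Proof.
elim: s p => [|z s IH] p //= /andP [/eqP E hs] H.
have [h1 h2] : (forall y, y \in s -> f (sr y) = f (stp wt z)) /\
   f (wend wt (stp wt z) s) = f (stp wt z).
  by apply: IH => // y ys; apply: H; rewrite inE ys orbT.
have hz : f (stp wt z) = f p by rewrite -H ?inE ?eqxx // E.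
split; last by rewrite wend_cons h2.
by move=> y; rewrite inE => /predU1P [->|/h1 ->]; rewrite ?E.
Qed.

Lemma closed_const wt s (T : eqType) (f : nat -> T) : closed wt s ->
  (forall z, z \in s -> f (sr z) = f (stp wt z)) ->
  forall z z', z \in s -> z' \in s -> f (sr z) = f (sr z').
Proof.
move=> [p [h1 _]] H z z' zs zs'; have [h2 _] := walk_const h1 H.
by rewrite !h2.
Qed.

(** The successor is taken cyclically, so the tour is shifted until it starts at [z]. *)
Lemma closed_next wt s z : closed wt s -> z \in s ->
  exists2 z', z' \in s & sr z' = stp wt z.
Proof.
move=> hc zs; have [s1 [s2 E]] : exists s1 s2, s = s1 ++ z :: s2.
  by case/splitPr: zs => s1 s2; exists s1, s2.
have hc' : closed wt ((z :: s2) ++ s1) by apply: closed_rot; rewrite -E.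
case E': (s2 ++ s1) => [|y q].
  case: hc' => p; rewrite /= E' /wend /= => -[/andP [/eqP h _] h2].
  by exists z; rewrite // h -h2.
exists y.
  have : y \in s2 ++ s1 by rewrite E' inE eqxx.
  by rewrite E !mem_cat inE => /orP [] ->; rewrite ?orbT.
by case: hc' => p /= [+ _]; rewrite E' /= => /andP [_ /andP [/eqP]].
Qed.

(** Vertex nodes belong to tours whatever their weight, so zeroed memory is a valid start; other
    nodes do exactly when their weight is nonzero. By the last clause a tour contains the vertex
    node of every vertex it visits, so components can be read off vertex nodes. *)
Definition struct (F : seq (seq nat)) wt :=
  [/\ uniq (flatten F),
      forall z, (z \in flatten F) = okn z && ((sr z == ds z) || (wt z != 0)),
      forall s, s \in F -> closed wt s,
      forall s z z', s \in F -> z \in s -> z' \in s -> lv z = lv z' &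
      forall s z, s \in F -> z \in s -> vx (lv z) (sr z) \in s].

Definition conn (F : seq (seq nat)) i x y :=
  has (fun s => (vx i x \in s) && (vx i y \in s)) F.

(** The pairs that an edge between [u] and [v] would join. *)
Definition cross F i u v x y :=
  (conn F i x u && conn F i y v) || (conn F i x v && conn F i y u).

Lemma connP (F : seq (seq nat)) i x y :
  reflect (exists s, [/\ s \in F, vx i x \in s & vx i y \in s]) (conn F i x y).
Proof.
apply: (iffP hasP) => [[s sF /andP [h1 h2]]|[s [h1 h2 h3]]]; first by exists s.
by exists s; rewrite ?h2.
Qed.

Lemma conn_sym F i x y : conn F i x y = conn F i y x.
Proof. by apply: eq_has => s; rewrite andbC. Qed.

Lemma flatten_uniq_in (F : seq (seq nat)) s1 s2 z : uniq (flatten F) ->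
  s1 \in F -> s2 \in F -> z \in s1 -> z \in s2 -> s1 = s2.
Proof.
elim: F => //= s F IH; rewrite cat_uniq => /and3P [_ /hasPn h u].
have no q : q \in F -> z \in q -> z \in s -> False.
  move=> qF zq; have : z \in flatten F by apply/flattenP; exists q.
  by move=> /h /negP.
rewrite !inE => /predU1P [->|h1] /predU1P [->|h2] //.
- by move=> z1 z2; case: (no _ h2 z2 z1).
- by move=> z1 z2; case: (no _ h1 z1 z2).
- exact: IH.
Qed.

Lemma mem_flat (F : seq (seq nat)) s z : s \in F -> z \in s -> z \in flatten F.
Proof. by move=> h1 h2; apply/flattenP; exists s. Qed.

Section WithStruct.
Variables (F : seq (seq nat)) (wt : nat -> nat).
Hypothesis hS : struct F wt.

Lemma tour_uniq s1 s2 z : s1 \in F -> s2 \in F -> z \in s1 -> z \in s2 -> s1 = s2.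
Proof. by case: hS => u _ _ _ _; apply: flatten_uniq_in. Qed.

Lemma tour_okn s z : s \in F -> z \in s -> okn z.
Proof. by move=> h1 h2; case: hS => _ h _ _ _; have := mem_flat h1 h2; rewrite h => /andP []. Qed.

Lemma conn_refl i x : i <= L -> x < n -> conn F i x x.
Proof.
move=> hi hx; case: hS => _ h _ _ _.
have : vx i x \in flatten F.
  by rewrite h okn_nd // sr_nd // ds_nd // eqxx.
by case/flattenP => s sF vs; apply/connP; exists s.
Qed.

Lemma conn_trans i y x z : conn F i x y -> conn F i y z -> conn F i x z.
Proof.
move=> /connP [s [h1 h2 h3]] /connP [s' [h4 h5 h6]].
have E := tour_uniq h1 h4 h3 h5; subst s'.
by apply/connP; exists s.
Qed.

Lemma conn_in s z z' : s \in F -> z \in s -> z' \in s -> conn F (lv z) (sr z) (sr z').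
Proof.
move=> sF zs zs'; case: hS => _ _ _ h4 h5; apply/connP; exists s; split=> //.
  exact: h5.
by rewrite (h4 s z z') // h5.
Qed.

Lemma conn_eq_r i x y z : conn F i x y -> conn F i z x = conn F i z y.
Proof.
move=> h; apply/idP/idP => h2; first exact: conn_trans h2 h.
by apply: conn_trans h2 _; rewrite conn_sym.
Qed.

Lemma tour_mem s i x z : s \in F -> vx i x \in s -> x < n ->
  z \in flatten F -> lv z = i -> sr z = x -> z \in s.
Proof.
move=> sF xs hx /flattenP [s' s'F zs'] E1 E2; case: hS => _ _ _ _ h5.
have := h5 s' z s'F zs'; rewrite E1 E2 => h.
by rewrite (tour_uniq sF s'F xs h).
Qed.

Lemma conn_tour s i x y : s \in F -> vx i x \in s -> conn F i x y = (vx i y \in s).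
Proof.
move=> sF xs; apply/connP/idP => [[s' [h1 h2 h3]]|h]; last by exists s.
by rewrite (tour_uniq sF h1 xs h2).
Qed.

Lemma conn_stp s z : s \in F -> z \in s -> conn F (lv z) (sr z) (stp wt z).
Proof.
move=> sF zs; case: (hS) => _ _ h3 _ _.
by have [z' z's <-] := closed_next (h3 s sF) zs; exact: conn_in sF zs z's.
Qed.

End WithStruct.

Lemma struct_perm (F F' : seq (seq nat)) wt : perm_eq F F' -> struct F wt -> struct F' wt.
Proof.
move=> hp [h1 h2 h3 h4 h5]; have hf := perm_flatten hp; split.
- by rewrite -(perm_uniq hf).
- by move=> z; rewrite -(perm_mem hf).
- by move=> s; rewrite -(perm_mem hp); apply: h3.
- by move=> s z z'; rewrite -(perm_mem hp); apply: h4.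
- by move=> s z; rewrite -(perm_mem hp); apply: h5.
Qed.

Lemma conn_perm (F F' : seq (seq nat)) i x y : perm_eq F F' -> conn F i x y = conn F' i x y.
Proof. exact: perm_has. Qed.

Lemma arc_upd wt h k z : arc (upd wt h k) z = if z == h then k %% B != 0 else arc wt z.
Proof. by rewrite /arc /upd; case: (z == h). Qed.

Lemma struct_ext F wt wt' : wt =1 wt' -> struct F wt -> struct F wt'.
Proof.
move=> E [h1 h2 h3 h4 h5]; split=> //; first by move=> z; rewrite h2 E.
by move=> s /h3; apply: closed_ext => z _; rewrite /stp /arc E.
Qed.

Lemma stp_upd_neq wt h k z : z != h -> stp (upd wt h k) z = stp wt z.
Proof. by rewrite /stp arc_upd => /negbTE ->. Qed.

Lemma struct_setw F wt z k : struct F wt -> (k %% B != 0) = arc wt z ->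
  (sr z == ds z) || ((k != 0) == (wt z != 0)) -> struct F (upd wt z k).
Proof.
move=> [h1 h2 h3 h4 h5] ha hk; split=> //.
  move=> y; rewrite h2 /upd; case: (eqVneq y z) => [->|//]; congr andb.
  by case: (sr z == ds z) hk => //= /eqP ->.
move=> s /h3; apply: closed_ext => y _; rewrite /stp arc_upd.
by case: (eqVneq y z) => [->|//]; rewrite ha.
Qed.

(** A node that is not an arc goes beside a node with the same source, where the walk merely
    pauses. *)
Lemma struct_insert F wt s1 s2 u h k : struct ((s1 ++ u :: s2) :: F) wt ->
  h \notin flatten ((s1 ++ u :: s2) :: F) -> okn h -> sr h = sr u -> lv h = lv u ->
  k != 0 -> k %% B = 0 ->
  struct ((s1 ++ h :: u :: s2) :: F) (upd wt h k).
Proof.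
move=> [h1 h2 h3 h4 h5] hF hok hs hl k0 kB.
have hp : perm_eq (flatten ((s1 ++ h :: u :: s2) :: F)) (h :: flatten ((s1 ++ u :: s2) :: F)).
  by apply/permP => c; rewrite /= !count_cat /= ?count_cat /=; clear; lia.
have us : u \in s1 ++ u :: s2 by rewrite mem_cat inE eqxx orbT.
have mS z : (z \in s1 ++ h :: u :: s2) = (z == h) || (z \in s1 ++ u :: s2).
  by rewrite !mem_cat !inE; case: (z == h); rewrite ?orbT.
have nh s z : s \in (s1 ++ u :: s2) :: F -> z \in s -> z != h.
  by move=> sF zs; apply: contraNneq hF => <-; apply: mem_flat zs.
have vh : vx (lv h) (sr h) \in s1 ++ h :: u :: s2.
  by rewrite hs hl mS h5 ?inE ?eqxx ?orbT.
split.
- by rewrite (perm_uniq hp) cons_uniq hF h1.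
- move=> z; rewrite (perm_mem hp) inE h2 /upd; case: (eqVneq z h) => [->|//].
  by rewrite hok k0 orbT.
- move=> s; rewrite inE => /predU1P [->|sF]; last first.
    have sF' : s \in (s1 ++ u :: s2) :: F by rewrite inE sF orbT.
    apply: closed_ext (h3 s sF') => z zs.
    by rewrite stp_upd_neq // (nh s).
  have [|p [hw he]] := h3 (s1 ++ u :: s2); first by rewrite inE eqxx.
  have ext : {in s1 ++ u :: s2, stp wt =1 stp (upd wt h k)}.
    by move=> z zs; rewrite stp_upd_neq // (nh (s1 ++ u :: s2)) // inE eqxx.
  exists p; move: hw he; rewrite (walk_ext _ ext) (wend_ext _ ext) !walk_cat !wend_cat /=.
  set q := wend _ p s1; move=> /andP [-> /andP [/eqP hu hw]].
  have hst : stp (upd wt h k) h = sr h by rewrite /stp arc_upd eqxx kB.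
  by rewrite !wend_cons hst hs hu eqxx /=.
- move=> s z z'; rewrite inE => /predU1P [->|sF]; last by apply: h4; rewrite inE sF orbT.
  have h4' := h4 (s1 ++ u :: s2); rewrite inE eqxx in h4'.
  rewrite !mS => /predU1P [->|zs] /predU1P [->|zs'] //; last exact: h4'.
    by rewrite hl; apply: h4'.
  by rewrite hl; apply: h4'.
- move=> s z; rewrite inE => /predU1P [->|sF]; last by apply: h5; rewrite inE sF orbT.
  rewrite mS => /predU1P [->//|zs].
  by rewrite mS h5 ?orbT // inE eqxx.
Qed.

Lemma struct_remove F wt s1 s2 h : struct ((s1 ++ h :: s2) :: F) wt ->
  ~~ arc wt h -> sr h != ds h ->
  struct ((s1 ++ s2) :: F) (upd wt h 0).
Proof.
move=> [h1 h2 h3 h4 h5] ha hsd.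
have hp : perm_eq (flatten ((s1 ++ h :: s2) :: F)) (h :: flatten ((s1 ++ s2) :: F)).
  by apply/permP => c; rewrite /= !count_cat /= ?count_cat /=; clear; lia.
have mS z : (z \in s1 ++ h :: s2) = (z == h) || (z \in s1 ++ s2).
  by rewrite !mem_cat !inE; case: (z == h); rewrite ?orbT.
have hF : h \notin flatten ((s1 ++ s2) :: F).
  by move: h1; rewrite (perm_uniq hp) => /andP [].
have nh s z : s \in (s1 ++ s2) :: F -> z \in s -> z != h.
  by move=> sF zs; apply: contraNneq hF => <-; apply: mem_flat zs.
have nv i x : x < n -> vx i x != h.
  by move=> hx; apply: contraNneq hsd => <-; rewrite sr_nd // ds_nd.
split.
- by move: h1; rewrite (perm_uniq hp) => /andP [].
- move=> z; rewrite /upd; case: (eqVneq z h) => [->|zh].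
    by rewrite (negbTE hF) eqxx (negbTE hsd) andbF.
  by rewrite -h2 (perm_mem hp) inE (negbTE zh).
- move=> s; rewrite inE => /predU1P [->|sF]; last first.
    have sF' : s \in (s1 ++ h :: s2) :: F by rewrite inE sF orbT.
    apply: closed_ext (h3 s sF') => z zs.
    by rewrite stp_upd_neq // (nh s) // inE sF orbT.
  have [|p [hw he]] := h3 (s1 ++ h :: s2); first by rewrite inE eqxx.
  have ext : {in s1 ++ s2, stp (upd wt h 0) =1 stp wt}.
    by move=> z zs; rewrite stp_upd_neq // (nh (s1 ++ s2)) // inE eqxx.
  exists p; rewrite (walk_ext _ ext) (wend_ext _ ext).
  move: hw he; rewrite !walk_cat !wend_cat /= wend_cons /stp (negbTE ha).
  by move=> /andP [-> /andP [/eqP -> ->]].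
- move=> s z z'; rewrite inE => /predU1P [->|sF]; last by apply: h4; rewrite inE sF orbT.
  by move=> zs zs'; apply: (h4 (s1 ++ h :: s2)); rewrite ?mS ?zs ?zs' ?orbT // inE eqxx.
- move=> s z; rewrite inE => /predU1P [->|sF]; last by apply: h5; rewrite inE sF orbT.
  move=> zs; have := h5 (s1 ++ h :: s2) z; rewrite inE eqxx !mS zs orbT.
  by move=> /(_ isT isT); rewrite (negbTE (nv _ _ (sr_lt z))).
Qed.

(** * Addition and removal of one tree edge in one level *)

Section Link.
Variables (i x y : nat).
Hypotheses (hi : i <= L) (hx : x < n) (hy : y < n) (xy : x != y).
Let a := nd i x y.
Let b := nd i y x.

Lemma nd_ab : a != b.
Proof. by apply: contraNneq xy => /(congr1 sr); rewrite !sr_nd // => ->. Qed.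

Lemma vx_nab p j : p < n -> (vx j p != a) && (vx j p != b).
Proof.
move=> hp; apply/andP; split; apply: contraNneq xy => E.
  by have := congr1 sr E; have := congr1 ds E; rewrite /a !sr_nd // !ds_nd // => <- <-.
by have := congr1 sr E; have := congr1 ds E; rewrite /b !sr_nd // !ds_nd // => <- <-.
Qed.

(** Shifted to start at its vertex node, the tour of [y] is a closed walk at [y]; the two arcs lead
    into it and back to [x]. *)
Lemma struct_link F wt s1 s2 s3 s4 k :
  let F0 := (s1 ++ vx i x :: s2) :: (s3 ++ vx i y :: s4) :: F in
  struct F0 wt -> a \notin flatten F0 -> b \notin flatten F0 -> k %% B != 0 ->
  struct ((s1 ++ a :: vx i y :: s4 ++ s3 ++ b :: vx i x :: s2) :: F) (upd (upd wt a k) b k).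
Proof.
move=> F0; set T := s1 ++ a :: _; move=> [h1 h2 h3 h4 h5] aF bF kB.
have k0 : k != 0 by apply: contraNneq kB => ->; rewrite mod0n.
have hp : perm_eq (flatten (T :: F)) (a :: b :: flatten F0).
  by apply/permP => c; rewrite /F0 /T /= !count_cat /= ?count_cat /= ?count_cat /=; clear; lia.
have suF : s1 ++ vx i x :: s2 \in F0 by rewrite inE eqxx.
have svF : s3 ++ vx i y :: s4 \in F0 by rewrite !inE eqxx orbT.
have FF s : s \in F -> s \in F0 by move=> sF; rewrite !inE sF !orbT.
have mT z : (z \in T) = [|| z == a, z == b, z \in s1 ++ vx i x :: s2 | z \in s3 ++ vx i y :: s4].
  rewrite /T !(mem_cat, inE); case: (z == a); case: (z == b); case: (z \in s1); case: (z == vx i x);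
  by case: (z == vx i y); case: (z \in s2); case: (z \in s3); case: (z \in s4).
set wt' := upd _ b k.
have ext z s : s \in F0 -> z \in s -> stp wt' z = stp wt z.
  move=> sF zs; rewrite /wt' !stp_upd_neq //.
    by apply: contraNneq aF => <-; apply: mem_flat zs.
  by apply: contraNneq bF => <-; apply: mem_flat zs.
have lvu z : z \in s1 ++ vx i x :: s2 -> lv z = i.
  move=> zs; rewrite -(lv_nd i hx hx); apply: (h4 _ _ _ suF) => //.
  by rewrite mem_cat inE eqxx orbT.
have lvv z : z \in s3 ++ vx i y :: s4 -> lv z = i.
  move=> zs; rewrite -(lv_nd i hy hy); apply: (h4 _ _ _ svF) => //.
  by rewrite mem_cat inE eqxx orbT.
have lvT z : z \in T -> lv z = i.
  rewrite mT => /or4P [/eqP ->|/eqP ->|/lvu|/lvv] //; exact: lv_nd.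
have ab := nd_ab.
split.
- by rewrite (perm_uniq hp) /= inE negb_or ab aF bF h1.
- move=> z; rewrite (perm_mem hp) !inE h2 /wt' /upd.
  case: (eqVneq z b) => [->|zb]; first by rewrite orbT k0 orbT okn_nd.
  by case: (eqVneq z a) => [->|//]; rewrite k0 orbT okn_nd.
- move=> s; rewrite inE => /predU1P [->|sF]; last first.
    by apply: closed_ext (h3 s (FF s sF)) => z zs; rewrite (ext z s) // FF.
  have stA : stp wt' a = y by rewrite /stp /wt' !arc_upd (negbTE ab) eqxx kB ds_nd.
  have stB : stp wt' b = x by rewrite /stp /wt' !arc_upd eqxx kB ds_nd.
  have stV p j : p < n -> stp wt' (vx j p) = p.
    by move=> hq; rewrite /stp sr_nd // ds_nd //; case: ifP.
  have [p [hw he]] : closed wt' (s1 ++ vx i x :: s2).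
    by apply: closed_ext (h3 _ suF) => z zs; rewrite (ext z _ suF zs).
  have [q [hw2 he2]] : closed wt' ((vx i y :: s4) ++ s3).
    apply: closed_rot; apply: closed_ext (h3 _ svF) => z zs; by rewrite (ext z _ svF zs).
  exists p; rewrite /T.
  rewrite walk_cat /= wend_cat /= in hw he.
  case/andP: hw => hw /andP [/eqP hu hw1]; rewrite sr_nd // in hu.
  have qy : q = y by case/andP: hw2 => /eqP <- _; rewrite sr_nd.
  rewrite {}qy /= wend_cons in hw2 he2; case/andP: hw2 => _ hw2.
  rewrite wend_cons in he; rewrite !stV // in hw1 hw2 he he2.
  rewrite -[s4 ++ s3 ++ _]/(s4 ++ s3 ++ [:: b, vx i x & s2]) catA.
  move: hw2 he2; set R := s4 ++ s3 => hw2 he2.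
  rewrite walk_cat wend_cat -hu hw /= !wend_cons stA !stV // walk_cat wend_cat hw2 he2 /=.
  by rewrite !wend_cons stB !stV // !sr_nd // !eqxx.
- move=> s z z'; rewrite inE => /predU1P [->|sF]; last by apply: h4; apply: FF.
  by move=> /lvT -> /lvT ->.
- move=> s z; rewrite inE => /predU1P [->|sF]; last by apply: h5; apply: FF.
  move=> zT; rewrite (lvT z zT); move: zT; rewrite mT => /or4P [/eqP ->|/eqP ->|zs|zs].
  + by rewrite sr_nd // mT mem_cat inE eqxx !orbT.
  + by rewrite sr_nd // mT !mem_cat !inE eqxx !orbT.
  + by have h := h5 _ _ suF zs; rewrite (lvu z zs) in h; rewrite mT h !orbT.
  + by have h := h5 _ _ svF zs; rewrite (lvv z zs) in h; rewrite mT h !orbT.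
Qed.

Lemma conn_link F wt s1 s2 s3 s4 j p q :
  let F0 := (s1 ++ vx i x :: s2) :: (s3 ++ vx i y :: s4) :: F in
  struct F0 wt -> p < n -> q < n ->
  conn ((s1 ++ a :: vx i y :: s4 ++ s3 ++ b :: vx i x :: s2) :: F) j p q =
  conn F0 j p q || (j == i) && cross F0 i x y p q.
Proof.
move=> F0 hS hp hq; set T := s1 ++ a :: _.
have suF : s1 ++ vx i x :: s2 \in F0 by rewrite inE eqxx.
have svF : s3 ++ vx i y :: s4 \in F0 by rewrite !inE eqxx orbT.
have mT z r : z = vx r.2 r.1 -> r.1 < n -> (z \in T) = (z \in s1 ++ vx i x :: s2) || (z \in s3 ++ vx i y :: s4).
  move=> E hr; rewrite /T !(mem_cat, inE) E.
  have /andP [/negbTE -> /negbTE ->] := vx_nab r.2 hr.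
  case: (_ \in s1); case: (_ == vx i x);
  by case: (_ == vx i y); case: (_ \in s2); case: (_ \in s3); case: (_ \in s4).
have mp := mT (vx j p) (p, j) (erefl _) hp; have mq := mT (vx j q) (q, j) (erefl _) hq.
have cu r : conn F0 i r x = (vx i r \in s1 ++ vx i x :: s2).
  by rewrite conn_sym (conn_tour hS r suF) // mem_cat inE eqxx orbT.
have cv r : conn F0 i r y = (vx i r \in s3 ++ vx i y :: s4).
  by rewrite conn_sym (conn_tour hS r svF) // mem_cat inE eqxx orbT.
rewrite /cross !cu !cv /conn /= mp mq.
case: (eqVneq j i) => [->|ji] /=.
  by case: (vx i p \in _); case: (vx i q \in _); case: (vx i p \in _); case: (vx i q \in _); case: (has _ _).
have nl s r : s \in F0 -> vx i r \in s -> r < n -> (vx j p \in s) = false.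
  case: hS => _ _ _ h4 _ sF rs hr; apply: contraNF ji => ps.
  by rewrite -(lv_nd j hp hp) (h4 s _ _ sF ps rs) lv_nd.
have xs : vx i x \in s1 ++ vx i x :: s2 by rewrite mem_cat inE eqxx orbT.
have ys : vx i y \in s3 ++ vx i y :: s4 by rewrite mem_cat inE eqxx orbT.
by rewrite (nl _ x suF xs) // (nl _ y svF ys) //= orbF.
Qed.

(** Both pieces are closed walks, at [y] and at [x]. They share no vertex because [P] is constant
    along each of them, with different values; this puts every vertex node on the right side. *)
Lemma struct_cut F wt s1 s2 U V (P : nat -> bool) :
  struct ((s1 ++ a :: s2) :: F) wt -> s2 ++ s1 = V ++ b :: U ->
  arc wt a -> arc wt b -> P x != P y ->
  (forall z, z \in s1 ++ a :: s2 -> z != a -> z != b -> P (sr z) = P (stp wt z)) ->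
  struct (V :: U :: F) (upd (upd wt a 0) b 0) /\ vx i x \in U /\ vx i y \in V.
Proof.
move=> [h1 h2 h3 h4 h5] E arca arcb Pxy HP; set wt' := upd _ b 0.
set T := s1 ++ a :: s2 in h1 h2 h3 h4 h5 HP *.
have TF : T \in T :: F by rewrite inE eqxx.
have FF s : s \in F -> s \in T :: F by move=> sF; rewrite inE sF orbT.
have ab := nd_ab.
have pT : perm_eq T (a :: b :: (V ++ U)).
  apply: (@perm_trans _ (a :: (s2 ++ s1))); last first.
    by rewrite E; apply/permP => c /=; rewrite !count_cat /=; clear; lia.
  by apply/permP => c; rewrite /T /= !count_cat /=; clear; lia.
have hp : perm_eq (flatten (T :: F)) (a :: b :: flatten (V :: U :: F)).
  by rewrite /= catA -!cat_cons perm_cat2r.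
have u' : uniq (a :: b :: flatten (V :: U :: F)) by rewrite -(perm_uniq hp).
move: (u'); rewrite !cons_uniq inE negb_or => /and3P [/andP [_ aF] bF uF].
have mT z : (z \in T) = [|| z == a, z == b, z \in V | z \in U].
  by rewrite (perm_mem pT) !inE mem_cat.
have nab s z : s \in V :: U :: F -> z \in s -> (z != a) && (z != b).
  move=> sF zs; apply/andP; split.
    by apply: contraNneq aF => <-; apply: mem_flat zs.
  by apply: contraNneq bF => <-; apply: mem_flat zs.
have VF : V \in V :: U :: F by rewrite inE eqxx.
have UF : U \in V :: U :: F by rewrite !inE eqxx orbT.
have lvT z : z \in T -> lv z = i.
  by move=> zs; rewrite -(lv_nd i hx hy); apply: (h4 _ _ _ TF) => //; rewrite mT eqxx.
have ext z s : s \in V :: U :: F -> z \in s -> stp wt z = stp wt' z.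
  by move=> sF zs; have /andP [z1 z2] := nab s z sF zs; rewrite /wt' !stp_upd_neq.
have sta : stp wt a = y by rewrite /stp arca ds_nd.
have stb : stp wt b = x by rewrite /stp arcb ds_nd.
have [wV [eV [wU eU]]] : walk wt y V /\ wend wt y V = y /\ walk wt x U /\ wend wt x U = x.
  have : closed wt ((a :: s2) ++ s1) by apply: closed_rot; apply: h3.
  rewrite /= E => -[p]; rewrite /= wend_cons sta walk_cat wend_cat /= wend_cons stb sr_nd //.
  rewrite sr_nd // => -[/and4P [/eqP <- -> /eqP <- ->] ->].
  by [].
have HPs s z : s \in [:: V; U] -> z \in s -> P (sr z) = P (stp wt z).
  move=> sVU zs; have sF : s \in V :: U :: F by move: sVU; rewrite !inE => /orP [] ->; rewrite ?orbT.
  have /andP [z1 z2] := nab s z sF zs; apply: HP => //.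
  by move: sVU; rewrite mT !inE => /orP [/eqP <-|/eqP <-]; rewrite zs ?orbT.
have [PV _] := walk_const wV (fun z => HPs V z (mem_head _ _)).
have [PU _] := walk_const wU (fun z => HPs U z (mem_last V [:: U])).
have vT z : z \in V -> vx i (sr z) \in V.
  move=> zV; have zT : z \in T by rewrite mT zV !orbT.
  have := h5 T z TF zT; rewrite (lvT z zT) mT.
  have /andP [/negbTE -> /negbTE ->] := vx_nab i (sr_lt z) => /= /orP [//|/PU].
  by rewrite sr_nd ?sr_lt // PV // => Pe; rewrite Pe eqxx in Pxy.
have uT z : z \in U -> vx i (sr z) \in U.
  move=> zV; have zT : z \in T by rewrite mT zV !orbT.
  have := h5 T z TF zT; rewrite (lvT z zT) mT.
  have /andP [/negbTE -> /negbTE ->] := vx_nab i (sr_lt z) => /= /orP [/PV|//].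
  by rewrite sr_nd ?sr_lt // PU // => Pe; rewrite Pe eqxx in Pxy.
split; last first.
  have vxT : vx i x \in T by have := h5 T a TF; rewrite mT eqxx /a lv_nd // sr_nd //; apply.
  have vyT : vx i y \in T by have := h5 T b TF; rewrite mT eqxx orbT /b lv_nd // sr_nd //; apply.
  split.
    move: vxT; rewrite mT; have /andP [/negbTE -> /negbTE ->] := vx_nab i hx => /= /orP [/PV|//].
    by rewrite sr_nd // => Pe; rewrite Pe eqxx in Pxy.
  move: vyT; rewrite mT; have /andP [/negbTE -> /negbTE ->] := vx_nab i hy => /= /orP [//|/PU].
  by rewrite sr_nd // => Pe; rewrite Pe eqxx in Pxy.
split=> //.
- move=> z; rewrite /wt' /upd; case: (eqVneq z b) => [->|zb].
    by rewrite (negbTE bF) eqxx orbF sr_nd // ds_nd // eq_sym (negbTE xy) andbF.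
  case: (eqVneq z a) => [->|za].
    by rewrite (negbTE aF) eqxx orbF sr_nd // ds_nd // (negbTE xy) andbF.
  by rewrite -h2 (perm_mem hp) !inE (negbTE za) (negbTE zb).
- move=> s; rewrite !inE => /or3P [/eqP ->|/eqP ->|sF].
  + exists y; rewrite -(walk_ext _ (fun z => ext z V VF)) -(wend_ext _ (fun z => ext z V VF)) //.
  + exists x; rewrite -(walk_ext _ (fun z => ext z U UF)) -(wend_ext _ (fun z => ext z U UF)) //.
  + by apply: closed_ext (h3 s (FF s sF)) => z zs; apply: (ext z s) => //; rewrite !inE sF !orbT.
- move=> s z z'; rewrite !inE => /or3P [/eqP ->|/eqP ->|sF]; last by apply: h4; apply: FF.
    by move=> zV zV'; rewrite !lvT ?mT ?zV ?zV' ?orbT.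
  by move=> zV zV'; rewrite !lvT ?mT ?zV ?zV' ?orbT.
- move=> s z; rewrite !inE => /or3P [/eqP ->|/eqP ->|sF]; last by apply: h5; apply: FF.
    by move=> zV; rewrite lvT ?vT // mT zV !orbT.
  by move=> zV; rewrite lvT ?uT // mT zV !orbT.
Qed.

Lemma conn_cut F wt wt' s1 s2 U V :
  struct ((s1 ++ a :: s2) :: F) wt -> s2 ++ s1 = V ++ b :: U ->
  struct (V :: U :: F) wt' -> vx i x \in U -> vx i y \in V ->
  (forall j p q, p < n -> q < n -> conn ((s1 ++ a :: s2) :: F) j p q =
    conn (V :: U :: F) j p q || (j == i) && cross (V :: U :: F) i x y p q) /\
  ~~ conn (V :: U :: F) i x y.
Proof.
move=> hS E hS' xU yV; set T := s1 ++ a :: s2 in hS *.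
have TF : T \in T :: F by rewrite inE eqxx.
have VF : V \in V :: U :: F by rewrite inE eqxx.
have UF : U \in V :: U :: F by rewrite !inE eqxx orbT.
have pT : perm_eq T (a :: b :: (V ++ U)).
  apply: (@perm_trans _ (a :: (s2 ++ s1))); last first.
    by rewrite E; apply/permP => c /=; rewrite !count_cat /=; clear; lia.
  by apply/permP => c; rewrite /T /= !count_cat /=; clear; lia.
have mT j p : p < n -> (vx j p \in T) = (vx j p \in V) || (vx j p \in U).
  move=> hp; rewrite (perm_mem pT) !inE mem_cat.
  by have /andP [/negbTE -> /negbTE ->] := vx_nab j hp.
have cU r : conn (V :: U :: F) i r x = (vx i r \in U) by rewrite conn_sym (conn_tour hS' r UF xU).
have cV r : conn (V :: U :: F) i r y = (vx i r \in V) by rewrite conn_sym (conn_tour hS' r VF yV).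
split; last first.
  rewrite cV; apply/negP => xV; case: hS' => + _ _ _ _.
  by rewrite /= catA cat_uniq cat_uniq => /andP [/and3P [_ /hasPn /(_ _ xU)]]; rewrite /= xV.
move=> j p q hp hq; rewrite /cross !cU !cV /conn /= !mT //.
case: (eqVneq j i) => [->|ji] /=.
  by case: (vx i p \in _); case: (vx i q \in _); case: (vx i p \in _); case: (vx i q \in _); case: (has _ _).
have nl s r : s \in V :: U :: F -> vx i r \in s -> r < n -> (vx j p \in s) = false.
  case: hS' => _ _ _ h4 _ sF rs hr; apply: contraNF ji => ps.
  by rewrite -(lv_nd j hp hp) (h4 s _ _ sF ps rs) lv_nd.
by rewrite (nl _ x UF xU) // (nl _ y VF yV) //= orbF.
Qed.
End Link.
End Walks.
End Nodes.

(** * Levels of edges *)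

Lemma mem_split (s : seq nat) z : z \in s -> exists s1 s2, s = s1 ++ z :: s2.
Proof. by case/splitPr => s1 s2; exists s1, s2. Qed.

Lemma pick_flat (F : seq (seq nat)) z : z \in flatten F ->
  exists s1 s2 F', perm_eq F ((s1 ++ z :: s2) :: F').
Proof.
case/flattenP => s sF /mem_split [s1 [s2 E]].
by exists s1, s2, (rem s F); rewrite -E; apply: perm_to_rem.
Qed.

(* The state of a pair of vertices: [Un a] when its two arcs are in the tours of
   the levels below [a], unmarked ([Un 0] for a non-edge); [Mk a] for a tree
   edge of level [a], whose arcs are in the tours up to level [a], marked at
   level [a]; [Hf a] for a non-tree edge of level [a]. *)
Inductive status := Un of nat | Mk of nat | Hf of nat.

Definition tarc s i := match s with Un a => i < a | Mk a => i <= a | Hf _ => false end.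

Definition setst (st : nat -> nat -> status) x y s p q :=
  if ((p == x) && (q == y)) || ((p == y) && (q == x)) then s else st p q.

Section Good.
Variables (n L B : nat).
Hypothesis n0 : 0 < n.
Hypothesis B2 : 1 < B.
Notation nd := (nd n).
Notation vx := (vx n).
Notation conn := (conn n).
Notation cross := (cross n).
Notation struct := (struct n L B).
Notation arc := (arc B).
Notation sr := (sr n).
Notation ds := (ds n).
Notation lv := (lv n).

Definition W s i : nat :=
  match s with
  | Un a => i < a
  | Mk a => if i < a then 1 else if i == a then 1 + B else 0
  | Hf a => if i == a then B * B else 0
  end.

(* The weight of a node, in base [B]: its digits count arcs, arcs marked at this
   level and non-tree edges, and the last one is [x + 1] at the vertex [x] that
   stores the color of a tour of level 0. *)
Definition WT (st : nat -> nat -> status) (c : nat -> nat) i x y : nat :=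
  if x == y then if i == 0 then B * B * B * c x else 0 else W (st x y) i.

Definition wok st c wt :=
  forall i x y, i <= L -> x < n -> y < n -> wt (nd i x y) = WT st c i x y.

Definition stok (st : nat -> nat -> status) :=
  (forall x y, st x y = st y x) /\
  (forall x y, match st x y with Un a => a <= L.+1 | Mk a => a <= L | Hf a => a <= L end).

(** Every tree edge is a bridge of its levels, stated by a cut rather than by the absence of cycles:
    [P] changes across the edge and across no other arc. *)
Definition bridges (st : nat -> nat -> status) :=
  forall i x y, i <= L -> x < n -> y < n -> x != y -> tarc (st x y) i ->
  exists P : nat -> bool, P x != P y /\
    forall p q, p < n -> q < n -> p != q -> tarc (st p q) i ->
      ~~ ((p == x) && (q == y)) -> ~~ ((p == y) && (q == x)) -> P p = P q.

Definition good F wt st c := [/\ struct F wt, wok st c wt, stok st & bridges st].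

Lemma W_arc s i : (W s i %% B != 0) = tarc s i.
Proof.
case: s => a /=.
- by case: (i < a); rewrite ?mod0n ?modn_small.
- by case: (ltngtP i a) => _; rewrite ?mod0n ?modnDr ?modn_small.
- by case: (i == a); rewrite ?mod0n ?modnMl.
Qed.

Lemma arc_nd st c wt i x y : wok st c wt -> i <= L -> x < n -> y < n ->
  arc wt (nd i x y) = (x != y) && tarc (st x y) i.
Proof.
move=> hw hi hx hy; rewrite /arc hw // /WT.
case: (eqVneq x y) => _ /=; last exact: W_arc.
by case: (i == 0); rewrite ?mod0n // -!mulnA modnMr.
Qed.

Lemma good_perm F F' wt st c : perm_eq F F' -> good F wt st c -> good F' wt st c.
Proof. by move=> hp [h1 h2 h3 h4]; split=> //; apply: struct_perm hp h1. Qed.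

Lemma good_ext F wt wt' st c : wt =1 wt' -> good F wt st c -> good F wt' st c.
Proof.
move=> E [h1 h2 h3 h4]; split=> //; first exact: struct_ext E h1.
by move=> i x y hi hx hy; rewrite -E h2.
Qed.

(** Only the two nodes of the pair at level [j] are rewritten; at the other levels the old and the
    new status have equal weights. *)
Lemma wok_set st c wt wt' j x y s : wok st c wt -> x < n -> y < n -> x != y ->
  (forall i, i <= L -> i != j -> W s i = W (st x y) i) -> (forall p q, st p q = st q p) ->
  wt' =1 upd (upd wt (nd j x y) (W s j)) (nd j y x) (W s j) ->
  wok (setst st x y s) c wt'.
Proof.
move=> hw hx hy xy hs sym E i p q hi hp hq; rewrite E /upd /WT /setst.
have nE x' y' : x' < n -> y' < n -> (nd i p q == nd j x' y') = [&& i == j, p == x' & q == y'].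
  move=> hx' hy'; apply/eqP/and3P => [h|[/eqP -> /eqP -> /eqP ->] //].
  have [e1 e2 e3] := nd_dec n0 i hp hq; have [e4 e5 e6] := nd_dec n0 j hx' hy'.
  by move: e4 e5 e6; rewrite -h e1 e2 e3 => -> -> ->.
rewrite !nE //; have hwt := hw i p q hi hp hq; rewrite /WT in hwt.
have [ij|ij] /= := eqVneq i j; last first.
  rewrite hwt; case: (eqVneq p q) => // pq.
  case: ifP => // /orP [] /andP [/eqP -> /eqP ->]; rewrite hs //.
  by rewrite sym.
subst j; rewrite hwt; case: (boolP ((p == y) && (q == x))) => [/andP [/eqP -> /eqP ->]|_].
  by rewrite eq_sym (negbTE xy) orbT.
rewrite orbF; case: (boolP ((p == x) && (q == y))) => [/andP [/eqP -> /eqP ->]|_] //.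
by rewrite (negbTE xy).
Qed.

Lemma stok_set st x y s : stok st ->
  match s with Un a => a <= L.+1 | Mk a => a <= L | Hf a => a <= L end ->
  stok (setst st x y s).
Proof.
move=> [h1 h2] hs; split=> p q; rewrite /setst; last by case: ifP.
by rewrite orbC [(q == x) && _]andbC [(q == y) && _]andbC; case: ifP.
Qed.

Lemma bridges_mono st st' : (forall i p q, i <= L -> tarc (st' p q) i -> tarc (st p q) i) ->
  bridges st -> bridges st'.
Proof.
move=> hm hb i x y hi hx hy xy ht; have [P [h1 h2]] := hb i x y hi hx hy xy (hm _ _ _ hi ht).
by exists P; split=> // p q hp hq pq /(hm _ _ _ hi); apply: h2.
Qed.

Lemma setst_tarc st x y s i p q : st x y = st y x -> tarc s i = tarc (st x y) i ->
  tarc (setst st x y s p q) i = tarc (st p q) i.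
Proof.
by move=> sym h; rewrite /setst; case: ifP => // /orP [] /andP [/eqP -> /eqP ->]; rewrite ?h ?sym.
Qed.

Section WithGood.
Variables (F : seq (seq nat)) (wt : nat -> nat) (st : nat -> nat -> status) (c : nat -> nat).
Hypothesis hG : good F wt st c.

Lemma good_mem i x y : i <= L -> x < n -> y < n -> tarc (st x y) i -> nd i x y \in flatten F.
Proof.
move=> hi hx hy ht; case: hG => [[_ h2 _ _ _] hw _ _].
rewrite h2 okn_nd // sr_nd // ds_nd //; case: (eqVneq x y) => //= xy.
by have := arc_nd hw hi hx hy; rewrite xy ht /arc; apply: contraNneq => ->; rewrite mod0n.
Qed.

Lemma good_vx i x : i <= L -> x < n -> vx i x \in flatten F.
Proof.
move=> hi hx; case: hG => [[_ h2 _ _ _] hw _ _].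
by rewrite h2 okn_nd // sr_nd // ds_nd // eqxx.
Qed.

Lemma arc_conn i x y : i <= L -> x < n -> y < n -> x != y -> tarc (st x y) i -> conn F i x y.
Proof.
move=> hi hx hy xy ht; have := good_mem hi hx hy ht.
case: hG => hS hw _ _; case/flattenP => s sF zs.
have := conn_stp hS sF zs; rewrite lv_nd // sr_nd //.
by rewrite /stp (arc_nd hw) // xy ht ds_nd.
Qed.

Lemma arc_tour s z : s \in F -> z \in s -> arc wt z ->
  [/\ lv z <= L, sr z < n, ds z < n, sr z != ds z & tarc (st (sr z) (ds z)) (lv z)].
Proof.
move=> sF zs; case: hG => hS hw _ _; have ok := tour_okn hS sF zs.
have z0 : 0 < z by case/andP: ok.
rewrite -{1}(nd_eta n z0) (arc_nd hw) ?sr_lt ?ds_lt ?(lv_le n0 ok) //.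
by move=> /andP [h1 h2]; split; rewrite ?sr_lt ?ds_lt ?(lv_le n0 ok).
Qed.

(** Being connected to a fixed vertex at level [j] is preserved by every step of the tour, hence
    constant along it. *)
Lemma tour_span s j : s \in F -> j <= L ->
  (forall z, z \in s -> arc wt z -> conn F j (sr z) (ds z)) ->
  forall z z', z \in s -> z' \in s -> conn F j (sr z) (sr z').
Proof.
move=> sF hj H z z' zs zs'; case: hG => hS hw _ _; case: (hS) => _ _ hc _ _.
have := closed_const (f := conn F j (sr z)) (hc s sF).
move=> /(_ _ z z' zs zs'); rewrite (conn_refl n0 hS) ?sr_lt // => <- // y ys.
rewrite /stp; case: ifP => // ay; apply: (conn_eq_r hS).
exact: H.
Qed.

(** An arc of level [j] is also an arc of every lower level, so a tour of level [j] stays inside one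
    component of level [i]. *)
Lemma conn_nest i j x y : i <= j -> conn F j x y -> j <= L -> x < n -> y < n -> conn F i x y.
Proof.
move=> ij + hj hx hy; case/connP => s [sF xs ys].
rewrite -[x in conn _ _ x _](sr_nd n0 j hx hx) -[y](sr_nd n0 j hy hy).
apply: (tour_span sF) => //; first exact: leq_trans hj.
move=> z zs az; have [h1 h2 h3 h4 h5] := arc_tour sF zs az.
have lz : lv z = j.
  by rewrite -(lv_nd n0 j hx hx); case: hG => [[_ _ _ h _] _ _ _]; apply: (h s).
apply: arc_conn => //; first by rewrite (leq_trans ij).
by move: h5; rewrite lz; case: (st _ _) => a //=; apply: leq_trans.
Qed.

End WithGood.

Lemma good_cut_decomp F wt st c j x y : good F wt st c -> j <= L -> x < n -> y < n -> x != y ->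
  tarc (st x y) j ->
  exists s1 s2 U V F', perm_eq F ((s1 ++ nd j x y :: s2) :: F') /\
    s2 ++ s1 = V ++ nd j y x :: U.
Proof.
move=> hG hj hx hy xy ht.
have [s1 [s2 [F' hp]]] := pick_flat (good_mem hG hj hx hy ht).
set s := s1 ++ _ in hp; have sF : s \in F by rewrite (perm_mem hp) inE eqxx.
have as_ : nd j x y \in s by rewrite mem_cat inE eqxx orbT.
case: (hG) => hS hw [sym _] _; have hc := conn_stp hS sF as_.
(* The arc leads to [y], so the vertex node of [y] is in this tour, and with it every node that
   starts at [y]. *)
have bs : nd j y x \in s.
  have ay : vx j y \in s.
    move: hc; rewrite lv_nd // sr_nd // /stp (arc_nd hw) // xy ht ds_nd //.
    rewrite (conn_tour hS y sF) //.
    by case: hS => _ _ _ _ h5; have := h5 s _ sF as_; rewrite lv_nd // sr_nd.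
  apply: (tour_mem hS sF ay hy); rewrite ?lv_nd ?sr_nd //.
  by apply: (good_mem hG) => //; rewrite sym.
have : nd j y x \in s2 ++ s1.
  move: bs; rewrite /s !mem_cat inE orbC => /orP [/orP [E|->]|->]; rewrite ?orbT //.
  by rewrite eq_sym (negbTE (nd_ab n0 j hx hy xy)) in E.
case/mem_split => V [U E]; by exists s1, s2, U, V, F'.
Qed.

(** A tree edge leaves its levels from the top downwards: at level [j], either [Mk j] or [Un j.+1]
    becomes [Un j]. The separating predicate of the edge is what [struct_cut] asks for. *)
Lemma good_cut F wt wt' st c j x y s1 s2 U V :
  good ((s1 ++ nd j x y :: s2) :: F) wt st c -> s2 ++ s1 = V ++ nd j y x :: U ->
  j <= L -> x < n -> y < n -> x != y -> st x y = Un j.+1 \/ st x y = Mk j ->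
  wt' =1 upd (upd wt (nd j x y) 0) (nd j y x) 0 ->
  [/\ good (V :: U :: F) wt' (setst st x y (Un j)) c,
      vx j x \in U, vx j y \in V, ~~ conn (V :: U :: F) j x y &
      forall i p q, p < n -> q < n -> conn ((s1 ++ nd j x y :: s2) :: F) i p q =
        conn (V :: U :: F) i p q || (i == j) && cross (V :: U :: F) j x y p q].
Proof.
move=> hG E hj hx hy xy hst Ew; case: (hG) => hS hw hk hb; have [sym _] := hk.
have ht : tarc (st x y) j by case: hst => -> /=.
have [P [Pxy HP]] := hb j x y hj hx hy xy ht.
set s := s1 ++ _ in hG hS *; have sF : s \in s :: F by rewrite inE eqxx.
have aS : nd j x y \in s by rewrite mem_cat inE eqxx orbT.
have [hS' [xU yV]] : struct (V :: U :: F) (upd (upd wt (nd j x y) 0) (nd j y x) 0) /\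
   vx j x \in U /\ vx j y \in V.
  apply: (struct_cut n0 hx hy xy hS E (P := P)) => //.
  - by rewrite (arc_nd hw) // xy ht.
  - by rewrite (arc_nd hw) // eq_sym xy sym ht.
  move=> z zs za zb; rewrite /stp; case: ifP => // az.
  have [h1 h2 h3 h4 h5] := arc_tour hG sF zs az.
  have lz : lv z = j.
    by rewrite -(lv_nd n0 j hx hy); case: hS => _ _ _ h _; apply: (h s).
  have z0 : 0 < z by case/andP: (tour_okn hS sF zs).
  rewrite lz in h5; apply: HP => //.
    by apply: contra za => /andP [/eqP <- /eqP <-]; rewrite -lz nd_eta.
  by apply: contra zb => /andP [/eqP <- /eqP <-]; rewrite -lz nd_eta.
have [hc hn] := conn_cut n0 hx hy xy hS E hS' xU yV.
split=> //; split.
- by apply: struct_ext hS' => z; rewrite Ew.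
- apply: (wok_set (j := j) hw) => //; last by move=> z; rewrite Ew /= ltnn.
  move=> i hi ij; case: hst => -> /=.
    by rewrite ltnS [i <= j]leq_eqVlt (negbTE ij).
  by rewrite (negbTE ij); case: ltnP.
- by apply: stok_set => //; apply: ltnW.
- apply: bridges_mono hb => i p q hi; rewrite /setst; case: ifP => // /orP [] /andP [/eqP -> /eqP ->].
    by case: hst => -> /= h; [apply: ltnW | apply: ltnW].
  by rewrite sym; case: hst => -> /= h; [apply: ltnW | apply: ltnW].
Qed.

Lemma good_link_decomp F wt st c j x y : good F wt st c -> j <= L -> x < n -> y < n ->
  ~~ conn F j x y ->
  exists s1 s2 s3 s4 F', perm_eq F ((s1 ++ vx j x :: s2) :: (s3 ++ vx j y :: s4) :: F').
Proof.
move=> hG hj hx hy nc.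
have [s1 [s2 [F1 hp]]] := pick_flat (good_vx hG hj hx).
have : vx j y \in flatten F1.
  have := good_vx hG hj hy; rewrite (perm_mem (perm_flatten hp)) /= mem_cat => /orP [h|//].
  case/negP: nc; apply/connP; exists (s1 ++ vx j x :: s2); split=> //.
    by rewrite (perm_mem hp) inE eqxx.
  by rewrite mem_cat inE eqxx orbT.
case/pick_flat => s3 [s4 [F2 hp2]]; exists s1, s2, s3, s4, F2.
by apply: perm_trans hp _; rewrite perm_cons.
Qed.

(** A tree edge enters its levels upwards, one at a time: [Un j] becomes [Un j.+1], or [Mk j] at its
    top level. *)
Lemma good_link F wt wt' st c j x y s1 s2 s3 s4 s :
  let F0 := (s1 ++ vx j x :: s2) :: (s3 ++ vx j y :: s4) :: F in
  let F1 := (s1 ++ nd j x y :: vx j y :: s4 ++ s3 ++ nd j y x :: vx j x :: s2) :: F in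
  good F0 wt st c ->
  j <= L -> x < n -> y < n -> x != y -> st x y = Un j -> s = Un j.+1 \/ s = Mk j ->
  wt' =1 upd (upd wt (nd j x y) (W s j)) (nd j y x) (W s j) ->
  [/\ good F1 wt' (setst st x y s) c, nd j x y \notin flatten F0, nd j y x \notin flatten F0 &
      forall i p q, p < n -> q < n -> conn F1 i p q = conn F0 i p q || (i == j) && cross F0 j x y p q].
Proof.
move=> F0 F1 hG hj hx hy xy hst hs Ew; case: (hG) => hS hw hk hb; have [sym _] := hk.
have W0 p q : p = x /\ q = y \/ p = y /\ q = x -> nd j p q \notin flatten F0.
  case: hS => _ h2 _ _ _ hpq; rewrite h2.
  have [hp hq pq spq] : [/\ p < n, q < n, p != q & st p q = Un j].
    by case: hpq => -[-> ->]; split=> //; rewrite 1?eq_sym // sym.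
  by rewrite sr_nd // ds_nd // (negbTE pq) hw // /WT (negbTE pq) spq /= ltnn andbF.
have aF : nd j x y \notin flatten F0 by apply: W0; left.
have bF : nd j y x \notin flatten F0 by apply: W0; right.
have Wj : W s j %% B != 0 by rewrite W_arc; case: hs => -> /=.
have hS' := struct_link n0 hj hx hy xy hS aF bF Wj.
have hc i p q : p < n -> q < n -> conn F1 i p q = conn F0 i p q || (i == j) && cross F0 j x y p q.
  by move=> hp hq; apply: (conn_link n0 hx hy xy i hS).
have nc : ~~ conn F0 j x y.
  have sF : s1 ++ vx j x :: s2 \in F0 by rewrite inE eqxx.
  rewrite (conn_tour hS y sF) ?mem_cat ?inE ?eqxx ?orbT //.
  case: hS => + _ _ _ _; rewrite /F0 /= cat_uniq => /and3P [_ /hasPn h _].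
  by have := h (vx j y); rewrite !mem_cat inE eqxx !orbT => /(_ isT).
split=> //; split.
- by apply: struct_ext hS' => z; rewrite Ew.
- apply: (wok_set (j := j) hw) => // i hi ij; rewrite hst.
  case: hs => -> /=; first by rewrite ltnS [i <= j]leq_eqVlt (negbTE ij).
  by rewrite (negbTE ij); case: ltnP.
- by apply: stok_set => //; case: hs => ->.
- move=> i p q hi hp hq pq.
  case: (boolP ((i == j) && (((p == x) && (q == y)) || ((p == y) && (q == x))))) => [/andP [/eqP ei h] _|h].
    (* The new edge is separated by the old component of [x], which every old arc respects. *)
    subst i; exists (fun z => conn F0 j x z); split.
      case/orP: h => /andP [/eqP -> /eqP ->]; rewrite (negbTE nc) (conn_refl n0 hS) //.
    move=> p' q' hp' hq' pq' + h1 h2.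
    have nxy : ((p' == x) && (q' == y)) || ((p' == y) && (q' == x)) = false.
      move: h1 h2; case/orP: h => /andP [/eqP -> /eqP ->].
        by move=> /negbTE -> /negbTE ->.
      by move=> /negbTE h1 /negbTE h2; rewrite h1 h2.
    rewrite /setst nxy => ht; apply: (conn_eq_r hS); exact: (arc_conn hG).
  move=> ht; have ht0 : tarc (st p q) i.
    move: ht h; rewrite /setst; case: ifP => //; rewrite andbT => e ht ij.
    have -> : st p q = Un j by case/orP: e => /andP [/eqP -> /eqP ->]; rewrite // sym.
    move: ht ij; case: hs => -> /=; rewrite ?ltnS leq_eqVlt => /orP [->//|] //.
  have [P [h1 h2]] := hb i p q hi hp hq pq ht0.
  have [ij|ij] := eqVneq i j; last first.
    exists P; split=> // p' q' hp' hq' pq'; rewrite setst_tarc //; first exact: h2.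
    by rewrite hst; case: hs => -> /=; rewrite ?ltnS [i <= j]leq_eqVlt (negbTE ij).
  subst i; rewrite eqxx /= in h.
  (* The side of [x] is recolored so that the new arc does not cross. *)
  exists (fun z => if conn F0 j x z then P z (+) (P x (+) P y) else P z).
  have hcc z z' : z < n -> z' < n -> z != z' -> tarc (st z z') j -> conn F0 j x z = conn F0 j x z'.
    by move=> hz hz' zz' tz; apply: (conn_eq_r hS); apply: (arc_conn hG).
  split.
    rewrite (hcc p q) //; case: ifP => // _.
    by move: h1; case: (P p); case: (P q); case: (P x); case: (P y).
  move=> p' q' hp' hq' pq' ht' e1 e2.
  case: (boolP (((p' == x) && (q' == y)) || ((p' == y) && (q' == x)))) => [e|e].
    case/orP: e => /andP [/eqP -> /eqP ->]; rewrite (negbTE nc) (conn_refl n0 hS) //.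
      by case: (P x); case: (P y).
    by case: (P x); case: (P y).
  rewrite /setst (negbTE e) in ht'.
  by rewrite (hcc p' q') // (h2 p' q').
Qed.

(** For changes of status that add no arc, so that the separating predicates are inherited. *)
Lemma good_set F F' wt wt' st c j x y s : good F wt st c -> struct F' wt' ->
  x < n -> y < n -> x != y ->
  (forall i, i <= L -> i != j -> W s i = W (st x y) i) ->
  match s with Un a => a <= L.+1 | Mk a => a <= L | Hf a => a <= L end ->
  (forall i, i <= L -> tarc s i -> tarc (st x y) i) ->
  wt' =1 upd (upd wt (nd j x y) (W s j)) (nd j y x) (W s j) ->
  good F' wt' (setst st x y s) c.
Proof.
move=> [hS hw hk hb] hS' hx hy xy hs hL ht Ew; have [sym _] := hk; split=> //.
- exact: (wok_set (j := j) hw).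
- exact: stok_set.
- apply: bridges_mono hb => i p q hi; rewrite /setst; case: ifP => // e.
  by case/orP: e => /andP [/eqP -> /eqP ->]; [|rewrite sym]; apply: ht.
Qed.

Lemma conn_nonvx F s1 s2 i j x y p q : x < n -> y < n -> x != y -> p < n -> q < n ->
  conn ((s1 ++ nd j x y :: s2) :: F) i p q = conn ((s1 ++ s2) :: F) i p q.
Proof.
move=> hx hy xy hp hq; rewrite /conn /= !mem_cat !inE.
have /andP [/negbTE -> _] := vx_nab n0 j hx hy xy i hp.
by have /andP [/negbTE -> _] := vx_nab n0 j hx hy xy i hq.
Qed.

Lemma struct_half_ins F wt s1 s2 j x y : struct ((s1 ++ vx j x :: s2) :: F) wt ->
  j <= L -> x < n -> y < n -> x != y -> wt (nd j x y) = 0 ->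
  nd j x y \notin flatten ((s1 ++ vx j x :: s2) :: F) /\
  struct ((s1 ++ nd j x y :: vx j x :: s2) :: F) (upd wt (nd j x y) (B * B)).
Proof.
move=> hS hj hx hy xy w0.
have aF : nd j x y \notin flatten ((s1 ++ vx j x :: s2) :: F).
  by case: hS => _ h _ _ _; rewrite h w0 eqxx orbF sr_nd // ds_nd // (negbTE xy) andbF.
split=> //; apply: struct_insert hS aF _ _ _ _ _ => //.
- exact: okn_nd.
- by rewrite !sr_nd.
- by rewrite !lv_nd.
- by rewrite muln_eq0 orbb -lt0n ltnW.
- by rewrite modnMl.
Qed.

Lemma struct_half_rem F wt s1 s2 j x y : struct ((s1 ++ nd j x y :: s2) :: F) wt ->
  x < n -> y < n -> x != y -> wt (nd j x y) = B * B ->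
  struct ((s1 ++ s2) :: F) (upd wt (nd j x y) 0).
Proof.
move=> hS hx hy xy w0; apply: struct_remove hS _ _ => //.
  by rewrite /arc w0 modnMl eqxx.
by rewrite sr_nd // ds_nd.
Qed.

(** The first half of the promotion of a tree edge: [Mk j] and [Un j.+1] have the same arcs and
    differ in the mark only. *)
Lemma good_unmark F wt wt' st c j x y : good F wt st c -> j <= L -> x < n -> y < n -> x != y ->
  st x y = Mk j -> wt' =1 upd (upd wt (nd j x y) 1) (nd j y x) 1 ->
  good F wt' (setst st x y (Un j.+1)) c.
Proof.
move=> hG hj hx hy xy hst Ew; case: (hG) => hS hw [sym _] _.
have A p q wt0 : p = x /\ q = y \/ p = y /\ q = x -> struct F wt0 ->
    wt0 (nd j p q) = 1 + B -> struct F (upd wt0 (nd j p q) 1).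
  move=> hpq hS0 w0; apply: struct_setw => //.
    by rewrite /arc w0 modnDr.
  by rewrite w0 orbT.
have wE p q : p = x /\ q = y \/ p = y /\ q = x -> wt (nd j p q) = 1 + B.
  case=> -[-> ->]; rewrite hw // /WT ?[y == x]eq_sym (negbTE xy) ?[st y x]sym hst /= ltnn eqxx //.
apply: (good_set (j := j) hG) => //.
- apply: struct_ext (fun z => esym (Ew z)) _; apply: (A y x); [by right| |].
    by apply: (A x y) => //; [left | apply: wE; left].
  rewrite /upd eq_sym; have := nd_ab n0 j hx hy xy => /negbTE ->.
  by apply: wE; right.
- move=> i hi ij; rewrite hst /= ltnS [i <= j]leq_eqVlt (negbTE ij) /=.
  by case: ltnP.
- by move=> i hi; rewrite hst.
- by move=> z; rewrite Ew /= ltnSn.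
Qed.

Lemma good_vertex F wt wt' st c x k : good F wt st c -> x < n ->
  wt' =1 upd wt (vx 0 x) (B * B * B * k) -> good F wt' st (upd c x k).
Proof.
move=> [hS hw hk hb] hx Ew; split=> //.
  apply: struct_ext (fun z => esym (Ew z)) _; apply: struct_setw => //.
    by rewrite /arc hw // /WT eqxx /= -!mulnA !modnMr.
  by rewrite sr_nd // ds_nd // eqxx.
move=> i p q hi hp hq; rewrite Ew /upd /WT.
have -> : (nd i p q == vx 0 x) = [&& i == 0, p == x & q == x].
  apply/eqP/and3P => [h|[/eqP -> /eqP -> /eqP ->] //].
  have [e1 e2 e3] := nd_dec n0 i hp hq; have [e4 e5 e6] := nd_dec n0 0 hx hx.
  by move: e4 e5 e6; rewrite -/(vx 0 x) -h e1 e2 e3 => -> -> ->.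
have := hw i p q hi hp hq; rewrite /WT => ->.
case: (eqVneq i 0) => //= _; case: (eqVneq p x) => [->|//] /=.
  by rewrite [q == x]eq_sym ?eqxx; case: (x == q).
Qed.

(** * Arc counts, promotion credit and the size invariant *)

Definition prs := [seq (p, q) | p <- iota 0 n, q <- iota 0 n].

Lemma mem_prs p q : ((p, q) \in prs) = (p < n) && (q < n).
Proof.
apply/allpairsP/andP => [[[a b] /= [h1 h2 [-> ->]]]|[h1 h2]].
  by move: h1 h2; rewrite !mem_iota.
by exists (p, q); rewrite !mem_iota.
Qed.

Lemma uniq_prs : uniq prs.
Proof. by apply: allpairs_uniq; rewrite ?iota_uniq // => -[a b] [d e]. Qed.

Lemma size_prs : size prs = n * n.
Proof. by rewrite size_allpairs !size_iota. Qed.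

Definition isa (st : nat -> nat -> status) i (pq : nat * nat) :=
  (pq.1 != pq.2) && tarc (st pq.1 pq.2) i.

(** Ordered pairs are counted, so a tree edge counts twice and the number equals the lowest digit of
    the sum over the tour. *)
Definition cnt F st i x := count (fun pq => isa st i pq && conn F i x pq.1) prs.

Lemma cnt_le F st i x : cnt F st i x <= n * n.
Proof. by rewrite -size_prs; apply: count_size. Qed.

Lemma cnt_sub F F' st st' i i' x x' :
  (forall p q, p < n -> q < n -> p != q -> tarc (st p q) i -> conn F i x p ->
     tarc (st' p q) i' /\ conn F' i' x' p) ->
  cnt F st i x <= cnt F' st' i' x'.
Proof.
move=> H; rewrite /cnt -!size_filter; apply: uniq_leq_size.
  by rewrite filter_uniq ?uniq_prs.
move=> [p q]; rewrite !mem_filter mem_prs /isa /= => /andP [/andP [/andP [h1 h2] h3] /andP [hp hq]].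
by have [-> ->] := H p q hp hq h1 h2 h3; rewrite h1 hp hq.
Qed.

Lemma cnt_eq F F' st st' i x :
  (forall p q, p < n -> q < n -> p != q -> tarc (st p q) i = tarc (st' p q) i) ->
  (forall p, p < n -> conn F i x p = conn F' i x p) ->
  cnt F st i x = cnt F' st' i x.
Proof.
move=> h1 h2; apply/eqP; rewrite eqn_leq; apply/andP.
by split; apply: cnt_sub => p q hp hq pq; [rewrite h1 // h2 | rewrite -h1 // -h2].
Qed.

Lemma count_add3 (T : eqType) (P1 P2 P3 P : pred T) s :
  (forall z, z \in s -> P1 z + P2 z + P3 z <= P z) ->
  count P1 s + count P2 s + count P3 s <= count P s.
Proof.
elim: s => //= z s IH H.
have h1 := H z (mem_head _ _).
have h2 : count P1 s + count P2 s + count P3 s <= count P s.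
  by apply: IH => y ys; apply: H; rewrite inE ys orbT.
by move: h1 h2; clear; lia.
Qed.

Lemma count_sub3 (T : eqType) (P1 P2 P3 P : pred T) s :
  (forall z, z \in s -> P z <= P1 z + P2 z + P3 z) ->
  count P s <= count P1 s + count P2 s + count P3 s.
Proof.
elim: s => //= z s IH H.
have h1 := H z (mem_head _ _).
have h2 : count P s <= count P1 s + count P2 s + count P3 s.
  by apply: IH => y ys; apply: H; rewrite inE ys orbT.
by move: h1 h2; clear; lia.
Qed.

Definition isxy (x y : nat) (pq : nat * nat) :=
  ((pq.1 == x) && (pq.2 == y)) || ((pq.1 == y) && (pq.2 == x)).

Lemma count_xy x y : x < n -> y < n -> x != y -> count (isxy x y) prs = 2.
Proof.
move=> hx hy xy; rewrite (eq_count (a2 := predU (pred1 (x, y)) (pred1 (y, x)))); last first.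
  by move=> -[p q].
have := count_predUI (pred1 (x, y)) (pred1 (y, x)) prs.
rewrite !count_uniq_mem ?uniq_prs // !mem_prs hx hy /=.
suff -> : count (predI (pred1 (x, y)) (pred1 (y, x))) prs = 0 by rewrite addn0.
rewrite (eq_count (a2 := pred0)) ?count_pred0 // => -[p q] /=.
by apply/negbTE/negP => /andP [/eqP [-> _] /eqP [E _]]; rewrite E eqxx in xy.
Qed.

Definition lvp s := match s with Un _ => 0 | Mk a => L.+1 - a | Hf a => L.+1 - a end.

(* Credit for the promotions that the edges may still undergo. *)
Definition epot (st : nat -> nat -> status) := sumn [seq lvp (st pq.1 pq.2) | pq <- prs].

(** The factor 2 comes from the two orders of the pair. *)
Lemma epot_set st x y s : x < n -> y < n -> x != y -> st x y = st y x ->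
  epot (setst st x y s) + 2 * lvp (st x y) = epot st + 2 * lvp s.
Proof.
move=> hx hy xy sym.
have H (l : seq (nat * nat)) : sumn [seq lvp (setst st x y s pq.1 pq.2) | pq <- l] + count (isxy x y) l * lvp (st x y) =
    sumn [seq lvp (st pq.1 pq.2) | pq <- l] + count (isxy x y) l * lvp s.
  elim: l => //= -[p q] l IH; rewrite !mulnDl.
suff h : lvp (setst st x y s p q) + isxy x y (p, q) * lvp (st x y) =
    lvp (st p q) + isxy x y (p, q) * lvp s.
    move: IH h; rewrite -[(p, q).1]/p -[(p, q).2]/q.
    generalize (isxy x y (p, q) * lvp s) (isxy x y (p, q) * lvp (st x y)).
    generalize (count (isxy x y) l * lvp s) (count (isxy x y) l * lvp (st x y)).
    by clear=> *; lia.
  rewrite /setst -[_ || _]/(isxy x y (p, q)); case: ifP; rewrite ?mul0n //.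
  by case/orP => /andP [/= /eqP -> /eqP ->]; rewrite ?sym !mul1n addnC.
by have := H prs; rewrite count_xy.
Qed.

(* Between the removal of the tree edge [uv] and its replacement, the levels in
   [lo, hi) are open: there the edge was cut and no replacement was linked. *)
Definition dyn F (st : nat -> nat -> status) lo hi u v :=
  [/\ forall i x, i <= L -> x < n -> cnt F st i x * 2 ^ i <= n * n,
      forall j, lo <= j < hi -> (cnt F st j u + cnt F st j v + 2) * 2 ^ j <= n * n,
      forall x y i, x < n -> y < n -> st x y = Hf i ->
        conn F i x y || (lo <= i < hi) && cross F i u v x y &
      forall j, lo <= j < hi -> ~~ conn F j u v].

Lemma dyn_same F F' st st' lo hi u v :
  (forall i p q, p < n -> q < n -> conn F' i p q = conn F i p q) ->
  (forall i p q, p < n -> q < n -> tarc (st' p q) i = tarc (st p q) i) ->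
  (forall p q i, p < n -> q < n -> st' p q = Hf i -> st p q = Hf i \/ conn F' i p q) ->
  u < n -> v < n -> hi <= L.+1 -> dyn F st lo hi u v -> dyn F' st' lo hi u v.
Proof.
move=> hc ht hh hu hv hL [h1 h2 h3 h4].
have cE i x : x < n -> cnt F' st' i x = cnt F st i x.
  by move=> hx; apply: cnt_eq => [p q hp hq _|p hp]; rewrite ?ht ?hc.
split.
- by move=> i x iL hx; rewrite cE // h1.
- by move=> j hj; rewrite !cE // h2.
- move=> x y i hx hy /hh [//|//|/h3|->//].
  by rewrite /cross !hc // => H; apply: H.
- by move=> j hj; rewrite hc // h4.
Qed.

Lemma dyn_empty F st lo hi u v lo' hi' u' v' : hi <= lo -> hi' <= lo' ->
  dyn F st lo hi u v -> dyn F st lo' hi' u' v'.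
Proof.
have E a b j : b <= a -> (a <= j < b) = false.
  by move=> ba; apply/negbTE/negP => /andP [h1 h2]; have := leq_ltn_trans h1 h2; rewrite ltnNge ba.
move=> h h' [h1 h2 h3 h4]; split=> //; try by move=> j; rewrite E.
by move=> x y i hx hy /(h3 x y i hx hy); rewrite !E.
Qed.
End Good.

(** * Preservation of the size invariant *)

Section Dyn.
Variables (n L B : nat).
Hypothesis n0 : 0 < n.
Hypothesis B2 : 1 < B.
Notation nd := (nd n).
Notation vx := (vx n).
Notation conn := (conn n).
Notation cross := (cross n).
Notation struct := (struct n L B).
Notation arc := (arc B).
Notation sr := (sr n).
Notation ds := (ds n).
Notation lv := (lv n).
Notation good := (good n L B).
Notation cnt := (cnt n).
Notation dyn := (dyn n L).

Lemma setst_xy st x y s : setst st x y s x y = s.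
Proof. by rewrite /setst !eqxx. Qed.

Lemma setst_isxy st x y s p q : setst st x y s p q = if isxy x y (p, q) then s else st p q.
Proof. by []. Qed.

Lemma isxyP st x y p q : (forall p q, st p q = st q p :> status) -> isxy x y (p, q) -> st p q = st x y.
Proof. by move=> sym /orP [] /andP [/= /eqP -> /eqP ->]. Qed.

(** The cut opens level [j]. The bound of the former component covered both sides and the two arcs
    just removed, which are the summand 2; non-tree edges of level [j] may cross from now on. *)
Lemma dyn_cut F F' wt wt' st j hi u v : struct F wt -> struct F' wt' ->
  u < n -> v < n -> u != v -> j <= L -> j < hi ->
  st u v = Un j.+1 \/ st u v = Mk j -> (forall p q, st p q = st q p) ->
  (forall i p q, p < n -> q < n -> conn F i p q = conn F' i p q || (i == j) && cross F' j u v p q) ->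
  ~~ conn F' j u v ->
  dyn F st j.+1 hi u v -> dyn F' (setst st u v (Un j)) j hi u v.
Proof.
move=> hS hS' hu hv uv hj hjh hst sym hc nc [h1 h2 h3 h4].
have huv : tarc (st u v) j by case: hst => -> /=.
have tE i p q : i != j -> tarc (setst st u v (Un j) p q) i = tarc (st p q) i.
  move=> ij; apply: setst_tarc; first exact: sym.
  by case: hst => -> /=; rewrite ?ltnS [i <= j]leq_eqVlt (negbTE ij).
have cE i p q : i != j -> p < n -> q < n -> conn F' i p q = conn F i p q.
  by move=> /negbTE ij hp hq; rewrite hc // ij /= orbF.
have nE i x : i != j -> x < n -> cnt F' (setst st u v (Un j)) i x = cnt F st i x.
  by move=> ij hx; apply: cnt_eq => [p q hp hq _|p hp]; rewrite ?tE ?cE.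
have ruu : conn F' j u u by apply: (conn_refl n0 hS').
have rvv : conn F' j v v by apply: (conn_refl n0 hS').
split.
- move=> i x iL hx; have [->|ij] := eqVneq i j; last by rewrite nE // h1.
  apply: leq_trans (h1 j x hj hx); rewrite leq_mul2r; apply/orP; right.
  apply: cnt_sub => p q hp hq pq; rewrite setst_isxy; case: ifP => _ /=; rewrite ?ltnn // => ->.
  by rewrite hc // => ->.
- move=> i /andP [ji ih]; have [ij|ij] := eqVneq i j; last first.
    by rewrite !nE // h2 // ih andbT ltn_neqAle eq_sym ij.
  rewrite {i ji ih}ij; apply: leq_trans (h1 j u hj hu); rewrite leq_mul2r; apply/orP; right.
  (* The arcs on the side of [u], those on the side of [v] and the removed pair are disjoint parts
     of the old component. *)
  rewrite -(count_xy hu hv uv); apply: count_add3 => -[p q]; rewrite mem_prs => /andP [hp hq].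
  rewrite /isa /= setst_isxy; case: ifP => e.
    rewrite /= ltnn !andbF /= (isxyP sym e) huv hc //= eqxx /cross ruu /=.
    by case/orP: e => /andP [/= /eqP -> /eqP ->]; rewrite ?ruu ?rvv ?orbT ?andbT ?uv // eq_sym uv.
  case: (p != q) => //=; case: (tarc _ _) => //=; rewrite addn0 hc // eqxx /cross ruu /=.
  rewrite [conn F' j p v]conn_sym [conn F' j p u]conn_sym.
  case: (boolP (conn F' j u p)) => //= up; last by case: (conn F' j v p).
  suff /negbTE -> : ~~ conn F' j v p by [].
  apply: contra nc => vp; apply: (conn_trans hS' up); by rewrite conn_sym.
- move=> x y i hx hy; rewrite setst_isxy; case: ifP => // _ /(h3 x y i hx hy).
  rewrite hc //; have [->|ij] := eqVneq i j; first by rewrite leqnn hjh ltnn /= orbF.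
  rewrite /= orbF => /orP [->//|/andP [/andP [l1 l2] hx']].
  rewrite (ltnW l1) l2 /=.
  by have -> : cross F' i u v x y = cross F i u v x y; [rewrite /cross !cE | rewrite hx' orbT].
- move=> i /andP [ji ih]; have [->|ij] := eqVneq i j; first by [].
  by rewrite cE // h4 // ih andbT ltn_neqAle eq_sym ij.
Qed.

(** The replacement joins the same two sides and fills the room of the removed arcs, so level [j]
    closes with its former component and within its bound. *)
Lemma dyn_relink F F' wt wt' st j hi u v x y s : struct F wt -> struct F' wt' ->
  u < n -> v < n -> x < n -> y < n -> x != y -> j <= L -> j < hi ->
  st x y = Un j -> s = Un j.+1 \/ s = Mk j -> (forall p q, st p q = st q p) ->
  cross F j u v x y ->
  (forall i p q, p < n -> q < n -> conn F' i p q = conn F i p q || (i == j) && cross F j x y p q) ->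
  dyn F st j hi u v -> dyn F' (setst st x y s) j.+1 hi u v /\
  (forall p q, p < n -> q < n -> conn F' j p q = conn F j p q || cross F j u v p q).
Proof.
move=> hS hS' hu hv hx hy xy hj hjh hst hs sym hxy hc [h1 h2 h3 h4].
have sj i : i != j -> tarc s i = (i < j).
  by move=> ij; case: hs => -> /=; rewrite ?ltnS [i <= j]leq_eqVlt (negbTE ij).
have tE i p q : i != j -> tarc (setst st x y s p q) i = tarc (st p q) i.
  by move=> ij; apply: setst_tarc; rewrite // hst sj.
have cE i p q : i != j -> p < n -> q < n -> conn F' i p q = conn F i p q.
  by move=> /negbTE ij hp hq; rewrite hc // ij /= orbF.
have nE i z : i != j -> z < n -> cnt F' (setst st x y s) i z = cnt F st i z.
  by move=> ij hz; apply: cnt_eq => [p q hp hq _|p hp]; rewrite ?tE ?cE.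
have cc p q : p < n -> q < n -> conn F' j p q = conn F j p q || cross F j u v p q.
  move=> hp hq; rewrite hc // eqxx /=; congr orb; rewrite /cross.
  have E a b z : conn F j a b -> conn F j z a = conn F j z b by move=> h; apply: (conn_eq_r hS).
  case/orP: hxy => /andP [e1 e2].
    by rewrite !(E x u) // !(E y v).
  by rewrite !(E x v) // !(E y u) // orbC.
split=> //; split.
- move=> i z iL hz; have [->|ij] := eqVneq i j; last by rewrite nE // h1.
  (* On either side the component becomes the joined one, bounded by the clause for open levels; any
     other component is unchanged. *)
  case: (boolP (conn F j u z || conn F j v z)) => hz'.
    apply: leq_trans (h2 j _); last by rewrite leqnn.
    rewrite leq_mul2r; apply/orP; right.
    rewrite -(count_xy hx hy xy); apply: count_sub3 => -[p q]; rewrite mem_prs => /andP [hp hq].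
    rewrite /isa /= setst_isxy; case: ifP => e; first by rewrite addn1; case: (_ && _).
    case: (p != q) => //=; case: (tarc _ _) => //=; rewrite addn0 cc //.
    have T a b d : conn F j a b -> conn F j b d -> conn F j a d by apply: (conn_trans hS).
    case: (boolP (conn F j z p)) => /= [zp|_].
      by case/orP: hz' => h; rewrite (T _ _ _ h zp) //; case: (conn F j u p).
    rewrite /cross [conn F j p v]conn_sym [conn F j p u]conn_sym.
    by case: (conn F j v p); case: (conn F j u p); case: (conn F j z u); case: (conn F j z v).
  apply: leq_trans (h1 j z hj hz); rewrite leq_mul2r; apply/orP; right.
  move: hz'; rewrite negb_or => /andP [uz vz].
  have cz p : p < n -> conn F' j z p = conn F j z p.
    move=> hp; rewrite cc // /cross ![conn F j z u]conn_sym ![conn F j z v]conn_sym.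
    by rewrite (negbTE uz) (negbTE vz) /= orbF.
  apply: cnt_sub => p q hp hq pq; rewrite setst_isxy cz //; case: ifP => // e _ zp.
  have hxy' : conn F j u p || conn F j v p.
    have : conn F j x u || conn F j x v by case/orP: hxy => /andP [-> _]; rewrite ?orbT.
    have : conn F j y u || conn F j y v by case/orP: hxy => /andP [_ ->]; rewrite ?orbT.
    by case/orP: e => /andP [/= /eqP -> _]; rewrite ![conn F j _ u]conn_sym ![conn F j _ v]conn_sym.
  case/orP: hxy' => h; [case/negP: uz | case/negP: vz];
    by apply: (conn_trans hS h); rewrite conn_sym.
- move=> i /andP [ji ih]; have ij : i != j by rewrite neq_ltn ji orbT.
  by rewrite !nE // h2 // ih ltnW.
- move=> p q i hp hq; rewrite setst_isxy; case: ifP => [_|_ /(h3 p q i hp hq)]; first by case: hs => ->.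
  have [->|ij] := eqVneq i j.
    by rewrite cc // => /orP [->//|/andP [_ ->]]; rewrite orbT.
  rewrite cE // => /orP [->//|/andP [/andP [l1 l2] hx']].
  rewrite ltn_neqAle eq_sym ij l1 l2 /=.
  by have -> : cross F' i u v p q = cross F i u v p q; [rewrite /cross !cE | rewrite hx' orbT].
- move=> i /andP [ji ih]; have ij : i != j by rewrite neq_ltn ji orbT.
  by rewrite cE // h4 // ih ltnW.
Qed.

(** Promotion of a tree edge. Everything that the edge joins at level [i.+1] lies in the component
    of [x] at level [i], and this component already meets the bound of the next level. *)
Lemma dyn_link F F' wt wt' st c i lo hi u v x y s : struct F wt -> good F' wt' (setst st x y s) c ->
  u < n -> v < n -> x < n -> y < n -> x != y -> i < L -> hi <= i.+1 ->
  st x y = Un i.+1 -> s = Un i.+2 \/ s = Mk i.+1 -> (forall p q, st p q = st q p) ->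
  (forall j p q, p < n -> q < n -> conn F' j p q = conn F j p q || (j == i.+1) && cross F i.+1 x y p q) ->
  cnt F st i x * 2 ^ i.+1 <= n * n ->
  dyn F st lo hi u v -> dyn F' (setst st x y s) lo hi u v.
Proof.
move=> hS hG hu hv hx hy xy hi1 hih hst hs sym hc hcnt [h1 h2 h3 h4].
have hi2 : i <= L by apply: ltnW.
have sj j : j != i.+1 -> tarc s j = (j < i.+1).
  by move=> ij; case: hs => -> /=; rewrite ?ltnS [j <= i.+1]leq_eqVlt (negbTE ij).
have tE j p q : j != i.+1 -> tarc (setst st x y s p q) j = tarc (st p q) j.
  by move=> ij; apply: setst_tarc; rewrite // hst sj.
have cE j p q : j != i.+1 -> p < n -> q < n -> conn F' j p q = conn F j p q.
  by move=> /negbTE ij hp hq; rewrite hc // ij /= orbF.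
have nE j z : j != i.+1 -> z < n -> cnt F' (setst st x y s) j z = cnt F st j z.
  by move=> ij hz; apply: cnt_eq => [p q hp hq _|p hp]; rewrite ?tE ?cE.
have op j : lo <= j < hi -> j != i.+1.
  by move=> /andP [_ jh]; rewrite neq_ltn (leq_trans jh hih).
have [hS' _ _ _] := hG.
have xyF : conn F' i x y.
  by apply: (arc_conn n0 B2 hG) => //; rewrite setst_xy; case: hs => -> /=; rewrite ltnW.
split.
- move=> j z jL hz; have [->|ij] := eqVneq j i.+1; last by rewrite nE // h1.
  case: (boolP (conn F i.+1 z x || conn F i.+1 z y)) => hz'.
    have iS : i != i.+1 by rewrite neq_ltn ltnSn.
    have zx : conn F' i z x.
      have h a : a < n -> conn F i.+1 z a -> conn F' i z a.
        move=> ha za; apply: (conn_nest n0 B2 hG (leqnSn i)) => //.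
        by rewrite hc // za.
      case/orP: hz' => /h; first exact.
      by move=> /(_ hy) zy; apply: (conn_trans hS' zy); rewrite conn_sym.
    apply: leq_trans hcnt; rewrite leq_mul2r; apply/orP; right.
    rewrite -(nE i x iS hx); apply: cnt_sub => p q hp hq pq ht zp; split.
      by case: (setst st x y s p q) ht => a //=; apply: leq_trans.
    have zp' : conn F' i z p by apply: (conn_nest n0 B2 hG (leqnSn i)).
    by apply: (conn_trans hS' _ zp'); rewrite conn_sym.
  apply: leq_trans (h1 i.+1 z hi1 hz); rewrite leq_mul2r; apply/orP; right.
  move: hz'; rewrite negb_or => /andP [zx zy].
  have cz p : p < n -> conn F' i.+1 z p = conn F i.+1 z p.
    by move=> hp; rewrite hc // /cross (negbTE zx) (negbTE zy) /= andbF orbF.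
  apply: cnt_sub => p q hp hq pq; rewrite setst_isxy cz //; case: ifP => // e _ zp.
  by case/orP: e => /andP [/= /eqP ep _]; rewrite ep ?(negbTE zx) ?(negbTE zy) in zp.
- move=> j hj; rewrite !nE ?op // h2 //.
- move=> p q j hp hq; rewrite setst_isxy; case: ifP => [_|_ /(h3 p q j hp hq)]; first by case: hs => ->.
  have [->|ij] := eqVneq j i.+1.
    rewrite hc // => /orP [->//|/andP [/op]]; by rewrite eqxx.
  rewrite cE // => /orP [->//|/andP [l1 hx']].
  rewrite l1 /=.
  by have -> : cross F' j u v p q = cross F j u v p q; [rewrite /cross !cE | rewrite hx' orbT].
- by move=> j hj; rewrite cE ?op // h4.
Qed.

(** If no non-tree edge of level [i] crosses, the level is correct for the graph without the removed
    edge, although its two sides stay apart. *)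
Lemma dyn_close F st i lo u v : (forall x y, x < n -> y < n -> st x y = Hf i -> conn F i x y) ->
  dyn F st lo i.+1 u v -> dyn F st lo i u v.
Proof.
move=> H [h1 h2 h3 h4]; split=> //.
- by move=> j /andP [l1 l2]; apply: h2; rewrite l1 ltnW.
- move=> x y j hx hy hst; have := h3 x y j hx hy hst.
  have [E|ij] := eqVneq j i; first by rewrite E H // -E.
  by move=> /orP [->//|/andP [/andP [l1]]]; rewrite ltnS leq_eqVlt (negbTE ij) /= => l2 ->; rewrite l1 l2 orbT.
- by move=> j /andP [l1 l2]; apply: h4; rewrite l1 ltnW.
Qed.

Lemma tour_level F wt st c s i x z : good F wt st c -> s \in F -> x < n -> vx i x \in s -> z \in s -> lv z = i.
Proof. by move=> [[_ _ _ h _] _ _ _] sF hx xs zs; rewrite -(lv_nd n0 i hx hx); apply: (h s). Qed.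

Lemma carcs_cnt F wt st c s i x : good F wt st c -> s \in F -> i <= L -> x < n -> vx i x \in s ->
  count (arc wt) s = cnt F st i x.
Proof.
move=> hG sF hi hx xs; case: (hG) => hS hw _ _.
rewrite /cnt -!size_filter.
rewrite -(size_map (fun pq => nd i pq.1 pq.2) [seq _ <- prs n | _]).
apply/perm_size/uniq_perm.
- rewrite filter_uniq //; case: hS => + _ _ _ _; elim: (F) sF => //= q F' IH.
  rewrite inE cat_uniq => /predU1P [->|sF'] /and3P [h _ h'] //; exact: IH.
- rewrite map_inj_in_uniq ?filter_uniq ?uniq_prs // => -[p q] [p' q'].
  rewrite !mem_filter !mem_prs => /and3P [_ h1 h2] /and3P [_ h3 h4] /= E.
  have := congr1 sr E; have := congr1 ds E; rewrite !sr_nd // !ds_nd //.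
  by move=> -> ->.
move=> z; rewrite mem_filter; apply/andP/mapP => [[az zs]|[[p q]]].
  have [h1 h2 h3 h4 h5] := arc_tour n0 B2 hG sF zs az.
  have lz := tour_level hG sF hx xs zs.
  exists (sr z, ds z); last by rewrite /= -lz nd_eta //; case/andP: (tour_okn hS sF zs).
  have hxz : conn F i x (sr z) by have := conn_in hS sF xs zs; rewrite lv_nd // sr_nd.
  by rewrite lz in h5; rewrite mem_filter mem_prs h2 h3 /isa /= h4 h5 hxz.
rewrite mem_filter mem_prs /isa /= => /andP [/andP [/andP [pq ht] hc] /andP [hp hq]] ->.
rewrite (arc_nd B2 hw) // pq ht; split=> //.
apply: (tour_mem hS sF (x := p)) => //; rewrite ?lv_nd ?sr_nd //.
  by rewrite -(conn_tour hS p sF xs).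
exact: (good_mem n0 B2 hG).
Qed.
End Dyn.

(** * Digits of the weights *)

Section Digits.
Variable B : nat.
Hypothesis B2 : 1 < B.

Definition D0 k := k %% B.
Definition D1 k := (k %/ B) %% B.
Definition D2 k := (k %/ B %/ B) %% B.
Definition D3 k := k %/ B %/ B %/ B.

Definition pos4 a b d e := a + B * (b + B * (d + B * e)).

Lemma pos4K k : k = pos4 (D0 k) (D1 k) (D2 k) (D3 k).
Proof.
rewrite /pos4 /D0 /D1 /D2 /D3 [k in LHS](divn_eq k B) [_ * B]mulnC [X in _ = X]addnC.
congr (_ * _ + _); rewrite [k %/ B in LHS](divn_eq (k %/ B) B) [_ * B]mulnC [X in _ = X]addnC.
congr (_ * _ + _); rewrite [_ %/ B in LHS](divn_eq (k %/ B %/ B) B) [_ * B]mulnC [X in _ = X]addnC.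
by [].
Qed.

Lemma pos4D a b d e : a < B -> b < B -> d < B ->
  [/\ D0 (pos4 a b d e) = a, D1 (pos4 a b d e) = b, D2 (pos4 a b d e) = d &
      D3 (pos4 a b d e) = e].
Proof.
move=> ha hb hd; have B0 : 0 < B by apply: ltnW.
have M x y : x < B -> (x + B * y) %% B = x /\ (x + B * y) %/ B = y.
  move=> hx; rewrite mulnC addnC modnMDl divnMDl // divn_small // addn0.
  by rewrite modn_small.
rewrite /D0 /D1 /D2 /D3 /pos4.
have [-> ->] := M a (b + B * (d + B * e)) ha.
have [-> ->] := M b (d + B * e) hb.
by have [-> ->] := M d e hd.
Qed.

Definition small_digits k := [&& D0 k <= 1, D1 k <= 1 & D2 k <= 1].

(** Fewer than [B] terms with low digits at most 1 produce no carry, and [D3] is everything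
    above. *)
Lemma digits_sum wt s : (forall z, z \in s -> small_digits (wt z)) -> size s < B ->
  [/\ D0 (wsum wt s) = wsum (fun z => D0 (wt z)) s,
      D1 (wsum wt s) = wsum (fun z => D1 (wt z)) s,
      D2 (wsum wt s) = wsum (fun z => D2 (wt z)) s &
      D3 (wsum wt s) = wsum (fun z => D3 (wt z)) s].
Proof.
move=> hs hB.
have E : wsum wt s = pos4 (wsum (fun z => D0 (wt z)) s) (wsum (fun z => D1 (wt z)) s)
   (wsum (fun z => D2 (wt z)) s) (wsum (fun z => D3 (wt z)) s).
  rewrite /pos4; elim: (s) => [|z s' IH]; first by rewrite /wsum /= !muln0.
  by rewrite !wsum_cons IH {1}(pos4K (wt z)) /pos4 !mulnDr; clear; lia.
have le f : (forall z, z \in s -> f (wt z) <= 1) -> wsum (fun z => f (wt z)) s < B.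
  move=> hf; apply: leq_ltn_trans hB; move: hf; elim: (s) => [|z s' IH] hf //.
  rewrite wsum_cons /= -add1n leq_add ?hf ?inE ?eqxx //.
  by apply: IH => y ys; apply: hf; rewrite inE ys orbT.
rewrite {1 2 3 4}E; apply: pos4D; apply: le => z /hs /and3P [] //.
Qed.

Lemma wsum_eq0 (f : nat -> nat) s : (wsum f s != 0) = has (fun z => f z != 0) s.
Proof. by elim: s => //= z s <-; rewrite wsum_cons addn_eq0 negb_and. Qed.

Lemma wsum_count (f : nat -> nat) (a : pred nat) s : {in s, forall z, f z = a z} -> wsum f s = count a s.
Proof.
elim: s => //= z s IH H; rewrite wsum_cons H ?inE ?eqxx // IH // => y ys.
by apply: H; rewrite inE ys orbT.
Qed.

Lemma digits_W s i : [/\ D0 (W B s i) = tarc s i, D1 (W B s i) = (if s is Mk a then i == a else false),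
  D2 (W B s i) = (if s is Hf a then i == a else false) & D3 (W B s i) = 0].
Proof.
have E a b d e : a < B -> b < B -> d < B -> forall k, k = pos4 a b d e ->
   [/\ D0 k = a, D1 k = b, D2 k = d & D3 k = e] by move=> h1 h2 h3 k ->; apply: pos4D.
have b1 (b : bool) : b < B by case: b; [|apply: ltnW].
case: s => a; apply: E; rewrite /= /pos4 ?b1 ?muln0 ?addn0 //; try exact: ltnW.
- by case: (ltngtP i a); rewrite ?muln0 ?muln1.
- by case: (i == a); rewrite ?muln0 ?muln1.
Qed.

Lemma digits_B3 c : [/\ D0 (B * B * B * c) = 0, D1 (B * B * B * c) = 0, D2 (B * B * B * c) = 0 &
  D3 (B * B * B * c) = c].
Proof.
have -> : B * B * B * c = pos4 0 0 0 c by rewrite /pos4 !add0n !mulnA.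
by apply: pos4D; apply: ltnW.
Qed.
End Digits.

(** * Reading a tour from the digits of its sum *)

Section Sums.
Variables (n L : nat).
Hypothesis n0 : 0 < n.
Notation B := (n * n).+1.
Lemma B2 : 1 < B. Proof. by rewrite ltnS muln_gt0 n0. Qed.
Notation nd := (nd n).
Notation vx := (vx n).
Notation conn := (conn n).
Notation good := (good n L B).
Notation arc := (arc B).
Notation sr := (sr n).
Notation ds := (ds n).
Notation lv := (lv n).
Notation D0 := (D0 B).
Notation D1 := (D1 B).
Notation D2 := (D2 B).
Notation D3 := (D3 B).

Section Tour.
Variables (F : seq (seq nat)) (wt : nat -> nat) (st : nat -> nat -> status) (c : nat -> nat).
Variables (s : seq nat).
Hypotheses (hG : good F wt st c) (sF : s \in F).

Lemma uniq_tour : uniq s.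
Proof.
case: hG => -[+ _ _ _ _] _ _ _; elim: (F) sF => //= q F' IH.
by rewrite inE cat_uniq => /predU1P [->|sF'] /and3P [h _ h'] //; exact: IH.
Qed.

(** The nodes of a tour share their level, so their ordered pairs tell them apart. This is why the
    base is [n * n] plus one. *)
Lemma size_tour : size s < B.
Proof.
rewrite ltnS -(size_prs n) -(size_map (fun z => (sr z, ds z)) s).
have hS : struct n L B F wt by case: hG.
apply: uniq_leq_size.
  rewrite map_inj_in_uniq ?uniq_tour // => z z' zs zs' [e1 e2].
  have z0 : 0 < z by case/andP: (tour_okn hS sF zs).
  have z'0 : 0 < z' by case/andP: (tour_okn hS sF zs').
  have el : lv z = lv z' by case: hS => _ _ _ h _; apply: (h s).
  by rewrite -(nd_eta n z0) -(nd_eta n z'0) e1 e2 el.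
by move=> _ /mapP [z zs ->]; rewrite mem_prs sr_lt ?ds_lt.
Qed.

Lemma wt_tour z : z \in s -> [/\ lv z <= L, sr z < n, ds z < n, z = nd (lv z) (sr z) (ds z) &
  wt z = WT B st c (lv z) (sr z) (ds z)].
Proof.
move=> zs; have [hS hw _ _] := hG; have ok := tour_okn hS sF zs.
have z0 : 0 < z by case/andP: ok.
have h1 : lv z <= L := lv_le n0 ok; have h2 := sr_lt n0 z; have h3 := ds_lt n0 z.
by split=> //; rewrite -?hw // nd_eta.
Qed.

Lemma digits_tour z : z \in s ->
  [/\ D0 (wt z) = arc wt z,
      D1 (wt z) = (sr z != ds z) && (if st (sr z) (ds z) is Mk a then lv z == a else false),
      D2 (wt z) = (sr z != ds z) && (if st (sr z) (ds z) is Hf a then lv z == a else false) &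
      D3 (wt z) = if (lv z == 0) && (sr z == ds z) then c (sr z) else 0].
Proof.
move=> zs; have [h1 h2 h3 h4 h5] := wt_tour zs; have [_ hw _ _] := hG.
rewrite /arc -/(D0 (wt z)) h5 /WT; case: (eqVneq (sr z) (ds z)) => e /=.
  have [e0 e1 e2 e3] := digits_B3 B2 (c (sr z)).
  case: (lv z == 0); rewrite ?e0 ?e1 ?e2 ?e3 //.
rewrite andbF; have [e0 e1 e2 e3] := digits_W B2 (st (sr z) (ds z)) (lv z).
rewrite e0 e1 e2 e3; case: (st _ _) => a /=; split=> //; by [case: (_ < _)|case: (_ <= _)].
Qed.

Lemma small_tour z : z \in s -> small_digits B (wt z).
Proof.
move=> zs; have [h1 h2 h3 h4] := digits_tour zs.
by rewrite /small_digits h1 h2 h3 !leq_b1.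
Qed.

(** Stated for subsequences because a descent tests the sums of subtrees. *)
Lemma sub_digits s' : subseq s' s ->
  [/\ D0 (wsum wt s') = count (arc wt) s',
      (D1 (wsum wt s') != 0) = has (fun z => D1 (wt z) != 0) s',
      (D2 (wsum wt s') != 0) = has (fun z => D2 (wt z) != 0) s' &
      D3 (wsum wt s') = wsum (fun z => D3 (wt z)) s'].
Proof.
move=> ss; have sm z : z \in s' -> z \in s by apply: mem_subseq.
have [e0 e1 e2 e3] : [/\ D0 (wsum wt s') = wsum (fun z => D0 (wt z)) s',
      D1 (wsum wt s') = wsum (fun z => D1 (wt z)) s',
      D2 (wsum wt s') = wsum (fun z => D2 (wt z)) s' &
      D3 (wsum wt s') = wsum (fun z => D3 (wt z)) s'].
  apply: digits_sum; first exact: B2.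
    by move=> z /sm; apply: small_tour.
  by apply: leq_ltn_trans size_tour; apply: size_subseq.
rewrite e0 e1 e2 e3 !wsum_eq0; split=> //.
by apply: wsum_count => z /sm zs; case: (digits_tour zs).
Qed.

Lemma sum_cnt i x : i <= L -> x < n -> vx i x \in s -> D0 (wsum wt s) = cnt n F st i x.
Proof.
move=> hi hx xs; have [-> _ _ _] := sub_digits (subseq_refl s).
exact: (carcs_cnt n0 B2 hG).
Qed.

Lemma found_mark i x h : x < n -> vx i x \in s -> h \in s -> D1 (wt h) != 0 ->
  [/\ h = nd i (sr h) (ds h), sr h < n, ds h < n & sr h != ds h /\ st (sr h) (ds h) = Mk i /\ conn F i x (sr h)].
Proof.
move=> hx xs hs; have [_ -> _ _] := digits_tour hs.
have [h1 h2 h3 h4 h5] := wt_tour hs; have lh := tour_level n0 hG sF hx xs hs.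
rewrite eqb0 negbK => /andP [e hst]; split=> //; first by rewrite {1}h4 lh.
split=> //; split.
  by move: hst; case: (st _ _) => // a /eqP; rewrite lh => ->.
by have [hS _ _ _] := hG; have := conn_in hS sF xs hs; rewrite lv_nd // sr_nd.
Qed.

Lemma found_half i x h : x < n -> vx i x \in s -> h \in s -> D2 (wt h) != 0 ->
  [/\ h = nd i (sr h) (ds h), sr h < n, ds h < n & sr h != ds h /\ st (sr h) (ds h) = Hf i /\ conn F i x (sr h)].
Proof.
move=> hx xs hs; have [_ _ -> _] := digits_tour hs.
have [h1 h2 h3 h4 h5] := wt_tour hs; have lh := tour_level n0 hG sF hx xs hs.
rewrite eqb0 negbK => /andP [e hst]; split=> //; first by rewrite {1}h4 lh.
split=> //; split.
  by move: hst; case: (st _ _) => // a /eqP; rewrite lh => ->.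
by have [hS _ _ _] := hG; have := conn_in hS sF xs hs; rewrite lv_nd // sr_nd.
Qed.

Lemma no_mark i x : x < n -> i <= L -> vx i x \in s -> D1 (wsum wt s) = 0 ->
  forall p q, p < n -> q < n -> p != q -> st p q = Mk i -> ~~ conn F i x p.
Proof.
move=> hx hi xs h p q hp hq pq hst.
have hS : struct n L B F wt by case: hG.
rewrite (conn_tour hS p sF xs); apply/negP => ps.
have zs : nd i p q \in s.
  apply: (tour_mem hS sF ps) => //; rewrite ?lv_nd ?sr_nd //.
  by apply: (good_mem n0 B2 hG); rewrite // hst /= leqnn.
have [_ hh _ _] := sub_digits (subseq_refl s).
move: hh; rewrite h eqxx => /esym/negbT/hasPn /(_ _ zs).
by have [_ -> _ _] := digits_tour zs; rewrite sr_nd // ds_nd // lv_nd // pq hst eqxx.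
Qed.

Lemma half_mem i p q : i <= L -> p < n -> q < n -> p != q -> st p q = Hf i -> nd i p q \in flatten F.
Proof.
move=> hi hp hq pq hst; have [[_ h2 _ _ _] hw _ _] := hG.
rewrite h2 okn_nd // sr_nd // ds_nd // hw // /WT (negbTE pq) hst /= eqxx.
by rewrite muln_eq0.
Qed.

Lemma no_half i x : x < n -> i <= L -> vx i x \in s -> D2 (wsum wt s) = 0 ->
  forall p q, p < n -> q < n -> p != q -> st p q = Hf i -> ~~ conn F i x p.
Proof.
move=> hx hi xs h p q hp hq pq hst.
have hS : struct n L B F wt by case: hG.
rewrite (conn_tour hS p sF xs); apply/negP => ps.
have zs : nd i p q \in s.
  apply: (tour_mem hS sF ps) => //; rewrite ?lv_nd ?sr_nd //.
  exact: half_mem.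
have [_ _ hh _] := sub_digits (subseq_refl s).
move: hh; rewrite h eqxx => /esym/negbT/hasPn /(_ _ zs).
by have [_ _ -> _] := digits_tour zs; rewrite sr_nd // ds_nd // lv_nd // pq hst eqxx.
Qed.

(** At most one vertex of the tour contributes to the top digit, so the sum spells its name. *)
Lemma sum_stored y : y < n -> vx 0 y \in s ->
  (forall p, p < n -> conn F 0 y p -> p != y -> c p = 0) -> D3 (wsum wt s) = c y.
Proof.
move=> hy ys hc; have hS : struct n L B F wt by case: hG.
have [_ _ _ ->] := sub_digits (subseq_refl s).
have u := uniq_tour.
have dz z : z \in s -> z != vx 0 y -> D3 (wt z) = 0.
  move=> zs zy; have [_ _ _ ->] := digits_tour zs.
  have [h1 h2 h3 h4 h5] := wt_tour zs; have l0 := tour_level n0 hG sF hy ys zs.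
  rewrite l0 eqxx /=; case: eqP => // e; apply: hc => //.
    by have := conn_in hS sF ys zs; rewrite lv_nd // sr_nd.
  by apply: contraNneq zy => e2; rewrite h4 l0 -e e2.
have dy : D3 (wt (vx 0 y)) = c y.
  by have [_ _ _ ->] := digits_tour ys; rewrite lv_nd // sr_nd // ds_nd // !eqxx.
move: u ys dz; elim: (s) => //= z s' IH /andP [zs' u] ; rewrite inE wsum_cons.
case: (eqVneq z (vx 0 y)) => [E|zy].
  rewrite {}E in zs' *; move=> _ dz; rewrite dy; suff -> : wsum (fun z => D3 (wt z)) s' = 0 by rewrite addn0.
  have {}dz q : q \in s' -> D3 (wt q) = 0.
    move=> qs; apply: dz; rewrite ?inE ?qs ?orbT //.
    by apply: contraNneq zs' => <-.
  elim: (s') dz => // a l IHl H; rewrite wsum_cons H ?mem_head // IHl // => b bl.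
  by apply: H; rewrite inE bl orbT.
rewrite /= => ys dz; rewrite dz ?mem_head // IH // => q qs qy.
by apply: dz => //; rewrite inE qs orbT.
Qed.

(** Along the walk the color changes at arcs and nowhere else. *)
Lemma tour_parity (col : nat -> bool) s1 s2 x :
  (forall z, z \in s -> arc wt z -> col (sr z) != col (ds z)) ->
  x < n -> s = s1 ++ vx (lv (vx 0 x)) x :: s2 ->
  forall p, walk n B wt p s -> col x = col p (+) odd (count (arc wt) s1).
Proof.
move=> hcol hx E p; rewrite E walk_cat /= => /andP [hw /andP [/eqP hx' _]].
rewrite sr_nd // in hx'; rewrite hx'.
have {}hcol z : z \in s1 -> arc wt z -> col (sr z) != col (ds z).
  by move=> zs; apply: hcol; rewrite E mem_cat zs.
elim: s1 p {E hx'} hw hcol => [|z s1 IH] p /= hw hcol; first by rewrite addbF.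
case/andP: hw => /eqP <- hw; rewrite wend_cons IH //; last first.
  by move=> y ys; apply: hcol; rewrite inE ys orbT.
rewrite oddD /stp; case: ifP => az; rewrite ?az //=.
by have := hcol z (mem_head _ _) az; case: (col _); case: (col _); case: (odd _).
Qed.
End Tour.
End Sums.

(** * Operations on tours *)

Definition ndE i x y :=
  Bin Add (Bin Add (Bin Mul (Bin Add (Bin Mul i (Var 0)) x) (Var 0)) y) (Const 1).

(* Variables 20, 21 and 22 hold a level and two vertices; 23 to 26 receive the
   nodes of their two ordered pairs and of the two vertices at that level. *)
Definition nodes :=
  Assign 23 (ndE (Var 20) (Var 21) (Var 22)) ;; Assign 24 (ndE (Var 20) (Var 22) (Var 21)) ;;
  Assign 25 (ndE (Var 20) (Var 21) (Var 21)) ;; Assign 26 (ndE (Var 20) (Var 22) (Var 22)).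

(** The weights of a non-tree edge and, below, of a tree edge at its own level; variable 3 holds the
    base. *)
Definition eBB := Bin Mul (Var 3) (Var 3).
Definition eMk := Bin Add (Const 1) (Var 3).

Section Machine.
Variables (w n L : nat).
Hypothesis n0 : 0 < n.
Notation B := (n * n).+1.
Notation N := (maxnd n L).
Notation Wb := (B * B * B * n).
Hypothesis hN : N * 8 + 16 <= 2 ^ w.
Hypothesis hW : N * Wb < 2 ^ w.
Notation nd := (nd n).
Notation vx := (vx n).
Notation conn := (conn n).
Notation cross := (cross n).
Notation good := (good n L B).
Notation cu := (cu N).
Notation FR := (FR N Wb).
Notation B2 := (B2 n0).

Lemma N0 : 0 < N. Proof. by rewrite /maxnd !muln_gt0 n0. Qed.

Lemma Wb_lt : Wb < 2 ^ w.
Proof. by apply: leq_ltn_trans hW; rewrite leq_pmull // N0. Qed.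

Lemma B3_le : B * B * B <= Wb. Proof. by rewrite leq_pmulr. Qed.
Lemma BB_le : B * B <= Wb. Proof. by apply: leq_trans B3_le; rewrite leq_pmulr. Qed.
Lemma B1_le : 1 + B <= Wb.
Proof.
apply: leq_trans BB_le; apply: leq_trans (_ : 2 * B <= _).
  by rewrite mul2n -addnn leq_add2r.
by rewrite leq_mul2r B2 orbT.
Qed.

Lemma eval_bin s o a b x y : eval w s a = x -> eval w s b = y ->
  binop_sem o x y < 2 ^ w -> eval w s (Bin o a b) = binop_sem o x y.
Proof. by move=> /= -> -> h; rewrite modn_small. Qed.

Lemma eval_ndE s ei ex ey i x y : vars s 0 = n -> eval w s ei = i -> eval w s ex = x ->
  eval w s ey = y -> i <= L -> x < n -> y < n -> eval w s (ndE ei ex ey) = nd i x y.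
Proof.
move=> h0 hi hx hy iL xn yn.
have hnd : nd i x y <= N by case/andP: (okn_nd n0 iL xn yn).
have hlt : nd i x y < 2 ^ w by apply: leq_ltn_trans hnd _; move: hN; clear; lia.
have le1 a b : a * n + b <= nd a b 0 by rewrite /nd addn0; apply: leq_trans (leqnSn _); rewrite leq_pmulr.
have E : nd i x y = (i * n + x) * n + y + 1 by rewrite addn1.
have m1 : i * n + x <= nd i x y.
  by rewrite E; apply: leq_trans (_ : (i * n + x) * n <= _); [rewrite leq_pmulr | rewrite -addnA leq_addr].
have e0 : eval w s (Var 0) = n by [].
have e1 : eval w s (Bin Mul ei (Var 0)) = i * n.
  by apply: (eval_bin (o := Mul) hi e0); apply: leq_ltn_trans hlt; apply: leq_trans m1; apply: leq_addr.
have e2 : eval w s (Bin Add (Bin Mul ei (Var 0)) ex) = i * n + x.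
  by apply: (eval_bin (o := Add) e1 hx); apply: leq_ltn_trans m1 hlt.
have e3 : eval w s (Bin Mul (Bin Add (Bin Mul ei (Var 0)) ex) (Var 0)) = (i * n + x) * n.
  by apply: (eval_bin (o := Mul) e2 e0); apply: leq_ltn_trans hlt; rewrite E -addnA leq_addr.
have e4 : eval w s (Bin Add (Bin Mul (Bin Add (Bin Mul ei (Var 0)) ex) (Var 0)) ey) = (i * n + x) * n + y.
  by apply: (eval_bin (o := Add) e3 hy); apply: leq_ltn_trans hlt; rewrite E leq_addr.
have e5 : eval w s (Const 1) = 1 by apply: (eval_cst hN).
by rewrite E; apply: (eval_bin (o := Add) e4 e5); rewrite /= -E.
Qed.

Lemma nodes_ok vs m tb t r i x y Q : vs 0 = n -> vs 20 = i -> vs 21 = x -> vs 22 = y ->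
  i <= L -> x < n -> y < n ->
  (forall t' vs', t' <= t + cu -> (forall i, i < 23 -> vs' i = vs i) ->
     vs' 23 = nd i x y -> vs' 24 = nd i y x -> vs' 25 = vx i x -> vs' 26 = vx i y ->
     Q t' r (State vs' m tb)) ->
  wp w nodes t r (State vs m tb) Q.
Proof.
move=> h0 hi hx hy iL xn yn HQ.
apply/wp_seq/(wp_assign (v := nd i x y)); first exact: eval_ndE.
apply/wp_seq/(wp_assign (v := nd i y x)); first exact: eval_ndE.
apply/wp_seq/(wp_assign (v := nd i x x)); first exact: eval_ndE.
apply: (wp_assign (v := nd i y y)); first exact: eval_ndE.
apply: HQ => //; first by move: (cu_ge hN hW); rewrite /=; clear; lia.
by move=> k hk; rewrite /upd !ltn_eqF // (leq_trans hk).
Qed.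

(** Joins two views of one memory: splay trees that hold the tours, and weights that hold the edge
    statuses and the names of stored vertices. *)
Definition St m F st c p := FR m F p /\ good F (fd 3 m) st c.

Lemma St_struct m F st c p : St m F st c p -> struct n L B F (fd 3 m).
Proof. by case=> _ []. Qed.

Lemma okN i x y : i <= L -> x < n -> y < n -> 0 < nd i x y <= N.
Proof. exact: okn_nd. Qed.

Definition cut_edge := nodes ;; cut_at 23 24.

Lemma cut_edge_ok vs m tb t r F st c p j x y Q : St m F st c p ->
  vs 0 = n -> vs 20 = j -> vs 21 = x -> vs 22 = y -> j <= L -> x < n -> y < n -> x != y ->
  st x y = Un j.+1 \/ st x y = Mk j ->
  (forall t' vs' m' p' F', t' + p' <= t + p + 12 * cu -> (forall i, i < 23 -> vs' i = vs i) ->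
     St m' F' (setst st x y (Un j)) c p' -> ~~ conn F' j x y ->
     (forall i p q, p < n -> q < n -> conn F i p q = conn F' i p q || (i == j) && cross F' j x y p q) ->
     Q t' r (State vs' m' tb)) ->
  wp w cut_edge t r (State vs m tb) Q.
Proof.
move=> [hF hG] h0 h20 h21 h22 jL xn yn xy hst HQ.
apply/wp_seq/(nodes_ok h0 h20 h21 h22) => // t1 vs1 ht1 hvs1 e1 e2 _ _.
have ht : tarc (st x y) j by case: hst => -> /=.
have [s1 [s2 [U [V [F' [hp E]]]]]] := good_cut_decomp n0 B2 hG jL xn yn xy ht.
apply: (cut_ok hN hW (FR_perm hp hF) E e1 e2) => // t2 vs2 m2 p2 ht2 hw2 hvs2 hF2.
have hG' := good_perm hp hG.
have [g1 g2 g3 g4 g5] := good_cut n0 B2 hG' E jL xn yn xy hst hw2.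
apply: (HQ t2 vs2 m2 p2 (V :: U :: F')) => //.
- by move: ht1 ht2; clear; lia.
- by move=> i hi; rewrite hvs2 ?hvs1 // (leq_trans hi).
- by move=> i a b ha hb; rewrite (conn_perm n i a b hp) g5.
Qed.

Definition link_edge e := nodes ;; link_at 23 24 25 26 e.

Lemma link_edge_ok vs m tb t r F st c p j x y e s Q : St m F st c p ->
  vs 0 = n -> vs 20 = j -> vs 21 = x -> vs 22 = y -> j <= L -> x < n -> y < n -> x != y ->
  st x y = Un j -> s = Un j.+1 \/ s = Mk j -> ~~ conn F j x y ->
  (forall vs' m', (forall i, i < 23 -> vs' i = vs i) -> eval w (State vs' m' tb) e = W B s j) ->
  cost e <= 10 ->
  (forall t' vs' m' p' F', t' + p' <= t + p + 14 * cu -> (forall i, i < 23 -> vs' i = vs i) ->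
     St m' F' (setst st x y s) c p' ->
     (forall i p q, p < n -> q < n -> conn F' i p q = conn F i p q || (i == j) && cross F j x y p q) ->
     Q t' r (State vs' m' tb)) ->
  wp w (link_edge e) t r (State vs m tb) Q.
Proof.
move=> [hF hG] h0 h20 h21 h22 jL xn yn xy hst hs nc he ce HQ.
apply/wp_seq/(nodes_ok h0 h20 h21 h22) => // t1 vs1 ht1 hvs1 e1 e2 e3 e4.
have [s1 [s2 [s3 [s4 [F' hp]]]]] := good_link_decomp n0 hG jL xn yn nc.
have hG' := good_perm hp hG.
have [_ a1 a2 _] := good_link n0 B2 hG' jL xn yn xy hst hs (frefl _).
have kW : W B s j <= Wb.
  case: hs => -> /=; first by apply: leq_trans (leq_b1 _) _; apply: leq_trans B1_le.
  by rewrite ltnn eqxx B1_le.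
apply: (link_ok hN hW (FR_perm hp hF) a1 a2 _ _ _ e1 e2 e3 e4 _ _ _ _ (fun m' => he vs1 m' hvs1)) => //.
- exact: nd_ab.
- exact: okN.
- exact: okN.
move=> t2 vs2 m2 p2 ht2 hw2 hvs2 hF2.
have [g1 _ _ g4] := good_link n0 B2 hG' jL xn yn xy hst hs hw2.
apply: (HQ t2 vs2 m2 p2 _ _ _ (conj hF2 g1)) => //.
- by move: ht1 ht2; clear; lia.
- by move=> i hi; rewrite hvs2 ?hvs1 // (leq_trans hi).
- move=> i a b ha hb; rewrite g4 // (conn_perm n i a b hp).
  by rewrite /cross !(conn_perm n j _ _ hp).
Qed.

(** A non-tree edge has two nodes, one in the tour of each end. *)
Definition half_del := remove 23 ;; remove 24.

Lemma half_del_ok vs m tb t r F st c p j x y Q : St m F st c p ->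
  vs 23 = nd j x y -> vs 24 = nd j y x -> j <= L -> x < n -> y < n -> x != y ->
  st x y = Hf j ->
  (forall t' vs' m' p' F', t' + p' <= t + p + 14 * cu -> (forall i, i < 40 -> vs' i = vs i) ->
     St m' F' (setst st x y (Un 0)) c p' ->
     (forall i p q, p < n -> q < n -> conn F' i p q = conn F i p q) ->
     Q t' r (State vs' m' tb)) ->
  wp w half_del t r (State vs m tb) Q.
Proof.
move=> [hF hG] e1 e2 jL xn yn xy hst HQ; case: (hG) => hS hw [sym _] _.
have yx : y != x by rewrite eq_sym.
have wa : fd 3 m (nd j x y) = B * B by rewrite hw // /WT (negbTE xy) hst /= eqxx.
have wb : fd 3 m (nd j y x) = B * B by rewrite hw // /WT (negbTE yx) sym hst /= eqxx.
have [s1 [s2 [F1 hp1]]] := pick_flat (half_mem n0 hG jL xn yn xy hst).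
apply/wp_seq/(remove_ok hN hW (FR_perm hp1 hF) e1) => // t1 vs1 m1 p1 ht1 hw1 hvs1 hF1.
have hS1 : struct n L B ((s1 ++ s2) :: F1) (fd 3 m1).
  apply: (struct_ext (wt := upd (fd 3 m) (nd j x y) 0)) => [z|]; first by rewrite hw1.
  apply: (struct_half_rem n0 (struct_perm hp1 hS)) => //.
have ab := nd_ab n0 j xn yn xy.
have wb1 : fd 3 m1 (nd j y x) = B * B by rewrite hw1 /upd eq_sym (negbTE ab).
have hb : nd j y x \in flatten ((s1 ++ s2) :: F1).
  case: hS1 => _ -> _ _ _; rewrite okn_nd // wb1 muln_eq0 orbT //.
have [t1' [t2' [F2 hp2]]] := pick_flat hb.
have e2' : vs1 24 = nd j y x by rewrite hvs1.
apply: (remove_ok hN hW (FR_perm hp2 hF1) e2') => // t2 vs2 m2 p2 ht2 hw2 hvs2 hF2.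
have Ew : fd 3 m2 =1 upd (upd (fd 3 m) (nd j x y) (W B (Un 0) j)) (nd j y x) (W B (Un 0) j).
  by move=> z; rewrite hw2 /upd; case: eqP => // _; rewrite hw1 /upd.
have hS2 : struct n L B ((t1' ++ t2') :: F2) (fd 3 m2).
  apply: (struct_ext (wt := upd (fd 3 m1) (nd j y x) 0)) => [z|]; first by rewrite hw2.
  apply: (struct_half_rem n0 (struct_perm hp2 hS1)) => //.
apply: (HQ t2 vs2 m2 p2 ((t1' ++ t2') :: F2)) => //.
- by move: ht1 ht2; clear; lia.
- by move=> i hi; rewrite hvs2 ?hvs1.
- split=> //; apply: (good_set (j := j) n0 hG hS2 xn yn xy) => //.
  by move=> i hi ij; rewrite hst /= (negbTE ij).
- move=> i a b ha hb'; rewrite -(conn_nonvx n0 F2 t1' t2' i j yn xn yx ha hb').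
  rewrite -(conn_perm n i a b hp2) -(conn_nonvx n0 F1 s1 s2 i j xn yn xy ha hb').
  by rewrite -(conn_perm n i a b hp1).
Qed.

Definition half_add := insert_before 23 25 eBB ;; insert_before 24 26 eBB.

Lemma half_add_ok vs m tb t r F st c p j x y Q : St m F st c p ->
  vs 3 = B -> vs 23 = nd j x y -> vs 24 = nd j y x -> vs 25 = vx j x -> vs 26 = vx j y ->
  j <= L -> x < n -> y < n -> x != y -> st x y = Un 0 ->
  (forall t' vs' m' p' F', t' + p' <= t + p + 14 * cu -> (forall i, i < 40 -> vs' i = vs i) ->
     St m' F' (setst st x y (Hf j)) c p' ->
     (forall i p q, p < n -> q < n -> conn F' i p q = conn F i p q) ->
     Q t' r (State vs' m' tb)) ->
  wp w half_add t r (State vs m tb) Q.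
Proof.
move=> [hF hG] h3 e1 e2 e3 e4 jL xn yn xy hst HQ; case: (hG) => hS hw [sym _] _.
have yx : y != x by rewrite eq_sym.
have he vs' m' : vs' 3 = B -> eval w (State vs' m' tb) eBB = B * B.
  move=> h; apply: (eval_bin (s := State vs' m' tb) (o := Mul) (a := Var 3) (b := Var 3) h h); exact: leq_ltn_trans BB_le Wb_lt.
have wa : fd 3 m (nd j x y) = 0 by rewrite hw // /WT (negbTE xy) hst.
have wb : fd 3 m (nd j y x) = 0 by rewrite hw // /WT (negbTE yx) sym hst.
have [s1 [s2 [F1 hp1]]] := pick_flat (good_vx n0 hG jL xn).
have [aF hS1] := struct_half_ins n0 B2 (struct_perm hp1 hS) jL xn yn xy wa.
apply/wp_seq/(insert_before_ok hN hW (FR_perm hp1 hF) aF _ e1 e3 _ _ (fun m' => he vs m' h3)) => //; [exact: okN|exact: BB_le|].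
move=> t1 vs1 m1 p1 ht1 hw1 hvs1 hF1.
have {}hS1 : struct n L B ((s1 ++ nd j x y :: vx j x :: s2) :: F1) (fd 3 m1).
  by apply: (struct_ext _ hS1) => z; rewrite hw1.
have ab := nd_ab n0 j xn yn xy.
have wb1 : fd 3 m1 (nd j y x) = 0 by rewrite hw1 /upd eq_sym (negbTE ab).
have hv : vx j y \in flatten ((s1 ++ nd j x y :: vx j x :: s2) :: F1).
  by case: hS1 => _ -> _ _ _; rewrite okn_nd // sr_nd // ds_nd // eqxx.
have [t1' [t2' [F2 hp2]]] := pick_flat hv.
have [bF hS2] := struct_half_ins n0 B2 (struct_perm hp2 hS1) jL yn xn yx wb1.
have e2' : vs1 24 = nd j y x by rewrite hvs1.
have e4' : vs1 26 = vx j y by rewrite hvs1.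
have h3' : vs1 3 = B by rewrite hvs1.
apply: (insert_before_ok hN hW (FR_perm hp2 hF1) bF _ e2' e4' _ _ (fun m' => he vs1 m' h3')) => //; [exact: okN|exact: BB_le|].
move=> t2 vs2 m2 p2 ht2 hw2 hvs2 hF2.
have Ew : fd 3 m2 =1 upd (upd (fd 3 m) (nd j x y) (W B (Hf j) j)) (nd j y x) (W B (Hf j) j).
  by move=> z; rewrite hw2 /upd /= eqxx; case: eqP => // _; rewrite hw1 /upd.
have {}hS2 : struct n L B ((t1' ++ nd j y x :: vx j y :: t2') :: F2) (fd 3 m2).
  by apply: (struct_ext _ hS2) => z; rewrite hw2.
apply: (HQ t2 vs2 m2 p2 _ _ _ (conj hF2 _)) => //.
- by move: ht1 ht2; clear; lia.
- by move=> i hi; rewrite hvs2 ?hvs1.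
- apply: (good_set (j := j) n0 hG hS2 xn yn xy) => //.
  by move=> i hi ij; rewrite hst /= (negbTE ij).
- move=> i a b ha hb'; rewrite (conn_nonvx n0 F2 t1' (vx j y :: t2') i j yn xn yx ha hb').
  rewrite -(conn_perm n i a b hp2) (conn_nonvx n0 F1 s1 (vx j x :: s2) i j xn yn xy ha hb').
  by rewrite -(conn_perm n i a b hp1).
Qed.

Definition unmark_edge := setat 23 (Const 1) ;; setat 24 (Const 1).

Lemma unmark_edge_ok vs m tb t r F st c p j x y Q : St m F st c p ->
  vs 23 = nd j x y -> vs 24 = nd j y x -> j <= L -> x < n -> y < n -> x != y ->
  st x y = Mk j ->
  (forall t' vs' m' p', t' + p' <= t + p + 4 * cu -> (forall i, i < 40 -> vs' i = vs i) ->
     St m' F (setst st x y (Un j.+1)) c p' ->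
     Q t' r (State vs' m' tb)) ->
  wp w unmark_edge t r (State vs m tb) Q.
Proof.
move=> [hF hG] e1 e2 jL xn yn xy hst HQ; case: (hG) => hS hw [sym _] _.
have pk z : z \in flatten F -> exists s F', z \in s /\ perm_eq F (s :: F').
  by move=> /flattenP [s sF zs]; exists s, (rem s F); split=> //; apply: perm_to_rem.
have ht : tarc (st x y) j by rewrite hst /=.
have ht' : tarc (st y x) j by rewrite sym.
have [s [F1 [as_ hp1]]] := pk _ (good_mem n0 B2 hG jL xn yn ht).
have e1w : 1 <= Wb by apply: leq_trans B1_le.
have ev1 s' : eval w s' (Const 1) = 1 by apply: (eval_cst hN).
apply/wp_seq/(setat_ok hN hW (FR_perm hp1 hF) as_ e1 _ _ (fun vs' m' _ => ev1 _) e1w) => //.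
move=> t1 vs1 m1 p1 ht1 hw1 hvs1 hF1.
have [s' [F2 [bs hp2]]] := pk _ (good_mem n0 B2 hG jL yn xn ht').
have hF1' : FR m1 (s' :: F2) p1.
  by apply: FR_perm hF1; apply: perm_trans hp2; rewrite perm_sym.
have e2' : vs1 24 = nd j y x by rewrite hvs1.
apply: (setat_ok hN hW hF1' bs e2' _ _ (fun vs' m' _ => ev1 _) e1w) => //.
move=> t2 vs2 m2 p2 ht2 hw2 hvs2 hF2.
apply: (HQ t2 vs2 m2 p2) => //.
- by move: ht1 ht2; clear; lia.
- by move=> i hi; rewrite hvs2 ?hvs1 //; apply: ltn_trans hi _.
- split; first by apply: FR_perm hF2; rewrite perm_sym.
  apply: (good_unmark n0 hG) hst _ => // z.
  by rewrite hw2 /upd; case: eqP => // _; rewrite hw1 /upd.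
Qed.
End Machine.

(** * The search for a replacement edge *)

Definition eD0 e := Bin Mod e (Var 3).
Definition eD1 e := Bin Mod (Bin Div e (Var 3)) (Var 3).
Definition eD2 e := Bin Mod (Bin Div (Bin Div e (Var 3)) (Var 3)) (Var 3).
Definition eD3 e := Bin Div (Bin Div (Bin Div e (Var 3)) (Var 3)) (Var 3).

Definition decode v :=
  Assign 22 (Bin Mod (Bin Defs.Sub (Var v) (Const 1)) (Var 0)) ;;
  Assign 21 (Bin Mod (Bin Div (Bin Defs.Sub (Var v) (Const 1)) (Var 0)) (Var 0)).

Definition edg s := if s is Un 0 then false else true.
(** True between updates: [Un a] with positive [a] occurs only while an edge is on its way through
    the levels. *)
Definition marked (st : nat -> nat -> status) :=
  forall x y, match st x y with Un a => a = 0 | _ => True end.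

Lemma marked_set st x y s : marked st -> match s with Un a => a = 0 | _ => True end ->
  marked (setst st x y s).
Proof. by move=> h hs p q; rewrite /setst; case: ifP => // _; apply: h. Qed.

Section Search.
Variables (w n L : nat).
Hypothesis n0 : 0 < n.
Notation B := (n * n).+1.
Notation N := (maxnd n L).
Notation Wb := (B * B * B * n).
Hypothesis hN : N * 8 + 16 <= 2 ^ w.
Hypothesis hW : N * Wb < 2 ^ w.
Hypothesis hL : forall k, 2 ^ k <= n * n -> k <= L.
Notation vx := (vx n).
Notation cu := (cu N).
Notation St := (St n L).
Notation cnt := (cnt n).
Notation sr := (sr n).
Notation ds := (ds n).
Notation D0 := (D0 B).
Notation D1 := (D1 B).
Notation D2 := (D2 B).
Notation D3 := (D3 B).

Definition cuge : 2500 <= cu := cu_ge hN hW.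

Lemma B_lt : B < 2 ^ w.
Proof. by apply: leq_ltn_trans (Wb_lt n0 hW); apply: leq_trans (B1_le n0); apply: leqnSn. Qed.

Section Eval.
Variables (s : state) (e : expr) (k : nat).
Hypotheses (h3 : vars s 3 = B) (he : eval w s e = k) (hk : k < 2 ^ w).

Lemma ev3 : eval w s (Var 3) = B. Proof. exact: h3. Qed.

Lemma eval_div1 : eval w s (Bin Div e (Var 3)) = k %/ B.
Proof. by apply: (eval_bin he ev3); apply: leq_ltn_trans hk; apply: leq_div. Qed.

Lemma eval_div2 : eval w s (Bin Div (Bin Div e (Var 3)) (Var 3)) = k %/ B %/ B.
Proof.
apply: (eval_bin eval_div1 ev3); apply: leq_ltn_trans hk.
exact: leq_trans (leq_div _ _) (leq_div _ _).
Qed.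

Lemma eval_D0 : eval w s (eD0 e) = D0 k.
Proof. by apply: (eval_bin he ev3); apply: leq_ltn_trans hk; apply: leq_mod. Qed.

Lemma eval_D1 : eval w s (eD1 e) = D1 k.
Proof.
apply: (eval_bin eval_div1 ev3); apply: leq_ltn_trans hk.
exact: leq_trans (leq_mod _ _) (leq_div _ _).
Qed.

Lemma eval_D2 : eval w s (eD2 e) = D2 k.
Proof.
apply: (eval_bin eval_div2 ev3); apply: leq_ltn_trans hk.
apply: leq_trans (leq_mod _ _) _; exact: leq_trans (leq_div _ _) (leq_div _ _).
Qed.

Lemma eval_D3 : eval w s (eD3 e) = D3 k.
Proof.
apply: (eval_bin eval_div2 ev3); apply: leq_ltn_trans hk.
apply: leq_trans (leq_div _ _) _; exact: leq_trans (leq_div _ _) (leq_div _ _).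
Qed.
End Eval.

Lemma decode_ok vs m tb t r v h Q : vs v = h -> h <= N -> vs 0 = n -> v != 22 ->
  (forall t' vs', t' <= t + cu -> (forall i, i != 21 -> i != 22 -> vs' i = vs i) ->
     vs' 21 = sr h -> vs' 22 = ds h -> Q t' r (State vs' m tb)) ->
  wp w (decode v) t r (State vs m tb) Q.
Proof.
move=> hv hN' h0 v22 HQ.
have hlt : h < 2 ^ w by apply: leq_ltn_trans hN' _; move: hN; clear; lia.
have e1 vs' : vs' v = h -> eval w (State vs' m tb) (Bin Defs.Sub (Var v) (Const 1)) = h.-1.
  move=> hv'; rewrite -subn1; apply: (eval_bin (o := Defs.Sub)); [exact: hv'|exact: (eval_cst hN)|].
  by apply: leq_ltn_trans hlt; apply: leq_subr.
have hlt' : h.-1 < 2 ^ w by apply: leq_ltn_trans hlt; apply: leq_pred.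
apply/wp_seq/(wp_assign (v := ds h)).
  apply: (eval_bin (o := Mod) (e1 _ hv) (_ : eval _ _ (Var 0) = n)) => //.
  by apply: leq_ltn_trans hlt'; apply: leq_mod.
have hv' : upd vs 22 (ds h) v = h by rewrite /upd (negbTE v22).
apply: (wp_assign (v := sr h)).
  apply: (eval_bin (o := Mod) (x := h.-1 %/ n) (y := n)) => //.
    apply: (eval_bin (o := Div) (e1 _ hv') (_ : eval _ _ (Var 0) = n)) => //.
    by apply: leq_ltn_trans hlt'; apply: leq_div.
  by apply: leq_ltn_trans hlt'; apply: leq_trans (leq_mod _ _) (leq_div _ _).
apply: HQ => //; first by move: cuge; rewrite /=; clear; lia.
by move=> i /negbTE h1 /negbTE h2; rewrite /upd h1 h2.
Qed.

Lemma tour_wsum_lt m F st c p s : St m F st c p -> s \in F -> wsum (fd 3 m) s < 2 ^ w.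
Proof.
move=> [[H [hp [ts [ht EH _]]]] _] sF; have := trees_wsum hW ht; apply: leq_ltn_trans.
have : s \in unzip2 H by rewrite (perm_mem hp).
rewrite EH /unzip2 -map_comp => /(perm_to_rem) hr.
rewrite /wsum /inos; have := perm_flatten hr => /(perm_map (fd 3 m)) /perm_sumn ->.
by rewrite /= map_cat sumn_cat leq_addr.
Qed.

Lemma acc_ok vs m tb t r v z s F st c p Q :
  St m F st c p -> s \in F -> z \in s -> vs v = z ->
  (forall t' vs' m' p', t' + p' <= t + p + cu -> fd 3 m' =1 fd 3 m ->
     (forall k, k < 50 -> vs' k = vs k) -> seen N m' z s -> St m' F st c p' ->
     Q t' r (State vs' m' tb)) ->
  wp w (splay v) t r (State vs m tb) Q.
Proof.
move=> [hF hG] sF zs hv HQ; have hp := perm_to_rem sF.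
apply: (access_ok hN hW (FR_perm hp hF) zs hv) => t' vs' m' p' h1 h2 h3 h4 h5.
apply: (HQ t' vs' m' p') => //; split; first by apply: FR_perm h5; rewrite perm_sym.
by apply: good_ext hG => y; rewrite h2.
Qed.

Lemma eval_sum vs m tb v z s F st c p : St m F st c p -> s \in F -> seen N m z s -> vs v = z ->
  eval w (State vs m tb) (Fd 4 (Var v)) = wsum (fd 3 m) s.
Proof.
move=> hS sF [_ <- _ /andP [_ zN] _] hv.
by rewrite (eval_Fd hN (x := z)).
Qed.

(* The endpoint whose side of the removed edge has fewer arcs; its node goes to 10. *)
Definition pick_side :=
  Assign 20 (Var 5) ;; Assign 21 (Var 1) ;; Assign 22 (Var 2) ;; nodes ;;
  splay 25 ;; Assign 12 (eD0 (Fd 4 (Var 25))) ;;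
  splay 26 ;; Assign 13 (eD0 (Fd 4 (Var 26))) ;;
  If (Bin Lt (Var 12) (Var 13)) (Assign 10 (Var 25)) (Assign 10 (Var 26)).

Lemma pick_side_ok vs m tb t r F st c p i u v Q : St m F st c p ->
  vs 0 = n -> vs 1 = u -> vs 2 = v -> vs 3 = B -> vs 5 = i -> i <= L -> u < n -> v < n ->
  (forall t' vs' m' p' x, t' + p' <= t + p + 10 * cu -> (forall k, k < 10 -> vs' k = vs k) ->
     vs' 10 = vx i x -> x = u \/ x = v -> 2 * cnt F st i x <= cnt F st i u + cnt F st i v ->
     St m' F st c p' -> Q t' r (State vs' m' tb)) ->
  wp w pick_side t r (State vs m tb) Q.
Proof.
move=> hS h0 h1 h2 h3 h5 iL un vn HQ; have [_ hG] := hS.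
apply/wp_seq/(wp_assign (v := i)) => //.
apply/wp_seq/(wp_assign (v := u)) => //.
apply/wp_seq/(wp_assign (v := v)) => //.
apply/wp_seq/(nodes_ok n0 hN hW (i := i) (x := u) (y := v)) => // t1 vs1 ht1 hvs1 e1 e2 e3 e4.
have {}hvs1 k : k < 20 -> vs1 k = vs k.
  by move=> hk; rewrite hvs1 ?(ltn_trans hk) // /upd !ltn_eqF // (leq_trans hk).
have [su suF us] : exists2 s, s \in F & vx i u \in s by apply/flattenP; apply: (good_vx n0 hG).
have [sv svF vs_] : exists2 s, s \in F & vx i v \in s by apply/flattenP; apply: (good_vx n0 hG).
apply/wp_seq/(acc_ok hS suF us e3) => t2 vs2 m2 p2 ht2 hw2 hvs2 hs2 hS2.
have [_ hG2] := hS2; have lt2 := tour_wsum_lt hS2 suF.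
have h23 : vars (State vs2 m2 tb) 3 = B by rewrite /= hvs2 // hvs1.
have h225 : vs2 25 = vx i u by rewrite hvs2.
apply/wp_seq/(wp_assign (v := cnt F st i u)).
  by rewrite (eval_D0 h23 (eval_sum tb hS2 suF hs2 h225) lt2); apply: (sum_cnt n0 hG2).
have e4' : upd vs2 12 (cnt F st i u) 26 = vx i v by rewrite /upd /= hvs2.
apply/wp_seq/(acc_ok hS2 svF vs_ e4') => t3 vs3 m3 p3 ht3 hw3 hvs3 hs3 hS3.
have [_ hG3] := hS3; have lt3 := tour_wsum_lt hS3 svF.
have h33 : vars (State vs3 m3 tb) 3 = B by rewrite /= hvs3 // /upd /= hvs2 // hvs1.
have h326 : vs3 26 = vx i v by rewrite hvs3.
apply/wp_seq/(wp_assign (v := cnt F st i v)).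
  by rewrite (eval_D0 h33 (eval_sum tb hS3 svF hs3 h326) lt3); apply: (sum_cnt n0 hG3).
set vs4 := upd vs3 _ _.
have v12 : vs4 12 = cnt F st i u by rewrite /vs4 /upd /= hvs3.
have v13 : vs4 13 = cnt F st i v by [].
have v25 : vs4 25 = vx i u by rewrite /vs4 /upd /= hvs3 //= /upd /= hvs2.
have v26 : vs4 26 = vx i v by rewrite /vs4 /upd /= hvs3.
have lo k : k < 10 -> vs4 k = vs k.
  move=> hk; have k50 : k < 50 by apply: ltn_trans hk _.
  rewrite /vs4 /upd ltn_eqF ?(ltn_trans hk) // hvs3 // /upd ltn_eqF ?(ltn_trans hk) //.
  by rewrite hvs2 // hvs1 // (ltn_trans hk).
have ev : eval w (State vs4 m3 tb) (Bin Lt (Var 12) (Var 13)) = (cnt F st i u < cnt F st i v).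
  apply: (eval_bin (s := State vs4 m3 tb) (o := Lt) (a := Var 12) (b := Var 13) v12 v13).
  by apply: leq_ltn_trans (leq_b1 _) _; apply: leq_ltn_trans B_lt.
apply: wp_if; rewrite ev => hlt.
  apply: (wp_assign (v := vx i u)) => //; apply: (HQ _ _ m3 p3 u) => //.
  - by move: ht1 ht2 ht3 cuge; rewrite /=; clear; lia.
  - by move=> k hk; rewrite /upd ltn_eqF // lo.
  - by left.
  - by move: hlt; case: ltnP => //; clear; lia.
apply: (wp_assign (v := vx i v)) => //; apply: (HQ _ _ m3 p3 v) => //.
- by move: ht1 ht2 ht3 cuge; rewrite /=; clear; lia.
- by move=> k hk; rewrite /upd ltn_eqF // lo.
- by right.
- by move: hlt; case: ltnP => //; clear; lia.
Qed.

Definition find_in (tst : expr -> expr) v :=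
  splay v ;; Assign 40 (Var v) ;; descend tst ;; splay 40.

(* [dg] is the digit of a weight that [tst] reads. *)
Lemma find_in_ok (tst : expr -> expr) (dg : nat -> nat) vs m tb t r v z s F st c p Q :
  (forall e, cost (tst e) <= cost e + 10) ->
  (forall vs' m' e k, vs' 3 = B -> eval w (State vs' m' tb) e = k -> k < 2 ^ w ->
     eval w (State vs' m' tb) (tst e) = dg k) ->
  St m F st c p -> s \in F -> vs v = z -> z \in s -> vs 3 = B ->
  (forall s', subseq s' s -> (dg (wsum (fd 3 m) s') != 0) = has (fun y => dg (fd 3 m y) != 0) s') ->
  dg (wsum (fd 3 m) s) != 0 -> v < 40 ->
  (forall t' vs' m' p' h, t' + p' <= t + p + 4 * cu -> fd 3 m' =1 fd 3 m ->
     (forall k, k < 40 -> vs' k = vs k) -> vs' 40 = h -> h \in s -> dg (fd 3 m h) != 0 ->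
     St m' F st c p' -> Q t' r (State vs' m' tb)) ->
  wp w (find_in tst v) t r (State vs m tb) Q.
Proof.
move=> tc tok [hF hG] sF hv zs h3 hd hd0 v40 HQ.
have hp := perm_to_rem sF.
have [r0 [H [hf hpH]]] := FR_pick (FR_perm hp hF).
apply/wp_seq/(forest_splay hN hW hf hv zs) => t1 vs1 m1 p1 ht1 hvs1 hw1 hf1.
have W1 s' : wsum (fd 3 m1) s' = wsum (fd 3 m) s' by apply: eq_wsum => y _; apply: hw1.
apply/wp_seq/(wp_assign (v := z)); first by rewrite /= hvs1 // (ltn_trans v40).
set vs2 := upd vs1 40 z.
have hvs2 k : k < 40 -> vs2 k = vs k.
  by move=> hk; rewrite /vs2 /upd ltn_eqF // hvs1 // (ltn_trans hk).
apply: (find_ok hN hW (tst := tst) (P := fun k => dg k != 0) (vs0 := vs) tc _ hf1 hvs2) => //.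
- move=> vs' m' e k hvs' he hk; rewrite (tok _ _ _ k) // hvs' //.
- by move=> s' ss; rewrite W1 hd //; apply: eq_has => y; rewrite hw1.
- by rewrite W1.
move=> t3 vs3 m3 p3 h ht3 hw3 hvs3 h40 hs hd3 hf3.
apply: (HQ t3 vs3 m3 p3 h) => //.
- by move: ht1 ht3 cuge; rewrite /cu /=; clear; lia.
- by move=> y; rewrite hw3 hw1.
- by rewrite -hw1.
- split; last by apply: good_ext hG => y; rewrite hw3 hw1.
  apply: (FR_perm (F := s :: rem s F)); first by rewrite perm_sym.
  exact: FR_mk hf3 hpH.
Qed.
End Search.

(* During a deletion, variables 1 and 2 hold the ends of the deleted edge, 3 the
   base of the weights, 5 the level, and 10 a vertex node of the searched side.  A
   replacement edge is reported in 7 and 8 by setting 6. *)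
Definition promote_loop :=
  splay 10 ;;
  While (eD1 (Fd 4 (Var 10))) (
    find_in eD1 10 ;; decode 40 ;; Assign 20 (Var 5) ;; nodes ;; unmark_edge ;;
    Assign 20 (Bin Add (Var 5) (Const 1)) ;; link_edge eMk ;; splay 10).

(** The connectivity test needs both nodes of the edge in their tours; its outcome waits in variable
    15 while they are removed. *)
Definition half_loop :=
  splay 10 ;; Assign 14 (eD2 (Fd 4 (Var 10))) ;;
  While (Var 14) (
    find_in eD2 10 ;; decode 40 ;; Assign 20 (Var 5) ;; nodes ;;
    (splay 23 ;; splay 24) ;; Assign 15 (Fd 2 (Var 23)) ;; half_del ;;
    If (Var 15)
      (Assign 20 (Bin Add (Var 5) (Const 1)) ;; nodes ;; half_add ;;
       splay 10 ;; Assign 14 (eD2 (Fd 4 (Var 10))))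
      (Assign 6 (Const 1) ;; Assign 7 (Var 21) ;; Assign 8 (Var 22) ;; Assign 14 (Const 0))).

(** * Correctness and cost of the two search loops *)

Section Search.
Variables (w n L : nat).
Hypothesis n0 : 0 < n.
Notation B := (n * n).+1.
Notation N := (maxnd n L).
Notation Wb := (B * B * B * n).
Hypothesis hN : N * 8 + 16 <= 2 ^ w.
Hypothesis hW : N * Wb < 2 ^ w.
Hypothesis hL : forall k, 2 ^ k <= n * n -> k <= L.
Notation nd := (nd n).
Notation vx := (vx n).
Notation conn := (conn n).
Notation cross := (cross n).
Notation good := (good n L B).
Notation cu := (cu N).
Notation B2 := (B2 n0).
Notation St := (St n L).
Notation dyn := (dyn n L).
Notation cnt := (cnt n).
Notation epot := (epot n L).
Notation sr := (sr n).
Notation ds := (ds n).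
Notation D1 := (D1 B).
Notation D2 := (D2 B).
Notation cuge := (cuge hN hW).

Lemma setst_setst st x y a b p q : setst (setst st x y a) x y b p q = setst st x y b p q.
Proof. by rewrite /setst; case: (_ || _). Qed.

(** The predicate that separates the edge at level [i] is constant along the tours of level [j],
    whose arcs are other arcs of level [i]. Hence a promoted tree edge is linked without closing a
    cycle. *)
Lemma bridge_sep F wt st c i j x y : good F wt st c -> i <= j -> i <= L -> j <= L ->
  x < n -> y < n -> x != y -> tarc (st x y) i -> ~~ tarc (st x y) j -> ~~ conn F j x y.
Proof.
move=> hG ij iL jL xn yn xy ti tj; have [hS hw [sym _] hb] := hG.
have [P [Pxy HP]] := hb i x y iL xn yn xy ti.
apply/negP => /connP [s [sF xs ys]].
have [_ _ hc _ _] := hS; have := closed_const (f := P) (hc s sF).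
move=> /(_ _ _ _ xs ys); rewrite !sr_nd // => E.
case/negP: Pxy; apply/eqP/E => z zs; rewrite /stp; case: ifP => // az.
have [h1 h2 h3 h4 h5] := arc_tour n0 B2 hG sF zs az.
have lz : lv n z = j := tour_level n0 hG sF xn xs zs.
rewrite lz in h5; apply: HP => //.
- by case: (st _ _) h5 => a //=; apply: leq_trans.
- by apply: contra tj => /andP [/eqP <- /eqP <-].
- by apply: contra tj => /andP [/eqP e1 /eqP e2]; rewrite sym -e1 -e2.
Qed.

Lemma cnt_conn F wt st c i x t : good F wt st c -> conn F i t x -> cnt F st i x = cnt F st i t.
Proof.
move=> [hS _ _ _] tx; apply/eqP; rewrite eqn_leq; apply/andP; split.
  apply: cnt_sub => p q hp hq pq ht h; split=> //; exact: (conn_trans hS tx h).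
apply: cnt_sub => p q hp hq pq ht h; split=> //; apply: (conn_trans hS _ h); by rewrite conn_sym.
Qed.

Lemma cnt_gt0 F st i t x y : x < n -> y < n -> x != y -> tarc (st x y) i -> conn F i t x ->
  0 < cnt F st i t.
Proof.
move=> xn yn xy ht tx; rewrite /cnt -has_count; apply/hasP; exists (x, y).
  by rewrite mem_prs xn yn.
by rewrite /isa /= xy ht tx.
Qed.

(** A count of at least 1 within the bound of level [i.+1] gives [2 ^ i.+1 <= n * n]; thus an edge
    to be promoted always finds a level above. *)
Lemma level_lt F st i t : 0 < cnt F st i t -> cnt F st i t * 2 ^ i.+1 <= n * n -> i < L.
Proof. by move=> h1 h2; apply: hL; apply: leq_trans h2; rewrite leq_pmull. Qed.

Lemma tour_of m F st c p i x : St m F st c p -> i <= L -> x < n -> exists2 s, s \in F & vx i x \in s.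
Proof. by move=> [_ hG] iL xn; apply/flattenP; apply: (good_vx n0 hG). Qed.

(** The last clause is what permits promotions: the searched side as a whole meets the bound of
    level [i.+1]. *)
Definition search_inv u v i t m F st c p :=
  [/\ St m F st c p, dyn F st 0 i.+1 u v, marked st & cnt F st i t * 2 ^ i.+1 <= n * n].

(** Promotions change connectivity only above level [i], and they never change the set of edges. *)
Definition keeps i F F' (st st' : nat -> nat -> status) :=
  (forall j p q, j <= i -> p < n -> q < n -> conn F' j p q = conn F j p q) /\
  (forall p q, edg (st' p q) = edg (st p q)).

Lemma keeps_trans i F1 F2 F3 st1 st2 st3 :
  keeps i F1 F2 st1 st2 -> keeps i F2 F3 st2 st3 -> keeps i F1 F3 st1 st3.
Proof.
move=> [h1 h2] [h3 h4]; split=> [j p q ji hp hq|p q]; last by rewrite h4.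
by rewrite h3 // h1.
Qed.

Lemma cost_eD1 e : cost (eD1 e) <= cost e + 10. Proof. by rewrite /=; lia. Qed.
Lemma cost_eD2 e : cost (eD2 e) <= cost e + 10. Proof. by rewrite /=; lia. Qed.

(** A promotion lowers [epot] by 2 and so frees [40 * cu], which covers one iteration of either
    loop. *)
Definition kc := 20 * cu.

Lemma promote_loop_ok tb r c i t u v Q : i <= L -> t < n -> u < n -> v < n ->
  forall vs m tm F st p,
  search_inv u v i t m F st c p ->
  vs 0 = n -> vs 3 = B -> vs 5 = i -> vs 10 = vx i t ->
  (forall t' vs' m' F' st' p', t' + p' + kc * epot st' <= tm + p + kc * epot st + 3 * cu ->
     (forall k, k < 12 -> vs' k = vs k) -> search_inv u v i t m' F' st' c p' ->
     keeps i F F' st st' ->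
     (forall x y, x < n -> y < n -> x != y -> st' x y = Mk i -> ~~ conn F' i t x) ->
     Q t' r (State vs' m' tb)) ->
  wp w promote_loop tm r (State vs m tb) Q.
Proof.
move=> iL tn un vn vs m tm F st p [hS hd hm hc] h0 h3 h5 h10 HQ.
have [s sF ts] := tour_of hS iL tn.
apply/wp_seq/(acc_ok hN hW hS sF ts h10) => t1 vs1 m1 p1 ht1 hw1 hvs1 hs1 hS1.
have {}HQ : forall t' vs' m' F' st' p', t' + p' + kc * epot st' <= t1 + p1 + kc * epot st + 1 * cu ->
     (forall k, k < 12 -> vs' k = vs1 k) -> search_inv u v i t m' F' st' c p' ->
     keeps i F F' st st' ->
     (forall x y, x < n -> y < n -> x != y -> st' x y = Mk i -> ~~ conn F' i t x) ->
     Q t' r (State vs' m' tb).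
  move=> t' vs' m' F' st' p' g1 g2 g3 g4 g5; apply: (HQ t' vs' m' F' st' p') => //.
    by move: g1 ht1; clear; lia.
  by move=> k hk; rewrite g2 // hvs1 // (ltn_trans hk).
have {h0} h0 : vs1 0 = n by rewrite hvs1.
have {h3} h3 : vs1 3 = B by rewrite hvs1.
have {h5} h5 : vs1 5 = i by rewrite hvs1.
have {h10} h10 : vs1 10 = vx i t by rewrite hvs1.
(* Every iteration that promotes lowers [epot], whose value therefore bounds their number. *)
have [k hk] : {k | epot st < k} by exists (epot st).+1.
move: s sF ts t1 vs1 m1 p1 hs1 hS1 HQ h0 h3 h5 h10 hd hm hc {hS ht1 hw1 hvs1 m tm vs p}.
elim: k => [//|k IH] in F st hk *; move=> s sF ts t1 vs1 m1 p1 hs1 hS1 HQ h0 h3 h5 h10 hd hm hc.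
have h3s : vars (State vs1 m1 tb) 3 = B by [].
have lt1 := tour_wsum_lt hW hS1 sF.
have ev : eval w (State vs1 m1 tb) (eD1 (Fd 4 (Var 10))) = D1 (wsum (fd 3 m1) s).
  by rewrite (eval_D1 h3s (eval_sum hN tb hS1 sF hs1 h10) lt1).
case: (hS1) => _ hG.
apply: wp_while; rewrite ev => hD.
  apply: (HQ _ vs1 m1 F st p1) => //.
    by move: cuge; rewrite /=; clear; lia.
  exact: (no_mark n0 hG sF tn iL ts hD).
have tok vs' m' e k' : vs' 3 = B -> eval w (State vs' m' tb) e = k' -> k' < 2 ^ w ->
   eval w (State vs' m' tb) (eD1 e) = D1 k'.
  by move=> g1 g2 g3; apply: (eval_D1).
have hsub s' : subseq s' s -> (D1 (wsum (fd 3 m1) s') != 0) = has (fun y => D1 (fd 3 m1 y) != 0) s'.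
  by move=> ss; have [_ -> _ _] := sub_digits n0 hG sF ss.
apply/wp_seq/(find_in_ok hN hW cost_eD1 tok hS1 sF h10 ts h3 hsub hD) => //.
move=> t2 vs2 m2 p2 h ht2 hw2 hvs2 h40 hs hd1 hS2.
have hd1' : D1 (fd 3 m2 h) != 0 by rewrite hw2.
have [_ hG2] := hS2.
have [Eh xn yn [xy [hst tx]]] := found_mark n0 hG2 sF tn ts hs hd1'.
set x := sr h in Eh xn xy hst tx; set y := ds h in Eh yn xy hst.
have hok : h <= N by have [hSt _ _ _] := hG; case/andP: (tour_okn hSt sF hs).
apply/wp_seq/(decode_ok hN hW h40 hok) => //; first by rewrite hvs2.
move=> t3 vs3 ht3 hvs3 v21 v22.
have v3 j : j < 20 -> vs3 j = vs1 j.
  by move=> hj; rewrite hvs3 ?hvs2 ?ltn_eqF ?(ltn_trans hj).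
apply/wp_seq/(wp_assign (v := i)); first by rewrite /= v3.
apply/wp_seq/(nodes_ok n0 hN hW (i := i) (x := x) (y := y)) => //; first by rewrite /upd /= v3.
move=> t4 vs4 ht4 hvs4 e1 e2 e3 e4.
have v4 j : j < 20 -> vs4 j = vs1 j.
  by move=> hj; rewrite hvs4 ?(ltn_trans hj) // /upd ltn_eqF // v3.
apply/wp_seq/(unmark_edge_ok n0 hN hW hS2 e1 e2 iL xn yn xy hst) => t5 vs5 m5 p5 ht5 hvs5 hS5.
have v5 j : j < 20 -> vs5 j = vs1 j by move=> hj; rewrite hvs5 ?v4 // (ltn_trans hj).
set st1 := setst st x y (Un i.+1) in hS5.
have sym : forall p q, st p q = st q p by case: (hG) => _ _ [].
have xt : tarc (st x y) i by rewrite hst /=.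
have iLt : i < L by apply: (level_lt (cnt_gt0 xn yn xy xt tx)).
have [_ hG5] := hS5; have hSt5 := St_struct hS5.
have st1xy : st1 x y = Un i.+1 by rewrite /st1 setst_xy.
have nc : ~~ conn F i.+1 x y.
  by apply: (bridge_sep hG5 (leqnSn i)) => //; rewrite st1xy /= ?ltnSn ?ltnn.
have sym1 p q : st1 p q = st1 q p by case: hG5 => _ _ [].
have iw : i + 1 < 2 ^ w.
  apply: leq_ltn_trans (_ : N < _); last by move: hN; clear; lia.
  rewrite addn1 /maxnd -mulnA; apply: (@leq_trans L.+1); first by rewrite ltnS ltnW.
  by rewrite leq_pmulr // muln_gt0 n0.
have ev5 : eval w (State vs5 m5 tb) (Bin Add (Var 5) (Const 1)) = i.+1.
  by rewrite -[RHS]addn1; apply: eval_add iw; [rewrite /= v5 | exact: (eval_cst hN)].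
apply/wp_seq/(wp_assign (v := i.+1) ev5).
have he vs' m' : (forall j, j < 23 -> vs' j = upd vs5 20 i.+1 j) ->
    eval w (State vs' m' tb) eMk = W B (Mk i.+1) i.+1.
  move=> g; have g3 : vs' 3 = B by rewrite g // /upd /= v5 // h3.
  rewrite /W ltnn eqxx; apply: eval_add; [exact: (eval_cst hN) | exact: g3 |].
  exact: leq_ltn_trans (B1_le n0) (Wb_lt n0 hW).
have v50 : upd vs5 20 i.+1 0 = n by rewrite /upd /= v5.
have v521 : upd vs5 20 i.+1 21 = x by rewrite /upd /= hvs5 // hvs4.
have v522 : upd vs5 20 i.+1 22 = y by rewrite /upd /= hvs5 // hvs4.
apply/wp_seq/(link_edge_ok n0 hN hW hS5 v50 (erefl _) v521 v522 iLt xn yn xy st1xy (or_intror (erefl _)) nc he) => //.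
move=> t6 vs6 m6 p6 F6 ht6 hvs6 hS6 hc6.
have v6 j : j < 20 -> vs6 j = vs1 j.
  by move=> hj; rewrite hvs6 ?(ltn_trans hj) // /upd ltn_eqF // v5.
set st2 := setst st1 x y (Mk i.+1) in hS6.
have [_ hG6] := hS6.
have st2E p q : st2 p q = setst st x y (Mk i.+1) p q by rewrite /st2 /st1 setst_setst.
have [s6 s6F ts6] := tour_of hS6 iL tn.
have v610 : vs6 10 = vx i t by rewrite v6.
apply: (acc_ok hN hW hS6 s6F ts6 v610) => t7 vs7 m7 p7 ht7 hw7 hvs7 hs7 hS7.
have v7 j : j < 20 -> vs7 j = vs1 j by move=> hj; rewrite hvs7 ?v6 // (ltn_trans hj).
have kp : keeps i F F6 st st2.
  split=> [j p q ji hp hq|p q].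
    by rewrite hc6 // ltn_eqF ?ltnS //= orbF.
  rewrite st2E setst_isxy; case: ifP => // e; by rewrite (isxyP sym e) hst.
have tE j p q : j <= i -> tarc (st2 p q) j = tarc (st p q) j.
  move=> ji; rewrite st2E; apply: setst_tarc => //.
  by rewrite hst /= ji (leq_trans ji).
have tE1 j p q : tarc (st1 p q) j = tarc (st p q) j.
  by rewrite /st1; apply: setst_tarc; rewrite // hst /= ltnS.
have ct1 : cnt F st1 i x = cnt F st i t.
  by rewrite -(cnt_conn hG tx); apply: cnt_eq => // p q hp hq _; rewrite tE1.
have ct2 : cnt F6 st2 i t = cnt F st i t.
  apply: cnt_eq => [p q hp hq _|p hp]; first by rewrite tE.
  by have [-> //] := kp.
have hd1'' : dyn F st1 0 i.+1 u v.
  apply: (dyn_same (F := F) (st := st)) => //.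
  by move=> p q j hp hq; rewrite /st1 setst_isxy; case: ifP => // _ ->; left.
have hd2 : dyn F6 st2 0 i.+1 u v.
  apply: (dyn_link n0 B2 hSt5 hG6 un vn xn yn xy iLt (leqnn _) st1xy (or_intror (erefl _)) sym1 hc6 _ hd1'').
  by rewrite ct1.
have hep : epot st2 + 2 = epot st.
  have e5 := epot_set L (Un i.+1) xn yn xy (sym x y).
  have e6 := epot_set L (Mk i.+1) xn yn xy (sym1 x y).
  rewrite -/st1 hst /= in e5; rewrite -/st2 st1xy /= in e6.
  by move: e5 e6 iLt; clear; lia.
apply: (IH F6 st2 _ s6 s6F ts6 t7 vs7 m7 p7 hs7 hS7) => //; last 1 first.
- by rewrite ct2.
- by move: hk hep; clear; lia.
- move=> t' vs' m' F' st' p' g1 g2 g3 g4 g5; apply: (HQ t' vs' m' F' st' p') => //.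
  + move: g1 ht2 ht3 ht4 ht5 ht6 ht7 cuge; rewrite /kc -hep mulnDr [cost _]/=.
    rewrite /=; clear; lia.
  + by move=> j hj; rewrite g2 // v7 // (ltn_trans hj).
  + exact: keeps_trans kp g4.
- by rewrite v7.
- by rewrite v7.
- by rewrite v7.
- by rewrite v7.
- by move=> p q; rewrite st2E; apply: (marked_set x y hm (s := Mk i.+1)).
Qed.
Lemma conn_test_ok vs m tb t r va vb x y s F st c p Q :
  St m F st c p -> s \in F -> x \in s -> y \in flatten F -> x != y -> vs va = x -> vs vb = y ->
  vb < 50 ->
  (forall t' vs' m' p', t' + p' <= t + p + 2 * cu -> fd 3 m' =1 fd 3 m ->
     (forall k, k < 50 -> vs' k = vs k) -> (fd 2 m' x != 0) = (y \in s) ->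
     St m' F st c p' -> Q t' r (State vs' m' tb)) ->
  wp w (splay va ;; splay vb) t r (State vs m tb) Q.
Proof.
move=> [hF hG] sF xs yF xy ha hb b50 HQ; have hp := perm_to_rem sF.
have yF' : y \in flatten (s :: rem s F) by rewrite -(perm_mem (perm_flatten hp)).
apply: (conn_ok hN hW (FR_perm hp hF) xs yF' xy ha hb b50) => t' vs' m' p' h1 h2 h3 h4 h5.
apply: (HQ t' vs' m' p') => //; split; first by apply: FR_perm h5; rewrite perm_sym.
by apply: good_ext hG => z; rewrite h2.
Qed.

(** Without arcs the walk would never leave its first vertex. *)
Lemma conn_cnt F wt st c i x y : good F wt st c -> i <= L -> x < n -> y < n -> x != y ->
  conn F i x y -> 0 < cnt F st i x.
Proof.
move=> hG iL xn yn xy /connP [s [sF xs ys]]; have [[_ _ hc _ _] _ _ _] := hG.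
rewrite -(carcs_cnt n0 B2 hG sF iL xn xs) -has_count; apply: contraNT xy => /hasPn na.
have := closed_const (f := id) (hc s sF) _ xs ys; rewrite !sr_nd // => -> // z zs.
by rewrite /stp (negbTE (na z zs)).
Qed.

(** The hypothesis on level [i.+1] is the effect of promoting the tree edges: ends joined on the
    searched side are joined one level up, so a non-tree edge may follow. *)
Lemma half_loop_ok tb r c i t u v Q : i <= L -> t < n -> u < n -> v < n ->
  forall vs m tm F st p,
  search_inv u v i t m F st c p ->
  (i < L -> forall p q, p < n -> q < n -> conn F i t p -> conn F i t q -> conn F i.+1 p q) ->
  vs 0 = n -> vs 3 = B -> vs 5 = i -> vs 10 = vx i t ->
  (forall t' vs' m' F' st' p', t' + p' + kc * epot st' <= tm + p + kc * epot st + 3 * cu ->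
     (forall k, k < 12 -> vs' k = vs k) -> search_inv u v i t m' F' st' c p' ->
     keeps i F F' st st' ->
     (forall x y, x < n -> y < n -> x != y -> st' x y = Hf i -> ~~ conn F' i t x) ->
     Q t' r (State vs' m' tb)) ->
  (forall t' vs' m' F' st' p' x y, t' + p' + kc * epot st' <= tm + p + kc * epot st + 30 * cu ->
     (forall k, k < 6 -> vs' k = vs k) -> vs' 6 = 1 -> vs' 7 = x -> vs' 8 = y ->
     search_inv u v i t m' F' st' c p' -> keeps i F F' st (setst st' x y (Hf 0)) ->
     x < n -> y < n -> x != y -> st' x y = Un 0 -> cross F' i u v x y ->
     Q t' r (State vs' m' tb)) ->
  wp w half_loop tm r (State vs m tb) Q.
Proof.
move=> iL tn un vn vs m tm F st p [hS hd hm hc] hsp h0 h3 h5 h10 HQ HQf.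
have [s sF ts] := tour_of hS iL tn.
apply/wp_seq/(acc_ok hN hW hS sF ts h10) => t1 vs1 m1 p1 ht1 hw1 hvs1 hs1 hS1.
have h31 : vars (State vs1 m1 tb) 3 = B by rewrite /= hvs1.
have h101 : vs1 10 = vx i t by rewrite hvs1.
have ev : eval w (State vs1 m1 tb) (eD2 (Fd 4 (Var 10))) = D2 (wsum (fd 3 m1) s).
  exact: (eval_D2 h31 (eval_sum hN tb hS1 sF hs1 h101) (tour_wsum_lt hW hS1 sF)).
apply/wp_seq/(wp_assign ev); set vs2 := upd _ _ _.
have {ev} v14 : vs2 14 = D2 (wsum (fd 3 m1) s) by [].
have c2 : cost (eD2 (Fd 4 (Var 10))) < cu by move: cuge; rewrite /=; clear; lia.
have {}ht1 : t1 + (cost (eD2 (Fd 4 (Var 10)))).+1 + p1 <= tm + p + 2 * cu.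
  by move: ht1 c2; clear; lia.
have lo k : k < 14 -> vs2 k = vs k.
  by move=> hk; rewrite /vs2 /upd ltn_eqF // hvs1 // (ltn_trans hk).
move: (t1 + _) ht1 => t2 ht2.
have {}HQ : forall t' vs' m' F' st' p', t' + p' + kc * epot st' <= t2 + p1 + kc * epot st + cu ->
     (forall k, k < 12 -> vs' k = vs2 k) -> search_inv u v i t m' F' st' c p' ->
     keeps i F F' st st' ->
     (forall x y, x < n -> y < n -> x != y -> st' x y = Hf i -> ~~ conn F' i t x) ->
     Q t' r (State vs' m' tb).
  move=> t' vs' m' F' st' p' g1 g2 g3 g4 g5; apply: (HQ t' vs' m' F' st' p') => //.
    by move: g1 ht2; clear; lia.
  by move=> k hk; rewrite g2 // lo // (ltn_trans hk).
have {}HQf : forall t' vs' m' F' st' p' x y, t' + p' + kc * epot st' <= t2 + p1 + kc * epot st + 28 * cu ->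
     (forall k, k < 6 -> vs' k = vs2 k) -> vs' 6 = 1 -> vs' 7 = x -> vs' 8 = y ->
     search_inv u v i t m' F' st' c p' -> keeps i F F' st (setst st' x y (Hf 0)) ->
     x < n -> y < n -> x != y -> st' x y = Un 0 -> cross F' i u v x y ->
     Q t' r (State vs' m' tb).
  move=> t' vs' m' F' st' p' x y g1 g2 g3 g4 g5 g6 g7 g8 g9 g10 g11 g12.
  apply: (HQf t' vs' m' F' st' p' x y) => //.
    by move: g1 ht2; clear; lia.
  by move=> k hk; rewrite g2 // lo // (ltn_trans hk).
have {h0} h0 : vs2 0 = n by rewrite lo.
have {h3} h3 : vs2 3 = B by rewrite lo.
have {h5} h5 : vs2 5 = i by rewrite lo.
have {h10} h10 : vs2 10 = vx i t by rewrite lo.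
have [k hk] : {k | epot st < k} by exists (epot st).+1.
clearbody vs2.
move: s sF ts t2 vs2 m1 p1 hS1 HQ HQf h0 h3 h5 h10 v14 hd hm hc hsp {hS ht2 hw1 hvs1 m tm vs p h31 h101 c2 lo hs1 t1 vs1}.
elim: k => [//|k IH] in F st hk *; move=> s sF ts t1 vs1 m1 p1 hS1 HQ HQf h0 h3 h5 h10 v14 hd hm hc hsp.
case: (hS1) => _ hG.
apply: wp_while; rewrite [eval _ _ _]/= v14 => hD.
  apply: (HQ _ vs1 m1 F st p1) => //.
    by move: cuge; rewrite /=; clear; lia.
  exact: (no_half n0 hG sF tn iL ts hD).
have tok vs' m' e k' : vs' 3 = B -> eval w (State vs' m' tb) e = k' -> k' < 2 ^ w ->
   eval w (State vs' m' tb) (eD2 e) = D2 k'.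
  by move=> g1 g2 g3; apply: (eval_D2).
have hsub s' : subseq s' s -> (D2 (wsum (fd 3 m1) s') != 0) = has (fun y => D2 (fd 3 m1 y) != 0) s'.
  by move=> ss; have [_ _ -> _] := sub_digits n0 hG sF ss.
apply/wp_seq/(find_in_ok hN hW cost_eD2 tok hS1 sF h10 ts h3 hsub hD) => //.
move=> t2 vs2 m2 p2 h ht2 hw2 hvs2 h40 hs hd1 hS2.
have hd1' : D2 (fd 3 m2 h) != 0 by rewrite hw2.
have [_ hG2] := hS2.
have [Eh xn yn [xy [hst tx]]] := found_half n0 hG2 sF tn ts hs hd1'.
set x := sr h in Eh xn xy hst tx; set y := ds h in Eh yn xy hst.
have hok : h <= N by have [hSt _ _ _] := hG; case/andP: (tour_okn hSt sF hs).
apply/wp_seq/(decode_ok hN hW h40 hok) => //; first by rewrite hvs2.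
move=> t3 vs3 ht3 hvs3 v21 v22.
have v3 j : j < 20 -> vs3 j = vs1 j.
  by move=> hj; rewrite hvs3 ?hvs2 ?ltn_eqF ?(ltn_trans hj).
apply/wp_seq/(wp_assign (v := i)); first by rewrite /= v3.
apply/wp_seq/(nodes_ok n0 hN hW (i := i) (x := x) (y := y)) => //; first by rewrite /upd /= v3.
move=> t4 vs4 ht4 hvs4 e1 e2 e3 e4.
have v4 j : j < 20 -> vs4 j = vs1 j.
  by move=> hj; rewrite hvs4 ?(ltn_trans hj) // /upd ltn_eqF // v3.
have sym : forall p q, st p q = st q p by case: (hG) => _ _ [].
have hyx : nd i y x \in flatten F.
  by apply: (half_mem n0 hG2) => //; [rewrite eq_sym | rewrite sym].
have ab := nd_ab n0 i xn yn xy.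
have xs : nd i x y \in s by rewrite -Eh.
have hS0 := St_struct hS2.
have ysE : (nd i y x \in s) = conn F i x y.
  apply/idP/idP => [h'|h'].
    by have := conn_in hS0 sF xs h'; rewrite lv_nd // !sr_nd.
  have xvs : vx i x \in s by rewrite -(conn_tour hS0 x sF ts).
  apply: (tour_mem hS0 sF (x := y)) => //; rewrite ?lv_nd ?sr_nd //.
  by rewrite -(conn_tour hS0 y sF xvs).
have Hfin : forall p q, isxy x y (p, q) -> st p q = Hf i by move=> p' q' e; rewrite (isxyP sym e).
apply/wp_seq/(conn_test_ok hS2 sF xs hyx ab e1 e2) => //.
move=> t5 vs5 m5 p5 ht5 hw5 hvs5 hcn hS5; rewrite ysE in hcn.
have xN : nd i x y <= N by rewrite -Eh.
set d := fd 2 m5 (nd i x y) in hcn.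
apply/wp_seq/(wp_assign (v := d)).
  by rewrite (eval_Fd hN (x := nd i x y)) // /= hvs5.
set vs6 := upd vs5 15 d.
have v6 j : j < 14 -> vs6 j = vs1 j.
  by move=> hj; rewrite /vs6 /upd ltn_eqF ?ltnS ?(ltnW hj) // hvs5 ?v4 ?(ltn_trans hj).
have w6 j : 15 < j < 50 -> vs6 j = vs4 j.
  by move=> /andP [g1 g2]; rewrite /vs6 /upd gtn_eqF // hvs5.
have e61 : vs6 23 = nd i x y by rewrite w6.
have e62 : vs6 24 = nd i y x by rewrite w6.
apply/wp_seq/(half_del_ok n0 hN hW hS5 e61 e62 iL xn yn xy hst) => t7 vs7 m7 p7 F7 ht7 hvs7 hS7 hc7.
set st1 := setst st x y (Un 0) in hS7.
have [_ hG7] := hS7.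
have ev15 : eval w (State vs7 m7 tb) (Var 15) = d by rewrite /= hvs7.
have tE1 s' p' q' j : (s' = Un 0 \/ s' = Hf i.+1) -> tarc (setst st x y s' p' q') j = tarc (st p' q') j.
  by move=> hs'; apply: setst_tarc => //; rewrite hst /=; case: hs' => ->.
apply: wp_if; rewrite ev15 => hd15; last first.
  apply/wp_seq/(wp_assign (v := 1)); first exact: (eval_cst hN).
  apply/wp_seq/(wp_assign (v := x)); first by rewrite /= /upd /= hvs7 // w6 // hvs4.
  apply/wp_seq/(wp_assign (v := y)); first by rewrite /= /upd /= hvs7 // w6 // hvs4.
  apply: (wp_assign (v := 0)); first exact: (eval_cst hN).
  set vs8 := upd _ _ _.
  have nc : ~~ conn F i x y by rewrite -hcn hd15.
  apply: wp_while => [_|]; last by [].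
(* A non-tree edge of an open level either has its ends joined there or crosses between the two
   sides. *)
have hx : cross F i u v x y.
    by have [_ _ /(_ x y i xn yn hst) + _] := hd; rewrite (negbTE nc) => /= /andP [].
  have hx7 : cross F7 i u v x y by rewrite /cross !hc7.
  apply: (HQf _ vs8 m7 F7 st1 p7 x y) => //.
  + have := epot_set L (Un 0) xn yn xy (sym x y); rewrite -/st1 [lvp L (Un 0)]/= muln0 addn0 => E.
    have le : epot st1 <= epot st by rewrite -E leq_addr.
    have {}le : kc * epot st1 <= kc * epot st by rewrite leq_mul2l le orbT.
    move: le ht2 ht3 ht4 ht5 ht7 cuge; rewrite /=; clear; lia.
  + by move=> j hj; rewrite /vs8 /upd !ltn_eqF ?(leq_trans hj) // hvs7 ?v6 // (leq_trans hj).
  + split=> //.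
    * apply: (dyn_same (F := F) (st := st)) => //.
        by move=> p' q' j _ _; apply: tE1; left.
      by move=> p' q' j _ _; rewrite /st1 setst_isxy; case: ifP => // _; left.
    * exact: marked_set.
    * rewrite (_ : cnt F7 st1 i t = cnt F st i t) //.
      by apply: cnt_eq => [p' q' _ _ _|p' hp']; [apply: tE1; left | rewrite hc7].
  + split=> [j p' q' _ hp' hq'|p' q']; first by rewrite hc7.
    by rewrite setst_setst setst_isxy; case: ifP => // /Hfin ->.
  + exact: setst_xy.
have cxy : conn F i x y by rewrite -hcn.
have ct0 : 0 < cnt F st i t by rewrite -(cnt_conn hG tx); apply: (conn_cnt hG iL xn yn).
have iLt : i < L by apply: (level_lt ct0).
have hv7 j : j < 14 -> vs7 j = vs1 j by move=> hj; rewrite hvs7 ?v6 // (ltn_trans hj).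
have iw : i + 1 < 2 ^ w.
  apply: leq_ltn_trans (_ : N < _); last by move: hN; clear; lia.
  rewrite addn1 /maxnd -mulnA; apply: (@leq_trans L.+1); first by rewrite ltnS ltnW.
  by rewrite leq_pmulr // muln_gt0 n0.
have ev7 : eval w (State vs7 m7 tb) (Bin Add (Var 5) (Const 1)) = i.+1.
  by rewrite -[RHS]addn1; apply: eval_add iw; [rewrite /= hv7 | exact: (eval_cst hN)].
apply/wp_seq/(wp_assign (v := i.+1) ev7).
apply/wp_seq/(nodes_ok n0 hN hW (i := i.+1) (x := x) (y := y)) => //.
- by rewrite /upd /= hv7.
- by rewrite /upd /= hvs7 // w6 // hvs4.
- by rewrite /upd /= hvs7 // w6 // hvs4.
move=> t8 vs8 ht8 hvs8 f1 f2 f3 f4.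
have v8 j : j < 14 -> vs8 j = vs1 j.
  by move=> hj; rewrite hvs8 ?(ltn_trans hj) // /upd ltn_eqF ?(ltn_trans hj) // hv7.
have h38 : vs8 3 = B by rewrite v8.
apply/wp_seq/(half_add_ok n0 hN hW hS7 h38 f1 f2 f3 f4 iLt xn yn xy (setst_xy _ _ _ _)).
move=> t9 vs9 m9 p9 F9 ht9 hvs9 hS9 hc9.
set st2 := setst st1 x y (Hf i.+1) in hS9.
have st2E p' q' : st2 p' q' = setst st x y (Hf i.+1) p' q' by rewrite /st2 /st1 setst_setst.
have v9 j : j < 14 -> vs9 j = vs1 j by move=> hj; rewrite hvs9 ?v8 // (ltn_trans hj).
have hcq j p' q' : p' < n -> q' < n -> conn F9 j p' q' = conn F j p' q' by move=> *; rewrite hc9 ?hc7.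
have [s9 s9F ts9] := tour_of hS9 iL tn.
have v910 : vs9 10 = vx i t by rewrite v9.
apply/wp_seq/(acc_ok hN hW hS9 s9F ts9 v910) => t10 vs10 m10 p10 ht10 hw10 hvs10 hs10 hS10.
have v10 j : j < 14 -> vs10 j = vs1 j by move=> hj; rewrite hvs10 ?v9 // (ltn_trans hj).
have h310 : vars (State vs10 m10 tb) 3 = B by rewrite /= v10.
have h1010 : vs10 10 = vx i t by rewrite v10.
have ev : eval w (State vs10 m10 tb) (eD2 (Fd 4 (Var 10))) = D2 (wsum (fd 3 m10) s9).
  exact: (eval_D2 h310 (eval_sum hN tb hS10 s9F hs10 h1010) (tour_wsum_lt hW hS10 s9F)).
apply: (wp_assign ev); set vs11 := upd _ _ _.
have v11 j : j < 14 -> vs11 j = vs1 j by move=> hj; rewrite /vs11 /upd ltn_eqF // v10.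
have cxy1 : conn F i.+1 x y.
  by apply: hsp => //; apply: (conn_trans hS0 tx).
have kp : keeps i F F9 st st2.
  split=> [j p' q' _ hp' hq'|p' q']; first by rewrite hcq.
  by rewrite st2E setst_isxy; case: ifP => // /Hfin ->.
have ct2 : cnt F9 st2 i t = cnt F st i t.
  by apply: cnt_eq => [p' q' _ _ _|p' hp']; [rewrite st2E; apply: tE1; right | rewrite hcq].
have hd2 : dyn F9 st2 0 i.+1 u v.
  apply: (dyn_same (F := F) (st := st)) => //.
    by move=> p' q' j _ _; rewrite st2E; apply: tE1; right.
  move=> p' q' j hp' hq'; rewrite st2E setst_isxy; case: ifP => [e [<-]|_]; last by left.
  right; rewrite hcq //; case/orP: e => /andP [/= /eqP -> /eqP ->] //.
  by rewrite conn_sym.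
have hep : epot st2 + 2 = epot st.
  have e5 := epot_set L (Un 0) xn yn xy (sym x y).
  have sym1 : st1 x y = st1 y x by case: hG7 => _ _ [].
  have e6 := epot_set L (Hf i.+1) xn yn xy sym1.
  rewrite -/st1 hst /= in e5; rewrite -/st2 /st1 setst_xy -/st1 /= in e6.
  by move: e5 e6 iLt; clear; lia.
apply: (IH F9 st2 _ s9 s9F ts9 _ vs11 m10 p10 hS10) => //; rewrite ?v11 //.
- by move: hk hep; clear; lia.
- move=> t' vs' m' F' st' p' g1 g2 g3 g4 g5; apply: (HQ t' vs' m' F' st' p') => //.
  + move: g1 ht2 ht3 ht4 ht5 ht7 ht8 ht9 ht10 cuge; rewrite /kc -hep mulnDr.
    rewrite /=; clear; lia.
  + by move=> j hj; rewrite g2 // v11 // (ltn_trans hj).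
  + exact: keeps_trans kp g4.
- move=> t' vs' m' F' st' p' x' y' g1 g2 g3 g4 g5 g6 g7 g8 g9 g10 g11 g12.
  apply: (HQf t' vs' m' F' st' p' x' y') => //.
  + move: g1 ht2 ht3 ht4 ht5 ht7 ht8 ht9 ht10 cuge; rewrite /kc -hep mulnDr.
    rewrite /=; clear; lia.
  + by move=> j hj; rewrite g2 // v11 // (ltn_trans hj).
  + exact: keeps_trans kp g7.
- by move=> p' q'; rewrite st2E; apply: (marked_set x y hm (s := Hf i.+1)).
- by rewrite ct2.
- by move=> iL' p' q' hp' hq'; rewrite !hcq //; apply: hsp.
Qed.
End Search.

(** * Deletion of a tree edge *)

(** The weights reveal the level: below it they are 1 for a tree edge and 0 for a non-tree edge, and
    at it they reach at least [B]. *)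
Definition level_search :=
  While (Bin Lt (Fd 3 (Var 23)) (Var 3)) (Assign 20 (Bin Add (Var 20) (Const 1)) ;; nodes).

(** From the top level down, so that the levels still holding the edge form an initial segment. *)
Definition cut_loop := While (Var 20) (Assign 20 (Bin Defs.Sub (Var 20) (Const 1)) ;; cut_edge).

(* The weight of a replacement edge: it is marked at its top level only. *)
Definition eRe := Bin Add (Const 1) (Bin Mul (Var 3) (Bin Eq (Var 20) (Var 5))).

Definition relink_levels :=
  Assign 20 (Const 0) ;; Assign 21 (Var 7) ;; Assign 22 (Var 8) ;;
  While (Bin Lt (Var 20) (Bin Add (Var 5) (Const 1)))
    (link_edge eRe ;; Assign 20 (Bin Add (Var 20) (Const 1))).

(** Variable 5 is one more than the level to be searched next; setting it to 0 ends the loop after a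
    success. *)
Definition search :=
  While (Var 5) (
    Assign 5 (Bin Defs.Sub (Var 5) (Const 1)) ;; pick_side ;; promote_loop ;; half_loop ;;
    If (Var 6) (relink_levels ;; Assign 5 (Const 0)) Skip).

Section Delete.
Variables (w n L : nat).
Hypothesis n0 : 0 < n.
Notation B := (n * n).+1.
Notation N := (maxnd n L).
Notation Wb := (B * B * B * n).
Hypothesis hN : N * 8 + 16 <= 2 ^ w.
Hypothesis hW : N * Wb < 2 ^ w.
Hypothesis hL : forall k, 2 ^ k <= n * n -> k <= L.
Notation nd := (nd n).
Notation conn := (conn n).
Notation cross := (cross n).
Notation cu := (cu N).
Notation B2 := (B2 n0).
Notation St := (St n L).
Notation dyn := (dyn n L).
Notation epot := (epot n L).
Notation sr := (sr n).
Notation ds := (ds n).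
Notation cuge := (cuge hN hW).
Notation kc := (kc n L).

(** The estimates below treat [L.+2 * cu] and [L.+1 * cu] as atoms and relate them by these
    facts. *)
Lemma level_cost : L.+2 * cu = cu + L.+1 * cu /\ cu <= L.+1 * cu.
Proof. by rewrite mulSn leq_pmull. Qed.

Lemma L2_lt : L.+2 < 2 ^ w.
Proof.
apply: leq_trans hN; have : L.+1 <= N by rewrite /maxnd -mulnA leq_pmulr // muln_gt0 n0.
clear; lia.
Qed.

Lemma eval_var_succ s x j : vars s x = j -> j <= L.+1 -> eval w s (Bin Add (Var x) (Const 1)) = j.+1.
Proof.
move=> hx jL; rewrite -[RHS]addn1; apply: eval_add => //; first exact: (eval_cst hN).
by rewrite addn1; apply: leq_ltn_trans L2_lt; rewrite ltnS.
Qed.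

Lemma eval_var_pred s x j : vars s x = j.+1 -> j <= L.+1 ->
  eval w s (Bin Defs.Sub (Var x) (Const 1)) = j.
Proof.
move=> hx jL; rewrite -[RHS]subn0 -subSS; apply: (eval_bin (o := Defs.Sub)) => //; first exact: (eval_cst hN).
by rewrite /= subSS subn0; apply: leq_ltn_trans L2_lt; rewrite (leq_trans jL).
Qed.

Lemma nat_of_bool_lt (b : bool) : b < 2 ^ w.
Proof. by apply: leq_ltn_trans (leq_b1 _) _; apply: leq_ltn_trans (B_lt n0 hW). Qed.

Lemma W_top s l : s = Mk l \/ s = Hf l -> B <= W B s l.
Proof.
case=> ->; rewrite /W ?ltnn eqxx; first exact: leq_addl.
exact: leq_pmulr.
Qed.

Lemma W_low s l i : s = Mk l \/ s = Hf l -> i < l -> W B s i < B.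
Proof. by case=> -> il; rewrite /W ?il ?(ltn_eqF il) // B2. Qed.

Lemma level_search_ok vs m tb t r F st c p x y l Q : St m F st c p ->
  vs 0 = n -> vs 3 = B -> vs 20 = 0 -> vs 21 = x -> vs 22 = y ->
  vs 23 = nd 0 x y -> vs 24 = nd 0 y x -> x < n -> y < n -> x != y -> l <= L ->
  st x y = Mk l \/ st x y = Hf l ->
  (forall t' vs', t' <= t + 2 * L.+2 * cu -> (forall k, k < 20 -> vs' k = vs k) ->
     vs' 20 = l -> vs' 21 = x -> vs' 22 = y -> vs' 23 = nd l x y -> vs' 24 = nd l y x ->
     Q t' r (State vs' m tb)) ->
  wp w level_search t r (State vs m tb) Q.
Proof.
move=> [hF hG] h0 h3 h20 h21 h22 h23 h24 xn yn xy lL hst HQ.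
suff H d i t0 vs0 : i + d = l -> t0 + d * (2 * cu) <= t + 2 * L.+1 * cu ->
    (forall k, k < 20 -> vs0 k = vs k) -> vs0 20 = i -> vs0 21 = x -> vs0 22 = y ->
    vs0 23 = nd i x y -> vs0 24 = nd i y x -> wp w level_search t0 r (State vs0 m tb) Q.
  apply: (H l 0) => //; rewrite leq_add2l mulnA [_ * 2]mulnC leq_mul2r leq_mul2l leqW ?orbT //.
elim: d i t0 vs0 => [|d IH] i t0 vs0 ld ht0 hv g20 g21 g22 g23 g24.
all: have il : i <= l by rewrite -ld leq_addr.
all: have iL : i <= L by apply: leq_trans lL.
all: have hw : fd 3 m (nd i x y) = W B (st x y) i by case: hG => _ -> //; rewrite /WT (negbTE xy).
all: have g23N : nd i x y <= N by case/andP: (okn_nd n0 iL xn yn).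
all: have ev : eval w (State vs0 m tb) (Bin Lt (Fd 3 (Var 23)) (Var 3)) = (W B (st x y) i < B) by
  apply: (eval_bin (o := Lt)); [by rewrite (eval_Fd hN (x := nd i x y)) // hw | by rewrite /= hv | exact: nat_of_bool_lt].
all: apply: wp_while; rewrite ev.
- move=> _; apply: (HQ _ vs0) => //; rewrite ?addn0 in ld *; rewrite -?ld //.
  by move: ht0 cuge; rewrite [2 * L.+2]mulnS mulnDl /=; clear; lia.
- by rewrite addn0 in ld; rewrite ld ltnNge (W_top hst).
- have i_l : i < l by rewrite -ld addnS ltnS leq_addr.
  by rewrite (W_low hst i_l).
move=> _; have iL1 : i.+1 <= L by apply: leq_trans lL; rewrite -ld addnS ltnS leq_addr.
apply/wp_seq/(wp_assign (v := i.+1)); first by apply: eval_var_succ; rewrite // leqW.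
apply: (nodes_ok n0 hN hW (i := i.+1) (x := x) (y := y)) => //; first by rewrite /upd /= hv.
move=> t1 vs1 ht1 hvs1 e1 e2 e3 e4; apply: (IH i.+1) => //; rewrite ?addSnnS //; try by rewrite hvs1.
  by move: ht1 ht0 cuge; rewrite /= mulSn; clear; lia.
by move=> k hk; rewrite hvs1 ?(ltn_trans hk) // /upd ltn_eqF // hv.
Qed.

Lemma cut_loop_ok vs m tb t r F st c p u v l Q : St m F st c p -> dyn F st l.+1 l.+1 u v ->
  vs 0 = n -> vs 20 = l.+1 -> vs 21 = u -> vs 22 = v -> u < n -> v < n -> u != v -> l <= L ->
  st u v = Mk l ->
  (forall t' vs' m' p' F' st', t' + p' <= t + p + 14 * L.+2 * cu -> (forall k, k < 20 -> vs' k = vs k) ->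
     St m' F' st' c p' -> (forall x y, st' x y = setst st u v (Un 0) x y) -> dyn F' st' 0 l.+1 u v ->
     (forall x y, x < n -> y < n -> conn F 0 x y = conn F' 0 x y || cross F' 0 u v x y) ->
     Q t' r (State vs' m' tb)) ->
  wp w cut_loop t r (State vs m tb) Q.
Proof.
move=> hS hd h0 h20 h21 h22 un vn uv lL hst HQ.
have symS m1 F1 st1 p1 a b : St m1 F1 st1 c p1 -> st1 a b = st1 b a by case=> _ [_ _ [h _] _]; apply: h.
(* Below [j] the edge is still present; the levels from [j] to [l] are open. *)
suff H j t0 vs0 m0 F0 st0 p0 : j <= l.+1 -> t0 + p0 + j * (13 * cu) <= t + p + 13 * L.+1 * cu ->
    (forall k, k < 20 -> vs0 k = vs k) -> vs0 20 = j -> vs0 21 = u -> vs0 22 = v ->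
    St m0 F0 st0 c p0 -> (forall x y, ~~ isxy u v (x, y) -> st0 x y = st x y) ->
    st0 u v = (if j == l.+1 then Mk l else Un j) -> dyn F0 st0 j l.+1 u v ->
    (if j == 0 then forall x y, x < n -> y < n -> conn F 0 x y = conn F0 0 x y || cross F0 0 u v x y
     else forall x y, x < n -> y < n -> conn F0 0 x y = conn F 0 x y) ->
    wp w cut_loop t0 r (State vs0 m0 tb) Q.
  apply: (H l.+1 t vs m F st p) => //; rewrite ?eqxx //.
  by rewrite leq_add2l mulnA [_ * 13]mulnC leq_mul2r leq_mul2l ltnS lL orbT.
elim: j t0 vs0 m0 F0 st0 p0 => [|j IH] t0 vs0 m0 F0 st0 p0 jl ht hv g20 g21 g22 hS0 so suv hd0 hc.
all: apply: wp_while; rewrite [eval _ _ _]/= g20 // => _.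
  apply: (HQ _ vs0 m0 p0 F0 st0) => //.
    have [] := level_cost; move: ht cuge.
    by rewrite -!mulnA; move: (L.+2 * cu) (L.+1 * cu) => X Y /=; clear; lia.
  move=> x y; rewrite setst_isxy; case: ifP => e; last by rewrite so ?e.
  by rewrite (isxyP _ e) // => a b; apply: symS hS0.
have jL : j <= L by apply: leq_trans lL.
apply/wp_seq/(wp_assign (v := j)); first by apply: eval_var_pred; [exact: g20 | exact: leqW].
have hst0 : st0 u v = Un j.+1 \/ st0 u v = Mk j.
  by rewrite suv; case: eqP => [[->]|_]; [right | left].
apply: (cut_edge_ok n0 hN hW hS0 (j := j) (x := u) (y := v)) => //; first by rewrite /upd /= hv.
move=> t1 vs1 m1 p1 F1 ht1 hvs1 hS1 nc hc1.
apply: (IH t1 vs1 m1 F1 _ p1 _ _ _ _ _ _ hS1); rewrite ?hvs1 //.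
- exact: ltnW.
- by move: ht1 ht cuge; rewrite /= mulSn; clear; lia.
- by move=> k hk; rewrite hvs1 ?(ltn_trans hk) // /upd ltn_eqF // hv.
- by move=> x y e; rewrite setst_isxy (negbTE e) so.
- by rewrite setst_xy (ltn_eqF jl).
- apply: (dyn_cut n0 (St_struct hS0) (St_struct hS1)) => //.
  by move=> a b; apply: symS hS0.
case: eqP => [E|/eqP j0] x y xn yn; last by rewrite -hc // hc1 // eq_sym (negbTE j0) orbF.
by rewrite -hc // hc1 // E eqxx.
Qed.

Lemma relink_levels_ok vs m tb t r F st c p u v i x y Q : St m F st c p -> dyn F st 0 i.+1 u v ->
  vs 0 = n -> vs 3 = B -> vs 5 = i -> vs 7 = x -> vs 8 = y ->
  u < n -> v < n -> x < n -> y < n -> x != y -> i <= L ->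
  st x y = Un 0 -> cross F i u v x y ->
  (forall t' vs' m' p' F' st', t' + p' <= t + p + 16 * L.+2 * cu -> (forall k, k < 20 -> vs' k = vs k) ->
     St m' F' st' c p' -> (forall a b, st' a b = setst st x y (Mk i) a b) -> dyn F' st' 0 0 u v ->
     (forall a b, a < n -> b < n -> conn F' 0 a b = conn F 0 a b || cross F 0 u v a b) ->
     Q t' r (State vs' m' tb)) ->
  wp w relink_levels t r (State vs m tb) Q.
Proof.
move=> hS hd h0 h3 h5 h7 h8 un vn xn yn xy iL hst hx HQ.
apply/wp_seq/(wp_assign (v := 0)); first exact: (eval_cst hN).
apply/wp_seq/(wp_assign (v := x)) => //.
apply/wp_seq/(wp_assign (v := y)) => //.
set vs1 := upd _ _ _; set t1 := t + _ + _ + _.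
have ht1 : t1 <= t + cu by rewrite /t1 /=; move: cuge; clear; lia.
have symS m1 F1 st1 p1 a b : St m1 F1 st1 c p1 -> st1 a b = st1 b a by case=> _ [_ _ [h _] _]; apply: h.
(* Components grow downwards, so an edge that crosses at level [i] crosses at all lower levels. *)
have hx0 k : k <= i -> cross F k u v x y.
  move=> ki; have [_ hG] := hS; move: hx; rewrite /cross.
  by case/orP => /andP [g1 g2]; rewrite (conn_nest n0 B2 hG ki g1) // (conn_nest n0 B2 hG ki g2) ?orbT.
suff H d j t0 vs0 m0 F0 st0 p0 : j + d = i.+1 -> t0 + p0 + d * (15 * cu) <= t + p + 15 * L.+1 * cu + cu ->
    (forall k, k < 20 -> vs0 k = vs k) -> vs0 20 = j -> vs0 21 = x -> vs0 22 = y ->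
    St m0 F0 st0 c p0 -> (forall a b, ~~ isxy x y (a, b) -> st0 a b = st a b) ->
    st0 x y = (if j == i.+1 then Mk i else Un j) -> dyn F0 st0 j i.+1 u v ->
    (forall k, j <= k <= i -> cross F0 k u v x y) ->
    (if j == 0 then F0 = F
     else forall a b, a < n -> b < n -> conn F0 0 a b = conn F 0 a b || cross F 0 u v a b) ->
    wp w (While (Bin Lt (Var 20) (Bin Add (Var 5) (Const 1)))
     (link_edge eRe ;; Assign 20 (Bin Add (Var 20) (Const 1)))) t0 r (State vs0 m0 tb) Q.
  apply: (H i.+1 0 t1 vs1 m F st p) => //.
  - move: ht1; have : i.+1 * (15 * cu) <= 15 * L.+1 * cu.
      by rewrite mulnA [_ * 15]mulnC leq_mul2r leq_mul2l ltnS iL orbT.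
    by clear; lia.
  - by move=> k hk; rewrite /vs1 /upd !ltn_eqF // (ltn_trans hk).
elim: d j t0 vs0 m0 F0 st0 p0 => [|d IH] j t0 vs0 m0 F0 st0 p0 jd ht hv g20 g21 g22 hS0 so sxy hd0 hx1 hc.
all: have ji : j <= i.+1 by rewrite -jd leq_addr.
all: have ev : eval w (State vs0 m0 tb) (Bin Lt (Var 20) (Bin Add (Var 5) (Const 1))) = (j < i.+1) by
  apply: (eval_bin (o := Lt)); [exact: g20 | apply: eval_var_succ; [by rewrite /= hv | by rewrite leqW] | exact: nat_of_bool_lt].
all: apply: wp_while; rewrite ev.
- move=> _; rewrite addn0 in jd; apply: (HQ _ vs0 m0 p0 F0 st0) => //.
  + have [] := level_cost; move: ht cuge.
    by rewrite -!mulnA; move: (L.+2 * cu) (L.+1 * cu) => X Y /=; clear; lia.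
  + move=> a b; rewrite setst_isxy; case: ifP => e; last by rewrite so ?e.
    by rewrite (isxyP _ e) ?sxy ?jd ?eqxx // => a' b'; apply: symS hS0.
  + by rewrite jd in hd0; apply: dyn_empty hd0.
  + by move: hc; rewrite jd.
- by rewrite addn0 in jd; rewrite jd ltnn.
- by rewrite -jd addnS ltnS leq_addr.
move=> _; have jil : j <= i by rewrite -ltnS -jd addnS ltnS leq_addr.
have jL : j <= L by apply: leq_trans iL.
have sj : st0 x y = Un j by rewrite sxy ltn_eqF.
set s := if j == i then Mk i else Un j.+1.
have hs : s = Un j.+1 \/ s = Mk j by rewrite /s; case: eqP => [->|_]; [right | left].
have hS0' := St_struct hS0.
(* The level is still open, so [u] and [v] are apart there, and with them the ends of the crossing
   edge. *)
have nc : ~~ conn F0 j x y.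
  have [_ _ _ /(_ j)] := hd0; rewrite leqnn ltnS jil => /(_ isT); apply: contra => cxy.
  have := hx1 j; rewrite leqnn jil => /(_ isT) /orP [] /andP [g1 g2].
    by rewrite conn_sym in g1; apply: (conn_trans hS0' g1); apply: (conn_trans hS0' cxy).
  rewrite conn_sym in g2; apply: (conn_trans hS0' g2); apply: (conn_trans hS0' _ g1).
  by rewrite conn_sym.
have he vs' m' : (forall k, k < 23 -> vs' k = vs0 k) -> eval w (State vs' m' tb) eRe = W B s j.
  move=> g; have E : W B s j = 1 + B * (j == i).
    by rewrite /s; case: eqP => [<-|_] /=; rewrite ?ltnn ?eqxx ?ltnSn ?muln1 ?muln0.
  have lB : B * (j == i) <= B by case: (j == i); rewrite ?muln1 ?muln0.
  have lB1 : 1 + B < 2 ^ w by apply: leq_ltn_trans (B1_le n0) (Wb_lt n0 hW).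
  rewrite E; apply: eval_add; [exact: (eval_cst hN) | | by apply: leq_ltn_trans lB1; rewrite leq_add2l].
  apply: (eval_bin (o := Mul) (x := B) (y := (j == i))); last first.
  - by apply: leq_ltn_trans lB1; apply: leq_trans lB _; apply: leq_addl.
  - apply: (eval_bin (o := Eq) (x := j) (y := i)); last exact: nat_of_bool_lt.
      by rewrite /= g.
    by rewrite /= g // hv.
  - by rewrite /= g // hv.
apply/wp_seq/(link_edge_ok n0 hN hW hS0 (j := j) (x := x) (y := y) _ _ _ _ jL xn yn xy sj hs nc he) => //.
  by rewrite hv.
move=> t2 vs2 m2 p2 F2 ht2 hvs2 hS2 hc2.
apply: (wp_assign (v := j.+1)); first by apply: eval_var_succ; rewrite /= ?hvs2 // leqW.
have hxj : cross F0 j u v x y by apply: hx1; rewrite leqnn.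
have [hd2 hcj] := dyn_relink hS0' (St_struct hS2) un vn xn yn xy jL (leq_ltn_trans jil (ltnSn _)) sj hs
  (fun a b => symS _ _ _ _ a b hS0) hxj hc2 hd0.
apply: (IH j.+1 _ _ m2 F2 _ p2 _ _ _ _ _ _ hS2) => //.
- by rewrite addSnnS.
- by move: ht2 ht cuge; rewrite /= mulSn; clear; lia.
- by move=> k hk; rewrite /upd ltn_eqF // hvs2 ?hv // (ltn_trans hk).
- by rewrite /upd /= hvs2.
- by rewrite /upd /= hvs2.
- by move=> a b e; rewrite setst_isxy (negbTE e) so.
- by rewrite setst_xy /s eqSS.
- move=> k /andP [k1 k2]; have := hx1 k; rewrite (ltnW k1) k2 => /(_ isT).
  by rewrite /cross !hc2 // (gtn_eqF k1) /= !orbF.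
move=> a b an bn; move: hc; case: eqP => [E hF|/eqP j0 hc].
  by rewrite -E hcj ?E ?hF.
by rewrite hc2 // eq_sym (negbTE j0) /= orbF hc.
Qed.

(** If no tree edge has level exactly [i], every arc of the tour also belongs to level [i.+1], so
    the tour spans a single component there. *)
Lemma unmarked_span m F st c p i t : St m F st c p -> marked st -> i < L -> t < n ->
  (forall x y, x < n -> y < n -> x != y -> st x y = Mk i -> ~~ conn F i t x) ->
  forall a b, a < n -> b < n -> conn F i t a -> conn F i t b -> conn F i.+1 a b.
Proof.
move=> hS hm iL tn nm a b an bn ta tb; have [_ hG] := hS; have hS' := St_struct hS.
have [s sF ts] := tour_of n0 hS (ltnW iL) tn.
rewrite !(conn_tour hS' _ sF ts) in ta tb.
rewrite -(sr_nd n0 i an an) -(sr_nd n0 i bn bn); apply: (tour_span n0 hG sF iL _ ta tb) => z zs az.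
have [h1 h2 h3 h4 h5] := arc_tour n0 B2 hG sF zs az.
have lz := tour_level n0 hG sF tn ts zs; rewrite lz in h5.
apply: (arc_conn n0 B2 hG) => //; move: (hm (sr z) (ds z)) (nm (sr z) (ds z) h2 h3 h4) h5.
case: (st _ _) => // d /=; first by move=> ->.
move=> _ hh; rewrite leq_eqVlt => /predU1P [E|//]; case/negP: (hh (congr1 Mk (esym E))).
by have := conn_in hS' sF ts zs; rewrite lv_nd // sr_nd.
Qed.

Lemma search_ok vs m tb t r F st c p u v k Q : St m F st c p -> dyn F st 0 k u v -> marked st ->
  vs 0 = n -> vs 1 = u -> vs 2 = v -> vs 3 = B -> vs 5 = k -> vs 6 = 0 ->
  u < n -> v < n -> k <= L.+1 ->
  (forall t' vs' m' p' F' st',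
     t' + p' + kc * epot st' <= t + p + kc * epot st + 60 * k * cu + 60 * L.+2 * cu ->
     (forall j, j < 5 -> vs' j = vs j) ->
     St m' F' st' c p' -> dyn F' st' 0 0 u v -> marked st' ->
     (forall a b, edg (st' a b) = edg (st a b)) ->
     (forall a b, a < n -> b < n ->
        conn F' 0 a b = conn F 0 a b || (vs' 6 != 0) && cross F 0 u v a b) ->
     Q t' r (State vs' m' tb)) ->
  wp w search t r (State vs m tb) Q.
Proof.
elim: k => [|i IH] in vs m t F st p *; move=> hS hd hm h0 h1 h2 h3 h5 h6 un vn kL HQ.
all: apply: wp_while; rewrite [eval _ _ _]/= h5 // => _.
  apply: (HQ _ vs m p F st) => //; last by move=> a b _ _; rewrite h6 /= orbF.
  have [] := level_cost; move: cuge.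
  by rewrite -!mulnA; move: (L.+2 * cu) (L.+1 * cu) => X Y /=; clear; lia.
have iL : i <= L by [].
apply/wp_seq/(wp_assign (v := i)); first by apply: eval_var_pred; [exact: h5 | exact: leqW].
apply/wp_seq/(pick_side_ok n0 hN hW hS (i := i) (u := u) (v := v)) => //.
move=> t1 vs1 m1 p1 x ht1 hvs1 h10 hx hcnt hS1.
have xn : x < n by case: hx => ->.
have v1 j : j < 10 -> j != 5 -> vs1 j = vs j by move=> h /negbTE j5; rewrite hvs1 // /upd j5.
have si : search_inv n L u v i x m1 F st c p1.
  (* The bound of the open level covers both sides together, so the smaller side meets the bound of
     the next level. *)
  split=> //; case: hd => _ /(_ i) hh _ _; move: hh; rewrite leqnn => /(_ isT).
  apply: leq_trans; rewrite expnS mulnA leq_mul2r orbC mulnC; apply/orP; left.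
  by apply: leq_trans hcnt _; apply: leq_addr.
have v15 : vs1 5 = i by rewrite hvs1.
apply/wp_seq/(promote_loop_ok n0 hN hW hL iL xn un vn si) => //; rewrite ?v1 //.
move=> t2 vs2 m2 F2 st2 p2 ht2 hvs2 si2 kp2 nm; have [hS2 hd2 hm2 hc2] := si2.
apply/wp_seq/(half_loop_ok n0 hN hW hL iL xn un vn si2) => //; rewrite ?hvs2 ?v15 ?h10 ?v1 //.
- by move=> iL'; apply: (unmarked_span hS2).
- move=> t3 vs3 m3 F3 st3 p3 ht3 hvs3 [hS3 hd3 hm3 hc3] kp3 nh.
  have [kc23 ke23] := keeps_trans kp2 kp3.
  have v3 j : j < 10 -> j != 5 -> vs3 j = vs j.
    by move=> h j5; rewrite hvs3 ?hvs2 ?v1 // (ltn_trans h).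
  have hS3' := St_struct hS3; have [_ hG3] := hS3.
  (* A crossing edge has one end on the searched side, where no non-tree edge of level [i] is
     left. *)
  have hd3' : dyn F3 st3 0 i u v.
    apply: (dyn_close _ (hd3)) => a b an bn hab; have [_ _ /(_ a b i an bn hab) + _] := hd3.
    case/orP => // /andP [_ hcr]; have [->|ab] := eqVneq a b; first exact: (conn_refl n0 hS3').
    have ha := nh a b an bn ab hab.
    have hb : ~~ conn F3 i x b.
      by apply: (nh b a) => //; [rewrite eq_sym | case: hG3 => _ _ [sym _] _; rewrite sym].
    move: hcr ha hb; rewrite /cross ![conn F3 i x _]conn_sym.
    by case: hx => ->; case/orP => /andP [g1 g2]; rewrite ?g1 ?g2.
  have ev6 : eval w (State vs3 m3 tb) (Var 6) = 0 by rewrite /= v3.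
  apply: wp_if; rewrite ev6 // => _; apply: wp_skip.
  have v35 : vs3 5 = i by rewrite hvs3 // hvs2.
  apply: (IH vs3 m3 _ F3 st3 p3) => //; rewrite ?v35 ?v3 //; first exact: ltnW.
  move=> t' vs' m' p' F' st' g1 g2 g3 g4 g5 g6 g7; apply: (HQ t' vs' m' p' F' st') => //.
  + move: g1 ht1 ht2 ht3 cuge; rewrite -!mulnA [i.+1 * _]mulSn.
    by move: (L.+2 * cu) (i * cu) => X Y /=; clear; lia.
  + by move=> j hj; rewrite g2 // v3 ?(ltn_trans hj) // ltn_eqF.
  + by move=> a b; rewrite g6 ke23.
  + by move=> a b an bn; rewrite g7 // /cross !kc23.
move=> t3 vs3 m3 F3 st3 p3 x' y' ht3 hvs3 h36 h37 h38 [hS3 hd3 hm3 _] kp3 xn' yn' xy' hst3 hcr.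
have [kc23 ke23] := keeps_trans kp2 kp3.
have v3 j : j < 5 -> vs3 j = vs j.
  by move=> h; rewrite hvs3 ?hvs2 ?v1 ?ltn_eqF // (ltn_trans h).
have v35 : vs3 5 = i by rewrite hvs3 // hvs2.
have ev6 : eval w (State vs3 m3 tb) (Var 6) = 1 by rewrite /= h36.
apply: wp_if; rewrite ev6 // => _.
apply/wp_seq/(relink_levels_ok hS3 hd3 (i := i) (x := x') (y := y')) => //; rewrite ?v3 //.
move=> t4 vs4 m4 p4 F4 st4 ht4 hvs4 hS4 hst4 hd4 hc4.
apply: (wp_assign (v := 0)); first exact: (eval_cst hN).
set vs5 := upd _ _ _; apply: wp_while => [_|]; last by [].
apply: (HQ _ vs5 m4 p4 F4 st4) => //.
- have sym3 : st3 x' y' = st3 y' x' by case: hS3 => _ [_ _ [h _] _].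
  have := epot_set L (Mk i) xn' yn' xy' sym3; rewrite hst3 [lvp L (Un 0)]/= muln0 addn0 => E.
  have {}E : epot st4 <= epot st3 + 2 * L.+1.
    rewrite (_ : epot st4 = epot (setst st3 x' y' (Mk i))).
      by rewrite E leq_add2l leq_mul2l /= leq_subr.
    by rewrite /epot; congr sumn; apply: eq_map => -[a b]; rewrite hst4.
  (* The replacement gave up its credit when it left its tours. Restoring it takes at most
     [2 * L.+1] promotions' worth, once per deletion. *)
  have {}E : kc * epot st4 <= kc * epot st3 + 40 * L.+1 * cu.
    apply: leq_trans (_ : kc * (epot st3 + 2 * L.+1) <= _); first by rewrite leq_mul2l E orbT.
    by rewrite mulnDr leq_add2l /kc mulnAC mulnA.
  have [] := level_cost; move: E ht1 ht2 ht3 ht4 cuge; rewrite -!mulnA [i.+1 * _]mulSn.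
  by move: (L.+2 * cu) (L.+1 * cu) (i * cu) => X Y Z /=; clear; lia.
- by move=> j hj; rewrite /vs5 /upd ltn_eqF // hvs4 ?v3 // (ltn_trans hj).
- move=> a b; rewrite hst4 setst_isxy; case: ifP => // _; exact: hm3.
- by move=> a b; rewrite hst4 -ke23 !setst_isxy; case: ifP.
- by move=> a b an bn; rewrite hc4 // /cross !kc23 // /vs5 /upd /= hvs4 // h36.
Qed.
End Delete.

(** * Stored colors *)

Definition set_base := Assign 3 (Bin Add (Bin Mul (Var 0) (Var 0)) (Const 1)).
(** The top digit is one more than the vertex, so that 0 can mean none. *)
Definition eB3 e := Bin Mul (Bin Mul (Bin Mul (Var 3) (Var 3)) (Var 3)) (Bin Add e (Const 1)).

(* If no stored vertex of the tour of the vertex in [a] carries its weight, that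
   vertex takes over; [b] tells whether it must also be given a color. *)
Definition claim (b : bool) a :=
  Assign 20 (Const 0) ;; Assign 21 (Var a) ;; Assign 22 (Var a) ;; nodes ;; splay 25 ;;
  If (eD3 (Fd 4 (Var 25))) Skip
    ((if b then SetStored (Var 21) (Const 0) else Skip) ;; setat 25 (eB3 (Var 21))).

Section Claim.
Variables (w n L : nat).
Hypothesis n0 : 0 < n.
Notation B := (n * n).+1.
Notation N := (maxnd n L).
Notation Wb := (B * B * B * n).
Hypothesis hN : N * 8 + 16 <= 2 ^ w.
Hypothesis hW : N * Wb < 2 ^ w.
Hypothesis hL : forall k, 2 ^ k <= n * n -> k <= L.
Notation vx := (vx n).
Notation conn := (conn n).
Notation cu := (cu N).
Notation St := (St n L).
Notation D3 := (D3 B).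
Notation cuge := (cuge hN hW).

Lemma n_lt : n < 2 ^ w.
Proof. by apply: leq_ltn_trans (Wb_lt n0 hW); rewrite leq_pmull. Qed.

Lemma eval_B3 vs m tb e x : vs 3 = B -> eval w (State vs m tb) e = x -> x < n ->
  eval w (State vs m tb) (eB3 e) = B * B * B * x.+1.
Proof.
move=> h3 he xn; have lt1 : x + 1 < 2 ^ w by rewrite addn1; apply: leq_ltn_trans xn n_lt.
have lt2 : B * B * B * x.+1 < 2 ^ w by apply: leq_ltn_trans (Wb_lt n0 hW); rewrite leq_mul2l xn orbT.
have h3' : eval w (State vs m tb) (Var 3) = B by [].
apply: (eval_bin (o := Mul) _ _ lt2).
  apply: (eval_bin (o := Mul) (x := B * B) (y := B)) => //.
    apply: (eval_bin (o := Mul) (x := B) (y := B)) => //.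
    exact: leq_ltn_trans (BB_le n0) (Wb_lt n0 hW).
  exact: leq_ltn_trans (B3_le n0) (Wb_lt n0 hW).
by rewrite -[RHS]addn1; apply: eval_add => //; apply: (eval_cst hN).
Qed.

Lemma setat_vertex_ok vs m tb t r F st c p v e k x Q : St m F st c p -> x < n -> vs v = vx 0 x ->
  v < 50 -> cost e <= 10 -> k <= n ->
  (forall vs' m', (forall i, i < 50 -> vs' i = vs i) -> eval w (State vs' m' tb) e = B * B * B * k) ->
  (forall t' vs' m' p', t' + p' <= t + p + 2 * cu -> (forall i, i < 50 -> vs' i = vs i) ->
     St m' F st (upd c x k) p' -> Q t' r (State vs' m' tb)) ->
  wp w (setat v e) t r (State vs m tb) Q.
Proof.
move=> [hF hG] xn hv v50 ce kn he HQ; have [s sF xs] := tour_of n0 (conj hF hG) (leq0n L) xn.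
have hp := perm_to_rem sF.
apply: (setat_ok hN hW (FR_perm hp hF) xs hv v50 ce he) => [|t' vs' m' p' h1 h2 h3 h4].
  by rewrite leq_mul2l kn orbT.
apply: (HQ t' vs' m' p') => //; split; first by apply: FR_perm h4; rewrite perm_sym.
exact: (good_vertex n0 hG xn h2).
Qed.

Lemma tour_color m F st c p s x y : St m F st c p -> s \in F -> x < n -> y < n -> vx 0 x \in s ->
  conn F 0 x y ->
  (forall z, z < n -> conn F 0 x z -> z != y -> c z = 0) -> D3 (wsum (fd 3 m) s) = c y.
Proof.
move=> hS sF xn yn xs xy hc; have [_ hG] := hS; have hS' := St_struct hS.
apply: (sum_stored n0 hG sF yn); first by rewrite -(conn_tour hS' y sF xs).
by move=> z zn yz zy; apply: hc => //; apply: (conn_trans hS' xy).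
Qed.

Definition claimed (b : bool) F x c tb c' tb' (d : nat) :=
  [\/ (exists y, [/\ y < n, conn F 0 x y & c y != 0]) /\ [/\ c' = c, tb' = tb & d = 0] |
      (forall y, y < n -> conn F 0 x y -> c y = 0) /\
      [/\ c' = upd c x x.+1, tb' = (if b then upd tb x (Some false) else tb) & d <= b]].

Lemma claim_ok b vs m tb t r F st c p a x Q : St m F st c p -> vs 0 = n -> vs 3 = B ->
  vs a = x -> a < 20 -> x < n ->
  (forall y z, y < n -> z < n -> conn F 0 x y -> conn F 0 x z -> c y != 0 -> c z != 0 -> y = z) ->
  (forall t' vs' m' p' c' tb' d, t' + p' <= t + p + 6 * cu -> (forall k, k < 20 -> vs' k = vs k) ->
     St m' F st c' p' -> claimed b F x c tb c' tb' d -> Q t' (r + d) (State vs' m' tb')) ->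
  wp w (claim b a) t r (State vs m tb) Q.
Proof.
move=> hS h0 h3 ha a20 xn hu HQ; have hS' := St_struct hS.
have [s sF xs] := tour_of n0 hS (leq0n L) xn.
apply/wp_seq/(wp_assign (v := 0)); first exact: (eval_cst hN).
apply/wp_seq/(wp_assign (v := x)); first by rewrite /= /upd ltn_eqF.
apply/wp_seq/(wp_assign (v := x)); first by rewrite /= /upd !ltn_eqF // (ltn_trans a20).
apply/wp_seq/(nodes_ok n0 hN hW (i := 0) (x := x) (y := x)) => // t1 vs1 ht1 hvs1 _ _ e3 _.
have v1 k : k < 20 -> vs1 k = vs k.
  by move=> hk; rewrite hvs1 ?(ltn_trans hk) // /upd !ltn_eqF // (ltn_trans hk).
have e21 : vs1 21 = x by rewrite hvs1.
apply/wp_seq/(acc_ok hN hW hS sF xs e3) => t2 vs2 m2 p2 ht2 hw2 hvs2 hs2 hS2.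
have v2 k : k < 20 -> vs2 k = vs k by move=> hk; rewrite hvs2 ?v1 // (ltn_trans hk).
have h32 : vars (State vs2 m2 tb) 3 = B by rewrite /= v2.
have h225 : vs2 25 = vx 0 x by rewrite hvs2.
have h221 : vs2 21 = x by rewrite hvs2.
have ev := eval_D3 h32 (eval_sum hN tb hS2 sF hs2 h225) (tour_wsum_lt hW hS2 sF).
have xx : conn F 0 x x by apply: (conn_refl n0 hS').
case: (boolP (has (fun y => conn F 0 x y && (c y != 0)) (iota 0 n))) => [/hasP [y]|/hasPn hn].
  rewrite mem_iota => /= yn /andP [xy cy].
  rewrite (tour_color hS2 sF xn yn xs xy) in ev; last first.
    move=> z zn xz zy; apply/eqP; apply: contraNT zy => cz; apply/eqP; exact: hu.
  apply: wp_if; rewrite ev => cy0; last by rewrite cy0 in cy.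
  apply: wp_skip; rewrite -[r in Q _ r _]addn0; apply: (HQ _ vs2 m2 p2 c tb 0) => //.
    by move: ht1 ht2 cuge; rewrite /=; clear; lia.
  by left; split=> //; exists y.
have {}hn y : y < n -> conn F 0 x y -> c y = 0.
  by move=> yn xy; apply/eqP; have := hn y; rewrite mem_iota xy negbK => ->.
rewrite (tour_color hS2 sF xn xn xs xx) ?(hn x) // in ev; last by move=> z zn xz _; apply: hn.
apply: wp_if; rewrite ev // => _; apply: wp_seq.
have he tb' vs' m' : (forall i, i < 50 -> vs' i = vs2 i) ->
    eval w (State vs' m' tb') (eB3 (Var 21)) = B * B * B * x.+1.
  by move=> g; apply: eval_B3; rewrite //= g // v2.
case: b HQ => HQ.
  apply: (wp_set_stored (x := x) (v := 0)) => //; first exact: (eval_cst hN).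
  apply: (setat_vertex_ok hS2 xn h225 _ _ xn (he _)) => // t3 vs3 m3 p3 ht3 hvs3 hS3.
  apply: (HQ t3 vs3 m3 p3 _ (upd tb x (Some false)) _ _ _ hS3).
  - by move: ht1 ht2 ht3 cuge; rewrite /=; clear; lia.
  - by move=> k hk; rewrite hvs3 ?v2 // (ltn_trans hk).
  - by right; split=> //; split=> //; case: (_ != _).
apply: wp_skip.
apply: (setat_vertex_ok hS2 xn h225 _ _ xn (he _)) => // t3 vs3 m3 p3 ht3 hvs3 hS3.
rewrite -[r in Q _ r _]addn0; apply: (HQ t3 vs3 m3 p3 _ tb 0 _ _ hS3).
- by move: ht1 ht2 ht3 cuge; rewrite /=; clear; lia.
- by move=> k hk; rewrite hvs3 ?v2 // (ltn_trans hk).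
- by right.
Qed.

(* A vertex may carry a color without carrying its weight only while it is isolated. *)
Definition tabw F (c : nat -> nat) (tb : nat -> option bool) :=
  [/\ forall x, x < n -> c x = 0 \/ c x = x.+1,
      forall x, x < n -> c x != 0 -> tb x != None,
      forall x y, x < n -> y < n -> tb x != None -> tb y != None -> conn F 0 x y -> x = y &
      forall x y, x < n -> y < n -> tb x != None -> c x = 0 -> conn F 0 x y -> x = y].

Definition hast F (tb : nat -> option bool) x := exists y, [/\ y < n, conn F 0 x y & tb y != None].

Lemma tabw_sub F F' c tb : (forall x y, x < n -> y < n -> conn F' 0 x y -> conn F 0 x y) ->
  tabw F c tb -> tabw F' c tb.
Proof.
move=> h [h1 h2 h3 h4]; split=> // x y xn yn g1 g2; first by move=> /(h _ _ xn yn); apply: h3.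
by move=> /(h _ _ xn yn); apply: h4.
Qed.

Lemma hast_sub F F' tb x : (forall y, y < n -> conn F 0 x y -> conn F' 0 x y) ->
  hast F tb x -> hast F' tb x.
Proof. by move=> h [y [yn xy ty]]; exists y; split=> //; apply: h. Qed.

Lemma tabw_uniq F wt c tb x : struct n L B F wt -> tabw F c tb ->
  forall y z, y < n -> z < n -> conn F 0 x y -> conn F 0 x z -> c y != 0 -> c z != 0 -> y = z.
Proof.
move=> hS [h1 h2 h3 h4] y z yn zn xy xz cy cz; apply: h3; rewrite ?h2 //.
by rewrite conn_sym in xy; apply: (conn_trans hS xy).
Qed.

(** If no vertex of the tour carries its weight, a colored one can only be isolated, hence [x]
    itself; so coloring [x] creates no second stored vertex. *)
Lemma claimed_true F wt x c tb c' tb' d : struct n L B F wt -> x < n -> tabw F c tb ->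
  claimed true F x c tb c' tb' d ->
  [/\ tabw F c' tb', hast F tb' x, forall y, tb y != None -> tb' y != None,
      forall y, c y != 0 -> c' y != 0 & d <= 1].
Proof.
move=> hS xn ht; have [h1 h2 h3 h4] := ht.
case=> [[[y [yn xy cy]] [-> -> ->]]|[hn [-> -> hd]]].
  by split=> //; exists y; split=> //; apply: h2.
have xx : conn F 0 x x by apply: (conn_refl n0 hS).
have st y : y < n -> conn F 0 x y -> tb y != None -> y = x.
  by move=> yn xy ty; apply: h4; rewrite ?hn // conn_sym.
split=> //.
- split=> [y yn|y yn|y z yn zn|y z yn zn]; rewrite /upd.
  + by case: (y =P x) => [->|_]; [right | apply: h1].
  + by case: (y =P x) => // _; apply: h2.
  + case: (y =P x) => [->|_]; case: (z =P x) => [->|_] //; last exact: h3.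
      by move=> _ tz xz; rewrite (st z).
    by move=> ty _ yx; rewrite (st y) // conn_sym.
  + by case: (y =P x) => // _; apply: h4.
- by exists x; split=> //; rewrite /upd eqxx.
- by move=> y; rewrite /upd; case: (y =P x).
- by move=> y; rewrite /upd; case: (y =P x).
Qed.

(** Some vertex of the tour has a color. If none carries its weight, that vertex is isolated, hence
    equal to [x], and the table can stay as it is. *)
Lemma claimed_false F wt x c tb c' tb' d : struct n L B F wt -> x < n -> tabw F c tb -> hast F tb x ->
  claimed false F x c tb c' tb' d ->
  [/\ tabw F c' tb, tb' = tb, exists y, [/\ y < n, conn F 0 x y & c' y != 0],
      forall y, c y != 0 -> c' y != 0 & d = 0].
Proof.
move=> hS xn ht [z [zn xz tz]]; have [h1 h2 h3 h4] := ht.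
case=> [[[y [yn xy cy]] [-> -> ->]]|[hn [-> -> hd]]].
  by split=> //; exists y.
have xx : conn F 0 x x by apply: (conn_refl n0 hS).
have st y : y < n -> conn F 0 x y -> tb y != None -> y = x.
  by move=> yn xy ty; apply: h4; rewrite ?hn // conn_sym.
split=> //.
- split=> [y yn|y yn|y u yn un|y u yn un]; rewrite /upd.
  + by case: (y =P x) => [->|_]; [right | apply: h1].
  + by case: (y =P x) => [->|_]; [rewrite -(st z) | apply: h2].
  + exact: h3.
  + by case: (y =P x) => // _; apply: h4.
- by exists x; split=> //; rewrite /upd eqxx.
- by move=> y; rewrite /upd; case: (y =P x).
- by apply/eqP; rewrite -leqn0.
Qed.
End Claim.

(** * Updates and queries *)

Definition end_nodes := Assign 20 (Const 0) ;; Assign 21 (Var 1) ;; Assign 22 (Var 2) ;; nodes.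

(** At its own level a tree edge weighs [1 + B] and a non-tree edge [B * B], which the test tells
    apart. *)
Definition delete_edge :=
  set_base ;; Assign 6 (Const 0) ;; end_nodes ;; level_search ;;
  If (Bin Lt (Fd 3 (Var 23)) eBB)
    (Assign 20 (Bin Add (Var 20) (Const 1)) ;; Assign 5 (Var 20) ;; cut_loop ;; search ;;
     If (Var 6) Skip (claim true 1 ;; claim true 2))
    half_del.

(** Both tours need a named stored vertex before a link: that of [v] is read from the sum in order
    to be erased, and that of [u] may cease to be isolated. *)
Definition insert_edge :=
  set_base ;; claim false 1 ;; claim false 2 ;; end_nodes ;; (splay 25 ;; splay 26) ;;
  Assign 15 (Fd 2 (Var 25)) ;;
  If (Var 15) half_add
    (splay 26 ;; Assign 27 (Bin Defs.Sub (eD3 (Fd 4 (Var 26))) (Const 1)) ;;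
     SetStored (Var 27) (Const 2) ;; Assign 28 (ndE (Const 0) (Var 27) (Var 27)) ;;
     setat 28 (Const 0) ;; link_edge eMk).

(** The arcs before the vertex and those before the stored vertex together have the parity of their
    distance. A top digit 0 means an isolated vertex, which stores its own color. *)
Definition get_color :=
  set_base ;; Assign 2 (Var 1) ;; end_nodes ;; splay 25 ;; Assign 12 (eD3 (Fd 4 (Var 25))) ;;
  If (Var 12)
    (Assign 13 (eD0 (Fd 4 (Fd 0 (Var 25)))) ;; Assign 27 (Bin Defs.Sub (Var 12) (Const 1)) ;;
     Assign 28 (ndE (Const 0) (Var 27) (Var 27)) ;; splay 28 ;;
     Assign 0 (Bin Mod (Bin Add (Bin Add (Var 13) (eD0 (Fd 4 (Fd 0 (Var 28))))) (Stored (Var 27)))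
       (Const 2)))
    (Assign 0 (Stored (Var 1))).

Section Updates.
Variables (w n L : nat).
Hypothesis n0 : 0 < n.
Notation B := (n * n).+1.
Notation N := (maxnd n L).
Notation Wb := (B * B * B * n).
Hypothesis hN : N * 8 + 16 <= 2 ^ w.
Hypothesis hW : N * Wb < 2 ^ w.
Hypothesis hL : forall k, 2 ^ k <= n * n -> k <= L.
Notation nd := (nd n).
Notation vx := (vx n).
Notation conn := (conn n).
Notation cross := (cross n).
Notation cu := (cu N).
Notation B2 := (B2 n0).
Notation St := (St n L).
Notation dyn := (dyn n L).
Notation epot := (epot n L).
Notation sr := (sr n).
Notation ds := (ds n).
Notation cuge := (cuge hN hW).
Notation kc := (kc n L).
Notation tabw := (tabw n).
Notation hast := (hast n).

(** No level is open; the zeros after the empty interval are placeholders for the ends of a removed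
    edge. *)
Definition inv m F st c (tb : nat -> option bool) p :=
  [/\ St m F st c p, dyn F st 0 0 0 0, marked st, tabw F c tb & forall x, x < n -> hast F tb x].

Lemma epot_ext st st' : (forall x y, st x y = st' x y) -> epot st = epot st'.
Proof. by move=> E; rewrite /epot; congr sumn; apply: eq_map => -[x y]; rewrite E. Qed.

Lemma set_base_ok vs m tb t r Q : vs 0 = n ->
  Q (t + 6) r (State (upd vs 3 B) m tb) -> wp w set_base t r (State vs m tb) Q.
Proof.
move=> h0 HQ; apply: (wp_assign (v := B)) => //; rewrite -[RHS]addn1.
have hB := B_lt n0 hW; have h0' : eval w (State vs m tb) (Var 0) = n by [].
apply: eval_add; [|exact: (eval_cst hN)|by rewrite addn1].
by apply: (eval_bin (o := Mul) h0' h0'); apply: ltnW.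
Qed.

Lemma end_nodes_ok vs m tb t r u v Q : vs 0 = n -> vs 1 = u -> vs 2 = v -> u < n -> v < n ->
  (forall t' vs', t' <= t + 2 * cu -> (forall i, i < 20 -> vs' i = vs i) ->
     vs' 20 = 0 -> vs' 21 = u -> vs' 22 = v ->
     vs' 23 = nd 0 u v -> vs' 24 = nd 0 v u -> vs' 25 = vx 0 u -> vs' 26 = vx 0 v ->
     Q t' r (State vs' m tb)) ->
  wp w end_nodes t r (State vs m tb) Q.
Proof.
move=> h0 h1 h2 un vn HQ.
apply/wp_seq/(wp_assign (v := 0)); first exact: (eval_cst hN).
apply/wp_seq/(wp_assign (v := u)) => //.
apply/wp_seq/(wp_assign (v := v)) => //.
apply: (nodes_ok n0 hN hW (i := 0) (x := u) (y := v)) => // t1 vs1 ht1 hvs1 e1 e2 e3 e4.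
apply: HQ => //; rewrite ?hvs1 //.
  by move: ht1 cuge; rewrite /=; clear; lia.
by move=> k hk; rewrite hvs1 ?(ltn_trans hk) // /upd !ltn_eqF // (ltn_trans hk).
Qed.

Lemma marked_edg st x y : marked st -> edg (st x y) = false -> st x y = Un 0.
Proof. by move=> /(_ x y); case: (st x y) => // a ->. Qed.

Lemma delete_edge_ok vs m tb t r F st c p u v Q : inv m F st c tb p ->
  vs 0 = n -> vs 1 = u -> vs 2 = v -> u < n -> v < n -> u != v -> edg (st u v) ->
  (forall t' vs' m' p' F' st' c' tb' d,
     t' + p' + kc * epot st' <= t + p + kc * epot st + 150 * L.+2 * cu ->
     inv m' F' st' c' tb' p' ->
     (forall x y, edg (st' x y) = edg (setst st u v (Un 0) x y)) -> d <= 1 ->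
     Q t' (r + d) (State vs' m' tb')) ->
  wp w delete_edge t r (State vs m tb) Q.
Proof.
move=> [hS hd hm ht hh] h0 h1 h2 un vn uv he HQ.
have [_ hG] := hS; have hS0 := St_struct hS.
have sym : forall a b, st a b = st b a by case: hG => _ _ [].
have [l lL hst] : exists2 l, l <= L & st u v = Mk l \/ st u v = Hf l.
  case: hG => _ _ [_ /(_ u v) hl] _; move: (hm u v) he hl; case: (st u v) => a.
  - by move=> ->.
  - by exists a => //; left.
  - by exists a => //; right.
apply/wp_seq/set_base_ok => //.
apply/wp_seq/(wp_assign (v := 0)); first exact: (eval_cst hN).
apply/wp_seq/(end_nodes_ok (u := u) (v := v)) => //.
move=> t1 vs1 ht1 hvs1 h20 h21 h22 h23 h24 _ _.
have h31 : vs1 3 = B by rewrite hvs1.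
have h61 : vs1 6 = 0 by rewrite hvs1.
have v1 k : k < 3 -> vs1 k = vs k.
  by move=> hk; rewrite hvs1 ?(ltn_trans hk) // /upd !ltn_eqF // (ltn_trans hk).
apply/wp_seq/(level_search_ok n0 hN hW hS _ h31 h20 h21 h22 h23 h24 un vn uv lL hst) => //.
  by rewrite v1.
move=> t2 vs2 ht2 hvs2 k20 k21 k22 k23 k24.
have v2 k : k < 3 -> vs2 k = vs k by move=> hk; rewrite hvs2 ?v1 // (ltn_trans hk).
have h32 : vs2 3 = B by rewrite hvs2.
have h62 : vs2 6 = 0 by rewrite hvs2.
have hw2 : fd 3 m (nd l u v) = W B (st u v) l by case: hG => _ -> //; rewrite /WT (negbTE uv).
have hN2 : nd l u v <= N by case/andP: (okn_nd n0 lL un vn).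
have ev : eval w (State vs2 m tb) (Bin Lt (Fd 3 (Var 23)) eBB) = (W B (st u v) l < B * B).
  apply: (eval_bin (o := Lt)); [by rewrite (eval_Fd hN (x := nd l u v)) // hw2 | | exact: (nat_of_bool_lt n0 hW)].
  apply: (eval_bin (s := State vs2 m tb) (o := Mul) (a := Var 3) (b := Var 3) h32 h32).
  exact: leq_ltn_trans (BB_le n0) (Wb_lt n0 hW).
have sub_ext st1 : (forall x y, st1 x y = setst st u v (Un 0) x y) ->
    epot st1 <= epot st /\ marked st1.
  move=> E; split; last by move=> x y; rewrite E; apply: (marked_set u v hm (s := Un 0)).
  rewrite (epot_ext E); have := epot_set L (Un 0) un vn uv (sym u v).
  by rewrite [lvp L (Un 0)]/= muln0 addn0 => <-; apply: leq_addr.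
have kcle st1 : epot st1 <= epot st -> kc * epot st1 <= kc * epot st by move=> e; rewrite leq_mul2l e orbT.
apply: wp_if; rewrite ev => hlt; last first.
  have hst' : st u v = Hf l.
    case: hst => // E; have EW : W B (Mk l) l = 1 + B by rewrite /W ltnn eqxx.
    suff h : 1 + B < B * B by rewrite E EW h in hlt.
    apply: (@leq_trans (2 * B)); first by rewrite mul2n -addnn ltn_add2r B2.
    by rewrite leq_mul2r B2 orbT.
  apply: (half_del_ok n0 hN hW hS k23 k24 lL un vn uv hst') => t3 vs3 m3 p3 F3 ht3 hvs3 hS3 hc3.
  set st3 := setst st u v (Un 0) in hS3.
  have [es ms] := sub_ext st3 (fun _ _ => erefl).
  rewrite -[r]addn0; apply: (HQ t3 vs3 m3 p3 F3 st3 c tb 0) => //.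
  - have := kcle _ es; have [] := level_cost n L; move: ht1 ht2 ht3 cuge.
    by rewrite -!mulnA; move: (L.+2 * cu) (L.+1 * cu) => X Y /=; clear; lia.
  - split=> //.
    + apply: (dyn_same (F := F) (st := st)) => //.
        by move=> i x y _ _; apply: setst_tarc; rewrite // hst'.
      by move=> x y i _ _; rewrite /st3 setst_isxy; case: ifP => // _; left.
    + by apply: tabw_sub ht => x y xn yn; rewrite hc3.
    + by move=> x xn; apply: hast_sub (hh x xn) => y yn; rewrite hc3.
have hst' : st u v = Mk l.
  case: hst => // E; have EW : W B (Hf l) l = B * B by rewrite /W eqxx.
  by rewrite E EW ltnn in hlt.
apply/wp_seq/(wp_assign (v := l.+1)); first by apply: (eval_var_succ n0 hN); [exact: k20 | exact: leqW].
apply/wp_seq/(wp_assign (v := l.+1)) => //.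
have hd' : dyn F st l.+1 l.+1 u v by apply: dyn_empty hd.
apply/wp_seq/(cut_loop_ok n0 hN hW hS hd' (vs := upd _ _ _)) => //; first by rewrite /upd /= v2.
move=> t3 vs3 m3 p3 F3 st3 ht3 hvs3 hS3 hst3 hd3 hc3.
have [es ms] := sub_ext st3 hst3.
have v3 k : k < 3 -> vs3 k = vs k.
  by move=> hk; rewrite hvs3 ?(ltn_trans hk) // /upd !ltn_eqF ?(ltn_trans hk) // v2.
have v33 : vs3 3 = B by rewrite hvs3.
have v35 : vs3 5 = l.+1 by rewrite hvs3.
have v36 : vs3 6 = 0 by rewrite hvs3.
apply/wp_seq/(search_ok n0 hN hW hL hS3 hd3 ms) => //; rewrite ?v33 ?v35 ?v36 ?v3 //.
move=> t4 vs4 m4 p4 F4 st4 ht4 hvs4 hS4 hd4 hm4 he4 hc4.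
have v4 k : k < 3 -> vs4 k = vs k by move=> hk; rewrite hvs4 ?v3 // (ltn_trans hk).
have hd40 : dyn F4 st4 0 0 0 0 by apply: dyn_empty hd4.
have hes x y : edg (st4 x y) = edg (setst st u v (Un 0) x y) by rewrite he4 hst3.
have hb : t4 + p4 + kc * epot st4 <= t + p + kc * epot st + 140 * L.+2 * cu.
  have l1 : l.+1 * cu <= L.+1 * cu by rewrite leq_mul2r ltnS lL orbT.
  have := kcle _ es; have [] := level_cost n L; move: ht1 ht2 ht3 ht4 l1 cuge; rewrite -!mulnA.
  by move: (L.+2 * cu) (L.+1 * cu) (l.+1 * cu) => X Y Z /=; clear; lia.
have hS4' := St_struct hS4.
apply: wp_if; rewrite [eval _ _ _]/= => h6.
  rewrite h6 /= in hc4.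
  have hcE x y : x < n -> y < n -> conn F4 0 x y = conn F 0 x y by move=> xn yn; rewrite hc4 // hc3.
  apply: wp_skip; rewrite -[r in Q _ r _]addn0; apply: (HQ _ vs4 m4 p4 F4 st4 c tb 0) => //.
    have [] := level_cost n L; move: hb cuge.
    by rewrite -!mulnA; move: (L.+2 * cu) (L.+1 * cu) => X Y /=; clear; lia.
  split=> //; first by apply: tabw_sub ht => x y xn yn; rewrite hcE.
  by move=> x xn; apply: hast_sub (hh x xn) => y yn; rewrite hcE.
rewrite h6 /= in hc4.
have hcE x y : x < n -> y < n -> conn F 0 x y = conn F4 0 x y || cross F4 0 u v x y.
  by move=> xn yn; rewrite hc3 // /cross !hc4 //= !orbF.
have h34 : vs4 3 = B.
  by rewrite hvs4.
have ht4w : tabw F4 c tb by apply: tabw_sub ht => x y xn yn; rewrite hcE // => ->.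
apply/wp_seq/(claim_ok n0 hN hW hS4 (a := 1) (x := u)) => //; rewrite ?v4 //.
  exact: (tabw_uniq hS4' ht4w).
move=> t5 vs5 m5 p5 c5 tb5 d5 ht5 hvs5 hS5 hcl5.
have [ht5w hh5 up5 cp5 d5le] := claimed_true n0 hS4' un ht4w hcl5.
have v5 k : k < 3 -> vs5 k = vs k by move=> hk; rewrite hvs5 ?v4 // (ltn_trans hk).
have v53 : vs5 3 = B by rewrite hvs5.
apply: (claim_ok n0 hN hW hS5 (a := 2) (x := v)) => //; rewrite ?v53 ?v5 //.
  exact: (tabw_uniq hS4' ht5w).
move=> t6 vs6 m6 p6 c6 tb6 d6 ht6 hvs6 hS6 hcl6.
have [ht6w hh6 up6 cp6 d6le] := claimed_true n0 hS4' vn ht5w hcl6.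
rewrite -addnA; apply: (HQ t6 vs6 m6 p6 F4 st4 c6 tb6 (d5 + d6)) => //.
- have [] := level_cost n L; move: hb ht5 ht6 cuge.
  by rewrite -!mulnA; move: (L.+2 * cu) (L.+1 * cu) => X Y /=; clear; lia.
- split=> // x xn; have [y [yn xy ty]] := hh x xn.
  have T a b d : conn F4 0 a b -> conn F4 0 b d -> conn F4 0 a d by apply: (conn_trans hS4').
  have hu : conn F4 0 x u -> hast F4 tb6 x.
    by move=> xu; have [z [zn uz tz]] := hh5; exists z; split; [|apply: T uz|apply: up6].
  have hv : conn F4 0 x v -> hast F4 tb6 x.
    by move=> xv; have [z [zn vz tz]] := hh6; exists z; split; [|apply: T vz|].
  rewrite hcE // in xy; case/orP: xy => [xy|/orP [] /andP [g1 g2]].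
  + by exists y; split=> //; apply/up6/up5.
  + exact: hu.
  + exact: hv.
(* The tour had one stored vertex; the side that kept it is not recolored. *)
have [y [yn uy ty]] := hh u un.
have uvc : conn F 0 u v by rewrite hcE // /cross !(conn_refl n0 hS4') ?orbT.
(* A stored vertex without its weight would be isolated, but this one shares its old tour with both
   [u] and [v]. *)
have cy : c y != 0.
  have [_ _ _ g4] := ht; apply/eqP => cy0; case/eqP: uv.
  rewrite -(g4 y u) //; last by rewrite conn_sym.
  by apply: (g4 y v) => //; rewrite conn_sym in uy; apply: (conn_trans hS0 uy).
have : conn F4 0 u y || conn F4 0 v y.
  by move: uy; rewrite hcE // => /orP [->//|/orP [] /andP [_]]; rewrite conn_sym => ->; rewrite ?orbT.
case/orP => hy.
  have d50 : d5 = 0 by case: hcl5 => [[_ []]//|[/(_ y yn hy) g]]; rewrite g in cy.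
  by rewrite d50.
have d60 : d6 = 0 by case: hcl6 => [[_ []]//|[/(_ y yn hy) g]]; have := cp5 y cy; rewrite g.
by rewrite d60 addn0.
Qed.

(** At level 0 the size bound is [n * n], which every component meets, so a new tree edge always
    fits. *)
Lemma dyn_link0 F F' st x y : (forall p q, st p q = st q p) -> st x y = Un 0 -> x < n -> y < n ->
  (forall i p q, p < n -> q < n -> conn F' i p q = conn F i p q || (i == 0) && cross F 0 x y p q) ->
  dyn F st 0 0 0 0 -> dyn F' (setst st x y (Mk 0)) 0 0 0 0.
Proof.
move=> sym hst xn yn hc [h1 h2 h3 h4]; split=> //.
- move=> [|i] z iL zn; first by rewrite muln1 cnt_le.
  apply: leq_trans (h1 i.+1 z iL zn); rewrite leq_mul2r; apply/orP; right.
  apply: cnt_sub => p q pn qn _; rewrite setst_tarc //; last by rewrite hst.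
  by rewrite hc // orbF.
- move=> p q i pn qn; rewrite setst_isxy; case: ifP => // _ /(h3 p q i pn qn).
  by rewrite hc // orbF => ->.
Qed.

Lemma insert_edge_ok vs m tb t r F st c p u v Q : inv m F st c tb p ->
  vs 0 = n -> vs 1 = u -> vs 2 = v -> u < n -> v < n -> u != v -> edg (st u v) = false ->
  (forall t' vs' m' p' F' st' c' tb' d,
     t' + p' + kc * epot st' <= t + p + kc * epot st + 100 * L.+2 * cu ->
     inv m' F' st' c' tb' p' ->
     (forall x y, edg (st' x y) = edg (setst st u v (Mk 0) x y)) -> d <= 1 ->
     Q t' (r + d) (State vs' m' tb')) ->
  wp w insert_edge t r (State vs m tb) Q.
Proof.
move=> [hS hd hm ht hh] h0 h1 h2 un vn uv he HQ.
have hst := marked_edg hm he; have hS0 := St_struct hS.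
apply/wp_seq/set_base_ok => //; set vs0 := upd vs 3 B.
apply/wp_seq/(claim_ok n0 hN hW hS (vs := vs0) (a := 1) (x := u)) => //.
  exact: (tabw_uniq hS0 ht).
move=> t1 vs1 m1 p1 c1 tb1 d1 ht1 hvs1 hS1 hcl1.
have [ht1w E1 hc1 cp1 d10] := claimed_false n0 hS0 un ht (hh u un) hcl1.
rewrite {}E1 {}d10 addn0 in hcl1 *.
have v1 k : k < 3 -> vs1 k = vs k by move=> hk; rewrite hvs1 ?(ltn_trans hk) // /vs0 /upd ltn_eqF.
have v13 : vs1 3 = B by rewrite hvs1.
apply/wp_seq/(claim_ok n0 hN hW hS1 (a := 2) (x := v)) => //; rewrite ?v1 //.
  exact: (tabw_uniq hS0 ht1w).
move=> t2 vs2 m2 p2 c2 tb2 d2 ht2 hvs2 hS2 hcl2.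
have [ht2w E2 hc2 cp2 d20] := claimed_false n0 hS0 vn ht1w (hh v vn) hcl2.
rewrite {}E2 {}d20 addn0 in hcl2 *.
have {}hc1 : exists y, [/\ y < n, conn F 0 u y & c2 y != 0].
  by have [y [yn uy cy]] := hc1; exists y; split=> //; apply: cp2.
have v2 k : k < 4 -> vs2 k = vs0 k by move=> hk; rewrite hvs2 ?hvs1 // (ltn_trans hk).
apply/wp_seq/(end_nodes_ok (u := u) (v := v)) => //; rewrite ?v2 //.
move=> t3 vs3 ht3 hvs3 h20 h21 h22 h23 h24 h25 h26.
have [s sF us] := tour_of n0 hS2 (leq0n L) un.
have [_ hG2] := hS2; have vF : vx 0 v \in flatten F by apply: (good_vx n0 hG2).
have uvx : vx 0 u != vx 0 v by apply: contraNneq uv => /(congr1 sr); rewrite !sr_nd // => ->.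
apply/wp_seq/(conn_test_ok hN hW hS2 sF us vF uvx h25 h26) => // t4 vs4 m4 p4 ht4 hw4 hvs4 hcn hS4.
rewrite -(conn_tour hS0 v sF us) in hcn.
have [_ hG4] := hS4; have hN2 : vx 0 u <= N by case/andP: (okn_nd n0 (leq0n L) un un).
have sym : forall a b, st a b = st b a by case: hG4 => _ _ [].
set d := fd 2 m4 (vx 0 u) in hcn.
apply/wp_seq/(wp_assign (v := d)).
  by rewrite (eval_Fd hN (x := vx 0 u)) //= hvs4.
set vs5 := upd vs4 15 d.
have v5 k : 15 < k < 50 -> vs5 k = vs3 k by move=> /andP [g1 g2]; rewrite /vs5 /upd gtn_eqF // hvs4.
have l5 k : k < 4 -> vs5 k = vs0 k.
  move=> hk; rewrite /vs5 /upd ltn_eqF ?(ltn_trans hk) // hvs4 ?(ltn_trans hk) //.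
  by rewrite hvs3 ?v2 // (ltn_trans hk).
have h53 : vs5 3 = B by rewrite l5.
have ep s' : (s' = Hf 0 \/ s' = Mk 0) -> kc * epot (setst st u v s') <= kc * epot st + 40 * L.+1 * cu.
  move=> hs'; have := epot_set L s' un vn uv (sym u v).
  rewrite hst [lvp L (Un 0)]/= muln0 addn0 => ->.
  have -> : lvp L s' = L.+1 by case: hs' => -> /=; rewrite subn0.
  by rewrite mulnDr leq_add2l /kc mulnAC mulnA.
have ed s' : (s' = Hf 0 \/ s' = Mk 0) -> forall x y, edg (setst st u v s' x y) = edg (setst st u v (Mk 0) x y).
  by move=> hs' x y; rewrite !setst_isxy; case: ifP => //; case: hs' => ->.
apply: wp_if; rewrite [eval _ _ _]/= => hd0.
  have cuv : conn F 0 u v by rewrite -hcn.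
  have h523 : vs5 23 = nd 0 u v by rewrite v5.
  have h524 : vs5 24 = nd 0 v u by rewrite v5.
  have h525 : vs5 25 = vx 0 u by rewrite v5.
  have h526 : vs5 26 = vx 0 v by rewrite v5.
  apply: (half_add_ok n0 hN hW hS4 h53 h523 h524 h525 h526 (leq0n L) un vn uv hst).
  move=> t6 vs6 m6 p6 F6 ht6 hvs6 hS6 hc6.
  rewrite -[r]addn0; apply: (HQ t6 vs6 m6 p6 F6 _ c2 tb 0 _ _ (ed _ (or_introl (erefl _)))) => //.
    have := ep (Hf 0) (or_introl (erefl _)); have [] := level_cost n L; move: ht1 ht2 ht3 ht4 ht6 cuge.
    by rewrite -!mulnA; move: (L.+2 * cu) (L.+1 * cu) => X Y /=; clear; lia.
  split=> //.
  - apply: (dyn_same (F := F) (st := st)) => //.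
      by move=> i x y _ _; apply: setst_tarc; rewrite // hst.
    move=> x y i xn yn; rewrite setst_isxy; case: ifP => [e [<-]|_]; last by left.
    right; rewrite hc6 //; case/orP: e => /andP [/= /eqP -> /eqP ->] //.
    by rewrite conn_sym.
  - exact: marked_set.
  - by apply: tabw_sub ht2w => x y xn yn; rewrite hc6.
  - by move=> x xn; apply: hast_sub (hh x xn) => y yn; rewrite hc6.
have nuv : ~~ conn F 0 u v by rewrite -hcn (hd0 : d = 0).
have [z [zn vz cz]] := hc2; have [g1 g2 g3 g4] := ht2w.
have cE : c2 z = z.+1 by case: (g1 z zn) => // E; rewrite E in cz.
have [s' s'F vs'_] := tour_of n0 hS4 (leq0n L) vn.
have h526 : vs5 26 = vx 0 v by rewrite v5.
apply/wp_seq/(acc_ok hN hW hS4 s'F vs'_ h526) => t6 vs6 m6 p6 ht6 hw6 hvs6 hs6 hS6.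
have l6 k : k < 4 -> vs6 k = vs0 k by move=> hk; rewrite hvs6 ?l5 // (ltn_trans hk).
have h36 : vars (State vs6 m6 tb) 3 = B by rewrite /= l6.
have h626 : vs6 26 = vx 0 v by rewrite hvs6.
have ev := eval_D3 h36 (eval_sum hN tb hS6 s'F hs6 h626) (tour_wsum_lt hW hS6 s'F).
rewrite (tour_color n0 hS6 s'F vn zn vs'_ vz) ?cE in ev; last first.
  move=> a an va az; apply/eqP; apply: contraNT az => ca; apply/eqP.
  exact: (tabw_uniq hS0 ht2w (x := v)).
have zw : z.+1 < 2 ^ w by apply: leq_ltn_trans zn (n_lt n0 hW).
apply/wp_seq/(wp_assign (v := z)).
  rewrite -[RHS]subn0 -subSS; apply: (eval_bin (o := Defs.Sub) ev); first exact: (eval_cst hN).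
  by rewrite /= subSS subn0 ltnW.
(* The word 2 stands for no color. This is the only change of the table during an insertion. *)
apply/wp_seq/(wp_set_stored (x := z) (v := 2)) => //; first exact: (eval_cst hN).
apply/wp_seq/(wp_assign (v := vx 0 z)).
  by apply: (eval_ndE n0 hN) => //; [rewrite /= /upd /= l6 | exact: (eval_cst hN)].
set vs7 := upd _ 28 _; set tb7 := upd tb z _.
have v7 k : k < 27 -> vs7 k = vs5 k.
  by move=> hk; rewrite /vs7 /upd !ltn_eqF ?hvs6 // (ltn_trans hk).
have e28 : vs7 28 = vx 0 z by [].
apply/wp_seq/(setat_vertex_ok n0 hN hW hS6 zn e28 (k := 0)) => //.
  by move=> vs' m' _; rewrite muln0; apply: (eval_cst hN).
move=> t8 vs8 m8 p8 ht8 hvs8 hS8.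
have v8 k : k < 27 -> vs8 k = vs5 k by move=> hk; rewrite hvs8 ?v7 // (ltn_trans hk).
have he8 vs' m' : (forall j, j < 23 -> vs' j = vs8 j) ->
    eval w (State vs' m' tb7) eMk = W B (Mk 0) 0.
  move=> g; have gg : vs' 3 = B by rewrite g // v8.
  rewrite /W ltnn eqxx; apply: eval_add; [exact: (eval_cst hN) | exact: gg |].
  exact: leq_ltn_trans (B1_le n0) (Wb_lt n0 hW).
apply: (link_edge_ok n0 hN hW hS8 _ _ _ _ (leq0n L) un vn uv hst (or_intror (erefl _)) nuv he8) => //.
- by rewrite v8 // l5.
- by rewrite v8 // v5.
- by rewrite v8 // v5.
- by rewrite v8 // v5.
move=> t9 vs9 m9 p9 F9 ht9 hvs9 hS9 hc9.
apply: (HQ t9 vs9 m9 p9 F9 _ (upd c2 z 0) tb7 _ _ _ (ed _ (or_intror (erefl _)))); last by case: (_ != _).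
  have := ep (Mk 0) (or_intror (erefl _)); have [] := level_cost n L; move: ht1 ht2 ht3 ht4 ht6 ht8 ht9 cuge.
  by rewrite -!mulnA; move: (L.+2 * cu) (L.+1 * cu) => X Y /=; clear; lia.
have tz : tb z != None by apply: g2.
have uz : ~~ conn F 0 u z.
  by apply: contra nuv => uz; rewrite conn_sym in vz; apply: (conn_trans hS0 uz).
have tb7E a : tb7 a = if a == z then None else tb a by [].
have T a b d' : conn F 0 a b -> conn F 0 b d' -> conn F 0 a d' by apply: (conn_trans hS0).
have cS a b : conn F 0 a b = conn F 0 b a by apply: conn_sym.
have hcF a b : a < n -> b < n -> conn F9 0 a b = conn F 0 a b || cross F 0 u v a b.
  by move=> an bn; rewrite hc9.
split=> //.
- exact: (dyn_link0 sym hst un vn hc9 hd).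
- exact: marked_set.
- split=> [x xn|x xn|x y xn yn|x y xn yn]; rewrite ?tb7E /upd.
  + by case: (x =P z) => _; [left | apply: g1].
  + by case: (x =P z) => // _; apply: g2.
  + case: (x =P z) => // xz; case: (y =P z) => // yz tx ty.
    have xv : ~~ conn F 0 x v.
      by apply/negP => xv; case: xz; apply: g3 => //; apply: (T _ v).
    have yv : ~~ conn F 0 y v.
      by apply/negP => yv; case: yz; apply: g3 => //; apply: (T _ v).
    by rewrite hcF // /cross (negbTE xv) (negbTE yv) !andbF !orbF; apply: g3.
  + case: (x =P z) => // xz tx cx.
    have xv : ~~ conn F 0 x v.
      by apply/negP => xv; case: xz; apply: g3 => //; apply: (T _ v).
    have xu : ~~ conn F 0 x u.
      have [a [an ua ca]] := hc1; apply/negP => xu.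
      have E : x = a by apply: g3 => //; [apply: g2 | apply: (T _ u)].
      by rewrite -E cx in ca.
    by rewrite hcF // /cross (negbTE xv) (negbTE xu) /= orbF; apply: g4.
- move=> x xn; have [a [an xa ta]] := hh x xn.
  case: (eqVneq a z) => [E|az]; last first.
    by exists a; rewrite tb7E (negbTE az) hcF // xa.
  (* Vertices that relied on the erased [z] are now connected to the stored vertex on the side of
     [u]. *)
  have [b [bn ub cb]] := hc1; have bz : b != z by apply: contraNneq uz => <-.
  exists b; rewrite tb7E (negbTE bz) hcF //; split=> //; last exact: g2.
  rewrite E in xa; apply/orP; right; apply/orP; right; rewrite (cS b) ub andbT.
  by apply: (T _ z) => //; rewrite cS.
Qed.

(* The digit sum left of a splayed node counts the arcs that precede it in the tour. *)
Lemma eval_prefix vs m tb va z s s1 s2 F st c p : St m F st c p -> s \in F -> seen N m z s ->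
  vs 3 = B -> vs va = z -> s = s1 ++ z :: s2 ->
  eval w (State vs m tb) (eD0 (Fd 4 (Fd 0 (Var va)))) = count (arc B (fd 3 m)) s1.
Proof.
move=> hS sF [_ _ h0N /andP [_ zN] hpre] h3 hv E; have [_ hG] := hS.
have ss : subseq s1 s by rewrite E prefix_subseq.
have [<- _ _ _] := sub_digits n0 hG sF ss.
apply: eval_D0 => //.
  rewrite -(hpre _ _ E) -[fd 4 m _]/(fd 4 (Defs.mem (State vs m tb)) (fd 0 m z)).
  by apply: (eval_Fd hN) => //; apply: (eval_Fd hN).
apply: leq_ltn_trans (tour_wsum_lt hW hS sF).
by rewrite E wsum_cat leq_addr.
Qed.

(** Proved for an arbitrary coloring that is proper and agrees with the table, so that the answers
    to all queries belong to one coloring. *)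
Lemma get_color_ok vs m tb t r F st c p v (col : nat -> bool) Q : inv m F st c tb p ->
  vs 0 = n -> vs 1 = v -> v < n ->
  (forall x y, x < n -> y < n -> x != y -> edg (st x y) -> col x != col y) ->
  (forall x b, x < n -> tb x = Some b -> col x = b) ->
  (forall t' (vs' : nat -> nat) m' p', t' + p' <= t + p + 10 * cu -> vs' 0 = col v -> St m' F st c p' ->
     Q t' r (State vs' m' tb)) ->
  wp w get_color t r (State vs m tb) Q.
Proof.
move=> [hS hd hm ht hh] h0 h1 vn hcol htb HQ; have hS0 := St_struct hS.
have evc vs' m' a x : vs' a = x -> x < n -> tb x != None ->
    eval w (State vs' m' tb) (Stored (Var a)) = col x.
  move=> ha xn; rewrite /= ha; case E: (tb x) => [b|//] _.
  by rewrite (htb x b xn E) /= modn_small // (nat_of_bool_lt n0 hW).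
apply/wp_seq/set_base_ok => //.
apply/wp_seq/(wp_assign (v := v)) => //.
apply/wp_seq/(end_nodes_ok (u := v) (v := v)) => //.
move=> t1 vs1 ht1 hvs1 h20 _ _ _ _ h25 _.
have [s sF xs] := tour_of n0 hS (leq0n L) vn.
apply/wp_seq/(acc_ok hN hW hS sF xs h25) => t2 vs2 m2 p2 ht2 hw2 hvs2 hs2 hS2.
have v2 k : k < 20 -> vs2 k = upd (upd vs 3 B) 2 v k by move=> hk; rewrite hvs2 ?hvs1 // (ltn_trans hk).
have h32 : vars (State vs2 m2 tb) 3 = B by rewrite /= v2.
have h225 : vs2 25 = vx 0 v by rewrite hvs2.
have ev := eval_D3 h32 (eval_sum hN tb hS2 sF hs2 h225) (tour_wsum_lt hW hS2 sF).
apply/wp_seq/(wp_assign ev); set vs3 := upd vs2 12 _.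
have vv : conn F 0 v v by apply: (conn_refl n0 hS0).
have [g1 g2 g3 g4] := ht.
case: (boolP (has (fun y => conn F 0 v y && (c y != 0)) (iota 0 n))) => [/hasP [y]|/hasPn hn]; last first.
  have {}hn y : y < n -> conn F 0 v y -> c y = 0.
    by move=> yn vy; apply/eqP; have := hn y; rewrite mem_iota vy negbK => ->.
  have e12 : vs3 12 = 0.
    by rewrite /vs3 /upd /= (tour_color n0 hS2 sF vn vn xs vv) ?(hn v) // => z zn vz _; apply: hn.
  apply: wp_if; rewrite [eval _ _ _]/= e12 // => _.
  have [z [zn vz tz]] := hh v vn.
  have E : z = v by apply: g4; rewrite ?hn // conn_sym.
  rewrite E in tz.
  apply: (wp_assign (v := col v)); first by apply: evc => //; rewrite /vs3 /upd /= v2.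
  apply: (HQ _ (upd vs3 0 (col v)) m2 p2) => //.
  by move: ht1 ht2 cuge; rewrite /=; clear; lia.
rewrite mem_iota => /= yn /andP [vy cy].
have cE : c y = y.+1 by case: (g1 y yn) => // E; rewrite E in cy.
have e12 : vs3 12 = y.+1.
  rewrite /vs3 /upd /= (tour_color n0 hS2 sF vn yn xs vy) ?cE // => z zn vz zy.
  by apply/eqP; apply: contraNT zy => cz; apply/eqP; apply: (tabw_uniq hS0 ht (x := v)).
have yw : y.+1 < 2 ^ w by apply: leq_ltn_trans yn (n_lt n0 hW).
apply: wp_if; rewrite [eval _ _ _]/= e12 // => _.
have [s1 [s2 Es]] := mem_split xs.
have h33 : vs3 3 = B by rewrite /vs3 /upd /= v2.
have h325 : vs3 25 = vx 0 v by rewrite /vs3 /upd /= h225.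
apply/wp_seq/(wp_assign (v := count (arc B (fd 3 m)) s1)).
  rewrite (eval_prefix tb hS2 sF hs2 h33 h325 Es).
  by apply: eq_count => z; rewrite /arc hw2.
apply/wp_seq/(wp_assign (v := y)).
  rewrite -[RHS]subn0 -subSS; apply: (eval_bin (o := Defs.Sub) (x := y.+1)); [exact: e12|exact: (eval_cst hN)|].
  by rewrite /= subSS subn0 ltnW.
apply/wp_seq/(wp_assign (v := vx 0 y)).
  by apply: (eval_ndE n0 hN) => //; [rewrite /vs3 /upd /= v2 | exact: (eval_cst hN)].
set vs4 := upd _ 28 _.
have ys : vx 0 y \in s by rewrite -(conn_tour hS0 y sF xs).
apply/wp_seq/(acc_ok hN hW hS2 sF ys (v := 28)) => // t5 vs5 m5 p5 ht5 hw5 hvs5 hs5 hS5.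
have [r1 [r2 Er]] := mem_split ys.
have h53 : vs5 3 = B by rewrite hvs5 // /vs4 /upd /= h33.
have h528 : vs5 28 = vx 0 y by rewrite hvs5.
have ev5 := eval_prefix tb hS5 sF hs5 h53 h528 Er.
have [_ hG] := hS; have [_ hw _ _] := hG.
have harc z : z \in s -> arc B (fd 3 m) z -> col (sr z) != col (ds z).
  move=> zs az; have [l1 l2 l3 l4 l5] := arc_tour n0 B2 hG sF zs az.
  by apply: hcol => //; move: (hm (sr z) (ds z)) l5; case: (st _ _) => // a ->.
have [_ _ /(_ s sF) [q [hwalk _]] _ _] := hS0.
have lz x : x < n -> lv n (vx 0 x) = 0 by move=> xn; apply: lv_nd.
have c1 : col v = col q (+) odd (count (arc B (fd 3 m)) s1).
  by apply: (tour_parity n0 harc vn (s2 := s2)) hwalk; rewrite lz.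
have c2 : col y = col q (+) odd (count (arc B (fd 3 m)) r1).
  by apply: (tour_parity n0 harc yn (s2 := r2)) hwalk; rewrite lz.
have e13 : vs5 13 = count (arc B (fd 3 m)) s1 by rewrite hvs5.
have e27 : vs5 27 = y by rewrite hvs5.
have ecol := evc vs5 m5 27 y e27 yn (g2 y yn cy).
have E5 : count (arc B (fd 3 m5)) r1 = count (arc B (fd 3 m)) r1.
  by apply: eq_count => z; rewrite /arc hw5 hw2.
rewrite E5 in ev5.
have cle q' : subseq q' s -> count (arc B (fd 3 m)) q' < B.
  by move=> ss; apply: leq_ltn_trans (count_size _ _) _; apply: leq_ltn_trans (size_tour n0 hG sF); apply: size_subseq.
have le1 : count (arc B (fd 3 m)) s1 < B by apply: cle; rewrite Es prefix_subseq.
have le2 : count (arc B (fd 3 m)) r1 < B by apply: cle; rewrite Er prefix_subseq.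
have B8 : 8 * B < 2 ^ w.
  apply: leq_trans _ hN; apply: (@leq_trans (N * 8 + 16)) => //.
  have : n * n <= N by rewrite /maxnd -mulnA leq_pmull.
  by clear; lia.
apply: (wp_assign (v := col v)).
  (* The color at the start of the walk enters both parities and cancels. *)
  have -> : nat_of_bool (col v) =
      (count (arc B (fd 3 m)) s1 + count (arc B (fd 3 m)) r1 + col y) %% 2.
    rewrite modn2 !oddD oddb c1 c2; congr nat_of_bool.
    by case: (col q); case: (odd _); case: (odd _).
  apply: (eval_bin (o := Mod) (y := 2)); last 1 first.
  - by apply: leq_ltn_trans (_ : 2 < _); [rewrite ltnW // ltn_pmod | move: B8; clear; lia].
  - have lc : col y <= 1 by apply: leq_b1.
    apply: eval_add => //; last by move: B8 le1 le2 lc; clear; lia.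
    by apply: eval_add => //; move: B8 le1 le2; clear; lia.
  - exact: (eval_cst hN).
apply: (HQ _ (upd vs5 0 (col v)) m5 p5) => //.
by move: ht1 ht2 ht5 cuge; rewrite /=; clear; lia.
Qed.
End Updates.

(** * Amortized cost and the implicit coloring *)

(** The word factor is 12 because nodes are at most [2 ^ (4 * lg n)] and weights at most
    [2 ^ (7 * lg n)], so that every sum of weights is below [2 ^ (12 * lg n)]. *)
Definition hdt := Algorithm 12 insert_edge delete_edge get_color.

(** * The initial state *)

Section Init.
Variables (w n L : nat).
Hypothesis n0 : 0 < n.
Notation B := (n * n).+1.
Notation N := (maxnd n L).
Notation Wb := (B * B * B * n).
Notation sr := (sr n).
Notation ds := (ds n).
Notation B2 := (B2 n0).

Definition vertex_nodes := [seq z <- iota 0 N.+1 | okn n L z && (sr z == ds z)].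
Definition forest0 := [seq [:: z] | z <- vertex_nodes].
Definition st0 (x y : nat) := Un 0.

Lemma flatten_forest0 : flatten forest0 = vertex_nodes.
Proof. by rewrite /forest0 flatten_map1 map_id. Qed.

Lemma mem_vertex_nodes z : (z \in vertex_nodes) = okn n L z && (sr z == ds z).
Proof.
rewrite mem_filter mem_iota /= add0n ltnS.
by case E : (okn n L z) => //=; case/andP: E => _ ->; rewrite andbT.
Qed.

Lemma uniq_vertex_nodes : uniq vertex_nodes.
Proof. by rewrite filter_uniq ?iota_uniq. Qed.

(** In zeroed memory every node reads as a tree of one node with weight 0, so the initial tours
    exist without preprocessing and at potential 0. *)
Lemma FR0 : FR N Wb (fun=> 0) forest0 0.
Proof.
set ts := [seq Nd Lf z Lf | z <- vertex_nodes].
have E : inos ts = vertex_nodes by rewrite /inos -map_comp flatten_map1 map_id.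
exists (map handle ts); split.
  by rewrite /unzip2 -!map_comp; apply: perm_refl.
exists ts; split=> //; last first.
  by rewrite -map_comp; elim: (vertex_nodes) => //= z s <-.
split=> //; rewrite ?E.
- move=> i; case: (ltnP i (size vertex_nodes)) => hi; last by rewrite nth_default ?size_map.
  by rewrite (nth_map 0).
- by rewrite cons_uniq uniq_vertex_nodes mem_vertex_nodes.
- by apply/allP => z; rewrite mem_vertex_nodes => /andP [/andP []].
Qed.

(** All vertices store colors and none carries its weight, which is allowed because all are
    isolated. *)
Lemma inv0 tb : (forall x, tb x = Some false) ->
  inv n L (fun=> 0) forest0 st0 (fun=> 0) tb 0.
Proof.
move=> htb; have na z : arc B (fd 3 (fun=> 0)) z = false by rewrite /arc /fd mod0n.
have hS : struct n L B forest0 (fd 3 (fun=> 0)).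
  split.
  - by rewrite flatten_forest0 uniq_vertex_nodes.
  - by move=> z; rewrite flatten_forest0 mem_vertex_nodes orbF.
  - by move=> s /mapP [z zV ->]; exists (sr z); rewrite /wend /= /stp na eqxx.
  - by move=> s z z' /mapP [a aV ->]; rewrite !inE => /eqP -> /eqP ->.
  - move=> s z /mapP [a aV ->]; rewrite !inE => /eqP ->.
    move: aV; rewrite mem_vertex_nodes => /andP [/andP [a0 _] /eqP E].
    by rewrite /vx {2}E nd_eta.
have cxy x y : x < n -> y < n -> conn n forest0 0 x y -> x = y.
  move=> xn yn /connP [s [/mapP [z zV ->]]]; rewrite !inE => /eqP <- /eqP /(congr1 sr).
  by rewrite !sr_nd.
have cx x : x < n -> conn n forest0 0 x x by move=> xn; apply: (conn_refl n0 hS).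
split=> //.
- split; first exact: FR0.
  split=> // i x y hi hx hy; rewrite /WT; case: (x == y) => //.
  by rewrite muln0; case: (i == 0).
- split=> // i x hi hx; rewrite /cnt (eq_count (a2 := pred0)) ?count_pred0 // => z.
  by rewrite /isa /= andbF.
- split=> [x xn|x xn|x y xn yn _ _|x y xn yn _ _]; rewrite ?htb //; [by left|exact: cxy|exact: cxy].
- by move=> x xn; exists x; rewrite htb cx.
Qed.
End Init.

Lemma set2_isxy n (u v a b : 'I_n) : a != b -> ([set a; b] == [set u; v]) = isxy u v (val a, val b).
Proof.
move=> ab; rewrite /isxy /= !val_eqE; apply/idP/idP => [/eqP E|]; last first.
  by case/orP => /andP [/eqP -> /eqP ->] //; rewrite setUC.
have ha : a \in [set u; v] by rewrite -E set21.
have hb : b \in [set u; v] by rewrite -E set22.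
move: ha hb ab; rewrite !in_set2 => /orP [] /eqP -> /orP [] /eqP ->; by rewrite ?eqxx ?orbT.
Qed.

Definition ext n (col : 'I_n -> bool) z := if insub z is Some o then col o else false.

Lemma ext_ord n (col : 'I_n -> bool) (x : 'I_n) : ext col x = col x.
Proof. by rewrite /ext valK. Qed.

(** * Sizes of the parameters, and service of a sequence of operations *)

Section Serve.
Variables (n : nat).
Hypothesis n0 : 0 < n.
Notation L := (2 * lg n).
Notation w := (12 * lg n).
Notation B := (n * n).+1.
Notation N := (maxnd n L).
Notation Wb := (B * B * B * n).

Lemma n_lt_lg : n < 2 ^ lg n. Proof. exact: trunc_log_ltn. Qed.

Lemma nn_lt : n * n < 2 ^ L.
Proof. by rewrite mulnC expnM -[_ ^ 2]mulnn ltn_mul // n_lt_lg. Qed.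
Lemma pow_L k : 2 ^ k <= n * n -> k <= L.
Proof. by move=> h; rewrite -(leq_exp2l (m := 2)) //; apply: leq_trans h _; apply/ltnW/nn_lt. Qed.

Lemma N_le : N <= 2 ^ (4 * lg n).
Proof.
have e : 4 * lg n = L + L by clear; lia.
rewrite /maxnd -mulnA e expnD leq_mul //; last exact/ltnW/nn_lt.
have h : lg n < 2 ^ lg n by apply: ltn_expl.
(* Since [lg n] is positive, [L] splits so that its first part already bounds the number of
   levels. *)
rewrite (_ : L = (lg n).+1 + (lg n).-1); last by rewrite /lg; clear; lia.
apply: (@leq_trans (2 ^ (lg n).+1)); first by rewrite expnS; move: h; clear; lia.
by rewrite leq_exp2l // leq_addr.
Qed.

Lemma NB : N * 8 + 16 <= 2 ^ w.
Proof.
have h := N_le; have : 2 ^ (4 * lg n) * 2 ^ 4 <= 2 ^ w.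
  by rewrite -expnD leq_exp2l // /lg; clear; lia.
have : 2 ^ 4 <= 2 ^ (4 * lg n) by rewrite leq_exp2l // /lg; clear; lia.
by rewrite (_ : 2 ^ 4 = 16) //; move: h; clear; lia.
Qed.

Lemma NW : N * Wb < 2 ^ w.
Proof.
have hB : B <= 2 ^ L := nn_lt.
apply: (@leq_ltn_trans (2 ^ (4 * lg n) * (2 ^ L * 2 ^ L * 2 ^ L * 2 ^ lg n))).
  by rewrite !leq_mul // ?N_le // ltnW // n_lt_lg.
by rewrite -!expnD ltn_exp2l // /lg; clear; lia.
Qed.

(** The number of nodes is polynomial in [n], so a splay takes amortized time O(log n). *)
Lemma cu_le : cu N <= 2500 * (5 * lg n).
Proof.
rewrite /cu leq_mul2l; apply/orP; right; rewrite /cc.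
have : trunc_log 2 N <= 4 * lg n.
  by rewrite -(trunc_expnK (p := 2) (4 * lg n)) //; apply: leq_trunc_log; apply: N_le.
by rewrite /lg; clear; lia.
Qed.

Notation kc := (kc n L).
Notation epot := (epot n L).
Notation conn := (conn n).
Notation sr := (sr n).
Notation ds := (ds n).

Definition represents (G : graph n) (st : nat -> nat -> status) :=
  forall u v : 'I_n, u != v -> edg (st u v) = ([set u; v] \in G).

(** [phi] is the whole potential: that of the splay trees together with the credit of the edges. *)
Definition cinv (G : graph n) (g : config) phi := exists F st c p,
  [/\ inv n L (cmem g) F st c (ctab g) p, represents G st & phi = p + kc * epot st].

Definition op_bound (o : op n) := if is_update o then 150 * L.+2 * cu N else 10 * cu N.

Lemma bip_neq (G : graph n) (u v : 'I_n) : bipartite G -> [set u; v] \in G -> u != v.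
Proof. by case=> col hc /hc; apply: contraNneq => ->. Qed.

Definition proper_on (G : graph n) (tb : nat -> option bool) (col : 'I_n -> bool) :=
  proper_coloring G col /\ agrees tb col.

Lemma query_ok G g phi (col : 'I_n -> bool) (v : 'I_n) :
  proper_on G (ctab g) col -> cinv G g phi ->
  exists t g' phi', [/\ call hdt (GetColor v) g t 0 g' (col v), cinv G g' phi' &
    t + phi' <= phi + 10 * cu N].
Proof.
move=> [hp ha] [F [st [c [p [hi hr ->]]]]]; have [hS hd hm ht hh] := hi.
have [t [r [s [He [phi' [h1 h2 h3 h4]]]]]] : wp w get_color 0 0
    (State (nth 0 [:: n; val v]) (cmem g) (ctab g)) (fun t r s => exists phi',
    [/\ cinv G (Config (Defs.mem s) (tab s)) phi', vars s 0 = col v,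
      t + phi' <= p + kc * epot st + 10 * cu N & r = 0]).
  apply: (get_color_ok n0 NB NW hi (v := v) (col := ext col)) => //.
  - move=> x y xn yn xy; rewrite -[x]/(val (Ordinal xn)) -[y]/(val (Ordinal yn)) hr // !ext_ord.
    exact: hp.
  - by move=> x b xn; rewrite -[x]/(val (Ordinal xn)) ext_ord; apply: ha.
  - move=> t' vs' m' p' h1 h2 h3; exists (p' + kc * epot st); split=> //.
    + by exists F, st, c, p'.
    + by rewrite /= h2 ext_ord.
    + by move: h1; clear; lia.
exists t, (Config (Defs.mem s) (tab s)), phi'; split=> //.
by exists s; split=> //; move: He; rewrite (h4 : r = 0).
Qed.

(** Any proper coloring, flipped on each component so as to match its stored vertex, agrees with the
    table. For uniqueness, the difference of two such colorings is constant along a tour of level 0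
    and vanishes at the stored vertex. *)
Lemma implicit_ex G g phi : bipartite G -> cinv G g phi ->
  exists col, implicit_coloring G (ctab g) col.
Proof.
move=> [col0 h0] [F [st [c [p [hi hr _]]]]]; have [hS hd hm ht hh] := hi.
have hS0 := St_struct hS; have [_ hG] := hS; have [_ _ g3 _] := ht.
set rep := fun x : 'I_n => [pick y : 'I_n | conn F 0 x y && (ctab g y != None)].
have repP x : exists2 y : 'I_n, rep x = Some y & conn F 0 x y /\ ctab g y != None.
  rewrite /rep; case: pickP => [y /andP [h1 h2]|h]; first by exists y.
  have [y [yn xy ty]] := hh x (ltn_ord x).
  by have := h (Ordinal yn); rewrite /= xy ty.
have rep_eq (x y : 'I_n) : conn F 0 x y -> rep x = rep y.
  move=> xy; apply: eq_pick => z /=; congr (_ && _).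
  rewrite ![conn F 0 _ z]conn_sym; exact: (conn_eq_r hS0 _ xy).
set col := fun x => if rep x is Some y then col0 x (+) (col0 y (+) odflt false (ctab g y)) else col0 x.
(* A non-tree edge has its ends joined at its own level, hence also at level 0. *)
have edge_conn (u v : 'I_n) : u != v -> [set u; v] \in G -> conn F 0 u v.
  move=> uv; rewrite -hr // => he; have uvn : val u != val v by [].
  have [_ _ hf _] := hd; have [_ _ [_ /(_ u v) hl] _] := hG.
  move: he (hm u v) hl (hf u v) (arc_conn n0 (B2 n0) hG (i := 0) (leq0n _) (ltn_ord u) (ltn_ord v) uvn).
  case: (st u v) => a /=; first by move=> + h0'; rewrite h0'.
    by move=> _ _ _ _; apply.
  move=> _ _ aL /(_ a (ltn_ord u) (ltn_ord v) (erefl _)); rewrite orbF => h _.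
  by apply: (conn_nest n0 (B2 n0) hG (leq0n a)).
have arcE z s : s \in F -> z \in s -> arc B (fd 3 (cmem g)) z -> lv n z = 0 ->
    exists u v : 'I_n, [/\ val u = sr z, val v = ds z & [set u; v] \in G].
  move=> sF zs az l0; have [l1 l2 l3 l4 l5] := arc_tour n0 (B2 n0) hG sF zs az.
  exists (Ordinal l2), (Ordinal l3); split=> //; rewrite -hr //=.
  by move: (hm (sr z) (ds z)) l5; case: (st _ _) => // a ->.
have colp : proper_coloring G col.
  move=> u v uvG; have uv : u != v by apply: bip_neq uvG; exists col0.
  rewrite /col (rep_eq _ _ (edge_conn u v uv uvG)); have := h0 u v uvG.
  by case: (rep v) => [y|] //; case: (col0 y (+) _); case: (col0 u); case: (col0 v).
have cola : agrees (ctab g) col.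
  move=> v b tv; have [y E [vy ty]] := repP v.
  have tvn : ctab g v != None by rewrite tv.
  have yv : v = y by apply/val_inj/(g3 v y (ltn_ord v) (ltn_ord y) tvn ty vy).
  by rewrite /col E -yv tv /=; case: (col0 v); case: b {tv}.
exists col; split=> // col' cp' ca' x.
have [y _ [xy ty]] := repP x.
have [s [sF xs ys]] := connP _ _ _ _ _ xy.
have [_ _ /(_ s sF) hcl _ _] := hS0.
have := closed_const (f := fun z => ext col' z (+) ext col z) hcl _ xs ys.
rewrite !sr_nd // !ext_ord => H.
have {}H : col' x (+) col x = col' y (+) col y.
  apply: H => z zs; rewrite /stp; case: ifP => // az.
  have l0 : lv n z = 0 by apply: (tour_level n0 hG sF (ltn_ord x) xs).
  have [u [v [<- <- uvG]]] := arcE z s sF zs az l0; rewrite !ext_ord.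
  have := colp u v uvG; have := cp' u v uvG.
  by case: (col' u); case: (col' v); case: (col u); case: (col v).
case E: (ctab g y) ty => [b|//] _; move: H; rewrite (ca' y b E) (cola y b E) addbb.
by case: (col' x); case: (col x).
Qed.

Lemma maintains_cinv G g phi : bipartite G -> cinv G g phi -> maintains hdt G g.
Proof.
move=> hb hi; have [col [h1 h2 h3]] := implicit_ex hb hi; exists col; split=> // v.
by have [t [g' [phi' [hc _ _]]]] := query_ok v (conj h1 h2) hi; exists t, g'.
Qed.

Lemma serve_op G o g phi : legal G o -> bipartite G -> cinv G g phi ->
  exists t r g' x phi', [/\ call hdt o g t r g' x, cinv (apply_op G o) g' phi',
    t + phi' <= phi + op_bound o & is_update o ==> (r <= 1)].
Proof.
move=> hl hb [F [st [c [p [hi hr ->]]]]].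
have hN := NB; have hW := NW; have hL := pow_L.
case: o hl => [u v|u v|v] /= hl.
- have [uv nG] := hl; have uvn : val u != val v by [].
  have [t [r [s [He [phi' [h1 h2 h3]]]]]] : wp w insert_edge 0 0
      (State (nth 0 [:: n; val u; val v]) (cmem g) (ctab g)) (fun t r s => exists phi',
      [/\ cinv ([set u; v] |: G) (Config (Defs.mem s) (tab s)) phi',
        t + phi' <= p + kc * epot st + op_bound (Insert u v) & r <= 1]).
    apply: (insert_edge_ok n0 hN hW hi (u := u) (v := v)) => //.
      by rewrite hr // (negbTE nG).
    move=> t' vs' m' p' F' st' c' tb' d h1 h2 h3 h4; exists (p' + kc * epot st'); split=> //.
      exists F', st', c', p'; split=> // a b ab.
      rewrite h3 setst_isxy in_setU1 set2_isxy //; case: ifP => //= _; exact: hr.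
    rewrite addnA; apply: leq_trans h1 _; rewrite !add0n leq_add2l /op_bound /=.
    by rewrite !leq_mul2r; apply/orP; right; apply/orP; right; clear; lia.
  exists t, r, (Config (Defs.mem s) (tab s)), (vars s 0), phi'; split=> //.
  by exists s; split.
- have uv := bip_neq hb hl; have uvn : val u != val v by [].
  have [t [r [s [He [phi' [h1 h2 h3]]]]]] : wp w delete_edge 0 0
      (State (nth 0 [:: n; val u; val v]) (cmem g) (ctab g)) (fun t r s => exists phi',
      [/\ cinv (G :\ [set u; v]) (Config (Defs.mem s) (tab s)) phi',
        t + phi' <= p + kc * epot st + op_bound (Delete u v) & r <= 1]).
    apply: (delete_edge_ok n0 hN hW hL hi (u := u) (v := v)) => //.
      by rewrite hr.
    move=> t' vs' m' p' F' st' c' tb' d h1 h2 h3 h4; exists (p' + kc * epot st'); split=> //.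
      exists F', st', c', p'; split=> // a b ab.
      rewrite h3 setst_isxy in_setD1 set2_isxy //; case: ifP => //= _; exact: hr.
    by rewrite addnA; apply: leq_trans h1 _; rewrite !add0n.
  exists t, r, (Config (Defs.mem s) (tab s)), (vars s 0), phi'; split=> //.
  by exists s; split.
have [col [h1 h2 _]] := implicit_ex hb (ex_intro _ F (ex_intro _ st (ex_intro _ c (ex_intro _ p (And3 hi hr (erefl _)))))).
have [t [g' [phi' [h3 h4 h5]]]] := query_ok v (conj h1 h2) (ex_intro _ F (ex_intro _ st (ex_intro _ c (ex_intro _ p (And3 hi hr (erefl _)))))).
by exists t, 0, g', (nat_of_bool (col v)), phi'.
Qed.

(** The potentials telescope over the sequence. *)
Lemma serve_ops ops : forall (G : graph n) g phi, bipartite G -> cinv G g phi -> admissible G ops ->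
  exists costs g' phi', [/\ serves hdt g ops costs g', cinv (foldl (@apply_op n) G ops) g' phi',
    bipartite (foldl (@apply_op n) G ops),
    total_time costs + phi' <= phi + \sum_(o <- ops) op_bound o &
    one_recoloring_per_update ops costs].
Proof.
elim: ops => [|o ops IH] G g phi hb hi /=.
  by move=> _; exists [::], g, phi; split=> //; [constructor | rewrite big_nil addn0].
case=> hl hb' ha; have [t [r [g1 [x [phi1 [hc hi1 ht hr]]]]]] := serve_op hl hb hi.
have [costs [g2 [phi2 [hs hi2 hb2 ht2 hr2]]]] := IH _ _ _ hb' hi1 ha.
exists ((t, r) :: costs), g2, phi2; split=> //; last by rewrite /= hr hr2.
  exact: serves_cons hc hs.
by rewrite big_cons /total_time /= -/(total_time costs); move: ht ht2; clear; lia.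
Qed.
End Serve.

(** The number of levels plus one, [(2 * lg n).+2], is at most [4 * lg n], and [cu] is at most
    [2500 * 5 * lg n]. Their product gives the square for updates, a constant number of units the
    logarithm for queries. *)
Lemma bound_ex : exists C, forall n (ops : seq (op n)), 0 < n ->
  \sum_(o <- ops) op_bound o <= C * (num_updates ops * lg n ^ 2 + num_queries ops * lg n).
Proof.
exists (150 * (4 * (2500 * 5))) => n ops n0.
have E2 a b d e l : a * (b * l) * (d * (e * l)) = a * (b * (d * e)) * (l * l) by lia.
have E1 a b d e l : a * b * (d * (e * l)) = a * (b * (d * e)) * l by lia.
have hu (o : op n) : is_update o -> op_bound o <= 150 * (4 * (2500 * 5)) * lg n ^ 2.
  move=> ho; have -> : op_bound o = 150 * (2 * lg n).+2 * cu (maxnd n (2 * lg n)) by rewrite /op_bound ho.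
  rewrite -mulnn -E2; apply: (leq_mul _ (cu_le n)); rewrite leq_mul2l; apply/orP; right.
  by rewrite /lg; clear; lia.
have hq (o : op n) : ~~ is_update o -> op_bound o <= 150 * (4 * (2500 * 5)) * lg n.
  move=> /negbTE ho; have -> : op_bound o = 10 * cu (maxnd n (2 * lg n)) by rewrite /op_bound ho.
  by rewrite -E1; apply: (leq_mul _ (cu_le n)).
move: (150 * _) hu hq => C hu hq.
elim: ops => [|o ops IH]; first by rewrite big_nil.
rewrite big_cons /num_updates /num_queries /= -/(num_updates ops) -/(num_queries ops).
case: (boolP (is_update o)) => ho /=; rewrite add0n mulnDl mul1n.
  by rewrite -addnA mulnDr leq_add ?hu.
by rewrite addnCA mulnDr leq_add ?hq.
Qed.

Theorem theorem2 :
  exists (A : algorithm) (C : nat),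
    0 < word_factor A /\
    forall (n : nat) (ops : seq (op n)),
      admissible set0 ops ->
      exists (costs : seq (nat * nat)) (g : config),
        [/\ serves A init_config ops costs g,
            total_time costs <=
              C * (num_updates ops * lg n ^ 2 + num_queries ops * lg n),
            one_recoloring_per_update ops costs
          & maintains A (graph_after ops) g].
Proof.
have [C hC] := bound_ex; exists hdt, C; split=> // n ops ha.
(* Without vertices there are no operations, and the empty sequence is served at no cost. *)
case: (posnP n) => [n0|n0].
  subst n; case: ops ha => [|[[]|[]|[]] //] _.
  exists [::], init_config; split=> //; first by constructor.
  exists (fun=> false); split; last by case.
  by split; [move=> [] | move=> [] | move=> ? _ _ []].
have hb : bipartite (set0 : graph n) by exists (fun=> false) => u v; rewrite in_set0.
(* The initial potential is 0, so the amortized bound has no additive term. *)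
have hi : cinv (set0 : graph n) init_config 0.
  exists (forest0 n (2 * lg n)), st0, (fun=> 0), 0; split.
  - exact: inv0.
  - by move=> u v _; rewrite in_set0.
  - rewrite (_ : epot _ _ _ = 0) ?muln0 // /epot.
    by elim: (prs n) => //= z s ->.
have [costs [g [phi [h1 h2 h3 h4 h5]]]] := serve_ops n0 hb hi ha.
exists costs, g; split=> //; last exact: (maintains_cinv n0 h3 h2).
by apply: leq_trans (hC n ops n0); apply: leq_trans h4; apply: leq_addr.
Qed.
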